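(* Suppose Assumptions A and B hold and that $\mathbb{E}[|\varphi(Y,Z)|^{2+\delta}]<\infty$ for some $\delta>0$. Let $\gamma_n=\gamma_1 n^{-\beta}$, $n\ge1$, with $\gamma_1>0$ and $\beta\in(\frac12,1]$, and assume $\lambda\gamma_1>1$ if $\beta=1$. Then, as $\mathcal H\ni h\downarrow 0$, $$\begin{pmatrix} h^{-\beta}\big(\xi^h_{\lceil h^{-2}\rceil}-\xi^h_\star\big)\\ h^{-1}\big(\chi^h_{\lceil h^{-2}\rceil}-\chi^h_\star\big)\end{pmatrix}\xrightarrow{\ \mathcal L\ }\mathcal N(0,\Sigma_\beta),$$ where $$\Sigma_\beta=\begin{pmatrix}\dfrac{\alpha\gamma_1}{2f_{X_0}(\xi^0_\star)-\gamma_1^{-1}(1-\alpha)\mathbf 1_{\beta=1}} & \alpha\dfrac{\chi^0_\star-\xi^0_\star}{f_{X_0}(\xi^0_\star)}\mathbf 1_{\beta=1}\\[2mm] \alpha\dfrac{\chi^0_\star-\xi^0_\star}{f_{X_0}(\xi^0_\star)}\mathbf 1_{\beta=1} & \dfrac{\mathrm{Var}((X_0-\xi^0_\star)^+)}{(1-\alpha)^2}\end{pmatrix}.$$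
   Context: Fix $\alpha\in(0,1)$. Let $Y$ ($\mathbb R^d$-valued) and $Z$ ($\mathbb R^q$-valued) be independent random variables and $\varphi:\mathbb R^d\times\mathbb R^q\to\mathbb R$ measurable with $\varphi(Y,Z)\in L^1$. Set $X_0=\mathbb E[\varphi(Y,Z)\mid Y]$ and $\mathcal H=\{1/K:K\in\mathbb N,K\ge1\}$. For $h=1/K\in\mathcal H$, $X_h=\frac1K\sum_{k=1}^K\varphi(Y,Z^{(k)})$, where $Z^{(1)},\dots,Z^{(K)}$ are i.i.d. copies of $Z$ independent of $Y$. For $h\in\mathcal H\cup\{0\}$, $F_{X_h}$ denotes the cdf and $f_{X_h}$ the pdf of $X_h$, and $V_h(\xi)=\xi+\frac1{1-\alpha}\mathbb E[(X_h-\xi)^+]$, so that $V_h''=f_{X_h}/(1-\alpha)$; under Assumption A, $V_h$ has a unique minimizer $\xi^h_\star$, and $\chi^h_\star:=V_h(\xi^h_\star)=\min V_h$ ($\xi^0_\star,\chi^0_\star$ are the value-at-risk and expected shortfall of $X_0$ at level $\alpha$). Let $H_1(\xi,x)=1-\frac1{1-\alpha}\mathbf 1_{x\ge\xi}$ and $H_2(\xi,\chi,x)=\chi-\xi-\frac1{1-\alpha}(x-\xi)^+$. NSA scheme: given positive steps $(\gamma_n)_{n\ge1}$ and $h\in\mathcal H$, let $(X_h^{(n)})_{n\ge1}$ be i.i.d. copies of $X_h$, $\xi^h_0$ a real random variable independent of them, $\chi^h_0=0$, and for $n\ge0$: $\xi^h_{n+1}=\xi^h_n-\gamma_{n+1}H_1(\xi^h_n,X_h^{(n+1)})$,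 $\chi^h_{n+1}=\chi^h_n-\frac1{n+1}H_2(\xi^h_n,\chi^h_n,X_h^{(n+1)})$. Assumption A: (i) for each $h\in\mathcal H$, $F_{X_h}(\xi)-F_{X_0}(\xi)=v(\xi)h+w(\xi,h)h$ for all $\xi\in\mathbb R$, for functions $v,w(\cdot,h):\mathbb R\to\mathbb R$ with $\int_{\xi^0_\star}^\infty v(\xi)d\xi<\infty$ and $\lim_{\mathcal H\ni h\downarrow0}w(\xi^0_\star,h)=\lim_{\mathcal H\ni h\downarrow0}\int_{\xi^0_\star}^\infty w(\xi,h)d\xi=0$ for any minimizer $\xi^0_\star$ of $V_0$; (ii) for each $h\in\mathcal H\cup\{0\}$, $X_h$ has a continuous pdf $f_{X_h}$, and $f_{X_h}\to f_{X_0}$ locally uniformly as $\mathcal H\ni h\downarrow0$; (iii) for every $R>0$, $\inf_{h\in\mathcal H\cup\{0\},\,\xi\in B(\xi^0_\star,R)}f_{X_h}(\xi)>0$; (iv) $\sup_{h\in\mathcal H\cup\{0\}}(\|f_{X_h}\|_\infty+[f_{X_h}]_{\rm Lip})<\infty$, where $[\cdot]_{\rm Lip}$ is the Lipschitz constant. Assumption B: with $c_\alpha=1\vee\frac{\alpha}{1-\alpha}$, $\sup_{h\in\mathcal H}\mathbb E\big[|\xi^h_0|^2\exp\big(\frac{4}{1-\alpha}c_\alpha\sup_{h'\in\mathcal H}\|f_{X_{h'}}\|_\infty|\xi^h_0|\big)\big]<\infty$. The constant $\lambda:=\inf_{h\in\mathcal H\cup\{0\}}\Big(\frac38V_h''(\xi^h_\star)\wedge\|V_h''\|_\infty\frac{V_h''(\xi^h_\star)^4}{4[V_h'']_{\rm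 Lip}^2}\Big)>0$. *)

(* Defs.v *)
From HB Require Import structures.
From mathcomp Require Import all_boot all_order all_algebra.
From mathcomp Require Import all_classical all_reals all_analysis.
Set Implicit Arguments. Unset Strict Implicit. Unset Printing Implicit Defensive.
Import Order.TTheory GRing.Theory Num.Def Num.Theory.
Import numFieldNormedType.Exports.
Local Open Scope classical_set_scope.
Local Open Scope ring_scope.

Section Defs.
Context {d : measure_display} {T : measurableType d} {R : realType}.
Variable P : probability T R.

Definition sigma_of {d'} {V : measurableType d'} (X : T -> V) : set (set T) :=
  [set X @^-1` B | B in [set B : set V | measurable B]].

Definition mutually_independent {I : eqType} (F : I -> set (set T)) : Prop :=
  forall (J : seq I) (A : I -> set T), uniq J ->
    (forall i, i \in J -> F i (A i)) ->
    P (\big[setI/setT]_(i <- J) A i) = (\prod_(i <- J) P (A i))%E.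

Definition same_law {d'} {V : measurableType d'} (X X' : T -> V) : Prop :=
  forall B : set V, measurable B -> P (X @^-1` B) = P (X' @^-1` B).

Definition is_cond_exp_given {d'} {V : measurableType d'}
    (X0 U : T -> R) (Y : T -> V) : Prop :=
  P.-integrable setT (EFin \o X0) /\
  (exists g : V -> R, measurable_fun setT g /\ X0 = g \o Y) /\
  forall B : set V, measurable B ->
    ('E_P[fun w => (X0 w * \1_(Y @^-1` B) w)%R] = 'E_P[fun w => (U w * \1_(Y @^-1` B) w)%R])%E.

Definition is_pdf (X : T -> R) (f : R -> R) : Prop :=
  (forall t, 0 <= f t) /\
  forall x, P (X @^-1` `]-oo, x]) =
            (\int[lebesgue_measure]_(t in `]-oo, x]) (f t)%:E)%E.

Definition cdf_of (X : T -> R) (x : R) : R := fine (P (X @^-1` `]-oo, x])).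

Definition Vfun (alpha : R) (X : T -> R) (xi : R) : R :=
  xi + (1 - alpha)^-1 * fine ('E_P[fun w => (Num.max (X w - xi) 0)%R])%E.

End Defs.

Definition is_minimizer {R : realType} (V : R -> R) (x : R) : Prop :=
  forall y, V x <= V y.

(** h = 1/K; for K = 0 this gives 0 (h = 0) *)
Definition hK {R : realType} (K : nat) : R := (K%:R)^-1.

(** X_h for h = 1/K (K >= 1), and X_0 for K = 0 *)
Definition Xh {T : Type} {R : realType} {U V : Type} (Y : T -> U)
    (Zs : nat -> T -> V) (phi : U -> V -> R) (X0 : T -> R) (K : nat) : T -> R :=
  if K is 0 then X0 else fun w => (K%:R)^-1 * \sum_(k < K) phi (Y w) (Zs k w).

Definition supnorm {R : realType} (f : R -> R) : R := sup (range (fun x => `|f x|)).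
Definition lipc {R : realType} (f : R -> R) : R :=
  sup [set r | exists x y : R, x != y /\ r = `|f x - f y| / `|x - y|].

Definition H1 {R : realType} (alpha xi x : R) : R :=
  1 - (1 - alpha)^-1 * (if xi <= x then 1 else 0).
Definition H2 {R : realType} (alpha xi chi x : R) : R :=
  chi - xi - (1 - alpha)^-1 * Num.max (x - xi) 0.

Fixpoint nsa {R : realType} (alpha : R) (gamma : nat -> R) (xi0 : R)
    (xs : nat -> R) (n : nat) : R * R :=
  match n with
  | 0 => (xi0, 0)
  | m.+1 => let p := nsa alpha gamma xi0 xs m in
      (p.1 - gamma m.+1 * H1 alpha p.1 (xs m.+1),
       p.2 - (m.+1)%:R^-1 * H2 alpha p.1 p.2 (xs m.+1))
  end.

(** the constant lambda (V_h'' = f_{X_h}/(1-alpha)) *)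
Definition lambda_const {R : realType} (alpha : R) (f : nat -> R -> R)
    (xis : nat -> R) : R :=
  inf (range (fun K : nat =>
    Num.min (3 / 8 * (f K (xis K) / (1 - alpha)))
      (supnorm (f K) / (1 - alpha) * (f K (xis K) / (1 - alpha)) ^+ 4
        / (4 * (lipc (f K) / (1 - alpha)) ^+ 2)))).

Definition gauss2_expect {R : realType} (l11 l12 l21 l22 : R) (g : R * R -> R)
  : \bar R :=
  (\int[@normal_prob R 0 1]_z1 \int[@normal_prob R 0 1]_z2
      (g (l11 * z1 + l12 * z2, l21 * z1 + l22 * z2))%:E)%E.

(** convergence in law (as K -> oo) of the R^2-valued W K to N(0, Sigma) with
    Sigma = (S11 S12; S12 S22): Sigma = L L^T for some L and E[g(W K)] -> E[g(L G)]
    for every bounded continuous g *)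
Definition cvg_law_gauss2 {d} {T : measurableType d} {R : realType}
    (P : probability T R) (W : nat -> T -> R * R) (S11 S12 S22 : R) : Prop :=
  exists l11 l12 l21 l22 : R,
    [/\ l11 ^+ 2 + l12 ^+ 2 = S11, l11 * l21 + l12 * l22 = S12,
        l21 ^+ 2 + l22 ^+ 2 = S22 &
    forall g : R * R -> R, continuous g -> measurable_fun setT g ->
      (exists M, forall p, `|g p| <= M) ->
      (fun K => ('E_P[g \o W K])%E) @ \oo --> gauss2_expect l11 l12 l21 l22 g].

(** Assumption A, for the family X K (X 0 = X_0, X K = X_{1/K}) with
    continuous pdfs f K *)
Definition assumptionA {d} {T : measurableType d} {R : realType}
    (P : probability T R) (alpha : R) (X : nat -> T -> R) (f : nat -> R -> R) : Prop :=
  [/\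
      (exists (v : R -> R) (w : nat -> R -> R),
        [/\ measurable_fun setT v, forall K, measurable_fun setT (w K),
            forall K, (0 < K)%N -> forall x,
              cdf_of P (X K) x - cdf_of P (X 0%N) x = v x * hK K + w K x * hK K &
            forall x0, is_minimizer (Vfun P alpha (X 0%N)) x0 ->
              [/\ (\int[lebesgue_measure]_(x in `[x0, +oo[) (v x)%:E < +oo)%E,
                  (fun K => w K x0) @ \oo --> 0 &
                  ((fun K => \int[lebesgue_measure]_(x in `[x0, +oo[) (w K x)%:E)
                     @ \oo --> 0)%E]]),
      (forall K, is_pdf P (X K) (f K) /\ continuous (f K)),
      (forall a b eps : R, 0 < eps ->
         \forall K \near \oo, forall x, a <= x <= b -> `|f K x - f 0%N x| <= eps),
      (forall x0, is_minimizer (Vfun P alpha (X 0%N)) x0 ->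
        forall r : R, 0 < r -> exists c : R, 0 < c /\
          forall K x, `|x - x0| < r -> c <= f K x) &
      (exists M : R, forall K x, `|f K x| <= M) /\
      (exists L : R, forall K x y, `|f K x - f K y| <= L * `|x - y|)].

(* Main.v *)
(** Write e_n = xi_n - xi_star. The process sqrt(1 + e_n^2) - 1, stopped on leaving a neighbourhood of xi_star, is a
    supermartingale up to summable errors, so the iterates stay near xi_star with probability close to 1, uniformly
    in h, and there E e_n^2 = O(gamma_n). Linearizing the mean field at xi_star then gives e_n as a linear combination
    of the i.i.d. variables H_1(xi_star, X^(k)), up to a martingale remainder (the increments of the indicator, of
    conditional variance O(|e_n|)) and a drift remainder of order e_n^2, both o(sqrt gamma_n) in probability.
    Likewise n (chi_n - chi_star) is the sum of the centred variables (X^(k) - xi_star)^+ / (1 - alpha), up to o(sqrt n).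

    With n = K^2 and h = 1/K the scaled error is thus, up to a term null in probability, a sum over a triangular
    array of independent plane vectors; its characteristic function is computed by a second-order expansion of each
    factor. The scaled errors are tight, and on a large square continuous functions are uniformly approximated by
    trigonometric polynomials (Bernstein polynomials in (1 + sin(x / A)) / 2), so that convergence of the
    characteristic functions gives weak convergence.

    The covariances of the array converge because xi_star^h -> xi_star^0 and so do the first two moments of
    (X_h - xi_star^h)^+: the truncated functions are approximated by staircases, whose expectations are given by the cdfs, and
    the tails are uniformly small by the moment of order 2 + delta. *)
Require Import Defs.
From HB Require Import structures.
From mathcomp Require Import all_boot all_order all_algebra.
From mathcomp Require Import all_classical all_reals all_analysis.
From mathcomp Require Import measurable_realfun ring lra.
Import Order.TTheory GRing.Theory Num.Def Num.Theory.
Import numFieldNormedType.Exports.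
Local Open Scope classical_set_scope.
Local Open Scope ring_scope.
Set Implicit Arguments. Unset Strict Implicit. Unset Printing Implicit Defensive.

(** * Recursions and step sizes *)

(** Both the law of the samples and the number of steps [K^2] change with [K], so every estimate
    must hold with constants shared by all [h]. Hence the record [sa_sys], whose parameters are
    these constants, and hence [sa_approx], which chooses its rank before the system. All systems
    are linearized with one slope, [q = f 0 (xis 0) / (1 - alpha)]; the gap to the true slope enters
    as [dq], which tends to 0.

    The mean field is bounded, so large errors are pulled back only at bounded speed and [E e_n^2]
    does not contract globally. The rate [gamma_n] is therefore proved under the flag [gd], the
    indicator that no exit has occurred since a rank [N].

    Half of the contraction rate [q] pays for the relative decrease of the steps, at most [1/n]. For
    [beta = 1] this needs [q gamma1 / 2 > 1], which follows from [lambda gamma1 > 1] since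
    [lambda <= 3/8 q]. The indicators of [beta = 1] in [Sigma] have two origins: the limit of
    [(gamma_n / gamma_(n+1) - 1) / gamma_(n+1)] on the diagonal, that of [h^(1 - beta)] off it. *)

Section recursions.
Context {R : realType}.
Implicit Types (a u x y e g : nat -> R).

Lemma near_oo_ge (N : nat) : \forall n \near \oo, (N <= n)%N.
Proof. by exists N. Qed.

(** The right-hand side is a convex combination of [x k] and [Y / m], with weights [1 - m * a k] and
    [m * a k]. *)
Lemma rec_le_bounded a x m B Y N : 0 < m ->
  (forall k, (N <= k)%N -> 0 <= a k) ->
  (forall k, (N <= k)%N -> m * a k <= 1) ->
  (forall k, (N <= k)%N -> x k.+1 <= (1 - m * a k) * x k + a k * Y) ->
  x N <= B -> Y / m <= B -> forall k, (N <= k)%N -> x k <= B.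
Proof.
move=> m0 a0 ma rec xB YB k /subnKC <-.
elim: (k - N)%N => [|j IH]; first by rewrite addn0.
rewrite addnS; have Nj : (N <= N + j)%N by exact: leq_addr.
apply: le_trans (rec _ Nj) _.
have := a0 _ Nj; have := ma _ Nj.
have Ym : Y <= m * B by rewrite mulrC -ler_pdivrMr.
move: (N + j)%N IH => i xi mai ai.
have h1 : (1 - m * a i) * x i <= (1 - m * a i) * B by apply: ler_wpM2l => //; lra.
have h2 : a i * Y <= a i * (m * B) by apply: ler_wpM2l.
by move: h1 h2; nra.
Qed.

(** The factor [1 + m * sum a] replaces the usual exponential: [(1 - u) * (1 + s + u) <= 1 + s] for
    [s, u >= 0], and divergence of the sum is enough for convergence to 0. *)
Lemma rec_le_decay a x m N : 0 < m ->
  (forall k, (N <= k)%N -> 0 <= a k) ->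
  (forall k, (N <= k)%N -> m * a k <= 1) ->
  (forall k, (N <= k)%N -> 0 <= x k) ->
  (forall k, (N <= k)%N -> x k.+1 <= (1 - m * a k) * x k) ->
  forall k, (N <= k)%N -> x k * (1 + m * \sum_(N <= j < k) a j) <= x N.
Proof.
move=> m0 a0 ma x0 rec k /subnKC <-.
elim: (k - N)%N => [|j IH].
  by rewrite addn0 big_geq// mulr0 addr0 mulr1.
have Nj : (N <= N + j)%N by exact: leq_addr.
rewrite addnS big_nat_recr//=.
have S0 : 0 <= \sum_(N <= i < N + j) a i.
  by rewrite big_nat_cond; apply: sumr_ge0 => i /andP[/andP[+ _] _]; exact: a0.
move: IH S0 (rec _ Nj) (a0 _ Nj) (ma _ Nj) (x0 _ Nj).
move: (\sum_(N <= i < N + j) a i) => S; move: (N + j)%N => i IH S0 reci ai mai xi.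
apply: le_trans IH.
have p0 : 0 <= 1 + m * (S + a i) by nra.
apply: (@le_trans _ _ ((1 - m * a i) * x i * (1 + m * (S + a i)))).
  by rewrite ler_wpM2r.
rewrite -subr_ge0.
have -> : x i * (1 + m * S) - (1 - m * a i) * x i * (1 + m * (S + a i)) =
  x i * (m * a i * (m * S + m * a i)) by ring.
by rewrite mulr_ge0// mulr_ge0 ?addr_ge0// mulr_ge0// ltW.
Qed.

Definition divergent_sum a := forall B : R, \forall n \near \oo, B <= \sum_(k < n) a k.

Lemma rec_cvg0 a x e m : 0 < m -> (forall k, 0 <= a k) -> a @ \oo --> 0 ->
  divergent_sum a -> (\forall k \near \oo, 0 <= x k) -> e @ \oo --> 0 ->
  (\forall k \near \oo, x k.+1 <= (1 - m * a k) * x k + a k * e k) ->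
  x @ \oo --> 0.
Proof.
move=> m0 a0 acvg adiv x0 ecvg rec.
apply/cvgrPdist_le => eps eps0.
have e2 : 0 < eps / 2 by lra.
have [N _ HN] : \forall k \near \oo, [/\ 0 <= x k, m * a k <= 1,
    e k <= m * (eps / 2) & x k.+1 <= (1 - m * a k) * x k + a k * e k].
  have mi : 0 < m^-1 by rewrite invr_gt0.
  have me : 0 < m * (eps / 2) by rewrite mulr_gt0.
  near=> k; split; [near: k => //| | |by near: k].
    rewrite mulrC -ler_pdivlMr// div1r.
    suff : `|0 - a k| <= m^-1 by rewrite sub0r normrN => /(le_trans (ler_norm _)).
    by near: k; move/cvgrPdist_le : acvg => /(_ _ mi).
  suff : `|0 - e k| <= m * (eps / 2) by rewrite sub0r normrN => /(le_trans (ler_norm _)).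
  by near: k; move/cvgrPdist_le : ecvg => /(_ _ me).
(* Beyond the rank [N], [a e <= m a eps / 2], so the excess of [x] over [eps / 2] obeys the
   homogeneous recursion. *)
pose z k := Num.max (x k - eps / 2) 0.
have zdec : forall k, (N <= k)%N -> z k * (1 + m * \sum_(N <= j < k) a j) <= z N.
  apply: rec_le_decay => //.
  - by move=> k /HN[].
  - by move=> k _; rewrite /z le_max lexx orbT.
  move=> k /HN[xk mak ek reck].
  have zk : x k - eps / 2 <= z k by rewrite /z le_max lexx.
  have zk0 : 0 <= z k by rewrite /z le_max lexx orbT.
  rewrite {1}/z ge_max; apply/andP; split; last by rewrite mulr_ge0// subr_ge0.
  have h1 : (1 - m * a k) * (x k - eps / 2) <= (1 - m * a k) * z k.
    by apply: ler_wpM2l => //; rewrite subr_ge0.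
  have h2 : a k * e k <= a k * (m * (eps / 2)) by apply: ler_wpM2l.
  by move: h1 h2 reck; nra.
have := adiv (\sum_(k < N) a k + m^-1 * (z N / (eps / 2))).
move=> adivN; near=> n.
have Nn : (N <= n)%N by near: n; exact: near_oo_ge.
have [xn _ _ _] := HN _ Nn.
rewrite sub0r normrN ger0_norm//.
suff : z n <= eps / 2 by rewrite /z ge_max => /andP[+ _]; lra.
have zn0 : 0 <= z n by rewrite /z le_max lexx orbT.
have : m^-1 * (z N / (eps / 2)) <= \sum_(N <= j < n) a j.
  have : \sum_(k < N) a k + m^-1 * (z N / (eps / 2)) <= \sum_(k < n) a k by near: n.
  have -> : \sum_(k < n) a k = \sum_(k < N) a k + \sum_(N <= j < n) a j.
    by rewrite -(big_mkord xpredT a) (@big_cat_nat _ _ _ N)//= big_mkord.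
  by rewrite lerD2l.
move=> S; have := zdec _ Nn; rewrite !leNgt => zn; apply: contra zn => znlt.
have mS : z N / (eps / 2) <= m * \sum_(N <= j < n) a j.
  by rewrite -ler_pdivrMl.
have : z N <= (eps / 2) * (m * \sum_(N <= j < n) a j).
  by rewrite mulrC -ler_pdivrMr.
have S0 : 0 <= m * \sum_(N <= j < n) a j.
  by apply: mulr_ge0; [exact: ltW|exact: sumr_ge0].
have : eps / 2 * (1 + m * \sum_(N <= j < n) a j) <= z n * (1 + m * \sum_(N <= j < n) a j).
  by apply: ler_wpM2r; [lra|exact: ltW].
by move: e2; lra.
Unshelve. all: by end_near. Qed.

(** [c / l] is the equilibrium of the limiting recursion. The deviation [|x - c / l|] falls under
    [rec_cvg0] with rate [l / 2], a lower bound of [g k] from some rank on. *)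
Lemma rec_cvg a x y g (l c : R) : 0 < l -> (forall k, 0 <= a k) -> a @ \oo --> 0 ->
  divergent_sum a -> g @ \oo --> l -> y @ \oo --> c ->
  (\forall k \near \oo, x k.+1 = (1 - g k * a k) * x k + a k * y k) ->
  x @ \oo --> c / l.
Proof.
move=> l0 a0 acvg adiv gl yc rec.
pose v k := `|x k - c / l|.
suff vcvg : v @ \oo --> 0.
  apply/cvgrPdist_le => eps eps0.
  move/cvgrPdist_le : vcvg => /(_ _ eps0); apply: filterS => k.
  by rewrite sub0r normrN /v normr_id distrC.
pose e k := `|y k - g k * (c / l)|.
apply: (@rec_cvg0 a v e (l / 2)) => //.
- by rewrite divr_gt0.
- by apply: nearW => k; rewrite /v.
- have -> : 0 = `|c - l * (c / l)| by rewrite mulrCA divff ?mulr1 ?subrr ?normr0// gt_eqF.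
  by apply: cvg_norm; apply: cvgB => //; apply: cvgMl.
have l2 : 0 < l / 2 by rewrite divr_gt0.
have gl2 : \forall k \near \oo, `|l - g k| <= l / 2 by move/cvgrPdist_le : gl; exact.
(* [g <= 2 l] and [a <= 1 / (2 l)] keep the factor [1 - g a] nonnegative. *)
have li : 0 < (l * 2)^-1 by rewrite invr_gt0 mulr_gt0.
have al : \forall k \near \oo, `|0 - a k| <= (l * 2)^-1 by move/cvgrPdist_le : acvg; exact.
near=> k.
have reck : x k.+1 = (1 - g k * a k) * x k + a k * y k by near: k.
have : `|l - g k| <= l / 2 by near: k.
rewrite ler_norml => /andP[g1 g2].
have : `|0 - a k| <= (l * 2)^-1 by near: k.
rewrite sub0r normrN ger0_norm// => ak.
have ga : g k * a k <= 1.
  have h : g k <= l * 2 by lra.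
  apply: (@le_trans _ _ ((l * 2) * (l * 2)^-1)); first by rewrite ler_pM//; lra.
  by rewrite divff// gt_eqF// mulr_gt0.
rewrite /v /e reck.
have -> : (1 - g k * a k) * x k + a k * y k - c / l =
  (1 - g k * a k) * (x k - c / l) + a k * (y k - g k * (c / l)) by ring.
apply: (le_trans (ler_normD _ _)); rewrite !normrM lerD//.
  rewrite ler_wpM2r// ger0_norm ?subr_ge0// lerD2l lerN2 ler_wpM2r//.
  by lra.
by rewrite (ger0_norm (a0 k)).
Unshelve. all: by end_near. Qed.

End recursions.

Section steps.
Context {R : realType}.
Variables (g1 b : R).
Hypotheses (g10 : 0 < g1) (b12 : 1 / 2 < b) (b1 : b <= 1).

Definition gam (n : nat) : R := g1 * (n%:R `^ (- b)).

Let b0 : 0 < b. Proof. by move: b12; lra. Qed.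

Let g1' : 0 <= g1. Proof. exact: ltW. Qed.

Lemma gam_gt0 n : 0 < gam n.+1.
Proof. by rewrite /gam mulr_gt0// powR_gt0// ltr0n. Qed.

Lemma gam_ge0 n : 0 <= gam n.
Proof. by rewrite /gam mulr_ge0// powR_ge0. Qed.

Lemma gam_ge_inv n : g1 * (n.+1%:R)^-1 <= gam n.+1.
Proof.
rewrite /gam ler_wpM2l// -powR_inv1 ?ler0n//.
by apply: ler_powR; [rewrite ler1n|move: b1; lra].
Qed.

Lemma gam_le n : gam n.+1 <= g1 * Num.sqrt (n.+1%:R)^-1.
Proof.
rewrite /gam ler_wpM2l// sqrtrV ?ler0n// -powR12_sqrt ?ler0n// -powRN.
by apply: ler_powR; [rewrite ler1n|move: b12; lra].
Qed.

Lemma gam_le_g1 n : gam n.+1 <= g1.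
Proof.
rewrite /gam -[leRHS]mulr1 ler_wpM2l//.
rewrite -[leRHS](powRr0 n.+1%:R).
by apply: ler_powR; [rewrite ler1n|move: b12; lra].
Qed.

Lemma sqrt_inv_cvg0 : (fun n : nat => Num.sqrt (n.+1%:R)^-1 : R) @ \oo --> 0.
Proof.
rewrite -[X in _ --> X]sqrtr0; apply: continuous_cvg; first exact: sqrt_continuous.
exact: cvg_harmonic.
Qed.

Lemma gam_cvg0 : (fun n => gam n.+1) @ \oo --> 0.
Proof.
apply: (@squeeze_cvgr _ _ _ _ (fun=> 0) (fun n => g1 * Num.sqrt (n.+1%:R)^-1)).
- by apply: nearW => n; rewrite gam_ge0 gam_le.
- exact: cvg_cst.
- by rewrite -[X in _ --> X](mulr0 g1); apply: cvgMr; exact: sqrt_inv_cvg0.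
Qed.

Lemma powR_inv (x r : R) : 0 <= x -> x^-1 `^ r = (x `^ r)^-1.
Proof. by move=> x0; rewrite -powR_inv1// -powRrM mulN1r powRN. Qed.

Lemma gam_sum : divergent_sum (fun n => gam n.+1).
Proof.
move=> B.
have H : series (@harmonic R) @ \oo --> +oo.
  apply: nondecreasing_dvgn_lt; last exact: dvg_harmonic.
  by apply: nondecreasing_series => n _ _; exact: harmonic_ge0.
move/cvgryPge : H => /(_ (B / g1)); apply: filterS => n.
rewrite ler_pdivrMr// mulrC => /le_trans; apply.
rewrite /series/= big_mkord mulr_sumr; apply: ler_sum => i _.
exact: gam_ge_inv.
Qed.

Lemma gam_ratio n : gam n.+1 / gam n.+2 <= 1 + (n.+1%:R)^-1.
Proof.
have n1 : 0 < n.+1%:R :> R by rewrite ltr0n.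
have n2 : 0 < n.+2%:R :> R by rewrite ltr0n.
have -> : gam n.+1 / gam n.+2 = (n.+2%:R / n.+1%:R) `^ b.
  rewrite /gam -mulf_div divff ?gt_eqF// mul1r !powRN invrK mulrC.
  by rewrite powRM ?invr_ge0 ?ler0n// powR_inv ?ler0n.
have -> : 1 + n.+1%:R^-1 = n.+2%:R / n.+1%:R :> R.
  by rewrite -[n.+2]addn1 natrD mulrDl divff ?gt_eqF// mul1r.
by apply: ler1_powR => //; rewrite ler_pdivlMr// mul1r ler_nat.
Qed.

Lemma gam_ratio_ge1 n : 1 <= gam n.+1 / gam n.+2.
Proof.
rewrite ler_pdivlMr ?gam_gt0// mul1r /gam ler_wpM2l// !powRN lef_pV2 ?posrE ?powR_gt0 ?ltr0n//.
by apply: ge0_ler_powR; rewrite ?nnegrE ?ler_nat// ltW.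
Qed.

(* [2 b - 1 = s > 0]: the terms telescope against [n^-s]. *)
Lemma gam_sq_le n : gam n.+2 ^+ 2 <=
  g1 ^+ 2 / (2 * b - 1) * (n.+1%:R `^ (- (2 * b - 1)) - n.+2%:R `^ (- (2 * b - 1))).
Proof.
set s := 2 * b - 1.
have s0 : 0 < s by rewrite /s; move: b12; lra.
have n1 : 0 < n.+1%:R :> R by rewrite ltr0n.
have n2 : 0 < n.+2%:R :> R by rewrite ltr0n.
have -> : gam n.+2 ^+ 2 = g1 ^+ 2 * (n.+2%:R `^ (- s) * n.+2%:R^-1).
  rewrite /gam exprMn; congr (_ * _).
  rewrite -powR_mulrn ?powR_ge0// -powRrM -(powR_inv1 (ltW n2)) -powRD; last first.
    by rewrite (gt_eqF n2) implybT.
  by congr (_ `^ _); rewrite /s; ring.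
rewrite -mulrA ler_wpM2l ?sqr_ge0// ler_pdivlMl//.
have -> : n.+1%:R `^ (- s) = n.+2%:R `^ (- s) * (n.+2%:R / n.+1%:R) `^ s :> R.
  rewrite powRM ?invr_ge0 ?ltW// mulrA -powRD; last by rewrite (gt_eqF n2) implybT.
  by rewrite addNr powRr0 mul1r powR_inv ?ltW// powRN.
rewrite -[X in _ <= _ - X]mulr1 -mulrBr mulrCA ler_wpM2l ?powR_ge0//.
rewrite lerBrDr addrC /powR gt_eqF ?divr_gt0//.
apply: le_trans (expR_ge1Dx _); rewrite lerD2l ler_wpM2l ?(ltW s0)//.
have -> : n.+2%:R / n.+1%:R = (1 + - n.+2%:R^-1)^-1 :> R.
  have -> : 1 - n.+2%:R^-1 = n.+1%:R / n.+2%:R :> R.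
    have e : n.+2%:R = n.+1%:R + 1 :> R by rewrite -[n.+2]addn1 natrD.
    by rewrite e; move: n1; move: (n.+1%:R : R) => y y0; field; rewrite gt_eqF//; lra.
  by rewrite invf_div.
have n2i : n.+2%:R^-1 < 1 :> R by rewrite invf_lt1// ltr1n.
rewrite lnV ?posrE ?subr_gt0// lerNr; apply: le_ln1Dx; rewrite ltrN2 //.
Qed.

Lemma gam_sq_sum_bounded : exists C : R, forall n, \sum_(k < n) gam k.+1 ^+ 2 <= C.
Proof.
set s := 2 * b - 1.
have s0 : 0 < s by rewrite /s; move: b12; lra.
exists (g1 ^+ 2 + g1 ^+ 2 / s) => -[|n].
  by rewrite big_ord0 addr_ge0// ?divr_ge0// ?sqr_ge0 ?ltW.
rewrite big_ord_recl lerD//.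
  by rewrite lerXn2r ?nnegrE ?gam_ge0 ?gam_le_g1.
apply: (@le_trans _ _ (\sum_(i < n) g1 ^+ 2 / s * (i.+1%:R `^ (- s) - i.+2%:R `^ (- s)))).
  by apply: ler_sum => i _; exact: gam_sq_le.
rewrite -mulr_sumr -[leRHS]mulr1 ler_wpM2l ?divr_ge0 ?sqr_ge0 ?(ltW s0)//.
rewrite -(big_mkord xpredT (fun i => i.+1%:R `^ (- s) - i.+2%:R `^ (- s))).
under eq_bigr do rewrite -opprB.
rewrite sumrN (telescope_sumr (fun i => i.+1%:R `^ (- s)))// opprB.
by rewrite powR1 lerBlDr lerDl powR_ge0.
Qed.

Lemma gam_sq_tail (eps : R) : 0 < eps ->
  exists N, forall n, \sum_(N <= k < n) gam k.+1 ^+ 2 <= eps.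
Proof.
move=> e0; have [C HC] := gam_sq_sum_bounded.
pose S n := \sum_(k < n) gam k.+1 ^+ 2.
have Snd : nondecreasing_seq S.
  apply/nondecreasing_seqP => n; rewrite /S big_ord_recr/= lerDl.
  by rewrite sqr_ge0.
have := nondecreasing_is_cvgn Snd (ex_intro _ C _).
move=> /(_ _)/wrap[|Scvg]; first by move=> _ [n _ <-]; exact: HC.
have [N _ HN] : \forall n \near \oo, lim (S @ \oo) - eps <= S n.
  have /cvgrPdist_le/(_ _ e0) : S @ \oo --> lim (S @ \oo) by exact: Scvg.
  by apply: filterS => n; rewrite ler_norml => /andP[_]; lra.
exists N => n; have [nN|Nn] := leqP n N; first by rewrite big_geq// ltW.
have -> : \sum_(N <= k < n) gam k.+1 ^+ 2 = S n - S N.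
  rewrite /S -!(big_mkord xpredT (fun k => gam k.+1 ^+ 2)).
  by rewrite (@big_cat_nat _ _ _ N 0 n)//= ?(ltnW Nn)// addrAC subrr add0r.
have := nondecreasing_cvgn_le Snd Scvg n; have := HN N (leqnn N); rewrite /=; lra.
Qed.

(* Normalized partial sums satisfy a contracting recursion with step [1/(n+1)]. *)
Lemma gam_avg_cvg0 :
  (fun n => (\sum_(k < n) gam k.+1) / Num.sqrt n%:R) @ \oo --> (0 : R).
Proof.
have hdiv : divergent_sum (fun n => (n.+1%:R)^-1 : R).
  move=> B.
  have H : series (@harmonic R) @ \oo --> +oo.
    apply: nondecreasing_dvgn_lt; last exact: dvg_harmonic.
    by apply: nondecreasing_series => n _ _; exact: harmonic_ge0.
  move/cvgryPge : H => /(_ B); apply: filterS => n.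
  by rewrite /series/= big_mkord.
have ecvg : (fun n => Num.sqrt n.+1%:R * gam n.+1) @ \oo --> (0 : R).
  have h : - b + 1 / 2 < 0 by move: b12; lra.
  suff H : (fun n : nat => n.+1%:R `^ (- (b - 1 / 2)) : R) @ \oo --> 0.
    rewrite -(mulr0 g1).
    have -> : (fun n => Num.sqrt n.+1%:R * gam n.+1) = (fun n => g1 * n.+1%:R `^ (- (b - 1 / 2))).
      apply/funext => n; rewrite -powR12_sqrt ?ler0n// /gam mulrCA -powRD; last first.
        by rewrite pnatr_eq0 implybT.
      by congr (_ * _ `^ _); ring.
    by apply: cvgMr.
  have c0 : 0 < b - 1 / 2 by move: b12; lra.
  under eq_fun do rewrite powRN -powR_inv ?ler0n//.
  apply/cvgrPdist_le => e e0.
  have := @cvg_harmonic R; move/cvgrPdist_le => /(_ (e `^ ((b - 1 / 2)^-1))).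
  rewrite powR_gt0// => /(_ isT); apply: filterS => n.
  rewrite !sub0r !normrN !ger0_norm ?powR_ge0 ?invr_ge0 ?ler0n// => H.
  have -> : e = (e `^ (b - 1 / 2)^-1) `^ (b - 1 / 2).
    by rewrite -powRrM mulVf ?gt_eqF// powRr1 ?ltW.
  by apply: ge0_ler_powR; rewrite ?nnegrE ?powR_ge0 ?invr_ge0 ?ler0n ?(ltW c0).
apply: (@rec_cvg0 _ (fun n => (n.+1%:R)^-1) _ (fun n => Num.sqrt n.+1%:R * gam n.+1) (1 / 2)) => //.
- exact: cvg_harmonic.
- apply: nearW => k; rewrite divr_ge0 ?sqrtr_ge0//; apply: sumr_ge0 => i _; exact: gam_ge0.
exists 1%N => // -[|k] _//=.
set r := Num.sqrt k.+2%:R; set r1 := Num.sqrt k.+1%:R.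
have r0 : 0 < r by rewrite sqrtr_gt0 ltr0n.
have r10 : 0 < r1 by rewrite sqrtr_gt0 ltr0n.
have rr : r ^+ 2 = k.+2%:R by rewrite sqr_sqrtr ?ler0n.
have rr1 : r1 ^+ 2 = k.+1%:R by rewrite sqr_sqrtr ?ler0n.
rewrite big_ord_recr/= mulrDl; apply: lerD; last first.
  have -> : gam k.+2 / r = (r ^+ 2)^-1 * (r * gam k.+2) by field; rewrite gt_eqF.
  by rewrite rr.
rewrite mulrCA ler_wpM2l//; first by apply: sumr_ge0 => i _; exact: gam_ge0.
rewrite ler_pdivlMr// ler_pdivrMl//.
(* Since [r ^+ 2 = r1 ^+ 2 + 1], the claim [r1 <= r - 1 / (2 r)] amounts to [0 <= (r - r1) ^+ 2]. *)
have -> : r * (1 - 1 / 2 / k.+2%:R) = r - 1 / 2 / r.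
  by rewrite -rr mulrBr mulr1; congr (_ - _); field; rewrite gt_eqF.
rewrite lerBrDr -lerBrDl ler_pdivrMr//.
have : r1 ^+ 2 + 1 = r ^+ 2 by rewrite rr rr1 -[k.+2]addn1 natrD.
have := sqr_ge0 (r - r1); move: r r1 {r0 r10 rr rr1} => r r1; nra.
Qed.

(** This ties the two scalings of the theorem together: at the final step [n = K^2], [h^(- beta)] is
    exactly [sqrt (gamma1 / gamma_n)]. *)
Lemma gam_norm n : (0 < n)%N -> (hK n `^ (- b)) ^+ 2 * gam (n ^ 2)%N = g1 :> R.
Proof.
move=> n0; have nR : 0 < n%:R :> R by rewrite ltr0n.
rewrite /gam /hK powR_inv ?ltW// -powRN opprK natrX -!powR_mulrn ?powR_ge0 ?ltW//.
rewrite -!powRrM mulrCA -powRD ?(gt_eqF nR) ?implybT//.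
have -> : b * 2 + 2 * - b = 0 by ring.
by rewrite powRr0 mulr1.
Qed.

(** [n * gam n] equals [g1] when [b = 1] and tends to infinity when [b < 1]. The lemma lets a
    contraction of rate [t] absorb the relative variation of the steps, which is of order
    [1 / n]. *)
Lemma inv_nat_le_gam (t : R) : 0 < t -> (b = 1 -> 1 < t * g1) ->
  \forall n \near \oo, n.+1%:R^-1 <= t * gam n.+2.
Proof.
move=> t0 tb.
have [b11|bn1] := eqVneq b 1.
  have [N _ HN] : \forall n \near \oo, n.+2%:R^-1 <= (t * g1 - 1) :> R.
    have := @cvg_harmonic R; move/cvgrPdist_le => /(_ (t * g1 - 1)).
    rewrite subr_gt0 => /(_ (tb b11)) [N _ HN]; exists N => // n Nn.
    have := HN n.+1 (leqW Nn); rewrite /= sub0r normrN ger0_norm// invr_ge0 ler0n//.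
  exists N.+1 => // -[//|n] /= Nn; have {}HN := HN n Nn.
  rewrite /gam b11 powR_inv1 ?ler0n// mulrA.
  have p2 : 0 < n.+2%:R :> R by rewrite ltr0n.
  have p3 : 0 < n.+3%:R :> R by rewrite ltr0n.
  have e : n.+3%:R = n.+2%:R + 1 :> R by rewrite -[n.+3]addn1 natrD.
  rewrite ler_pdivlMr// e; have -> : n.+2%:R^-1 * (n.+2%:R + 1) = 1 + n.+2%:R^-1 :> R.
    by field; rewrite gt_eqF.
  by move: HN; move: (n.+2%:R^-1) => y; lra.
have c0 : 0 < 1 - b by rewrite subr_gt0 lt_neqAle bn1 b1.
have tg : 0 < (t * g1 / 2) `^ ((1 - b)^-1) by rewrite powR_gt0// divr_gt0// mulr_gt0.
have [N _ HN] : \forall n \near \oo, n.+2%:R^-1 <= (t * g1 / 2) `^ ((1 - b)^-1).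
  have := @cvg_harmonic R; move/cvgrPdist_le => /(_ _ tg) [N _ HN]; exists N => // n Nn.
  have := HN n.+1 (leqW Nn); rewrite /= sub0r normrN ger0_norm// invr_ge0 ler0n//.
exists N => // n /= Nn; have {}HN := HN n Nn.
have p1 : 0 < n.+1%:R :> R by rewrite ltr0n.
have p2 : 0 < n.+2%:R :> R by rewrite ltr0n.
have H2 : n.+2%:R^-1 `^ (1 - b) <= t * g1 / 2.
  have -> : t * g1 / 2 = ((t * g1 / 2) `^ (1 - b)^-1) `^ (1 - b).
    rewrite -powRrM mulVf ?gt_eqF// powRr1 ?ltW// divr_gt0// mulr_gt0//.
  by apply: ge0_ler_powR; rewrite ?nnegrE ?powR_ge0 ?invr_ge0 ?ler0n ?(ltW c0).
have -> : t * gam n.+2 = t * g1 * (n.+2%:R `^ (1 - b)) / n.+2%:R.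
  rewrite /gam mulrA -[RHS]mulrA; congr (_ * _); rewrite -(powR_inv1 (ltW p2)) -powRD ?(gt_eqF p2) ?implybT//.
  by congr (_ `^ _); ring.
apply: (@le_trans _ _ (2 / n.+2%:R)).
  rewrite ler_pdivlMr// mulrC ler_pdivrMr// -natrM ler_nat mulSn mul1n addnS ltnS.
  by rewrite addSn ltnS leq_addr.
rewrite ler_wpM2r ?invr_ge0 ?(ltW p2)//.
have z0 : 0 < n.+2%:R `^ (1 - b) by rewrite powR_gt0.
move: H2; rewrite powR_inv ?(ltW p2)// -[X in X <= _ -> _]div1r ler_pdivrMr//.
by lra.
Qed.

(* [(gam k / gam k.+1 - 1) / gam k.+1] is [1/g1 + 1/(g1 k)] when [b = 1] and vanishes otherwise. *)
Lemma gam_ratio_cvg :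
  (fun n => (gam n.+1 / gam n.+2 - 1) / gam n.+2) @ \oo --> (if b == 1 then g1^-1 else 0).
Proof.
case: eqP => [b11|/eqP bn1].
  have -> : (fun n => (gam n.+1 / gam n.+2 - 1) / gam n.+2) = (fun n => g1^-1 * (1 + n.+1%:R^-1)).
    apply/funext => n; rewrite /gam b11 !powR_inv1 ?ler0n//.
    have p1 : 0 < n.+1%:R :> R by rewrite ltr0n.
    have -> : n.+2%:R = n.+1%:R + 1 :> R by rewrite -[n.+2]addn1 natrD.
    field; rewrite !gt_eqF//; lra.
  rewrite -[X in _ --> X]mulr1; apply: cvgMr; rewrite -[X in _ --> X]addr0.
  by apply: cvgD; [exact: cvg_cst|exact: cvg_harmonic].
apply/cvgrPdist_le => e e0.
have := @inv_nat_le_gam e e0 (fun h => match (negP bn1) (introT eqP h) with end).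
apply: filterS => n H; rewrite sub0r normrN ger0_norm.
  rewrite ler_pdivrMr ?gam_gt0//; apply: le_trans H.
  by rewrite lerBlDl gam_ratio.
by rewrite divr_ge0 ?gam_ge0// subr_ge0 gam_ratio_ge1.
Qed.

End steps.

(** * Expectation and independence *)

Section measurability.
Context {d} {T : measurableType d} {R : realType}.
Implicit Types f g : T -> R.

Lemma mfun_cst (c : R) : measurable_fun [set: T] (fun=> c).
Proof. exact: measurable_cst. Qed.

Lemma mfunD f g : measurable_fun setT f -> measurable_fun setT g ->
  measurable_fun setT (fun w => f w + g w).
Proof. exact: measurable_funD. Qed.

Lemma mfunB f g : measurable_fun setT f -> measurable_fun setT g ->
  measurable_fun setT (fun w => f w - g w).
Proof. exact: measurable_funB. Qed.

Lemma mfunN f : measurable_fun setT f -> measurable_fun setT (fun w => - f w).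
Proof.
move=> mf; have -> : (fun w => - f w) = (fun w => 0 - f w) by apply/funext => w; rewrite sub0r.
by apply: mfunB => //; exact: mfun_cst.
Qed.

Lemma mfunM f g : measurable_fun setT f -> measurable_fun setT g ->
  measurable_fun setT (fun w => f w * g w).
Proof. exact: measurable_funM. Qed.

Lemma mfunX f n : measurable_fun setT f -> measurable_fun setT (fun w => f w ^+ n).
Proof. exact: measurable_funX. Qed.

Lemma mfun_abs f : measurable_fun setT f -> measurable_fun setT (fun w => `|f w|).
Proof. by move=> mf; exact: (measurableT_comp (@normr_measurable _ setT) mf). Qed.

Lemma mfun_max f g : measurable_fun setT f -> measurable_fun setT g ->
  measurable_fun setT (fun w => Num.max (f w) (g w)).
Proof. exact: measurable_maxr. Qed.

Lemma mfun_if (b : T -> bool) f g : measurable_fun setT b ->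
  measurable_fun setT f -> measurable_fun setT g ->
  measurable_fun setT (fun w => if b w then f w else g w).
Proof. by move=> mb mf mg; exact: measurable_fun_ifT. Qed.

Lemma mfun_le f g : measurable_fun setT f -> measurable_fun setT g ->
  measurable_fun setT (fun w => f w <= g w).
Proof. exact: measurable_fun_ler. Qed.

Lemma mfun_lt f g : measurable_fun setT f -> measurable_fun setT g ->
  measurable_fun setT (fun w => f w < g w).
Proof. exact: measurable_fun_ltr. Qed.

Lemma mfun_comp (h : R -> R) f : measurable_fun setT h -> measurable_fun setT f ->
  measurable_fun setT (fun w => h (f w)).
Proof. by move=> mh mf; exact: (measurableT_comp mh mf). Qed.

Lemma mfun_sum (n : nat) (F : nat -> T -> R) :
  (forall k, measurable_fun setT (F k)) ->
  measurable_fun setT (fun w => \sum_(k < n) F k w).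
Proof. by move=> mF; exact: measurable_sum. Qed.

Lemma mfun_continuous (h : R -> R) : continuous h -> measurable_fun setT h.
Proof. exact: continuous_measurable_fun. Qed.

End measurability.

Ltac mfun := repeat first
  [ assumption | exact: mfun_cst | exact: measurable_id
  | exact: measurable_fst | exact: measurable_snd
  | apply: mfunX | apply: mfun_abs | apply: mfunB | apply: mfunD | apply: mfunN
  | apply: mfunM | apply: mfun_max | apply: mfun_if | apply: mfun_le
  | apply: mfun_lt ].

Section expectation.
Context {d} {T : measurableType d} {R : realType} (P : probability T R).
Implicit Types f g : T -> R.

Definition L1 f := P.-integrable setT (EFin \o f).
(** Expectation as a real number, the finite part of the integral, so that real arithmetic applies;
    the algebraic rules then ask for [L1]. *)
Definition Ex f : R := \int[P]_w f w.

Lemma L1_meas f : L1 f -> measurable_fun setT f.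
Proof. by move=> /measurable_int; rewrite measurable_EFinP. Qed.

Lemma Ex_fin f : L1 f -> (\int[P]_w (f w)%:E)%E = (Ex f)%:E.
Proof. by move=> Lf; rewrite /Ex/Rintegral fineK//; exact: integrable_fin_num. Qed.

Lemma eq_Ex f g : (forall w, f w = g w) -> Ex f = Ex g.
Proof. by move=> fg; congr Ex; apply/funext. Qed.

Lemma eq_L1 f g : (forall w, f w = g w) -> L1 f -> L1 g.
Proof. by move=> fg; have -> : f = g by apply/funext. Qed.

Lemma L1_le f g : measurable_fun setT f -> (forall w, `|f w| <= g w) -> L1 g -> L1 f.
Proof.
move=> mf fg; apply: le_integrable => //; first exact/measurable_EFinP.
by move=> w _ /=; rewrite lee_fin; apply: le_trans (fg w) (ler_norm _).
Qed.

Lemma L1_cst (c : R) : L1 (fun=> c).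
Proof. exact: finite_measure_integrable_cst. Qed.

Lemma L1_bnd f M : measurable_fun setT f -> (forall w, `|f w| <= M) -> L1 f.
Proof. by move=> mf fM; exact: (L1_le mf fM (L1_cst M)). Qed.

Lemma L1D f g : L1 f -> L1 g -> L1 (fun w => f w + g w).
Proof. by move=> Lf Lg; exact: (integrableD _ Lf Lg). Qed.

Lemma L1Z c f : L1 f -> L1 (fun w => c * f w).
Proof. by move=> Lf; exact: (integrableZl _ c Lf). Qed.

Lemma L1N f : L1 f -> L1 (fun w => - f w).
Proof. by move=> /(L1Z (-1)); apply: eq_L1 => w; rewrite mulN1r. Qed.

Lemma L1B f g : L1 f -> L1 g -> L1 (fun w => f w - g w).
Proof. by move=> Lf Lg; exact: (L1D Lf (L1N Lg)). Qed.

Lemma L1_abs f : L1 f -> L1 (fun w => `|f w|).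
Proof.
move=> Lf; have mf := L1_meas Lf.
by apply: le_integrable Lf => //= [|w _]; rewrite ?normr_id//; apply/measurable_EFinP; mfun.
Qed.

Lemma L1_sum n (F : nat -> T -> R) : (forall k, (k < n)%N -> L1 (F k)) ->
  L1 (fun w => \sum_(k < n) F k w).
Proof.
elim: n => [|n IH] LF; first by apply: (eq_L1 _ (L1_cst 0)) => w; rewrite big_ord0.
apply: (@eq_L1 (fun w => \sum_(k < n) F k w + F n w)).
  by move=> w; rewrite big_ord_recr.
by apply: L1D; [apply: IH => k /ltnW; exact: LF|exact: LF].
Qed.

Lemma Ex_cst c : Ex (fun=> c) = c.
Proof. by rewrite /Ex Rintegral_cst//= [X in fine X]probability_setT mulr1. Qed.

Lemma ExD f g : L1 f -> L1 g -> Ex (fun w => f w + g w) = Ex f + Ex g.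
Proof. exact: RintegralD. Qed.

Lemma ExZ c f : L1 f -> Ex (fun w => c * f w) = c * Ex f.
Proof. by move=> Lf; exact: RintegralZl. Qed.

Lemma ExN f : L1 f -> Ex (fun w => - f w) = - Ex f.
Proof.
by move=> Lf; rewrite -mulN1r -ExZ//; apply: eq_Ex => w; rewrite mulN1r.
Qed.

Lemma ExB f g : L1 f -> L1 g -> Ex (fun w => f w - g w) = Ex f - Ex g.
Proof. by move=> Lf Lg; rewrite ExD ?ExN//; exact: L1N. Qed.

Lemma Ex_sum n (F : nat -> T -> R) : (forall k, (k < n)%N -> L1 (F k)) ->
  Ex (fun w => \sum_(k < n) F k w) = \sum_(k < n) Ex (F k).
Proof.
elim: n => [|n IH] LF.
  by rewrite big_ord0 -[RHS](Ex_cst 0); apply: eq_Ex => w; rewrite big_ord0.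
rewrite big_ord_recr/= -IH; last by move=> k /ltnW; exact: LF.
rewrite -ExD ?L1_sum//; last 2 first.
- by move=> k /ltnW; exact: LF.
- exact: LF.
by apply: eq_Ex => w; rewrite big_ord_recr.
Qed.

Lemma Ex_le f g : L1 f -> L1 g -> (forall w, f w <= g w) -> Ex f <= Ex g.
Proof. by move=> Lf Lg fg; apply: le_Rintegral => // w _; exact: fg. Qed.

Lemma Ex_ge0 f : (forall w, 0 <= f w) -> 0 <= Ex f.
Proof. by move=> f0; apply: Rintegral_ge0 => w _. Qed.

Lemma Ex_abs f : L1 f -> `|Ex f| <= Ex (fun w => `|f w|).
Proof. by move=> Lf; exact: le_normr_Rintegral. Qed.

Definition L2 f := measurable_fun setT f /\ L1 (fun w => f w ^+ 2).

Lemma L2_L1M f g : L2 f -> L2 g -> L1 (fun w => f w * g w).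
Proof.
move=> [mf Lf] [mg Lg]; apply: (@L1_le _ (fun w => f w ^+ 2 + g w ^+ 2)); [by mfun| |exact: L1D].
move=> w; rewrite normrM -(real_normK (num_real (f w))) -(real_normK (num_real (g w))).
have := sqr_ge0 (`|f w| - `|g w|); have := normr_ge0 (f w); have := normr_ge0 (g w).
by move: (`|f w|) (`|g w|) => a b; nra.
Qed.

Lemma L2_bnd f M : measurable_fun setT f -> (forall w, `|f w| <= M) -> L2 f.
Proof.
move=> mf fM; split => //; apply: (@L1_bnd _ (M ^+ 2)); first by mfun.
by move=> w; rewrite normrX lerXn2r ?nnegrE//; apply: le_trans (fM w).
Qed.

Lemma L2_L1 f : L2 f -> L1 f.
Proof.
move=> Lf; apply: (@eq_L1 (fun w => f w * 1)); first by move=> w; rewrite mulr1.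
by apply: L2_L1M => //; apply: (@L2_bnd _ 1) => // w; rewrite normr1.
Qed.

Lemma L2_le f g : measurable_fun setT f -> (forall w, `|f w| <= `|g w|) -> L2 g -> L2 f.
Proof.
move=> mf fg [mg Lg]; split => //; apply: (L1_le _ _ Lg); first by mfun.
by move=> w; rewrite normrX -(real_normK (num_real (g w))) lerXn2r ?nnegrE.
Qed.

Lemma L2Z c f : L2 f -> L2 (fun w => c * f w).
Proof.
move=> [mf Lf]; split; first by mfun.
by apply: (eq_L1 _ (L1Z (c ^+ 2) Lf)) => w; rewrite exprMn.
Qed.

Lemma L2D f g : L2 f -> L2 g -> L2 (fun w => f w + g w).
Proof.
move=> Lf Lg; have [mf Lf2] := Lf; have [mg Lg2] := Lg; split; first by mfun.
apply: (eq_L1 _ (L1D (L1D Lf2 (L1Z 2 (L2_L1M Lf Lg))) Lg2)) => w; ring.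
Qed.

Lemma L2B f g : L2 f -> L2 g -> L2 (fun w => f w - g w).
Proof.
move=> Lf Lg; have := L2D Lf (L2Z (-1) Lg).
by congr L2; apply/funext => w; rewrite mulN1r.
Qed.

Lemma L2_abs f : L2 f -> L2 (fun w => `|f w|).
Proof.
by move=> [mf Lf]; split; [mfun|apply: (eq_L1 _ Lf) => w; rewrite real_normK ?num_real].
Qed.

Lemma L2_cst c : L2 (fun=> c).
Proof. by apply: (@L2_bnd _ `|c|) => //; mfun. Qed.

Lemma L2_bndM f g M : measurable_fun setT f -> (forall w, `|f w| <= M) -> L2 g ->
  L2 (fun w => f w * g w).
Proof.
move=> mf fM Lg; have [mg _] := Lg.
apply: (@L2_le _ (fun w => M * g w)); [by mfun| |exact: L2Z].
move=> w; rewrite !normrM ler_wpM2r//.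
by apply: le_trans (fM w) _; exact: ler_norm.
Qed.

(* Jensen, from [0 <= E (|f| - m)^2] with [m = E |f|]. *)
Lemma Ex_abs_sqr f : L2 f -> (Ex (fun w => `|f w|)) ^+ 2 <= Ex (fun w => f w ^+ 2).
Proof.
move=> Lf; have [mf Lf2] := Lf; have La := L2_L1 (L2_abs Lf).
set m := Ex _.
have : 0 <= Ex (fun w => (`|f w| - m) ^+ 2) by apply: Ex_ge0 => w; exact: sqr_ge0.
rewrite (_ : Ex (fun w => (`|f w| - m) ^+ 2) = Ex (fun w => (f w ^+ 2 - (2 * m) * `|f w|) + m ^+ 2)).
  have Lm := L1Z (2 * m) La.
  by rewrite (ExD (L1B Lf2 Lm) (L1_cst _)) (ExB Lf2 Lm) ExZ// Ex_cst -/m; nra.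
apply: eq_Ex => w; rewrite sqrrB real_normK ?num_real//; ring.
Qed.

Lemma Ex_dominated (f_ : nat -> T -> R) f g :
  (forall n, measurable_fun setT (f_ n)) -> measurable_fun setT f ->
  (forall w, (fun n => f_ n w) @ \oo --> f w) ->
  (forall n w, `|f_ n w| <= g w) -> L1 g -> (fun n => Ex (f_ n)) @ \oo --> Ex f.
Proof.
move=> mf_ mf cf fg Lg.
have [] := @dominated_convergence _ _ _ P setT measurableT (fun n => EFin \o f_ n) (EFin \o f) (EFin \o g).
- by move=> n; apply/measurable_EFinP.
- exact/measurable_EFinP.
- by apply: aeW => w _; apply: cvg_EFin; [exact: nearW|exact: cf].
- exact: Lg.
- by apply: aeW => w n _; rewrite /= lee_fin.
move=> If _ H.
rewrite /Ex /Rintegral; apply: fine_cvg.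
by rewrite fineK//; exact: integrable_fin_num.
Qed.

(** Monotone convergence, for functions whose integrability is not known beforehand: the truncations
    are bounded, so their real-valued expectations are meaningful. *)
Lemma L1_trunc f M : measurable_fun setT f -> (forall w, 0 <= f w) ->
  (forall n : nat, Ex (fun w => Num.min (f w) n%:R) <= M) -> L1 f /\ Ex f <= M.
Proof.
move=> mf f0 H.
have mm (n : nat) : measurable_fun setT (fun w => Num.min (f w) n%:R).
  by apply: measurable_minr => //; exact: mfun_cst.
have H' : (\int[P]_w (f w)%:E <= M%:E)%E.
  have C : ((\int[P]_w (Num.min (f w) n%:R)%:E) @[n --> \oo] -->
      \int[P]_w limn (fun n : nat => (Num.min (f w) n%:R)%:E))%E.
    apply: cvg_monotone_convergence => //.
    - by move=> n; exact/measurable_EFinP.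
    - by move=> n w _; rewrite lee_fin le_min f0 ler0n.
    - move=> w _ m n mn.
      by rewrite lee_fin le_min ge_min lexx/= ge_min ler_nat mn orbT.
  have E : (\int[P]_w limn (fun n : nat => (Num.min (f w) n%:R)%:E) = \int[P]_w (f w)%:E)%E.
    apply: eq_integral => w _; apply/cvg_lim => //; apply: cvg_EFin; first exact: nearW.
    apply: cvg_near_cst; exists (Num.truncn (f w)).+1 => // n /= nw.
    apply/min_idPl; rewrite ltW// -truncn_lt_nat//.
  rewrite -E -(cvg_lim _ C)//; apply: lime_le; first exact: cvgP C.
  apply: nearW => n; rewrite (Ex_fin (f := fun w => Num.min (f w) n%:R)) ?lee_fin//.
  apply: (@L1_bnd _ n%:R) => // w; rewrite ger0_norm ?ge_min ?lexx ?orbT// le_min f0 ler0n//.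
have Lf : L1 f.
  apply/integrableP; split; first exact/measurable_EFinP.
  under eq_integral do rewrite /= ger0_norm//.
  by apply: le_lt_trans H' _; rewrite ltry.
by split => //; rewrite -lee_fin -(Ex_fin Lf).
Qed.

End expectation.

#[global] Hint Resolve L1_cst : core.

Section independence.
Context {d} {T : measurableType d} {R : realType} (P : probability T R).
Context {dU} {U : measurableType dU}.

Definition indep_rv (S : T -> U) (X : T -> R) := forall A B,
  measurable A -> measurable B ->
  P (S @^-1` A `&` X @^-1` B) = (P (S @^-1` A) * P (X @^-1` B))%E.

Variables (S : T -> U) (X X' : T -> R).
Hypotheses (mS : measurable_fun setT S) (mX : measurable_fun setT X)
  (mX' : measurable_fun setT X') (XX' : same_law P X X') (SX : indep_rv S X).

Section indep_integral.
Variables (psi : U * R -> R) (h : U -> R).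
Hypotheses (mpsi : measurable_fun setT psi) (Lpsi : L1 P (fun w => psi (S w, X w)))
  (Lpsi' : forall u, L1 P (fun w => psi (u, X' w)))
  (psih : forall u, Ex P (fun w => psi (u, X' w)) = h u).

Let mSX : measurable_fun setT (fun w => (S w, X w)).
Proof. exact: measurable_fun_pair. Qed.

Let fS : {mfun T >-> U} := mfun_Sub (mem_set mS).
Let fX' : {mfun T >-> R} := mfun_Sub (mem_set mX').
Let fSX : {mfun T >-> (U * R)%type} := mfun_Sub (mem_set mSX).

(** Independence and the equality of the laws of [X] and [X'] give the values on rectangles, and
    these determine the product measure. *)
Let prod_law C : measurable C ->
  (distribution P fS \x distribution P fX')%E C = distribution P fSX C.
Proof.
apply: product_measure_unique => A B mA mB.
apply: (etrans (SX mA mB)); congr (_ * _)%E; exact: XX'.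
Qed.

(** Freezing lemma: [h (S w)] is the conditional expectation of [psi (S, X)] given [S], computed
    with [S] held fixed and [X] replaced by the copy [X']. The conditional expectations of the
    algorithm are taken through it. *)
Lemma Ex_indep : L1 P (h \o S) /\ Ex P (fun w => psi (S w, X w)) = Ex P (h \o S).
Proof.
have mE : measurable_fun setT (EFin \o psi) by apply/measurable_EFinP.
have Lprod : (distribution P fS \x distribution P fX')%E.-integrable setT (EFin \o psi).
  apply/integrableP; split => //.
  rewrite (eq_measure_integral (distribution P fSX)); last by move=> A mA _; exact: prod_law.
  rewrite ge0_integral_distribution//; last by apply: measurableT_comp.
  by move/integrableP : Lpsi => [].
have hE u : (\int[distribution P fX']_x (psi (u, x))%:E)%E = (h u)%:E.
  have mu : measurable_fun setT (fun x => psi (u, x)).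
    by apply: (measurableT_comp mpsi); exact: measurable_fun_pair.
  rewrite (@integral_distribution _ _ _ _ _ P fX' (fun x => (psi (u, x))%:E)).
  - by rewrite -psih -(Ex_fin (Lpsi' u)).
  - exact/measurable_EFinP.
  - exact: Lpsi'.
have hF : EFin \o h = fubini_F (distribution P fX') (EFin \o psi).
  by apply/funext => u; rewrite /fubini_F/= hE.
have Lh : (distribution P fS).-integrable setT (EFin \o h).
  by rewrite hF; exact: integrable_fubini_F.
have mh : measurable_fun setT (EFin \o h) by case/integrableP : Lh.
have Lh' : L1 P (h \o S).
  apply/integrableP; split.
    by apply/measurable_EFinP; apply: measurableT_comp => //; exact/measurable_EFinP.
  case/integrableP : Lh => _.
  by rewrite ge0_integral_distribution//; apply: measurableT_comp.
split => //.
apply: EFin_inj; rewrite -!Ex_fin//.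
have -> : (\int[P]_w ((h \o S) w)%:E = \int[distribution P fS]_u (h u)%:E)%E.
  by rewrite (@integral_distribution _ _ _ _ _ P fS (EFin \o h)).
transitivity (\int[distribution P fSX]_p (psi p)%:E)%E.
  by rewrite (@integral_distribution _ _ _ _ _ P fSX (EFin \o psi)).
rewrite -(eq_measure_integral (distribution P fSX) (fun A mA _ => prod_law mA)).
by rewrite -(integral12_prod_meas1 Lprod) -hF.
Qed.

End indep_integral.
End independence.

Section chain.
Context {d} {T : measurableType d} {R : realType} (P : probability T R).
Context {dU} {U : measurableType dU}.
Variables (x0 : T -> R) (xs : nat -> T -> R) (S : nat -> T -> U)
  (s0 : R -> U) (Phi : nat -> U * R -> U).
Hypotheses (mx0 : measurable_fun setT x0) (mxs : forall n, measurable_fun setT (xs n))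
  (indep : mutually_independent P
    (fun o : option nat => if o is Some n then sigma_of (xs n) else sigma_of x0))
  (ms0 : measurable_fun setT s0) (mPhi : forall n, measurable_fun setT (Phi n))
  (S0 : forall w, S 0%N w = s0 (x0 w))
  (SS : forall n w, S n.+1 w = Phi n (S n w, xs n w)).

Lemma chain_measurable n : measurable_fun setT (S n).
Proof.
elim: n => [|n IH].
  have -> : S 0%N = s0 \o x0 by apply/funext => w; rewrite S0.
  exact: measurableT_comp.
have -> : S n.+1 = Phi n \o (fun w => (S n w, xs n w)) by apply/funext => w; rewrite SS.
by apply: measurableT_comp => //; exact: measurable_fun_pair.
Qed.

(* The future is kept in the induction hypothesis as a finite intersection. *)
Let future (J : seq nat) (B : nat -> set R) := \big[setI/setT]_(j <- J) (xs j @^-1` B j).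

Let mpre d' (V : measurableType d') (X : T -> V) A : measurable_fun setT X -> measurable A ->
  measurable (X @^-1` A).
Proof. by move=> mX mA; rewrite -[X in measurable X]setTI; exact: mX. Qed.

Let mfuture J B : (forall j, measurable (B j)) -> measurable (future J B).
Proof. by move=> mB; apply: bigsetI_measurable => j _; exact: mpre. Qed.

Let prob_future J B : uniq J -> (forall j, measurable (B j)) ->
  P (future J B) = (\prod_(j <- J) P (xs j @^-1` B j))%E.
Proof.
move=> uJ mB; have := indep (J := map Some J)
  (A := fun o => if o is Some j then xs j @^-1` B j else setT).
rewrite map_inj_uniq; last by move=> ? ? [].
rewrite !big_map => /(_ uJ); apply => i /mapP[j jJ ->]; exists (B j) => //; exact: mB.
Qed.

Let indep_future n (A : set U) J B : uniq J -> all (fun j => n <= j)%N J ->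
  measurable A -> (forall j, measurable (B j)) ->
  P (S n @^-1` A `&` future J B) = (P (S n @^-1` A) * P (future J B))%E.
Proof.
elim: n A J B => [|n IH] A J B uJ nJ mA mB.
  have := indep (J := None :: map Some J)
    (A := fun o => if o is Some j then xs j @^-1` B j else x0 @^-1` (s0 @^-1` A)).
  have -> : uniq (None :: map Some J).
    rewrite /= map_inj_uniq ?uJ ?andbT; last by move=> ? ? [].
    by apply/mapP => -[].
  rewrite !big_cons !big_map (_ : S 0%N @^-1` A = x0 @^-1` (s0 @^-1` A)); last first.
    by apply/seteqP; split => w /=; rewrite S0.
  rewrite prob_future// => /(_ isT); apply => -[j|].
    by rewrite in_cons/= => _; exists (B j) => //; exact: mB.
  by move=> _; exists (s0 @^-1` A) => //=; rewrite -[s0 @^-1` A]setTI; exact: ms0.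
pose E := future J B; have mE : measurable E by exact: mfuture.
pose SX w := (S n w, xs n w).
have mSn := chain_measurable n.
have mSX : measurable_fun setT SX by exact: measurable_fun_pair.
pose fS : {mfun T >-> U} := mfun_Sub (mem_set mSn).
pose fX : {mfun T >-> R} := mfun_Sub (mem_set (mxs n)).
pose fSX : {mfun T >-> (U * R)%type} := mfun_Sub (mem_set mSX).
have nJ' : n \notin J by apply/negP => /(allP nJ); rewrite ltnn.
(* The event on [xs n] joins the future: the induction hypothesis is applied to the list [n :: J'],
   with the set of index [n] changed to [B']. *)
have rect A' B' (mA' : measurable A') (mB' : measurable B') J' :
    uniq J' -> n \notin J' -> all (fun j => n <= j)%N J' ->
    P (SX @^-1` (A' `*` B') `&` future J' B) =
    (P (S n @^-1` A') * P (xs n @^-1` B') * P (future J' B))%E.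
  move=> uJ' nJ2 nJ3.
  pose B2 j := if j == n then B' else B j.
  have mB2 j : measurable (B2 j) by rewrite /B2; case: ifP.
  have fJ : future J' B2 = future J' B.
    rewrite /future; apply: eq_big_seq => j jJ; rewrite /B2 ifF//.
    by apply/negP => /eqP jn; rewrite -jn jJ in nJ2.
  have fnJ : future (n :: J') B2 = xs n @^-1` B' `&` future J' B.
    by rewrite -fJ /future big_cons {1}/B2 eqxx.
  have u' : uniq (n :: J') by rewrite /= nJ2.
  have := IH A' (n :: J') B2 u'; rewrite fnJ /= leqnn => /(_ nJ3 mA' mB2).
  move=> H; transitivity (P (S n @^-1` A' `&` (xs n @^-1` B' `&` future J' B))).
    by congr (P _); rewrite setIA.
  rewrite H -muleA; congr (_ * _)%E.
  by rewrite -fnJ !prob_future// big_cons {1}/B2 eqxx -!prob_future// fJ.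
have PE0 : (0 <= fine (P E)) by rewrite fine_ge0.
pose c := NngNum PE0.
have cE : (c%:num)%:E = P E by rewrite /= fineK// fin_num_measure.
(* The measures [C |-> P (SX in C and E)] and [C |-> P E * P (SX in C)] agree on rectangles, hence
   on every [C]. This is needed because the preimage of [A] under [Phi n] is not a rectangle in
   general. *)
pose m1 := pushforward (mrestr P mE) fSX.
pose m2 := mscale c (distribution P fSX).
have H C : measurable C -> m1 C = m2 C.
  move=> mC.
  apply: (@measure_unique _ _ _ [set A `*` B | A in measurable & B in measurable]
    (fun=> setT) _ _ _ _ m1 m2) => //.
  - exact: measurable_prod_measurableType.
  - move=> _ _ [X mX' [X' mX2 <-]] [Y mY [Y' mY' <-]]; rewrite -setXI.
    by exists (X `&` Y); [exact: measurableI|exists (X' `&` Y') => //; exact: measurableI].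
  - by move=> _; exists setT => //; exists setT => //; rewrite setXTT.
  - by rewrite bigcup_const.
  - move=> _ [A' mA' [B' mB' <-]].
    transitivity (P (SX @^-1` (A' `*` B') `&` E)); first by [].
    transitivity (c%:num%:E * P (SX @^-1` (A' `*` B')))%E; last by [].
    have := rect A' B' mA' mB' [::] isT isT isT; rewrite /future big_nil setIT probability_setT mule1.
    move=> r0; have nJ2 : all (fun j => n <= j)%N J.
      by apply: sub_all nJ => j /ltnW.
    by rewrite (rect A' B' mA' mB' J uJ nJ' nJ2) cE muleC -r0.
  - move=> _; rewrite /m1 /pushforward /mrestr/=.
    by apply: le_lt_trans (probability_le1 P _) (ltry _) => //; apply: measurableI => //; exact: mpre.
have mC : measurable (Phi n @^-1` A) by rewrite -[Phi n @^-1` A]setTI; exact: mPhi.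
have SE : S n.+1 @^-1` A = SX @^-1` (Phi n @^-1` A).
  by apply/seteqP; split => w /=; rewrite SS.
transitivity (m1 (Phi n @^-1` A)); first by rewrite SE.
rewrite H//; transitivity (c%:num%:E * P (SX @^-1` (Phi n @^-1` A)))%E; first by [].
by rewrite SE cE muleC.
Qed.

Lemma chain_indep n : indep_rv P (S n) (xs n).
Proof.
move=> A B mA mB.
have := @indep_future n A [:: n] (fun=> B) isT.
by rewrite /= leqnn /future big_seq1 => /(_ isT mA (fun=> mB)).
Qed.

End chain.

(** * The Gaussian law *)

Section trigo_bounds.
Context {R : realType}.
Implicit Types x y : R.

Lemma normr_sin_le x : `|sin x| <= `|x|.
Proof.
wlog x0 : x / 0 <= x.
  by have [/[swap]/[apply]//|/ltW x0 H] := leP 0 x; rewrite -normrN -sinN -[`|x|]normrN H// oppr_ge0.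
have [|c _ e] := @MVT_segment R sin cos 0 x x0 (fun z _ => is_derive_sin z).
  by apply: continuous_subspaceT; exact: continuous_sin.
by move: e; rewrite sin0 !subr0 => ->; rewrite normrM -[leRHS]mul1r ler_wpM2r ?cos_max.
Qed.

Lemma one_sub_cos_le x : 0 <= 1 - cos x <= x ^+ 2 / 2.
Proof.
rewrite subr_ge0 cos_le1/=.
have -> : 1 - cos x = 2 * sin (x / 2) ^+ 2.
  have {1}-> : x = (x / 2) *+ 2 by rewrite -mulr_natr divfK.
  by rewrite cos_mulr2n sin2cos2 mulr2n; ring.
have := normr_sin_le (x / 2); rewrite -(@ler_pXn2r _ 2) ?nnegrE// !real_normK ?num_real//.
move=> /(ler_wpM2l (ler0n R 2)) /le_trans; apply; rewrite exprMn; lra.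
Qed.

Lemma sin_sub_id_cube x : `|sin x - x| <= `|x| ^+ 3.
Proof.
wlog x0 : x / 0 <= x.
  move=> H; have [/H//|/ltW x0] := leP 0 x.
  rewrite -normrN opprD opprK -sinN -[`|x|]normrN; have := H (- x); rewrite opprK; apply.
  by rewrite oppr_ge0.
have dd (z : R) : is_derive z (1 : R) (fun z : R => sin z - z) (cos z - 1).
  by apply: is_deriveB.
have [|c cx e] := @MVT_segment R (fun z => sin z - z) (fun z => cos z - 1) 0 x x0 (fun z _ => dd z).
  apply: continuous_subspaceT => z; apply: cvgB; [exact: continuous_sin|exact: cvg_id].
move: e; rewrite sin0 !subr0 => ->; rewrite normrM exprSr ler_wpM2r//.
have := one_sub_cos_le c; rewrite -normrN opprB => /andP[c0 c1].
rewrite ger0_norm// (ger0_norm x0); apply: (le_trans c1).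
move: cx; rewrite in_itv/= => /andP[c0' cx]; nra.
Qed.

(** Remainder function of Lindeberg's method: cubic near 0, so that many small summands contribute
    little, and quadratic at infinity, so that second moments suffice. *)
Definition mcub x : R := Num.min (x ^+ 2) (`|x| ^+ 3).

Lemma mcub_ge0 x : 0 <= mcub x.
Proof. by rewrite le_min sqr_ge0 exprn_ge0. Qed.

Lemma mcubE x : mcub x = if `|x| <= 1 then `|x| ^+ 3 else x ^+ 2.
Proof.
rewrite /mcub -(real_normK (num_real x)); case: ifPn => [x1|]; last first.
  rewrite -ltNge => x1; apply/min_idPl; rewrite [leRHS]exprS ler_peMl ?sqr_ge0//.
  exact: ltW.
by apply/min_idPr; rewrite exprS ler_piMl ?sqr_ge0.
Qed.

Lemma sin_taylor x : `|sin x - x| <= 2 * mcub x.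
Proof.
rewrite mcubE; case: ifPn => [_|].
  by apply: le_trans (sin_sub_id_cube x) _; rewrite ler_peMl ?exprn_ge0// ler1n.
rewrite -ltNge => x1; apply: le_trans (ler_normB _ _) _.
have := normr_sin_le x; rewrite -(real_normK (num_real x)); nra.
Qed.

Lemma cos_taylor x : `|cos x - (1 - x ^+ 2 / 2)| <= 2 * mcub x.
Proof.
have /andP[h1 h2] := one_sub_cos_le x.
have e0 : 0 <= cos x - (1 - x ^+ 2 / 2) by lra.
rewrite (ger0_norm e0) mcubE; case: ifPn => [x1|]; last first.
  by move=> _; have := sqr_ge0 x; lra.
(* By the half-angle formula the remainder is [2 ((x/2)^2 - sin(x/2)^2)]; factoring it reuses the
   cubic bound for the sine. *)
have E : cos x - (1 - x ^+ 2 / 2) = 2 * ((x / 2 - sin (x / 2)) * (x / 2 + sin (x / 2))).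
  have {1}-> : x = (x / 2) *+ 2 by rewrite -mulr_natr divfK.
  by rewrite cos_mulr2n cos2sin2 mulr2n; field.
rewrite E ler_pM2l//; apply: le_trans (ler_norm _) _; rewrite normrM.
have a1 := sin_sub_id_cube (x / 2); have a2 := normr_sin_le (x / 2).
have a3 := ler_normD (x / 2) (sin (x / 2)).
have n2 : `|x / 2| = `|x| / 2 by rewrite normrM (@ger0_norm _ 2^-1).
rewrite distrC in a1; rewrite n2 in a1 a2 a3.
have a4 : `|x / 2 + sin (x / 2)| <= `|x| by lra.
apply: le_trans (ler_pM (normr_ge0 _) (normr_ge0 _) a1 a4) _.
have := normr_ge0 x; move: (`|x|) x1 => t t1 t0.
have -> : (t / 2) ^+ 3 * t = t ^+ 3 * (t / 8) by field.
rewrite ler_piMr ?exprn_ge0//; lra.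
Qed.

Lemma expR_taylor x : 0 <= x -> `|expR (- x) - (1 - x)| <= x ^+ 2.
Proof.
move=> x0; have h1 := expR_ge1Dx (- x).
have e0 : 0 <= expR (- x) - (1 - x) by lra.
rewrite (ger0_norm e0) expRN.
have h2 := expR_ge1Dx x; have p : 0 < expR x := expR_gt0 x.
rewrite lerBlDr -div1r ler_pdivrMr//.
have q : 0 <= x ^+ 2 + (1 - x) by nra.
have := ler_wpM2l q h2; nra.
Qed.

Lemma mcub_mono x y : `|x| <= `|y| -> mcub x <= mcub y.
Proof.
move=> xy; rewrite /mcub -(real_normK (num_real x)) -(real_normK (num_real y)).
by rewrite le_min !ge_min !lerXn2r ?nnegrE// orbT.
Qed.

Lemma mcub2 x : mcub (2 * x) <= 8 * mcub x.
Proof.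
rewrite /mcub normrM [`|2|]ger0_norm// !exprMn minr_pMr ?ler0n//.
rewrite le_min !ge_min; apply/andP; split; apply/orP; [left|right].
  by rewrite ler_wpM2r ?sqr_ge0//; lra.
by rewrite ler_wpM2r ?exprn_ge0//; lra.
Qed.

(** In modulus [x + y] is at most twice the larger term, and doubling the argument costs a factor 8.
    The two kinds of noise can thus be bounded separately. *)
Lemma mcubD x y : mcub (x + y) <= 8 * (mcub x + mcub y).
Proof.
wlog xy : x y / `|x| <= `|y|.
  move=> H; have [/H//|/ltW yx] := leP `|x| `|y|.
  by rewrite addrC [mcub x + _]addrC; exact: H.
apply: (@le_trans _ _ (mcub (2 * y))).
  apply: mcub_mono; rewrite normrM [`|2|]ger0_norm//.
  by apply: le_trans (ler_normD _ _) _; lra.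
by apply: le_trans (mcub2 y) _; have := mcub_ge0 x; lra.
Qed.

End trigo_bounds.

Section gaussian.
Context {R : realType}.
Local Notation mu := (@lebesgue_measure R).
Local Notation phi := (@normal_pdf R 0 1).
Local Notation N01 := (@normal_prob R 0 1).

(** [normal_pdf] is identified with the Radon-Nikodym derivative by almost everywhere uniqueness of
    densities. *)
Lemma integral_normal_prob (f : R -> R) : N01.-integrable setT (EFin \o f) ->
  (\int[N01]_x (f x)%:E = \int[mu]_x (f x * phi x)%:E)%E.
Proof.
move=> fint; have mf : measurable_fun setT (EFin \o f) by exact: measurable_int fint.
rewrite -(Radon_Nikodym_change_of_variables (normal_prob_dominates 0 1))//=.
apply: ae_eq_integral => //.
- apply: emeasurable_funM => //; apply: (measurable_int mu).
  by apply: Radon_Nikodym_integrable; exact: normal_prob_dominates.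
- apply/measurable_EFinP; apply: measurable_funM; first exact/measurable_EFinP.
  exact: measurable_normal_pdf.
under [X in ae_eq _ _ _ X]eq_fun do rewrite EFinM.
apply: ae_eqe_mul2l => /=.
rewrite Radon_NikodymE//=; first exact: normal_prob_dominates.
move=> dom; case: cid => /= h [h1 h2 h3].
apply: integral_ae_eq => //=.
- by apply/measurable_EFinP; exact: measurable_normal_pdf.
- by move=> E E01 mE; rewrite -h3.
Qed.

Lemma phiE x : phi x = normal_peak 1 * expR (- x ^+ 2 / 2).
Proof.
by rewrite normal_pdfE ?oner_neq0// /normal_fun subr0 expr1n.
Qed.

Lemma sqr_phi_int : mu.-integrable setT (fun x => (x ^+ 2 * phi x)%:E).
Proof.
(* With [s ^+ 2 = 2], the dominating function is a multiple of the Gaussian density of variance 2;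
   the comparison is [y <= exp y] at [y = x^2 / 4]. *)
set s : R := Num.sqrt 2.
have s2 : s ^+ 2 = 2 by rewrite sqr_sqrtr.
have s0 : s != 0 by rewrite sqrtr_eq0 -ltNge.
pose C : R := 4 * normal_peak 1 / normal_peak s.
have C0 : 0 <= C by rewrite divr_ge0// ?mulr_ge0// ?normal_peak_ge0.
apply: (@le_integrable _ _ R mu setT measurableT _ (fun x => (C%:E * (normal_pdf 0 s x)%:E)%E)).
- apply/measurable_EFinP; apply: measurable_funM; first exact: measurable_funX.
  exact: measurable_normal_pdf.
- move=> x _; rewrite -EFinM !abse_EFin lee_fin !ger0_norm; last 2 first.
  + by rewrite mulr_ge0// normal_pdf_ge0.
  + by rewrite mulr_ge0 ?sqr_ge0// normal_pdf_ge0.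
  rewrite phiE normal_pdfE// /normal_fun subr0 s2.
  rewrite /C -!mulrA mulKf ?gt_eqF ?normal_peak_gt0//.
  set p : R := normal_peak 1.
  have p0 : 0 <= p by exact: normal_peak_ge0.
  suff H : (x : R) ^+ 2 * expR (- (x : R) ^+ 2 / 2) <= 4 * expR (- (x : R) ^+ 2 / (2 *+ 2)).
    by have := ler_wpM2l p0 H; rewrite !mulrA ![p * _]mulrC -!mulrA ![p * _]mulrC !mulrA.
  set y := x ^+ 2 / 4.
  have -> : x ^+ 2 = 4 * y by rewrite /y; field.
  have -> : - (4 * y) / 2 = - y - y by field.
  have -> : - (4 * y) / (2 *+ 2) = - y by rewrite -mulr_natr; field.
  rewrite expRD -mulrA ler_pM2l// mulrA ler_piMl ?expR_ge0//.
  rewrite expRN -ler_pdivlMr ?invr_gt0 ?expR_gt0// invrK mul1r.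
  by have := expR_ge1Dx y; lra.
- by apply: integrableZl => //; exact: integrable_normal_pdf.
Qed.

Lemma Ex_N01 f : L1 N01 f -> Ex N01 f = \int[mu]_x (f x * phi x).
Proof.
by move=> Lf; rewrite /Ex /Rintegral integral_normal_prob.
Qed.

Lemma N01_sqr : L1 N01 (fun z : R => z ^+ 2).
Proof.
have mm n : measurable_fun setT (fun w : R => Num.min (w ^+ 2) n%:R).
  by apply: measurable_minr; [exact: measurable_funX|exact: measurable_cst].
have [] // := @L1_trunc _ _ _ N01 (fun z : R => z ^+ 2) (\int[mu]_x (x ^+ 2 * phi x)).
- by move=> w; exact: sqr_ge0.
move=> n; have Lm : L1 N01 (fun w : R => Num.min (w ^+ 2) n%:R).
  apply: (@L1_bnd _ _ _ _ _ n%:R); first exact: mm.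
  by move=> w; rewrite ger0_norm ?ge_min ?lexx ?orbT// le_min sqr_ge0 ler0n.
have sq := sqr_phi_int.
have ml : mu.-integrable setT (EFin \o (fun x : R => Num.min (x ^+ 2) n%:R * phi x)).
  apply: (@le_integrable _ _ R mu setT measurableT _ _ _ _ sq).
    by apply/measurable_EFinP; apply: measurable_funM; [exact: mm|exact: measurable_normal_pdf].
  move=> x _; rewrite !abse_EFin lee_fin normrM [leRHS]normrM ler_wpM2r//.
  rewrite !ger0_norm ?sqr_ge0 ?le_min ?sqr_ge0 ?ler0n//.
  by rewrite ge_min lexx.
rewrite Ex_N01//; apply: le_Rintegral => // x _.
by rewrite ler_wpM2r ?normal_pdf_ge0// ge_min lexx.
Qed.

Lemma N01_L2_id : L2 N01 (fun z : R => z).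
Proof. by split => //; exact: N01_sqr. Qed.

Variable th : R.

Let mcos (s : R) : measurable_fun setT (fun z : R => cos (s * z + th)).
Proof.
apply: (@mfun_comp _ _ _ cos); first by apply: mfun_continuous; exact: continuous_cos.
by apply: mfunD; [apply: mfunM => //|]; exact: mfun_cst.
Qed.

Let msin (s : R) : measurable_fun setT (fun z : R => sin (s * z + th)).
Proof.
apply: (@mfun_comp _ _ _ sin); first by apply: mfun_continuous; exact: continuous_sin.
by apply: mfunD; [apply: mfunM => //|]; exact: mfun_cst.
Qed.

Let Lcos s : L2 N01 (fun z : R => cos (s * z + th)).
Proof. by apply: (@L2_bnd _ _ _ _ _ 1); [exact: mcos|move=> w; exact: (@cos_max R (s * w + th))]. Qed.

Let Lsin s : L2 N01 (fun z : R => sin (s * z + th)).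
Proof. by apply: (@L2_bnd _ _ _ _ _ 1); [exact: msin|move=> w; exact: (@sin_max R (s * w + th))]. Qed.

Let Lzsin s : L1 N01 (fun z : R => z * sin (s * z + th)).
Proof. exact: L2_L1M N01_L2_id (Lsin s). Qed.

(** The characteristic function without complex numbers: the phase [th] covers the real part
    ([th = 0]) and the imaginary part ([th = - pi / 2]). *)
Definition gcos (s : R) : R := Ex N01 (fun z : R => cos (s * z + th)).
Definition gzsin (s : R) : R := Ex N01 (fun z : R => z * sin (s * z + th)).

Lemma cos_taylor2 (a h : R) : `|cos (a + h) - cos a + h * sin a| <= 3 * h ^+ 2.
Proof.
have -> : cos (a + h) - cos a + h * sin a = - (cos a * (1 - cos h)) - sin a * (sin h - h).
  by rewrite cosD; ring.
apply: le_trans (ler_normB _ _) _; rewrite normrN !normrM.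
have h1 : `|cos a| * `|1 - cos h| <= h ^+ 2 / 2.
  have /andP[c0 c1] := one_sub_cos_le h; rewrite [X in _ * X]ger0_norm//.
  by apply: le_trans c1; rewrite ler_piMl ?cos_max.
have h2 : `|sin a| * `|sin h - h| <= 2 * h ^+ 2.
  have := sin_taylor h; have := cos_max a => _.
  have m : mcub h <= h ^+ 2 by rewrite ge_min lexx.
  move=> t; apply: (@le_trans _ _ `|sin h - h|); first by rewrite ler_piMl ?sin_max.
  by apply: (le_trans t); rewrite ler_pM2l.
by have := sqr_ge0 h; lra.
Qed.

Lemma gcos_taylor s h : `|gcos (s + h) - gcos s + h * gzsin s| <=
  3 * h ^+ 2 * Ex N01 (fun z : R => z ^+ 2).
Proof.
have L1' := L2_L1 (Lcos (s + h)); have L2' := L2_L1 (Lcos s); have L3 := L1Z h (Lzsin s).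
rewrite /gcos /gzsin -(ExZ _ (Lzsin s)) -(ExB L1' L2') -(ExD (L1B L1' L2') L3).
rewrite -ExZ ?N01_sqr//.
have Ld := L1D (L1B L1' L2') L3.
apply: le_trans (Ex_abs Ld) _; apply: Ex_le; [exact: L1_abs|exact: L1Z N01_sqr|].
move=> z; have -> : (s + h) * z + th = (s * z + th) + h * z by ring.
rewrite mulrA; apply: le_trans (cos_taylor2 _ _) _.
by rewrite exprMn mulrA.
Qed.

(** Differentiation under the integral: the pointwise error is at most [3 h^2 z^2], and the second
    moment is finite. *)
Lemma gcos_derive (s : R) : is_derive s (1 : R) gcos (- gzsin s).
Proof.
set K := Ex N01 (fun z : R => z ^+ 2).
have K0 : 0 <= K by apply: Ex_ge0 => z; exact: sqr_ge0.
suff H : h^-1 *: (gcos (h *: (1 : R) + s) - gcos s) @[h --> (0:R)^'] --> - gzsin s.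
  by apply: DeriveDef; [exact: cvgP H|exact: cvg_lim H].
apply/cvgrPdist_le => e e0.
near=> h.
have h0 : h != 0 by near: h; exact: nbhs_dnbhs_neq.
have hn : 0 < `|h| by rewrite normr_gt0.
rewrite scaler1 [h + s]addrC.
have := gcos_taylor s h; rewrite -/K => T.
have -> : - gzsin s - h^-1 *: (gcos (s + h) - gcos s) =
  - (h^-1 * (gcos (s + h) - gcos s + h * gzsin s)).
  by rewrite -[h^-1 *: _]/(h^-1 * _); field.
rewrite normrN normrM normfV ler_pdivrMl//; apply: (le_trans T).
rewrite -(real_normK (num_real h)) mulrAC [leRHS]mulrC.
have hK : `|h| * (3 * K + 1) <= e.
  rewrite -ler_pdivlMr; last by lra.
  near: h; apply: dnbhs0_le; rewrite divr_gt0//; lra.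
by move: hK; move: (`|h|) hn => t t0; nra.
Unshelve. all: by end_near. Qed.

(* Integration by parts on [-n, n]: (phi(z) sin(sz))' = (s cos(sz) - z sin(sz)) phi(z). *)
Lemma gzsinE s : gzsin s = s * gcos s.
Proof.
apply/eqP; rewrite -subr_eq0; apply/eqP.
pose g (z : R) := z * sin (s * z + th) - s * cos (s * z + th).
have Lsc : L1 N01 (fun z : R => s * cos (s * z + th)) by apply: L1Z; exact: L2_L1 (Lcos s).
have Lg : L1 N01 g by apply: L1B => //; exact: Lzsin.
have -> : gzsin s - s * gcos s = Ex N01 g.
  by rewrite /g ExB ?Lzsin// ExZ//; exact: L2_L1 (Lcos s).
have mg : measurable_fun setT g := L1_meas Lg.
(* Truncation to a compact interval, where the fundamental theorem of calculus applies; dominated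
   convergence removes it. *)
pose gn (n : nat) (z : R) := g z * \1_(`[- n.+1%:R, n.+1%:R]%classic : set R) z.
have mgn n : measurable_fun setT (gn n) by apply: measurable_funM => //; exact: measurable_indic.
have C : (fun n => Ex N01 (gn n)) @ \oo --> Ex N01 g.
  apply: (@Ex_dominated _ _ _ N01 gn g (fun z => `|g z|)) => //.
  - move=> z; apply: cvg_near_cst; exists (Num.truncn `|z|).+1 => // n /= nz.
    rewrite /gn indicE mem_set ?mulr1//= in_itv/=.
    rewrite -ler_norml; apply/ltW; rewrite -truncn_lt_nat//; exact: leqW.
  - move=> n z; rewrite /gn normrM ler_piMr//.
    by rewrite indicE; case: (_ \in _); rewrite ?normr1 ?normr0.
  - exact: L1_abs.
have E n : Ex N01 (gn n) = - (phi n.+1%:R * (sin (s * n.+1%:R + th) - sin (- (s * n.+1%:R) + th))).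
  have Lgn : L1 N01 (gn n).
    apply: (@L1_le _ _ _ N01 (gn n) (fun z => `|g z|)); [exact: mgn| |exact: L1_abs].
    move=> z; rewrite /gn normrM ler_piMr//.
    by rewrite indicE; case: (_ \in _); rewrite ?normr1 ?normr0.
  rewrite Ex_N01//.
  pose F (z : R) := - (phi z * sin (s * z + th)).
  pose f (z : R) := g z * phi z.
  have -> : \int[mu]_x (gn n x * phi x) = \int[mu]_(x in `[- n.+1%:R, n.+1%:R]) f x.
    rewrite [RHS]Rintegral_mkcond; apply: eq_Rintegral => x _.
    rewrite /gn /f patchE indicE; case: ifPn; rewrite ?mulr1// => _.
    by rewrite mulr0 mul0r.
  have dF (x : R) : is_derive x (1 : R) F (f x).
    have -> : F = (- (normal_peak 1 : R)) *:
        ((expR \o ((- (2^-1 : R)) *: (id ^+ 2 : R -> R))) * (sin \o (s *: id + cst th))).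
      apply/funext => z; rewrite /F phiE/=.
      rewrite -[RHS]/(- normal_peak 1 * (expR (- 2^-1 * (z ^+ 2)) * sin (s * z + th))).
      have -> : - z ^+ 2 / 2 = - 2^-1 * z ^+ 2 by ring.
      ring.
    have d0 : is_derive x (1:R) ((- (2^-1 : R)) *: (id ^+ 2 : R -> R)) (- x).
      by apply: is_derive_eq; rewrite -[LHS]/(- 2^-1 * (2 * x ^+ 1 * 1)) expr1; field.
    have d1 : is_derive x (1:R) (s *: (id : R -> R) + cst th) s.
      by apply: is_derive_eq; rewrite -[LHS]/(s * 1 + 0) mulr1 addr0.
    apply: is_derive_eq.
    rewrite -[LHS]/(- normal_peak 1 * (expR (- 2^-1 * x ^+ 2) * (cos (s * x + th) * s) +
      sin (s * x + th) * (expR (- 2^-1 * x ^+ 2) * - x))) /f /g phiE.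
    have -> : - x ^+ 2 / 2 = - 2^-1 * x ^+ 2 by ring.
    ring.
  have cF : continuous F.
    by move=> x; apply: differentiable_continuous; apply/derivable1_diffP; case: (dF x).
  have cf : continuous f.
    move=> x; apply: cvgM; last by apply: continuous_normal_pdf; exact: oner_neq0.
    apply: cvgB; apply: cvgM; [exact: cvg_id| |exact: cvg_cst|].
      apply: continuous_comp; last exact: continuous_sin.
      by apply: cvgD; [apply: cvgM; [exact: cvg_cst|exact: cvg_id]|exact: cvg_cst].
    apply: continuous_comp; last exact: continuous_cos.
    by apply: cvgD; [apply: cvgM; [exact: cvg_cst|exact: cvg_id]|exact: cvg_cst].
  have ab : - n.+1%:R < n.+1%:R :> R by rewrite -subr_gt0 opprK addr_gt0 ?ltr0n.
  have FTC : (\int[mu]_(x in `[(- n.+1%:R)%R, n.+1%:R%R]) (f x)%:E =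
      (F n.+1%:R)%:E - (F (- n.+1%:R)%R)%:E)%E.
    apply: continuous_FTC2 => //.
    - exact: continuous_subspaceT.
    - split.
      + by move=> x _; case: (dF x).
      + by apply: cvg_at_right_filter; exact: cF.
      + by apply: cvg_at_left_filter; exact: cF.
    - by move=> x _; rewrite derive1E; case: (dF x).
  rewrite /Rintegral FTC/= /F mulrN !phiE sqrrN; ring.
(* The boundary terms are at most [2 phi(n+1)], and [exp(- (n+1)^2 / 2) <= 2 / (n+1)]. *)
have C0 : (fun n => Ex N01 (gn n)) @ \oo --> (0 : R).
  apply/cvgrPdist_le => e e0.
  have p0 : 0 < (4 * normal_peak 1 : R) by rewrite mulr_gt0// normal_peak_gt0// oner_neq0.
  have := @cvg_harmonic R; move/cvgrPdist_le => /(_ (e / (4 * normal_peak 1))).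
  rewrite divr_gt0// => /(_ isT); apply: filterS => n.
  rewrite !sub0r !normrN E normrN (ger0_norm (harmonic_ge0 n)).
  rewrite ler_pdivlMr// => H; apply: le_trans H.
  apply: (@le_trans _ _ (2 * phi n.+1%:R)).
    rewrite normrM ger0_norm ?normal_pdf_ge0// mulrC ler_wpM2r ?normal_pdf_ge0//.
    by apply: le_trans (ler_normB _ _) _; rewrite -[2]/(1 + 1) lerD// sin_max.
  rewrite phiE; set p : R := normal_peak 1.
  have pp : 0 <= p by exact: normal_peak_ge0.
  have n0 : 0 < n.+1%:R :> R by rewrite ltr0n.
  have -> : harmonic n * (4 * p) = 2 * (p * (2 / n.+1%:R)) by rewrite /=; ring.
  rewrite ler_pM2l// ler_wpM2l// mulNr expRN -[leLHS]div1r ler_pdivrMr ?expR_gt0//.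
  have h1 : n.+1%:R / 2 <= expR (n.+1%:R ^+ 2 / 2) :> R.
    have n1 : 1 <= n.+1%:R :> R by rewrite ler1n.
    apply: le_trans (expR_ge1Dx _); nra.
  have := ler_wpM2l (_ : 0 <= 2 / n.+1%:R) h1.
  rewrite divr_ge0 ?(ltW n0)// => /(_ isT); apply: le_trans.
  by have -> : 2 / n.+1%:R * (n.+1%:R / 2) = 1 :> R by field; rewrite gt_eqF.
exact: cvg_unique C C0.
Qed.

(** By the two previous lemmas [gcos] solves [y' = - s y], so its product with [exp (s^2 / 2)] has
    derivative 0 and keeps its value [cos th] at 0. *)
Lemma gcosE s : gcos s = expR (- (s ^+ 2 / 2)) * cos th.
Proof.
pose H (s : R) := gcos s * expR (s ^+ 2 / 2).
have dH (x : R) : is_derive x (1 : R) H 0.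
  have -> : H = gcos * (expR \o (2^-1 *: (id ^+ 2 : R -> R))).
    by apply/funext => z; rewrite /H mulrC [_ / 2]mulrC [RHS]mulrC.
  have dg : is_derive x (1 : R) gcos (- (x * gcos x)) by rewrite -gzsinE; exact: gcos_derive.
  have d0 : is_derive x (1:R) ((2^-1 : R) *: (id ^+ 2 : R -> R)) x.
    by apply: is_derive_eq; rewrite -[LHS]/(2^-1 * (2 * x ^+ 1 * 1)) expr1; field.
  apply: is_derive_eq.
  rewrite -[LHS]/(gcos x * (expR (2^-1 * x ^+ 2) * x) + expR (2^-1 * x ^+ 2) * - (x * gcos x)).
  ring.
have : H s = H 0 by exact: is_derive_0_is_cst.
rewrite /H expr0n/= mul0r expR0 mulr1.
have -> : gcos 0 = cos th.
  rewrite /gcos -[RHS](Ex_cst N01); apply: eq_Ex => z; by rewrite mul0r add0r.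
have p := lt0r_neq0 (expR_gt0 (s ^+ 2 / 2)).
move=> h; apply: (mulIf p).
by rewrite h expRN mulrAC mulVf// mul1r.
Qed.

End gaussian.

(** * Characteristic functions and weak convergence *)

Section charfun_sum.
Context {d} {T : measurableType d} {R : realType} (P : probability T R).
Variables (x0 : T -> R) (xs : nat -> T -> R) (X : T -> R) (y : nat -> R -> R).
Hypotheses (mx0 : measurable_fun setT x0) (mxs : forall n, measurable_fun setT (xs n))
  (mX : measurable_fun setT X) (xsX : forall n, same_law P (xs n) X)
  (indep : mutually_independent P
    (fun o : option nat => if o is Some n then sigma_of (xs n) else sigma_of x0))
  (my : forall k, measurable_fun setT (y k))
  (Ly : forall k, L2 P (fun w => y k (X w)))
  (Ey : forall k, Ex P (fun w => y k (X w)) = 0).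

Let S n w := \sum_(k < n) y k (xs k w).
Let v n := \sum_(k < n) Ex P (fun w => y k (X w) ^+ 2).

Let myX k : measurable_fun setT (fun w => y k (X w)).
Proof. exact: mfun_comp. Qed.

Let mcosf (f : T -> R) : measurable_fun setT f -> measurable_fun setT (fun w => cos (f w)).
Proof. by apply: mfun_comp; apply: mfun_continuous; exact: continuous_cos. Qed.

Let msinf (f : T -> R) : measurable_fun setT f -> measurable_fun setT (fun w => sin (f w)).
Proof. by apply: mfun_comp; apply: mfun_continuous; exact: continuous_sin. Qed.

Let Lcos (f : T -> R) : measurable_fun setT f -> L1 P (fun w => cos (f w)).
Proof.
by move=> mf; apply: (@L1_bnd _ _ _ _ _ 1); [exact: mcosf|move=> w; exact: cos_max].
Qed.

Let Lsin (f : T -> R) : measurable_fun setT f -> L1 P (fun w => sin (f w)).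
Proof.
by move=> mf; apply: (@L1_bnd _ _ _ _ _ 1); [exact: msinf|move=> w; exact: sin_max].
Qed.

Lemma mfun_mcub (f : T -> R) : measurable_fun setT f -> measurable_fun setT (fun w => mcub (f w)).
Proof. by move=> mf; apply: measurable_minr; mfun. Qed.

Lemma L1_mcub (f : T -> R) : L2 P f -> L1 P (fun w => mcub (f w)).
Proof.
move=> [mf Lf]; apply: (L1_le _ _ Lf); first exact: mfun_mcub.
by move=> w; rewrite ger0_norm ?mcub_ge0// ge_min lexx.
Qed.

Let mS n : measurable_fun setT (S n).
Proof. by apply: (@mfun_sum _ _ _ n (fun k w => y k (xs k w))) => k; exact: mfun_comp (my k) (mxs k). Qed.

Let S_indep n : indep_rv P (S n) (xs n).
Proof.
apply: (@chain_indep _ _ _ P _ R x0 xs S (fun=> 0) (fun k p => p.1 + y k p.2)) => //.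
- move=> k; apply: measurable_funD; first exact: measurable_fst.
  by apply: measurableT_comp => //; exact: measurable_snd.
- by move=> w; rewrite /S big_ord0.
- by move=> k w; rewrite /S big_ord_recr.
Qed.

Let cos_step n th : Ex P (fun w => cos (S n.+1 w + th)) =
  Ex P (fun w => cos (S n w + th)) * Ex P (fun w => cos (y n (X w))) -
  Ex P (fun w => sin (S n w + th)) * Ex P (fun w => sin (y n (X w))).
Proof.
set C := Ex P (fun w => cos (y n (X w))); set D := Ex P (fun w => sin (y n (X w))).
have mSth : measurable_fun setT (fun w => S n w + th) by apply: mfunD (mS n) _; exact: mfun_cst.
pose psi (p : R * R) := cos (p.1 + th + y n p.2).
pose h u := cos (u + th) * C - sin (u + th) * D.
have mpsi : measurable_fun setT psi.
  apply: measurableT_comp; first by apply: mfun_continuous; exact: continuous_cos.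
  apply: measurable_funD; first by apply: measurable_funD => //; exact: measurable_fst.
  by apply: measurableT_comp => //; exact: measurable_snd.
have [|u|u|_ E] := @Ex_indep _ _ _ P _ R (S n) (xs n) X (mS n) (mxs n) mX (xsX n)
    (@S_indep n) psi h mpsi.
- by apply: Lcos; apply: mfunD => //; exact: mfun_comp (my n) (mxs n).
- by rewrite /psi/=; apply: Lcos; apply: (@mfunD _ _ _ (fun=> u + th)); [exact: mfun_cst|exact: myX].
- rewrite /h /C /D -!ExZ; [|exact: Lsin|exact: Lcos].
  rewrite -ExB; last 2 first.
  + by apply: L1Z; exact: Lcos.
  + by apply: L1Z; exact: Lsin.
  by apply: eq_Ex => w; rewrite /psi/= cosD.
transitivity (Ex P (fun w => psi (S n w, xs n w))).
  by apply: eq_Ex => w; rewrite /psi/= /S big_ord_recr/= addrAC.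
rewrite E ![_ * C]mulrC ![_ * D]mulrC -!ExZ; [|exact: Lsin|exact: Lcos].
rewrite -ExB; last 2 first.
- by apply: L1Z; exact: Lcos.
- by apply: L1Z; exact: Lsin.
by apply: eq_Ex => w; rewrite /h/= ![C * _]mulrC ![D * _]mulrC.
Qed.

(** One factor at a time. Let [s2 = E y^2]. Since [E y = 0], [|E sin y|] is at most [2 E mcub y],
    and [E cos y] is within [2 E mcub y + s2^2 / 4] of [exp (- s2 / 2)]. The errors add up because
    the remaining factors have modulus at most 1. *)
Lemma charfun_sum_approx n th :
  `|Ex P (fun w => cos (S n w + th)) - expR (- (v n / 2)) * cos th| <=
  \sum_(k < n) (4 * Ex P (fun w => mcub (y k (X w))) +
                Ex P (fun w => y k (X w) ^+ 2) ^+ 2 / 4).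
Proof.
elim: n => [|n IH].
  rewrite /v !big_ord0 mul0r oppr0 expR0 mul1r -(Ex_cst P (cos th)).
  rewrite (@eq_Ex _ _ _ P _ (fun=> cos th)) ?subrr ?normr0// => w.
  by rewrite /S big_ord0 add0r.
rewrite big_ord_recr/= cos_step.
set C := Ex P (fun w => cos (y n (X w))); set D := Ex P (fun w => sin (y n (X w))).
set s2 := Ex P (fun w => y n (X w) ^+ 2); set m := Ex P (fun w => mcub (y n (X w))).
set a := Ex P (fun w => cos (S n w + th)); set b := Ex P (fun w => sin (S n w + th)).
have [myn Ly2] := Ly n; have Lm := L1_mcub (Ly n).
have HC : `|C - (1 - s2 / 2)| <= 2 * m.
  have -> : C - (1 - s2 / 2) = Ex P (fun w => cos (y n (X w)) - (1 - (y n (X w)) ^+ 2 / 2)).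
    have L2' := L1Z (1/2) Ly2.
    rewrite ExB ?Lcos//; last by apply: (eq_L1 _ (L1B (L1_cst P 1) L2')) => w; lra.
    congr (_ - _); rewrite -{1}(Ex_cst P 1) /s2 mulrC -[2^-1]mul1r -ExZ// -ExB//.
    by apply: eq_Ex => w; lra.
  have L3 : L1 P (fun w => cos (y n (X w)) - (1 - y n (X w) ^+ 2 / 2)).
    apply: L1B; first exact: Lcos.
    by apply: (eq_L1 _ (L1B (L1_cst P 1) (L1Z (1/2) Ly2))) => w; lra.
  apply: le_trans (Ex_abs L3) _; rewrite /m -ExZ//.
  by apply: Ex_le; [exact: L1_abs|exact: L1Z|move=> w; exact: cos_taylor].
have HD : `|D| <= 2 * m.
  have -> : D = Ex P (fun w => sin (y n (X w)) - y n (X w)).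
    by rewrite ExB ?Ey ?subr0//; [exact: Lsin|exact: L2_L1].
  have L3 : L1 P (fun w => sin (y n (X w)) - y n (X w)) by apply: L1B; [exact: Lsin|exact: L2_L1].
  apply: le_trans (Ex_abs L3) _; rewrite /m -ExZ//.
  by apply: Ex_le; [exact: L1_abs|exact: L1Z|move=> w; exact: sin_taylor].
have Hb : `|b| <= 1.
  apply: le_trans (Ex_abs (Lsin _)) _; first by apply: mfunD (mS n) _; exact: mfun_cst.
  rewrite -[leRHS](Ex_cst P 1); apply: Ex_le => //; last by move=> w; exact: sin_max.
  by apply: L1_abs; apply: Lsin; apply: mfunD (mS n) _; exact: mfun_cst.
have s20 : 0 <= s2 by apply: Ex_ge0 => w; exact: sqr_ge0.
have HE : `|expR (- (s2 / 2)) - (1 - s2 / 2)| <= s2 ^+ 2 / 4.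
  have -> : s2 ^+ 2 / 4 = (s2 / 2) ^+ 2 by field.
  by apply: expR_taylor; rewrite divr_ge0.
have HC1 : `|C| <= 1.
  apply: le_trans (Ex_abs (Lcos _)) _; first exact: myX.
  rewrite -[leRHS](Ex_cst P 1); apply: Ex_le => //; last by move=> w; exact: cos_max.
  by apply: L1_abs; exact: Lcos.
have vS : v n.+1 = v n + s2 by rewrite /v big_ord_recr.
rewrite vS; have -> : - ((v n + s2) / 2) = - (v n / 2) + - (s2 / 2) by lra.
rewrite expRD; set e := expR (- (v n / 2)).
have e1 : `|e * cos th| <= 1.
  rewrite normrM mulr_ile1 ?cos_max// ger0_norm ?expR_ge0// -expR0 ler_expR oppr_le0 divr_ge0//.
  by apply: sumr_ge0 => k _; apply: Ex_ge0 => w; exact: sqr_ge0.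
rewrite (_ : a * C - b * D - e * expR (- (s2 / 2)) * cos th =
  (a - e * cos th) * C + (e * cos th * ((C - (1 - s2 / 2)) -
    (expR (- (s2 / 2)) - (1 - s2 / 2))) - b * D)); last by ring.
apply: le_trans (ler_normD _ _) _; apply: lerD.
  by rewrite normrM; apply: le_trans IH; rewrite ler_piMr.
apply: le_trans (ler_normB _ _) _.
rewrite (normrM (e * _)) (normrM b).
have : `|(C - (1 - s2 / 2)) - (expR (- (s2 / 2)) - (1 - s2 / 2))| <= 2 * m + s2 ^+ 2 / 4.
  by apply: le_trans (ler_normB _ _) _; exact: lerD.
have := normr_ge0 (e * cos th); have := normr_ge0 b; have := normr_ge0 D.
move: (`|e * cos th|) (`|b|) (`|D|) (`|C - (1 - s2 / 2) - _|) e1 Hb HD => e' b' D' q e1 b1 d1.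
move=> D0 b0 e0 q1.
have q0 : 0 <= 2 * m + s2 ^+ 2 / 4.
  by rewrite addr_ge0 ?divr_ge0 ?sqr_ge0 ?mulr_ge0//; apply: Ex_ge0 => w; exact: mcub_ge0.
have h1 := ler_wpM2l e0 q1; have h2 : e' * (2 * m + s2 ^+ 2 / 4) <= 2 * m + s2 ^+ 2 / 4 by rewrite ler_piMl.
have h3 : b' * D' <= D' by rewrite ler_piMl.
lra.
Qed.

End charfun_sum.

Section uniform_continuity.
Context {R : realType}.

(** Only [p] is confined to the square; its neighbour [q] may lie outside. Compactness is used in
    the form of near-coverings, with the scale [eta] as the parameter tending to 0. *)
Lemma box_unif_continuous (g : R * R -> R) (B e : R) : continuous g -> 0 < e ->
  exists2 eta : R, 0 < eta & forall p q : R * R, `|p.1| <= B -> `|p.2| <= B ->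
    `|q.1 - p.1| < eta -> `|q.2 - p.2| < eta -> `|g p - g q| <= e.
Proof.
move=> cg e0.
have cK : compact (`[- B, B]%classic `*` `[- B, B]%classic : set (R * R)).
  by apply: compact_setX; exact: segment_compact.
have /compact_near_coveringP cov := cK.
have [|r /= r0 H] := cov R (0 : R)^'+ (fun eta p => forall q : R * R,
    `|q.1 - p.1| < eta -> `|q.2 - p.2| < eta -> `|g p - g q| <= e) _.
  move=> p _.
  have e2 : 0 < e / 2 by rewrite divr_gt0.
  have /cvgrPdist_le/(_ _ e2) := cg p.
  rewrite -nbhs_ballE => -[r /= r0 Hr].
  exists (ball p (r / 2), [set eta | eta < r / 2]).
    split; first by apply: nbhsx_ballx; rewrite divr_gt0.
    by apply: nbhs_right_lt; rewrite divr_gt0.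
  move=> [p' eta] [/= [b1 b2] eta2] q q1 q2.
  have Hp' : `|g p - g p'| <= e / 2.
    by apply: Hr; split; apply: le_ball b1 || apply: le_ball b2; lra.
  have Hq : `|g p - g q| <= e / 2.
    apply: Hr; split => /=.
      move: b1; rewrite /ball/= => b1.
      rewrite (_ : p.1 - q.1 = (p.1 - p'.1) - (q.1 - p'.1)); last by ring.
      by apply: le_lt_trans (ler_normB _ _) _; lra.
    move: b2; rewrite /ball/= => b2.
    rewrite (_ : p.2 - q.2 = (p.2 - p'.2) - (q.2 - p'.2)); last by ring.
    by apply: le_lt_trans (ler_normB _ _) _; lra.
  rewrite (_ : g p' - g q = (g p - g q) - (g p - g p')); last by ring.
  by apply: le_trans (ler_normB _ _) _; lra.
exists (r / 2); first by rewrite divr_gt0.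
move=> p q p1 p2 q1 q2; apply: (H (r / 2)) => //=.
- by rewrite sub0r normrN ger0_norm; lra.
- by rewrite divr_gt0.
- by split; rewrite /= in_itv/= -ler_norml.
Qed.

End uniform_continuity.

(** * Bernstein operators and trigonometric approximation on a square *)

Section bernstein.
Context {R : realType}.
Implicit Types (u c : R) (f : nat -> R).

(* [bern m u f] is the expectation of [f] under the binomial law of parameters [m] and [u]. *)
Fixpoint bern (m : nat) u f : R :=
  if m is m'.+1 then (1 - u) * bern m' u f + u * bern m' u (fun i => f i.+1) else f 0%N.

Lemma bern_le m u f g : 0 <= u <= 1 -> (forall i, f i <= g i) -> bern m u f <= bern m u g.
Proof.
move=> /andP[u0 u1]; elim: m f g => [|m IH] f g fg/=; first exact: fg.
by apply: lerD; apply: ler_wpM2l; rewrite ?subr_ge0//; apply: IH.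
Qed.

Lemma bern_cst m u c : bern m u (fun=> c) = c.
Proof. by elim: m => //= m ->; ring. Qed.

Lemma bernD m u f g : bern m u (fun i => f i + g i) = bern m u f + bern m u g.
Proof. by elim: m f g => //= m IH f g; rewrite !IH; ring. Qed.

Lemma bernZ m u c f : bern m u (fun i => c * f i) = c * bern m u f.
Proof. by elim: m f => //= m IH f; rewrite !IH; ring. Qed.

Lemma eq_bern m u f g : (forall i, f i = g i) -> bern m u f = bern m u g.
Proof. by move=> fg; congr bern; apply/funext. Qed.

(** The shift [c] closes the induction: after a success the remaining trials are counted from
    [c + 1]. *)
Lemma bern_sqr m u c : bern m u (fun i => (i%:R + c) ^+ 2) = (m%:R * u + c) ^+ 2 + m%:R * u * (1 - u).
Proof.
elim: m c => [|m IH] c /=; first by rewrite !mul0r add0r addr0.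
rewrite IH (eq_bern _ _ (g := fun i => (i%:R + (c + 1)) ^+ 2)); last first.
  by move=> i; rewrite -[i.+1]addn1 natrD; congr (_ ^+ 2); ring.
by rewrite IH -[m.+1]addn1 natrD; ring.
Qed.

Lemma bern_var m u : 0 <= u <= 1 -> (0 < m)%N ->
  bern m u (fun i => (i%:R / m%:R - u) ^+ 2) <= m%:R^-1.
Proof.
move=> /andP[u0 u1] m0; have mR : 0 < m%:R :> R by rewrite ltr0n.
rewrite (eq_bern _ _ (g := fun i => (m%:R^-1) ^+ 2 * (i%:R + (- (m%:R * u))) ^+ 2)); last first.
  by move=> i; rewrite -exprMn; congr (_ ^+ 2); field; rewrite gt_eqF.
rewrite bernZ bern_sqr subrr expr0n/= add0r.
have -> : (m%:R^-1) ^+ 2 * (m%:R * u * (1 - u)) = m%:R^-1 * (u * (1 - u)).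
  by field; rewrite gt_eqF.
rewrite ler_piMr ?invr_ge0 ?ler0n//; nra.
Qed.

End bernstein.

Section trigonometric_polynomials.
Context {R : realType}.

(** Phases make sines a special case, and the product-to-sum formula keeps the class closed under
    multiplication. Each member is a finite sum of the test functions handled by characteristic
    functions. *)
Inductive trigpoly : (R * R -> R) -> Prop :=
| trig_cos c s t th : trigpoly (fun p => c * cos (s * p.1 + t * p.2 + th))
| trig_add h1 h2 : trigpoly h1 -> trigpoly h2 -> trigpoly (fun p => h1 p + h2 p).

Lemma eq_trig h1 h2 : (forall p, h1 p = h2 p) -> trigpoly h1 -> trigpoly h2.
Proof. by move=> e; have -> : h1 = h2 by apply/funext. Qed.

Lemma trig_cst c : trigpoly (fun=> c).
Proof.
by apply: eq_trig (trig_cos c 0 0 0) => p; rewrite !mul0r !addr0 cos0 mulr1.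
Qed.

Lemma trig_mul h1 h2 : trigpoly h1 -> trigpoly h2 -> trigpoly (fun p => h1 p * h2 p).
Proof.
elim=> [c s t th|a b _ IHa _ IHb] H2; last first.
  by apply: eq_trig (trig_add (IHa H2) (IHb H2)) => p; rewrite mulrDl.
elim: H2 => [c' s' t' th'|a b _ IHa _ IHb]; last first.
  by apply: eq_trig (trig_add IHa IHb) => p; rewrite mulrDr.
apply: eq_trig (trig_add (trig_cos (c * c' / 2) (s + s') (t + t') (th + th'))
                         (trig_cos (c * c' / 2) (s - s') (t - t') (th - th'))) => p.
have -> : (s + s') * p.1 + (t + t') * p.2 + (th + th') =
  (s * p.1 + t * p.2 + th) + (s' * p.1 + t' * p.2 + th') by ring.
have -> : (s - s') * p.1 + (t - t') * p.2 + (th - th') =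
  (s * p.1 + t * p.2 + th) - (s' * p.1 + t' * p.2 + th') by ring.
by rewrite cosD cosB; field.
Qed.

Lemma trig_sin1 s : trigpoly (fun p => sin (s * p.1)).
Proof.
apply: eq_trig (trig_cos 1 s 0 (- (pi / 2))) => p.
by rewrite mul1r mul0r addr0 cosBpihalf.
Qed.

Lemma trig_sin2 t : trigpoly (fun p => sin (t * p.2)).
Proof.
apply: eq_trig (trig_cos 1 0 t (- (pi / 2))) => p.
by rewrite mul1r mul0r add0r cosBpihalf.
Qed.

Lemma trig_bern m u (F : nat -> R * R -> R) : trigpoly u -> (forall i, trigpoly (F i)) ->
  trigpoly (fun p => bern m (u p) (fun i => F i p)).
Proof.
move=> Tu; elim: m F => [|m IH] F TF /=; first exact: TF.
apply: trig_add; apply: trig_mul => //; last exact: IH.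
  apply: trig_add; first exact: trig_cst.
  by apply: eq_trig (trig_mul (trig_cst (- 1)) Tu) => p; rewrite mulN1r.
exact: IH.
Qed.

(** Mean value theorem, with [cos >= cos 1] on [[-1, 1]]. It makes the inverse sine Lipschitz away
    from the endpoints, where its derivative is infinite. *)
Lemma sin_clamp_lip (a b : R) : -1 <= a <= 1 -> -1 <= b <= 1 ->
  cos 1 * `|a - b| <= `|sin a - sin b|.
Proof.
wlog ab : a b / a <= b.
  move=> H; have [ab|/ltW ba] := leP a b; first exact: H.
  by move=> ? ?; rewrite (distrC a) (distrC (sin a)); exact: H.
move=> /andP[a0 a1] /andP[b0 b1].
have [|c] := @MVT_segment R sin cos a b ab (fun z _ => is_derive_sin z).
  by apply: continuous_subspaceT; exact: continuous_sin.
rewrite in_itv/= => /andP[ac cb] E.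
rewrite distrC [leRHS]distrC E normrM ler_wpM2r//.
apply: le_trans (ler_norm _); rewrite -[cos c]cos_norm.
have c1 : `|c| <= 1 by rewrite ler_norml; apply/andP; split; lra.
have p1 := @pihalf_ge1 R.
have [->//|cn] := eqVneq `|c| 1; apply/ltW; rewrite ltr_cos ?lt_neqAle ?cn//.
  by rewrite in_itv/= normr_ge0/=; lra.
by rewrite in_itv/= ler01/=; lra.
Qed.

Lemma clamp_contract (s y z : R) : - s <= z -> z <= s ->
  `|Num.max (- s) (Num.min s y) - z| <= `|y - z|.
Proof.
move=> z0 z1; have := ler_norm (y - z); have := ler_norm (- (y - z)); rewrite normrN => n1 n2.
have [sy|ys] := leP s y.
  rewrite (max_idPr _); last by lra.
  by rewrite ger0_norm; lra.
have [h|h] := leP (- s) y; first by [].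
by rewrite ler0_norm; lra.
Qed.

(* A continuous inverse of [x |-> (1 + sin (x / A)) / 2] on [[-A, A]], clamped outside. *)
Let clamp (y : R) : R := Num.max (- sin 1) (Num.min (sin 1) y).
Let psi (A t : R) : R := A * asin (clamp (2 * t - 1)).

Let sin1 : 0 < sin (1 : R) <= 1.
Proof. by rewrite sin_le1 andbT sin2_gt0//; lra. Qed.

Let clampP y : - sin 1 <= clamp y <= sin 1.
Proof.
have /andP[s0 s1] := sin1.
rewrite /clamp le_max lexx ge_max ge_min lexx/= andbT; lra.
Qed.

Let asin_clamp y : -1 <= asin (clamp y) <= 1 /\ sin (asin (clamp y)) = clamp y.
Proof.
have /andP[s0 s1] := sin1; have /andP[c0 c1] := clampP y.
have c : -1 <= clamp y <= 1 by lra.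
have E : sin (asin (clamp y)) = clamp y by rewrite asinK// in_itv.
split => //.
have p1 := @pihalf_ge1 R; have b0 := asin_geNpi2 c; have b1 := asin_lepi2 c.
rewrite !leNgt; apply/andP; split; apply/negP.
  rewrite -(@ltr_sin R _ (-1)) ?in_itv/= ?E ?sinN; lra.
rewrite -(@ltr_sin R 1) ?in_itv/= ?E; lra.
Qed.

Let psi_close A x t : 0 < A -> `|x| <= A ->
  `|psi A t - x| <= 2 * A / cos 1 * `|t - (1 + sin (x / A)) / 2|.
Proof.
move=> A0 xA; have c1 : 0 < cos (1 : R) := cos1_gt0 R.
have [bI bE] := asin_clamp (2 * t - 1).
set b := asin (clamp (2 * t - 1)) in bI bE.
have aI : -1 <= x / A <= 1.
  by rewrite -ler_norml normrM normfV (gtr0_norm A0) ler_pdivrMr// mul1r.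
have -> : psi A t - x = A * (b - x / A) by rewrite /psi -/b; field; rewrite gt_eqF.
rewrite normrM (gtr0_norm A0).
have H := sin_clamp_lip bI aI.
have H2 : `|sin b - sin (x / A)| <= `|2 * t - 1 - sin (x / A)|.
  have /andP[s0 s1] := sin1.
  have sa : - sin 1 <= sin (x / A) <= sin 1.
    have p1 := @pihalf_ge1 R; case/andP: aI => a0 a1.
    rewrite -sinN !leNgt; apply/andP; split; apply/negP.
      rewrite ltr_sin ?in_itv/=; lra.
    rewrite ltr_sin ?in_itv/=; lra.
  rewrite bE /clamp; case/andP: sa => sa0 sa1.
  exact: clamp_contract.
have -> : 2 * A / cos 1 * `|t - (1 + sin (x / A)) / 2| = A * (`|2 * t - 1 - sin (x / A)| / cos 1).
  have -> : 2 * t - 1 - sin (x / A) = 2 * (t - (1 + sin (x / A)) / 2) by field.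
  by rewrite normrM (@ger0_norm _ 2)//; ring.
rewrite ler_pM2l// ler_pdivlMr// mulrC; exact: le_trans H H2.
Qed.

(** Being an average of values of [g], the approximant keeps the bound [M] on the whole plane, so
    that the small mass outside the square does no harm. *)
Lemma trig_approx (g : R * R -> R) (M A e : R) : continuous g -> (forall p, `|g p| <= M) ->
  0 < A -> 0 < e ->
  exists h, [/\ trigpoly h, forall p, `|h p| <= M &
    forall p, `|p.1| <= A -> `|p.2| <= A -> `|h p - g p| <= e].
Proof.
move=> cg gM A0 e0; have e2 : 0 < e / 2 by rewrite divr_gt0.
have M0 : 0 <= M := le_trans (normr_ge0 _) (gM (0, 0)).
have [eta eta0 Heta] := box_unif_continuous A cg e2.
have c1 : 0 < cos (1 : R) := cos1_gt0 R.
(* By [psi_close], [|t - u x| < dl] forces [|psi A t - x| < eta]. *)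
pose dl := eta * cos 1 / (2 * A).
have dl0 : 0 < dl by rewrite divr_gt0// mulr_gt0.
have d20 : 0 < dl ^+ 2 by rewrite exprn_gt0.
(* Chebyshev: where [|t - u x| >= dl], the trivial bound [2 M] is at most [B (t - u x)^2], whose
   mean under the binomial law is at most [B / m]. *)
pose B := 2 * M / dl ^+ 2.
have B0 : 0 <= B by apply: divr_ge0; [exact: mulr_ge0|exact: ltW].
pose m := (Num.truncn (4 * B / e)).+1.
have mR : 0 < m%:R :> R by rewrite ltr0n.
have mB : 2 * B / m%:R <= e / 2.
  have : 4 * B / e < m%:R by rewrite truncnS_gt.
  rewrite ltr_pdivrMr// ler_pdivrMr// => h; lra.
pose u (x : R) := (1 + sin (A^-1 * x)) / 2.
have u01 x : 0 <= u x <= 1.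
  by have := sin_geN1 (A^-1 * x); have := sin_le1 (A^-1 * x); rewrite /u => ? ?; apply/andP; split; lra.
pose h (p : R * R) := bern m (u p.1) (fun i => bern m (u p.2) (fun j => g (psi A (i%:R / m%:R), psi A (j%:R / m%:R)))).
have Tu1 : trigpoly (fun p => u p.1).
  apply: eq_trig (trig_mul (trig_cst (1/2)) (trig_add (trig_cst 1) (trig_sin1 A^-1))) => p.
  by rewrite /u; field.
have Tu2 : trigpoly (fun p => u p.2).
  apply: eq_trig (trig_mul (trig_cst (1/2)) (trig_add (trig_cst 1) (trig_sin2 A^-1))) => p.
  by rewrite /u; field.
exists h; split.
- apply: trig_bern => // i; apply: trig_bern => // j; exact: trig_cst.
- move=> p; rewrite ler_norml; apply/andP; split.
    rewrite -(bern_cst m (u p.1) (- M)); apply: bern_le => // i.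
    rewrite -(bern_cst m (u p.2) (- M)); apply: bern_le => // j.
    by have := gM (psi A (i%:R / m%:R), psi A (j%:R / m%:R)); rewrite ler_norml => /andP[].
  rewrite -(bern_cst m (u p.1) M); apply: bern_le => // i.
  rewrite -(bern_cst m (u p.2) M); apply: bern_le => // j.
  by have := gM (psi A (i%:R / m%:R), psi A (j%:R / m%:R)); rewrite ler_norml => /andP[].
move=> p p1 p2.
have key i j : `|g (psi A (i%:R / m%:R), psi A (j%:R / m%:R)) - g p| <=
    e / 2 + B * (i%:R / m%:R - u p.1) ^+ 2 + B * (j%:R / m%:R - u p.2) ^+ 2.
  have q1 : 0 <= B * (i%:R / m%:R - u p.1) ^+ 2 by rewrite mulr_ge0// sqr_ge0.
  have q2 : 0 <= B * (j%:R / m%:R - u p.2) ^+ 2 by rewrite mulr_ge0// sqr_ge0.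
  have big t x : dl <= `|t - u x| -> 2 * M <= B * (t - u x) ^+ 2.
    move=> H; rewrite /B mulrAC ler_pdivlMr// ler_wpM2l ?mulr_ge0//.
    by rewrite -(real_normK (num_real (t - u x))) lerXn2r// nnegrE// ltW.
  have triv : `|g (psi A (i%:R / m%:R), psi A (j%:R / m%:R)) - g p| <= 2 * M.
    apply: le_trans (ler_normB _ _) _.
    by have := gM (psi A (i%:R / m%:R), psi A (j%:R / m%:R)); have := gM p; lra.
  have near t x : `|x| <= A -> `|t - u x| < dl -> `|psi A t - x| < eta.
    move=> xA H; apply: le_lt_trans (psi_close t A0 xA) _.
    rewrite -[x / A]mulrC -/(u x) mulrC -ltr_pdivlMr ?divr_gt0 ?mulr_gt0//.
    by apply: (lt_le_trans H); rewrite /dl invf_div mulrA.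
  have [H1|H1] := ltP `|i%:R / m%:R - u p.1| dl; last by have := big _ _ H1; lra.
  have [H2|H2] := ltP `|j%:R / m%:R - u p.2| dl; last by have := big _ _ H2; lra.
  have := Heta p (psi A (i%:R / m%:R), psi A (j%:R / m%:R)) p1 p2 (near _ _ p1 H1) (near _ _ p2 H2).
  rewrite distrC; lra.
have V1 := bern_var (u01 p.1) (ltn0Sn _ : (0 < m)%N).
have V2 := bern_var (u01 p.2) (ltn0Sn _ : (0 < m)%N).
have bnd : bern m (u p.1) (fun i => bern m (u p.2) (fun j =>
    e / 2 + B * (i%:R / m%:R - u p.1) ^+ 2 + B * (j%:R / m%:R - u p.2) ^+ 2)) <= e.
  rewrite (eq_bern _ _ (g := fun i => (e / 2 + B * bern m (u p.2) (fun j => (j%:R / m%:R - u p.2) ^+ 2)) +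
      B * (i%:R / m%:R - u p.1) ^+ 2)); last first.
    by move=> i; rewrite bernD bern_cst bernZ; ring.
  rewrite bernD bern_cst bernZ.
  have := ler_wpM2l B0 V1; have := ler_wpM2l B0 V2; move: mB.
  rewrite -[2 * B / m%:R]mulrA; lra.
rewrite ler_norml; apply/andP; split; [rewrite lerBrDl|rewrite lerBlDl].
  rewrite lerBlDr; apply: (@le_trans _ _ (h p +
    bern m (u p.1) (fun i => bern m (u p.2) (fun j =>
    e / 2 + B * (i%:R / m%:R - u p.1) ^+ 2 + B * (j%:R / m%:R - u p.2) ^+ 2)))); last first.
    by rewrite lerD2l.
  rewrite /h -bernD -{1}(bern_cst m (u p.1) (g p)); apply: bern_le => // i.
  rewrite -bernD -{1}(bern_cst m (u p.2) (g p)); apply: bern_le => // j.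
  by have := key i j; rewrite ler_norml => /andP[]; lra.
apply: (@le_trans _ _ (g p +
    bern m (u p.1) (fun i => bern m (u p.2) (fun j =>
    e / 2 + B * (i%:R / m%:R - u p.1) ^+ 2 + B * (j%:R / m%:R - u p.2) ^+ 2)))); last first.
  by rewrite lerD2l.
rewrite /h -{1}(bern_cst m (u p.1) (g p)) -bernD; apply: bern_le => // i.
rewrite -{1}(bern_cst m (u p.2) (g p)) -bernD; apply: bern_le => // j.
by have := key i j; rewrite ler_norml => /andP[]; lra.
Qed.

End trigonometric_polynomials.

Section weak_convergence.
Context {d} {T : measurableType d} {R : realType} (P : probability T R).
Context {d'} {T' : measurableType d'} (Q : probability T' R).
Variables (W : nat -> T -> R * R) (V : T' -> R * R).
Hypotheses (mW : forall K, measurable_fun setT (W K)) (mV : measurable_fun setT V).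

Definition outside (A : R) (p : R * R) : R := if (`|p.1| <= A) && (`|p.2| <= A) then 0 else 1.

Lemma outside_ge0 A p : 0 <= outside A p.
Proof. by rewrite /outside; case: ifP. Qed.

Lemma outside_le1 A p : outside A p <= 1.
Proof. by rewrite /outside; case: ifP. Qed.

Lemma measurable_outside A : measurable_fun setT (outside A).
Proof.
apply: measurable_fun_ifT; [|exact: measurable_cst|exact: measurable_cst].
apply: measurable_and; apply: measurable_fun_ler.
- by apply: measurableT_comp; [exact: normr_measurable|exact: measurable_fst].
- exact: measurable_cst.
- by apply: measurableT_comp; [exact: normr_measurable|exact: measurable_snd].
- exact: measurable_cst.
Qed.

Lemma tight1 (e : R) : 0 < e -> exists2 A : R, 0 < A & Ex Q (fun w => outside A (V w)) <= e.
Proof.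
move=> e0.
have C : (fun n : nat => Ex Q (fun w => outside n.+1%:R (V w))) @ \oo --> Ex Q (fun=> 0).
  apply: (@Ex_dominated _ _ _ Q _ _ (fun=> 1)).
  - by move=> n; apply: (measurableT_comp (measurable_outside _) mV).
  - exact: mfun_cst.
  - move=> w; apply: cvg_near_cst.
    exists (Num.truncn (Num.max `|(V w).1| `|(V w).2|)).+1 => // n /= nw.
    have : Num.max `|(V w).1| `|(V w).2| < n.+1%:R.
      by rewrite -truncn_lt_nat; [exact: leqW|rewrite le_max normr_ge0].
    by rewrite gt_max /outside => /andP[/ltW -> /ltW ->].
  - by move=> n w; rewrite ger0_norm ?outside_ge0 ?outside_le1.
  - exact: L1_cst.
move/cvgrPdist_le : C => /(_ _ e0) [N _ HN].
exists N.+1%:R; first by rewrite ltr0n.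
have := HN N (leqnn N); rewrite /= Ex_cst sub0r normrN; apply: le_trans.
exact: ler_norm.
Qed.

Hypothesis charfun_cvg : forall s t th, (fun K => Ex P (fun w => cos (s * (W K w).1 + t * (W K w).2 + th)))
  @ \oo --> Ex Q (fun w => cos (s * (V w).1 + t * (V w).2 + th)).
Hypothesis tightW : forall e : R, 0 < e -> exists2 A : R, 0 < A &
  \forall K \near \oo, Ex P (fun w => outside A (W K w)) <= e.

Let mtrig (h : R * R -> R) : trigpoly h -> measurable_fun setT h.
Proof.
elim=> [c s t th|a b _ IHa _ IHb]; last exact: measurable_funD.
apply: measurable_funM; first exact: measurable_cst.
apply: measurableT_comp; first by apply: mfun_continuous; exact: continuous_cos.
apply: measurable_funD; last exact: measurable_cst.
by apply: measurable_funD; apply: measurable_funM;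
  do ?[exact: measurable_cst|exact: measurable_fst|exact: measurable_snd].
Qed.

Let btrig (h : R * R -> R) : trigpoly h -> exists M, forall p, `|h p| <= M.
Proof.
elim=> [c s t th|a b _ [Ma Ha] _ [Mb Hb]]; last first.
  by exists (Ma + Mb) => p; apply: le_trans (ler_normD _ _) _; exact: lerD.
by exists `|c| => p; rewrite normrM ler_piMr ?cos_max.
Qed.

Let Ltrig d1 (T1 : measurableType d1) (P1 : probability T1 R) (U : T1 -> R * R) (h : R * R -> R) :
  measurable_fun setT U -> trigpoly h -> L1 P1 (fun w => h (U w)).
Proof.
move=> mU Th; have [M HM] := btrig Th.
by apply: (@L1_bnd _ _ _ _ _ M) => //; apply: measurableT_comp => //; exact: mtrig.
Qed.

Let trig_cvg (h : R * R -> R) : trigpoly h -> (fun K => Ex P (fun w => h (W K w))) @ \oo --> Ex Q (fun w => h (V w)).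
Proof.
elim=> [c s t th|a b Ta IHa Tb IHb].
  have L1' d1 (T1 : measurableType d1) (P1 : probability T1 R) (U : T1 -> R * R) :
      measurable_fun setT U -> L1 P1 (fun w => cos (s * (U w).1 + t * (U w).2 + th)).
    move=> mU; have := Ltrig P1 mU (trig_cos 1 s t th).
    by apply: eq_L1 => w; rewrite mul1r.
  rewrite ExZ; last exact: L1'.
  rewrite (_ : (fun K => _) = (fun K => c * Ex P (fun w => cos (s * (W K w).1 + t * (W K w).2 + th)))).
    by apply: cvgMr; exact: charfun_cvg.
  by apply/funext => K; rewrite ExZ//; exact: L1'.
rewrite ExD; [|exact: Ltrig|exact: Ltrig].
rewrite (_ : (fun K => _) = (fun K => Ex P (fun w => a (W K w)) + Ex P (fun w => b (W K w)))).
  exact: cvgD.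
by apply/funext => K; rewrite ExD//; exact: Ltrig.
Qed.

Lemma charfun_weak_cvg (g : R * R -> R) (M : R) : continuous g -> measurable_fun setT g ->
  (forall p, `|g p| <= M) ->
  (fun K => Ex P (fun w => g (W K w))) @ \oo --> Ex Q (fun w => g (V w)).
Proof.
move=> cg mg gM; apply/cvgrPdist_le => e e0.
have M0 : 0 <= M := le_trans (normr_ge0 _) (gM (0, 0)).
(* Then [2 M e' <= e / 4]: replacing [g] by the trigonometric polynomial costs at most [3 e / 8]
   under each law, which leaves room for [e / 8] between the two laws. *)
pose e' := e / (8 * (M + 1)).
have e'0 : 0 < e' by rewrite divr_gt0// mulr_gt0//; lra.
have [A1 A10 HA1] := tightW e'0; have [A2 A20 HA2] := tight1 e'0.
have e80 : 0 < e / 8 by rewrite divr_gt0.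
pose A := Num.max A1 A2; have A0 : 0 < A by rewrite lt_max A10.
have [h [Th hM hg]] := trig_approx cg gM A0 e80.
have close d1 (T1 : measurableType d1) (P1 : probability T1 R) (U : T1 -> R * R) A' :
    measurable_fun setT U -> A' <= A -> Ex P1 (fun w => outside A' (U w)) <= e' ->
    `|Ex P1 (fun w => g (U w)) - Ex P1 (fun w => h (U w))| <= e / 8 + 2 * M * e'.
  move=> mU A'A HE.
  have Lg : L1 P1 (fun w => g (U w)) by apply: (@L1_bnd _ _ _ _ _ M) => //; exact: measurableT_comp.
  have Lh := Ltrig P1 mU Th.
  have mo : measurable_fun setT (fun w => outside A' (U w)).
    by apply: (measurableT_comp (measurable_outside _) mU).
  have Lo : L1 P1 (fun w => outside A' (U w)).
    by apply: (@L1_bnd _ _ _ _ _ 1) => // w; rewrite ger0_norm ?outside_ge0 ?outside_le1.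
  rewrite -ExB//; apply: le_trans (Ex_abs (L1B Lg Lh)) _.
  apply: (@le_trans _ _ (Ex P1 (fun w => e / 8 + 2 * M * outside A' (U w)))).
    apply: Ex_le; [exact: L1_abs (L1B Lg Lh)|by apply: L1D => //; exact: L1Z|].
    move=> w; rewrite /outside; case: ifPn => [/andP[u1 u2]|_].
      rewrite mulr0 addr0 distrC; apply: hg; [exact: le_trans u1 A'A|exact: le_trans u2 A'A].
    apply: le_trans (ler_normB _ _) _; have := gM (U w); have := hM (U w); lra.
  rewrite ExD ?Ex_cst ?ExZ//; last exact: L1Z.
  by rewrite lerD2l ler_wpM2l// mulr_ge0.
have small : e / 8 + 2 * M * e' <= 3 * e / 8.
  have -> : 2 * M * e' = (e / 4) * (M / (M + 1)) by rewrite /e'; field; lra.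
  have : M / (M + 1) <= 1 by rewrite ler_pdivrMr; lra.
  move: (M / (M + 1)) => q q1; nra.
have e4 : 0 < e / 8 by [].
have Ch : \forall K \near \oo, `|Ex Q (fun w => h (V w)) - Ex P (fun w => h (W K w))| <= e / 8.
  by move/cvgrPdist_le : (trig_cvg Th); exact.
near=> K.
have H1 := close _ _ P (W K) A1 (mW K) (_ : A1 <= A) _.
have {}H1 : `|Ex P (fun w => g (W K w)) - Ex P (fun w => h (W K w))| <= e / 8 + 2 * M * e'.
  by apply: H1; [rewrite le_max lexx|near: K].
have H2 : `|Ex Q (fun w => g (V w)) - Ex Q (fun w => h (V w))| <= e / 8 + 2 * M * e'.
  by apply: (close _ _ Q V A2) => //; rewrite le_max lexx orbT.
have H3 : `|Ex Q (fun w => h (V w)) - Ex P (fun w => h (W K w))| <= e / 8 by near: K.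
rewrite (_ : Ex Q (fun w => g (V w)) - Ex P (fun w => g (W K w)) =
  (Ex Q (fun w => g (V w)) - Ex Q (fun w => h (V w))) +
  (Ex Q (fun w => h (V w)) - Ex P (fun w => h (W K w))) -
  (Ex P (fun w => g (W K w)) - Ex P (fun w => h (W K w)))); last by ring.
apply: le_trans (ler_normB _ _) _; have := ler_normD (Ex Q (fun w => g (V w)) - Ex Q (fun w => h (V w)))
  (Ex Q (fun w => h (V w)) - Ex P (fun w => h (W K w))).
lra.
Unshelve. all: by end_near. Qed.

End weak_convergence.

(** * Stochastic approximation *)

Section rho.
Context {R : realType}.
Implicit Types x y h : R.

(** Quadratic at 0 and linear at infinity, like the available lower bound for the drift
    [(x - xst) * Vp x]. The drift thus dominates a multiple of [rho (x - xst)], whereas it grows too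
    slowly to dominate a multiple of the square. *)
Definition rho (x : R) : R := Num.sqrt (1 + x ^+ 2) - 1.

Let sq (x : R) : 1 <= Num.sqrt (1 + x ^+ 2).
Proof. by rewrite -[leLHS]sqrtr1 ler_wsqrtr// lerDl sqr_ge0. Qed.

Let sqE (x : R) : Num.sqrt (1 + x ^+ 2) ^+ 2 = 1 + x ^+ 2.
Proof. by rewrite sqr_sqrtr// addr_ge0 ?sqr_ge0. Qed.

Lemma rho_ge0 (x : R) : 0 <= rho x. Proof. by rewrite /rho subr_ge0. Qed.

Lemma rho_le_abs x : rho x <= `|x|.
Proof.
have := sq x; have := sqE x; rewrite /rho -(real_normK (num_real x)).
have := normr_ge0 x; move: (Num.sqrt (1 + `|x| ^+ 2)) => s; move: (`|x|) => t; nra.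
Qed.

Lemma rho_le_sqr x : rho x <= x ^+ 2 / 2.
Proof. by have := sq x; have := sqE x; rewrite /rho; move: (Num.sqrt (1 + x ^+ 2)) => s; nra. Qed.

Lemma rho_even x y : `|x| <= `|y| -> rho x <= rho y.
Proof.
move=> xy; rewrite lerB// ler_wsqrtr// lerD2l -(real_normK (num_real x)) -(real_normK (num_real y)).
by rewrite lerXn2r ?nnegrE.
Qed.

Definition rho' (x : R) : R := x / Num.sqrt (1 + x ^+ 2).

(** For the two square roots, [t <= s + (t^2 - s^2) / (2 s)] and [s >= 1]. *)
Lemma rho_taylor x h : rho (x + h) <= rho x + rho' x * h + h ^+ 2 / 2.
Proof.
rewrite /rho /rho'; have s1 := sq x; have s2 := sqE x; have t1 := sq (x + h); have t2 := sqE (x + h).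
move: (Num.sqrt (1 + x ^+ 2)) (Num.sqrt (1 + (x + h) ^+ 2)) s1 s2 t1 t2 => s t s1 s2 t1 t2.
have s0 : 0 < s by lra.
have -> : s - 1 + x / s * h + h ^+ 2 / 2 = (s - 1 + h ^+ 2 / 2) + (x * h) / s by field; lra.
rewrite -lerBlDl ler_pdivlMr//.
have h1 : 0 <= h ^+ 2 * (s - 1) by rewrite mulr_ge0 ?sqr_ge0// subr_ge0.
have h2 : 0 <= (t - s) ^+ 2 := sqr_ge0 _.
nra.
Qed.

Lemma rho'_le1 x : `|rho' x| <= 1.
Proof.
rewrite /rho' normrM normfV (ger0_norm (le_trans ler01 (sq x))) ler_pdivrMr; last exact: lt_le_trans ltr01 (sq x).
rewrite mul1r -sqrtr_sqr ler_wsqrtr// lerDr//.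
Qed.

Lemma mrho : measurable_fun setT rho.
Proof.
apply: mfunB; last exact: mfun_cst.
apply: (@mfun_comp _ _ _ Num.sqrt).
  by apply: mfun_continuous; exact: sqrt_continuous.
by apply: mfunD; [exact: mfun_cst|apply: mfunX].
Qed.

Lemma mrho' : measurable_fun setT rho'.
Proof.
apply: mfun_continuous => x; apply: cvgM; first exact: cvg_id.
apply: cvgV; first by rewrite gt_eqF// (lt_le_trans ltr01 (sq x)).
apply: continuous_comp; last exact: sqrt_continuous.
by apply: cvgD; [exact: cvg_cst|exact: exprn_continuous].
Qed.

End rho.

Section normalized.
Context {R : realType}.

(** The equality case of the scalar recursions, started from [B] at time [N]. When its arguments are
    constants shared by all systems, its convergence to 0 is uniform over the systems it
    dominates. *)
Fixpoint lrec (m : R) (g e : nat -> R) (B : R) (N k : nat) : R :=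
  if k is k'.+1 then
    if (k' < N)%N then B else (1 - m * g k') * lrec m g e B N k' + g k' * e k'
  else B.

Lemma lrec_start m g e B N : lrec m g e B N N = B.
Proof. by case: N => //= N; rewrite ltnS leqnn. Qed.

Lemma lrecS m g e B N k : (N <= k)%N ->
  lrec m g e B N k.+1 = (1 - m * g k) * lrec m g e B N k + g k * e k.
Proof. by move=> Nk; rewrite /= ltnNge Nk. Qed.

Lemma lrec_cvg0 m (g e : nat -> R) B N : 0 < m -> (forall k, 0 <= g k) -> g @ \oo --> 0 ->
  divergent_sum g -> e @ \oo --> 0 -> lrec m g e B N @ \oo --> 0.
Proof.
move=> m0 g0 gcvg gdiv e0.
rewrite -[X in _ --> X](mul0r m^-1); apply: (rec_cvg m0 g0 gcvg gdiv (cvg_cst m) e0).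
by exists N => // k /= Nk; rewrite ltnNge Nk.
Qed.

Lemma lrec0_le m g B N k : 0 < m -> 0 <= B -> (forall k, 0 <= g k) ->
  (forall k, (N <= k)%N -> 2 * m * g k <= 1) -> lrec m g (fun=> 0) B N k <= B.
Proof.
move=> m0 B0 g0 mg; have mg0 j : 0 <= m * g j by rewrite mulr_ge0// ltW.
suff /andP[] : 0 <= lrec m g (fun=> 0) B N k <= B by [].
elim: k => [|k /andP[l0 lB]] /=; first by rewrite B0 lexx.
case: ltnP => Nk; first by rewrite B0 lexx.
rewrite mulr0 addr0; have := mg _ Nk; rewrite -mulrA => h; have h0 := mg0 k.
rewrite mulr_ge0//=; last by lra.
by apply: le_trans lB; rewrite ler_piMl//; lra.
Qed.

(** Measures [x] in units of [w]: half of the contraction [2 m g] absorbs the decrease of [w], since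
    [(1 - 2 u) * (1 + u) <= 1 - u]. Of the source, the part [e], meant to vanish, goes into [lrec],
    and the constant part [D] leaves [D / m]. *)
Lemma rec_normalized (g w e x : nat -> R) m B D N : 0 < m -> 0 <= D ->
  (forall k, 0 <= g k) -> (forall k, (N <= k)%N -> 2 * m * g k <= 1) ->
  (forall k, (N <= k)%N -> 0 < w k) ->
  (forall k, (N <= k)%N -> w k <= (1 + m * g k) * w k.+1) ->
  (forall k, (N <= k)%N -> 0 <= x k) ->
  (forall k, (N <= k)%N -> x k.+1 <= (1 - 2 * m * g k) * x k + g k * w k.+1 * (e k + D)) ->
  x N <= B * w N ->
  forall k, (N <= k)%N -> x k <= w k * (lrec m g e B N k + D / m).
Proof.
move=> m0 D0 g0 mg w0 wS x0 rec xN k /subnKC <-; elim: (k - N)%N => [|j IH].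
  rewrite addn0 lrec_start mulrDr mulrC; apply: (le_trans xN).
  by rewrite mulrC lerDl mulr_ge0// ?divr_ge0// ltW// w0.
have Nj : (N <= N + j)%N by rewrite leq_addr.
rewrite addnS lrecS//; move: (N + j)%N Nj IH => i Ni IH.
have wi := w0 i Ni; have wi1 := w0 i.+1 (leqW Ni); have gi := g0 i.
have U0 : 0 <= lrec m g e B N i + D / m.
  by rewrite -(pmulr_rge0 _ wi); apply: le_trans (x0 i Ni) IH.
apply: le_trans (rec i Ni) _.
set U := lrec m g e B N i + D / m in U0 IH *.
have h1 : (1 - 2 * m * g i) * x i <= (1 - 2 * m * g i) * ((1 + m * g i) * w i.+1 * U).
  rewrite ler_wpM2l ?subr_ge0 ?mg//; apply: (le_trans IH).
  by rewrite ler_wpM2r// wS.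
have h2 : (1 - 2 * m * g i) * ((1 + m * g i) * w i.+1 * U) <= (1 - m * g i) * (w i.+1 * U).
  rewrite (_ : (1 - 2 * m * g i) * ((1 + m * g i) * w i.+1 * U) =
    (1 - 2 * m * g i) * (1 + m * g i) * (w i.+1 * U)); last by ring.
  apply: ler_wpM2r; first by rewrite mulr_ge0// ltW.
  have : 0 <= (m * g i) ^+ 2 := sqr_ge0 _; have : 0 <= m * g i by rewrite mulr_ge0// ltW.
  rewrite -mulrA; move: (m * g i) => a; nra.
have -> : w i.+1 * ((1 - m * g i) * lrec m g e B N i + g i * e i + D / m) =
   (1 - m * g i) * (w i.+1 * U) + g i * w i.+1 * (e i + D).
  by rewrite /U; field; rewrite gt_eqF.
by rewrite lerD2r; exact: le_trans h1 h2.
Qed.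

(** If [x] stayed above [eps / 2] from [N1] to [N], the divergent sum of the steps would push the
    weighted sum of [x] beyond [Bd]. So [x] falls below [eps / 2] there, and afterwards it grows by
    at most [eps / 2]. The rank [N] depends on the steps and the constants, not on [x]. *)
Lemma rho_decay_unif (g1 b cc Bd eps : R) (N0 : nat) : 0 < g1 -> 1 / 2 < b -> b <= 1 ->
  0 <= cc -> 0 <= Bd -> 0 < eps ->
  exists2 N, (N0 <= N)%N & (forall n, cc * \sum_(N <= k < n) gam g1 b k.+1 ^+ 2 <= eps) /\
  forall x : nat -> R, (forall k, 0 <= x k) ->
   (forall i j, (i <= j)%N -> x j <= x i + cc * \sum_(i <= k < j) gam g1 b k.+1 ^+ 2) ->
   (forall n, \sum_(k < n) gam g1 b k.+1 * x k <= Bd) -> x N <= eps.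
Proof.
move=> g10 b12 b1 cc0 Bd0 eps0.
have e2 : 0 < eps / 2 by rewrite divr_gt0.
have cc1 : 0 < cc + 1 by rewrite ltr_wpDl.
have [N1 HN1] := @gam_sq_tail _ g1 b g10 b12 (eps / 2 / (cc + 1)) (divr_gt0 e2 cc1).
have tail i n : (N1 <= i)%N -> cc * \sum_(i <= k < n) gam g1 b k.+1 ^+ 2 <= eps / 2.
  move=> Ni; apply: (@le_trans _ _ ((cc + 1) * (eps / 2 / (cc + 1)))); last first.
    by rewrite mulrC divfK// gt_eqF.
  apply: ler_pM => //; [by apply: sumr_ge0 => k _; rewrite sqr_ge0|by rewrite lerDl|].
  apply: le_trans (HN1 n); have [ni|ni] := leqP n i.
    by rewrite big_geq// sumr_ge0// => k _; rewrite sqr_ge0.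
  rewrite [leRHS](@big_cat_nat _ _ _ i)//=; last exact: ltnW.
  by rewrite lerDr sumr_ge0// => k _; rewrite sqr_ge0.
have [N2 _ HN2] := @gam_sum _ g1 b g10 b1 ((Bd + eps) / (eps / 2) + \sum_(k < N1) gam g1 b k.+1).
pose N := maxn N0 (maxn N1 N2).
have N1N : (N1 <= N)%N by rewrite /N !leq_max leqnn orbT.
exists N; first by rewrite leq_max leqnn.
split=> [n|x x0 xinc xsum].
  by apply: (le_trans (tail N n N1N)); rewrite ler_pdivrMr// ler_peMr// ?ler1n// ltW.
rewrite leNgt; apply/negP => xN.
have H k : (N1 <= k < N)%N -> eps / 2 < x k.
  move=> /andP[k1 k2]; have := xinc k N (ltnW k2); have := tail k N k1.
  by move: xN; lra.
have := HN2 N; rewrite /= !leq_max leqnn !orbT => /(_ isT).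
rewrite -!(big_mkord xpredT (fun k => gam g1 b k.+1)) (@big_cat_nat _ _ _ N1 0%N N)//=.
rewrite [leLHS]addrC lerD2l ler_pdivrMr// => h.
have : Bd + eps <= Bd; last by lra.
apply: (le_trans h); apply: le_trans (xsum N).
rewrite -(big_mkord xpredT (fun k => gam g1 b k.+1 * x k)) (@big_cat_nat _ _ _ N1 0%N N)//=.
rewrite ler_wpDl ?sumr_ge0//; first by move=> k _; rewrite mulr_ge0// gam_ge0.
rewrite mulr_suml; apply: ler_sum_nat => k kN.
by rewrite ler_wpM2l ?gam_ge0//; apply: ltW; exact: H.
Qed.

End normalized.

(** * One stochastic approximation system *)

Section sa_system.
Context {d} {T : measurableType d} {R : realType} (P : probability T R).
Variables (al g1 b : R).
Hypotheses (al01 : 0 < al < 1) (g10 : 0 < g1) (b12 : 1 / 2 < b) (b1 : b <= 1).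
Local Notation gam := (gam g1 b).
Variables (x0 : T -> R) (Xn : nat -> T -> R) (X : T -> R) (xst q r L MF Lv M0 dq : R).
Hypotheses (mx0 : measurable_fun setT x0) (mXn : forall n, measurable_fun setT (Xn n))
  (mX : measurable_fun setT X) (XnX : forall n, same_law P (Xn n.+1) X)
  (indep : mutually_independent P
    (fun o : option nat => if o is Some n then sigma_of (Xn n.+1) else sigma_of x0)).

Let c : R := 1 + (1 - al)^-1.
Let ca : R := (1 - al)^-1.

(** Mean field of the recursion for [xi]; [Vf] is the function [V_h] and [Vp] its derivative. *)
Definition Vp (x : R) : R := Ex P (fun w => H1 al x (X w)).
Definition Vf (x : R) : R := x + (1 - al)^-1 * Ex P (fun w => Num.max (X w - x) 0).

Hypotheses (LX : L1 P X) (q0 : 0 < q) (r0 : 0 < r) (r1 : r <= 1)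
  (L0 : 0 <= L) (MF0 : 0 <= MF) (Lv0 : 0 <= Lv) (dq0 : 0 <= dq)
  (HF : forall x y, Ex P (fun w => `|(if x <= X w then 1 else 0) - (if y <= X w then 1 else 0)|)
    <= MF * `|x - y|)
  (Hst : Vp xst = 0)
  (Hdrift1 : forall x, `|x - xst| <= r -> q / 2 * (x - xst) ^+ 2 <= (x - xst) * Vp x)
  (Hdrift2 : forall x, r <= `|x - xst| -> q / 2 * r * `|x - xst| <= (x - xst) * Vp x)
  (Hlin : forall x, `|Vp x - q * (x - xst)| <= L * (x - xst) ^+ 2 + dq * `|x - xst|)
  (HVf : forall x, 0 <= Vf x - Vf xst <= Lv * (x - xst) ^+ 2)
  (Lx0 : L2 P (fun w => x0 w - xst)) (Ex0 : Ex P (fun w => (x0 w - xst) ^+ 2) <= M0).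

Definition xi k w := (nsa al gam (x0 w) (fun n => Xn n w) k).1.
Definition ch k w := (nsa al gam (x0 w) (fun n => Xn n w) k).2.

Let e k w := xi k w - xst.

Let al1 : 0 < 1 - al. Proof. by case/andP: al01 => ? ?; rewrite subr_gt0. Qed.
Let ca0 : 0 < ca. Proof. by rewrite invr_gt0. Qed.
Let c0 : 0 < c. Proof. by rewrite addr_gt0. Qed.

Lemma H1_le x y : `|H1 al x y| <= c.
Proof.
rewrite /H1 /c; apply: le_trans (ler_normB _ _) _; rewrite normr1 lerD2l.
rewrite normrM (ger0_norm (ltW ca0)) -[leRHS]mulr1 ler_wpM2l ?(ltW ca0)//.
by case: ifP; rewrite ?normr1 ?normr0.
Qed.

Lemma mfun_H1 d1 (T1 : measurableType d1) (f g : T1 -> R) :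
  measurable_fun setT f -> measurable_fun setT g ->
  measurable_fun setT (fun w => H1 al (f w) (g w)).
Proof. by move=> mf mg; rewrite /H1; mfun. Qed.

Let xiS k w : xi k.+1 w = xi k w - gam k.+1 * H1 al (xi k w) (Xn k.+1 w).
Proof. by []. Qed.

Let eS k w : e k.+1 w = e k w - gam k.+1 * H1 al (xi k w) (Xn k.+1 w).
Proof. by rewrite /e xiS; ring. Qed.

Lemma mxi k : measurable_fun setT (xi k).
Proof.
elim: k => [|k IH]; first exact: mx0.
by apply: mfunB => //; apply: mfunM; [exact: mfun_cst|apply: mfun_H1].
Qed.

Let me k : measurable_fun setT (e k).
Proof. by apply: mfunB; [exact: mxi|exact: mfun_cst]. Qed.

Let LH1 x : L2 P (fun w => H1 al x (X w)).
Proof.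
apply: (@L2_bnd _ _ _ _ _ c); last by move=> w; exact: H1_le.
by apply: mfun_H1 => //; exact: mfun_cst.
Qed.

Lemma Vp_lip x y : `|Vp x - Vp y| <= ca * MF * `|x - y|.
Proof.
have L1x := L2_L1 (LH1 x); have L1y := L2_L1 (LH1 y).
rewrite /Vp -ExB//; apply: le_trans (Ex_abs (L1B L1x L1y)) _.
have mi t : measurable_fun setT (fun w => if t <= X w then 1 else 0 : R).
  by apply: mfun_if; [apply: mfun_le => //|..]; exact: mfun_cst.
have Ld : L1 P (fun w => `|(if x <= X w then 1 else 0) - (if y <= X w then 1 else 0) : R|).
  apply: L1_abs; apply: L1B; apply: (@L1_bnd _ _ _ _ _ 1) => // w;
  by case: ifP; rewrite ?normr1 ?normr0.
apply: (@le_trans _ _ (Ex P (fun w => ca * `|(if x <= X w then 1 else 0) - (if y <= X w then 1 else 0)|))).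
  apply: Ex_le; [exact: L1_abs (L1B L1x L1y)|exact: L1Z|move=> w].
  have -> : H1 al x (X w) - H1 al y (X w) =
      - (ca * ((if x <= X w then 1 else 0) - (if y <= X w then 1 else 0))).
    by rewrite /H1 -/ca; case: ifP; case: ifP => _ _; ring.
  by rewrite normrN normrM (gtr0_norm ca0).
by rewrite ExZ// -mulrA ler_wpM2l ?(ltW ca0).
Qed.

Lemma Vp_continuous : continuous Vp.
Proof.
move=> x; apply/cvgrPdist_le => eps eps0.
have K0 : 0 < ca * MF + 1 by rewrite ltr_wpDl// mulr_ge0// ltW.
near=> y; apply: le_trans (Vp_lip _ _) _.
apply: (@le_trans _ _ ((ca * MF + 1) * `|x - y|)); first by rewrite ler_wpM2r// lerDl.
rewrite mulrC -ler_pdivlMr//; near: y; apply/nbhs_ballP.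
by exists (eps / (ca * MF + 1)) => /=; [exact: divr_gt0|move=> y /ltW].
Unshelve. all: by end_near. Qed.

Lemma mVp : measurable_fun setT Vp.
Proof. by apply: mfun_continuous; exact: Vp_continuous. Qed.

Lemma Vp_bnd x : `|Vp x| <= c.
Proof.
have L1x := L2_L1 (LH1 x).
apply: le_trans (Ex_abs L1x) _; rewrite -[leRHS](Ex_cst P).
by apply: Ex_le => //; [exact: L1_abs|move=> w; exact: H1_le].
Qed.

Let Le k : L2 P (e k).
Proof.
elim: k => [|k IH]; first exact: Lx0.
have -> : e k.+1 = (fun w => e k w - gam k.+1 * H1 al (xi k w) (Xn k.+1 w)).
  by apply/funext => w; rewrite eS.
apply: L2B => //; apply: L2Z; apply: (@L2_bnd _ _ _ _ _ c); last by move=> w; exact: H1_le.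
by apply: mfun_H1 => //; exact: mxi.
Qed.

Section state.
Variables (N : nat) (a bb : nat -> R) (z : R -> R -> R).
Hypothesis (mz : measurable_fun setT (fun p : R * R => z p.1 p.2)).

Definition okr (k : nat) (x : R) : R := if (k < N)%N || (`|x - xst| <= r) then 1 else 0.

(** Equals 1 as long as the iterate has not left the ball of radius [r] between times [N] and [k].
    As a running product it can be updated from the current state, and it never increases. *)
Fixpoint gd (k : nat) (w : T) : R :=
  if k is k'.+1 then gd k' w * okr k (xi k w) else okr 0 (xi 0 w).

(** One recursion for two martingale remainders: that of [xi], with [a = 1 - q gam] and
    [bb = - gam], and that of [chi], with [a = bb = 1]. The flag keeps the increments bounded, and
    the value is 0 up to time [N]. *)
Fixpoint Ar (k : nat) (w : T) : R :=
  if k is k'.+1 then a k' * Ar k' w + bb k' * (if (N <= k')%N then gd k' w else 0) * z (xi k' w) (Xn k w)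
  else 0.

(** The iterate alone determines neither the flag nor the remainder. The triple is a chain driven by
    the samples, hence independent of the next sample. *)
Definition St k w := (xi k w, gd k w, Ar k w).

Lemma mfun_okr k d1 (T1 : measurableType d1) (f : T1 -> R) :
  measurable_fun setT f -> measurable_fun setT (fun w => okr k (f w)).
Proof.
move=> mf; rewrite /okr; case: (k < N)%N => /=; first exact: mfun_cst.
apply: mfun_if; [|exact: mfun_cst|exact: mfun_cst].
by apply: mfun_le; [apply: mfun_abs; apply: mfunB => //|]; exact: mfun_cst.
Qed.

Let PhiS k (p : (R * R * R) * R) : R * R * R :=
  let x' := p.1.1.1 - gam k.+1 * H1 al p.1.1.1 p.2 in
  (x', p.1.1.2 * okr k.+1 x',
   a k * p.1.2 + bb k * (if (N <= k)%N then p.1.1.2 else 0) * z p.1.1.1 p.2).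

Let mp1 : measurable_fun setT (fun p : (R * R * R) * R => p.1.1.1).
Proof.
apply: (measurableT_comp measurable_fst); apply: (measurableT_comp measurable_fst).
exact: measurable_fst.
Qed.
Let mp2 : measurable_fun setT (fun p : (R * R * R) * R => p.1.1.2).
Proof.
apply: (measurableT_comp measurable_snd); apply: (measurableT_comp measurable_fst).
exact: measurable_fst.
Qed.
Let mp3 : measurable_fun setT (fun p : (R * R * R) * R => p.1.2).
Proof. by apply: (measurableT_comp measurable_snd); exact: measurable_fst. Qed.
Let mp4 : measurable_fun setT (fun p : (R * R * R) * R => p.2).
Proof. exact: measurable_snd. Qed.

Let mPhiS k : measurable_fun setT (PhiS k).
Proof.
have mx' : measurable_fun setT (fun p : (R * R * R) * R => p.1.1.1 - gam k.+1 * H1 al p.1.1.1 p.2).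
  by apply: mfunB => //; apply: mfunM; [exact: mfun_cst|exact: mfun_H1].
apply: measurable_fun_pair; first apply: measurable_fun_pair => //.
  by apply: mfunM => //; exact: mfun_okr.
apply: mfunD; first by apply: mfunM => //; exact: mfun_cst.
apply: mfunM; first by apply: mfunM; [exact: mfun_cst|case: (N <= k)%N => //; exact: mfun_cst].
by apply: (measurableT_comp mz (measurable_fun_pair mp1 mp4)).
Qed.

Let s0 (x : R) : R * R * R := (x, okr 0 x, 0).
Let ms0 : measurable_fun setT s0.
Proof.
apply: measurable_fun_pair; last exact: mfun_cst.
by apply: measurable_fun_pair => //; exact: mfun_okr.
Qed.

Lemma mSt k : measurable_fun setT (St k).
Proof.
exact: (@chain_measurable _ _ _ _ _ x0 (fun n => Xn n.+1) St s0 PhiS).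
Qed.

Lemma St_indep k : indep_rv P (St k) (Xn k.+1).
Proof.
exact: (@chain_indep _ _ _ P _ _ x0 (fun n => Xn n.+1) St s0 PhiS).
Qed.

Lemma St_step k (psi : (R * R * R) * R -> R) (h : R * R * R -> R) :
  measurable_fun setT psi -> L1 P (fun w => psi (St k w, Xn k.+1 w)) ->
  (forall u, L1 P (fun w => psi (u, X w))) ->
  (forall u, Ex P (fun w => psi (u, X w)) = h u) ->
  L1 P (h \o St k) /\ Ex P (fun w => psi (St k w, Xn k.+1 w)) = Ex P (h \o St k).
Proof.
move=> mpsi L1' L2' H.
exact: (Ex_indep (mSt k) (mXn k.+1) mX (XnX k) (@St_indep k) mpsi L1' L2' H).
Qed.

Lemma gd01 k w : gd k w = 0 \/ gd k w = 1.
Proof.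
elim: k => [|k IH] /=; first by rewrite /okr; case: ifP; [right|left].
by case: IH => ->; rewrite ?mul0r ?mul1r; [left|rewrite /okr; case: ifP; [right|left]].
Qed.

Lemma gd_ge0 k w : 0 <= gd k w. Proof. by case: (gd01 k w) => ->. Qed.
Lemma gd_le1 k w : gd k w <= 1. Proof. by case: (gd01 k w) => ->. Qed.
Lemma gd_sqr k w : gd k w ^+ 2 = gd k w.
Proof. by case: (gd01 k w) => ->; rewrite ?expr0n ?expr1n. Qed.

Lemma gdS_le k w : gd k.+1 w <= gd k w.
Proof.
rewrite /= ler_piMr ?gd_ge0// /okr; by case: ifP.
Qed.

Lemma mgd k : measurable_fun setT (gd k).
Proof.
have := measurableT_comp (measurable_snd) (measurableT_comp measurable_fst (mSt k)).
by apply.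
Qed.

Lemma mAr k : measurable_fun setT (Ar k).
Proof.
have := measurableT_comp (measurable_snd) (mSt k).
by apply.
Qed.

Lemma gd_ok k w : (N <= k)%N -> gd k w = 1 -> `|e k w| <= r.
Proof.
move=> Nk; case: k Nk => [|k] Nk /=; rewrite /okr ltnNge Nk/= /e.
  by case: ifP => // _ /eqP; rewrite eq_sym oner_eq0.
by case: ifP => // _; rewrite mulr0 => /eqP; rewrite eq_sym oner_eq0.
Qed.

Lemma gd_zero_drift k w : (N <= k)%N -> gd k w * (q / 2 * e k w ^+ 2) <= gd k w * (e k w * Vp (xi k w)).
Proof.
move=> Nk; case: (gd01 k w) => g; rewrite g ?mul0r// !mul1r.
by apply: Hdrift1; exact: gd_ok Nk g.
Qed.

End state.

(** Placeholder noise, for the steps that involve only the iterate and the flag. *)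
Let z0 : R -> R -> R := fun _ _ => 0.
Let mz0 : measurable_fun setT (fun p : R * R => z0 p.1 p.2).
Proof. exact: mfun_cst. Qed.

Let mproj1 d1 (T1 : measurableType d1) (f : T1 -> (R * R * R) * R) :
  measurable_fun setT f -> measurable_fun setT (fun w => (f w).1.1.1).
Proof.
move=> mf; do 3 apply: (measurableT_comp measurable_fst).
exact: mf.
Qed.
Let mproj2 d1 (T1 : measurableType d1) (f : T1 -> (R * R * R) * R) :
  measurable_fun setT f -> measurable_fun setT (fun w => (f w).1.1.2).
Proof.
move=> mf; apply: (measurableT_comp measurable_snd); do 2 apply: (measurableT_comp measurable_fst).
exact: mf.
Qed.
Let mproj3 d1 (T1 : measurableType d1) (f : T1 -> (R * R * R) * R) :
  measurable_fun setT f -> measurable_fun setT (fun w => (f w).1.2).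
Proof.
move=> mf; apply: (measurableT_comp measurable_snd); apply: (measurableT_comp measurable_fst).
exact: mf.
Qed.
Let mproj4 d1 (T1 : measurableType d1) (f : T1 -> (R * R * R) * R) :
  measurable_fun setT f -> measurable_fun setT (fun w => (f w).2).
Proof. by move=> mf; apply: (measurableT_comp measurable_snd). Qed.
Let mid4 : measurable_fun setT (fun p : (R * R * R) * R => p).
Proof. exact: measurable_id. Qed.
Let m1 := mproj1 mid4. Let m2 := mproj2 mid4. Let m3 := mproj3 mid4. Let m4 := mproj4 mid4.

Let LHk k : L2 P (fun w => H1 al (xi k w) (Xn k.+1 w)).
Proof.
apply: (@L2_bnd _ _ _ _ _ c); last by move=> w; exact: H1_le.
by apply: mfun_H1 => //; exact: mxi.
Qed.

Let LVk k : L2 P (fun w => Vp (xi k w)).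
Proof.
apply: (@L2_bnd _ _ _ _ _ c); last by move=> w; exact: Vp_bnd.
by apply: mfun_comp; [exact: mVp|exact: mxi].
Qed.

Let EH1sqr x : Ex P (fun w => H1 al x (X w) ^+ 2) <= c ^+ 2.
Proof.
rewrite -[leRHS](Ex_cst P); apply: Ex_le => //; first by case: (LH1 x).
move=> w; rewrite -(real_normK (num_real (H1 al x (X w)))) lerXn2r ?nnegrE ?(ltW c0)//.
exact: H1_le.
Qed.

Let Ex_sqr_expand x t : Ex P (fun w => (x - xst - t * H1 al x (X w)) ^+ 2) =
  (x - xst) ^+ 2 - 2 * t * ((x - xst) * Vp x) + t ^+ 2 * Ex P (fun w => H1 al x (X w) ^+ 2).
Proof.
have [_ LH2] := LH1 x; have LH := L2_L1 (LH1 x).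
have L2' := L1Z (2 * t * (x - xst)) LH.
rewrite (@eq_Ex _ _ _ P _ (fun w => (x - xst) ^+ 2 - 2 * t * (x - xst) * H1 al x (X w) +
  t ^+ 2 * H1 al x (X w) ^+ 2)); last by move=> w; ring.
rewrite ExD; [|by apply: L1B|exact: L1Z].
rewrite ExB// Ex_cst !ExZ// /Vp; ring.
Qed.

Lemma energy k : Ex P (fun w => e k.+1 w ^+ 2) <=
  Ex P (fun w => e k w ^+ 2) - 2 * gam k.+1 * Ex P (fun w => e k w * Vp (xi k w)) + gam k.+1 ^+ 2 * c ^+ 2.
Proof.
set t := gam k.+1.
pose psi (p : (R * R * R) * R) := (p.1.1.1 - xst - t * H1 al p.1.1.1 p.2) ^+ 2.
have [|||u|Lh E] := @St_step 0 (fun=> 0) (fun=> 0) _ mz0 k psi (fun u => (u.1.1 - xst) ^+ 2 -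
    2 * t * ((u.1.1 - xst) * Vp u.1.1) + t ^+ 2 * Ex P (fun w => H1 al u.1.1 (X w) ^+ 2)).
- apply: mfunX; apply: mfunB; first by apply: mfunB => //; exact: mfun_cst.
  by apply: mfunM; [exact: mfun_cst|exact: mfun_H1].
- by case: (Le k.+1) => _; apply: eq_L1 => w; rewrite /psi eS /=; congr (_ ^+ 2); ring.
- move=> u; have L' := L2B (L2_cst P (u.1.1 - xst)) (L2Z t (LH1 u.1.1)).
  by case: L'.
- exact: Ex_sqr_expand.
have [_ Le2] := Le k; have LeV := L2_L1M (Le k) (LVk k).
have -> : Ex P (fun w => e k.+1 w ^+ 2) = Ex P (fun w => psi (St 0 (fun=> 0) (fun=> 0) z0 k w, Xn k.+1 w)).
  by apply: eq_Ex => w; rewrite /psi eS /=; congr (_ ^+ 2); ring.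
rewrite E -(ExZ _ LeV) -ExB//; last exact: L1Z.
rewrite -(Ex_cst P (t ^+ 2 * c ^+ 2)) -ExD//; last by apply: L1B => //; exact: L1Z.
apply: Ex_le => //; first by apply: L1D => //; apply: L1B => //; exact: L1Z.
by move=> w /=; rewrite lerD2l ler_wpM2l ?sqr_ge0.
Qed.

Lemma drift_ge0 x : 0 <= (x - xst) * Vp x.
Proof.
have [h|/ltW h] := leP `|x - xst| r.
  by apply: le_trans (Hdrift1 h); rewrite mulr_ge0 ?sqr_ge0 ?divr_ge0// ltW.
by apply: le_trans (Hdrift2 h); rewrite !mulr_ge0 ?divr_ge0// ltW.
Qed.

(** Global, but without a rate: far from [xst] the drift is only linear in the error. What it gives
    is a bound on [E e^2] and the summability of the weighted drifts. *)
Lemma energy_sum n : Ex P (fun w => e n w ^+ 2) +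
  2 * \sum_(k < n) gam k.+1 * Ex P (fun w => e k w * Vp (xi k w)) <=
  M0 + c ^+ 2 * \sum_(k < n) gam k.+1 ^+ 2.
Proof.
elim: n => [|n IH]; first by rewrite !big_ord0 !mulr0 !addr0.
by rewrite !big_ord_recr/=; have := energy n; lra.
Qed.

Let Lrho k : L1 P (fun w => rho (e k w)).
Proof.
apply: (L1_le _ _ (L1_abs (L2_L1 (Le k)))); first exact: mfun_comp mrho (me k).
by move=> w; rewrite ger0_norm ?rho_ge0 ?rho_le_abs.
Qed.

Let drift_rho x : 0 <= rho' (x - xst) * Vp x.
Proof.
rewrite /rho' mulrAC divr_ge0// ?drift_ge0//; exact: le_trans ler01 (sq _).
Qed.

Let H1sqr x y : H1 al x y ^+ 2 <= c ^+ 2.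
Proof.
rewrite -(real_normK (num_real (H1 al x y))) lerXn2r ?nnegrE ?(ltW c0)//; exact: H1_le.
Qed.

(** Near [xst] because [rho x <= x^2 / 2] and [r <= 1], far from it because [rho x <= |x|]. Combined
    with [energy_sum], it bounds the sum of the [gam E rho (e)]. *)
Lemma rho_drift x : q / 2 * r * rho (x - xst) <= (x - xst) * Vp x.
Proof.
have q2 : 0 <= q / 2 by rewrite divr_ge0// ltW.
have [h|/ltW h] := leP `|x - xst| r.
  apply: le_trans (Hdrift1 h); rewrite -mulrA ler_wpM2l//.
  have h1 := rho_le_sqr (x - xst); have h2 := rho_ge0 (x - xst).
  have := ler_wpM2r h2 r1; have := sqr_ge0 (x - xst); lra.
by apply: le_trans (Hdrift2 h); rewrite ler_wpM2l ?rho_le_abs// mulr_ge0// ltW.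
Qed.

Section flagged.
Variable N : nat.
Local Notation gdN := (gd N).

Lemma gd_early k w : (k < N)%N -> gdN k w = 1.
Proof.
elim: k => [|k IH] kN /=; first by rewrite /okr kN.
by rewrite IH ?mul1r ?/okr ?kN// ltnW.
Qed.

Let Lg k : L1 P (fun w => gdN k w).
Proof.
apply: (@L1_bnd _ _ _ _ _ 1); first exact: (mgd N (fun=> 0) (fun=> 0) mz0).
by move=> w; rewrite ger0_norm ?gd_ge0 ?gd_le1.
Qed.

Let LgM k f : L1 P f -> L1 P (fun w => gdN k w * f w).
Proof.
move=> Lf; have mf := L1_meas Lf; apply: (L1_le _ _ (L1_abs Lf)).
  by apply: mfunM => //; exact: L1_meas (Lg k).
by move=> w; rewrite normrM ler_piMl// ger0_norm ?gd_ge0 ?gd_le1.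
Qed.

(* The stopped process [gd rho(e) + (1 - gd) rho(r)] is a supermartingale up to [gam^2 c^2 / 2]. *)
Let Qs k := Ex P (fun w => gdN k w * rho (e k w) + (1 - gdN k w) * rho r).

Let LQ k : L1 P (fun w => gdN k w * rho (e k w) + (1 - gdN k w) * rho r).
Proof.
apply: L1D; first exact: LgM.
have := L1Z (rho r) (L1B (L1_cst P 1) (Lg k)); apply: eq_L1 => w; ring.
Qed.

Let Qs_step k : Qs k.+1 <= Qs k + gam k.+1 ^+ 2 * c ^+ 2 / 2.
Proof.
set t := gam k.+1.
(* The second-order bound of [rho] stands in for [rho] itself: it is affine in [H1], so its
   conditional mean is explicit. *)
pose psi (p : (R * R * R) * R) := p.1.1.2 * (rho (p.1.1.1 - xst) +
  rho' (p.1.1.1 - xst) * (- (t * H1 al p.1.1.1 p.2)) + t ^+ 2 * c ^+ 2 / 2) + (1 - p.1.1.2) * rho r.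
have mx1 : measurable_fun setT (fun p : (R * R * R) * R => p.1.1.1 - xst).
  by apply: mfunB => //; exact: mfun_cst.
have mpsi : measurable_fun setT psi.
  apply: mfunD; last by apply: mfunM; [apply: mfunB => //|]; exact: mfun_cst.
  apply: mfunM => //; apply: mfunD; last exact: mfun_cst.
  apply: mfunD; first exact: mfun_comp mrho mx1.
  apply: mfunM; first exact: mfun_comp mrho' mx1.
  by apply: mfunN; apply: mfunM; [exact: mfun_cst|exact: mfun_H1].
have Lr'H : L1 P (fun w => rho' (e k w) * (- (t * H1 al (xi k w) (Xn k.+1 w)))).
  apply: (@L1_bnd _ _ _ _ _ (1 * (t * c))).
    apply: mfunM; first exact: mfun_comp mrho' (me k).
    by apply: mfunN; apply: mfunM; [exact: mfun_cst|case: (LHk k)].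
  move=> w; have -> : `|rho' (e k w) * (- (t * H1 al (xi k w) (Xn k.+1 w)))| =
      `|rho' (e k w)| * (t * `|H1 al (xi k w) (Xn k.+1 w)|).
    by rewrite normrM normrN [in X in _ * X]normrM (ger0_norm (gam_ge0 b g10 k.+1 : 0 <= t)).
  apply: ler_pM => //; [by rewrite mulr_ge0 ?gam_ge0|exact: rho'_le1|].
  by rewrite ler_wpM2l ?gam_ge0// H1_le.
have Lpsi : L1 P (fun w => psi (St N (fun=> 0) (fun=> 0) z0 k w, Xn k.+1 w)).
  apply: L1D.
    by apply: LgM; apply: L1D => //; apply: L1D => //; exact: Lrho.
  have := L1Z (rho r) (L1B (L1_cst P 1) (Lg k)); apply: eq_L1 => w; rewrite /=; ring.
have [||Lh E] := @St_step N (fun=> 0) (fun=> 0) _ mz0 k psi (fun u => u.1.2 * (rho (u.1.1 - xst) -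
    t * (rho' (u.1.1 - xst) * Vp u.1.1) + t ^+ 2 * c ^+ 2 / 2) + (1 - u.1.2) * rho r) mpsi Lpsi.
- move=> u; have := L1D (L1Z (- (u.1.2 * rho' (u.1.1 - xst) * t)) (L2_L1 (LH1 u.1.1)))
    (L1_cst P (u.1.2 * (rho (u.1.1 - xst) + t ^+ 2 * c ^+ 2 / 2) + (1 - u.1.2) * rho r)).
  by apply: eq_L1 => w; rewrite /psi/=; ring.
- move=> u; rewrite (@eq_Ex _ _ _ P _ (fun w => - (u.1.2 * rho' (u.1.1 - xst) * t) * H1 al u.1.1 (X w) +
    (u.1.2 * (rho (u.1.1 - xst) + t ^+ 2 * c ^+ 2 / 2) + (1 - u.1.2) * rho r))); last first.
    by move=> w; rewrite /psi/=; ring.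
  rewrite ExD; [|by apply: L1Z; exact: L2_L1 (LH1 _)|exact: L1_cst].
  rewrite ExZ ?Ex_cst; last exact: L2_L1 (LH1 _).
  by rewrite /Vp; ring.
apply: (@le_trans _ _ (Ex P (fun w => psi (St N (fun=> 0) (fun=> 0) z0 k w, Xn k.+1 w)))).
  rewrite /Qs; apply: Ex_le => //.
  move=> w; rewrite /psi/= eS.
  have Ta := rho_taylor (e k w) (- (t * H1 al (xi k w) (Xn k.+1 w))).
  rewrite sqrrN exprMn in Ta; have HH := H1sqr (xi k w) (Xn k.+1 w).
  have T2 : rho (e k w - t * H1 al (xi k w) (Xn k.+1 w)) <= rho (e k w) +
      rho' (e k w) * (- (t * H1 al (xi k w) (Xn k.+1 w))) + t ^+ 2 * c ^+ 2 / 2.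
    by apply: (le_trans Ta); rewrite lerD2l ler_pM2r// ler_wpM2l ?sqr_ge0.
  case: (gd01 N k w) => -> ; rewrite ?mul0r ?mul1r ?subrr ?subr0 ?mul0r ?add0r ?addr0//.
  rewrite -eS in T2 *; rewrite /okr; case: ifP => [_|/negbT].
    by rewrite mul1r subrr mul0r addr0.
  (* At the exit time [|e| > r], so stopping at the value [rho r] does not raise the process. *)
  rewrite negb_or -ltNge => /andP[_ bad].
  rewrite mul0r add0r subr0 mul1r; apply: le_trans T2; apply: rho_even.
  by rewrite (gtr0_norm r0); exact: ltW.
have -> : Qs k + t ^+ 2 * c ^+ 2 / 2 = Ex P (fun w =>
    (gdN k w * rho (e k w) + (1 - gdN k w) * rho r) + t ^+ 2 * c ^+ 2 / 2).
  by rewrite ExD// Ex_cst.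
rewrite E; apply: Ex_le => //; first exact: L1D.
move=> w /=; have := drift_rho (xi k w); rewrite -/(e k w) => dr.
have tt : 0 <= t * (rho' (e k w) * Vp (xi k w)) by rewrite mulr_ge0// gam_ge0.
have cc : 0 <= t ^+ 2 * c ^+ 2 / 2 by rewrite divr_ge0// mulr_ge0 ?sqr_ge0.
by case: (gd01 N k w) => ->; lra.
Qed.

(** Before time [N] the flag is 1 and the stopped process is [rho (e)] itself; [N] being arbitrary,
    this is the estimate without stopping. *)
Lemma rho_incr i j : (i <= j)%N -> (j < N)%N -> Ex P (fun w => rho (e j w)) <=
  Ex P (fun w => rho (e i w)) + c ^+ 2 / 2 * \sum_(i <= k < j) gam k.+1 ^+ 2.
Proof.
have QE k : (k < N)%N -> Ex P (fun w => rho (e k w)) = Qs k.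
  by move=> kN; apply: eq_Ex => w; rewrite gd_early// mul1r subrr mul0r addr0.
elim: j => [|j IH] ij jN.
  by rewrite big_geq// mulr0 addr0; move: ij; rewrite leqn0 => /eqP ->.
move: ij; rewrite leq_eqVlt => /orP[/eqP <-|ij]; first by rewrite big_geq// mulr0 addr0.
rewrite big_nat_recr//= mulrDr addrA; have := IH ij (ltnW jN); have := Qs_step j.
by rewrite -!QE// ?(ltnW jN)//; lra.
Qed.

(** Maximal inequality: where the flag is 0 the stopped process is worth [rho r], and at time [N] it
    is at most [rho (e_N)]. *)
Lemma exit_prob n : (N <= n)%N -> rho r * Ex P (fun w => 1 - gdN n w) <=
  Ex P (fun w => rho (e N w)) + c ^+ 2 / 2 * \sum_(N <= k < n) gam k.+1 ^+ 2.
Proof.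
move=> Nn; have L1g := L1B (L1_cst P 1) (Lg n).
apply: (@le_trans _ _ (Qs n)).
  rewrite -ExZ// /Qs; apply: Ex_le; [exact: L1Z|exact: LQ|move=> w].
  by rewrite mulrC lerDr mulr_ge0 ?gd_ge0 ?rho_ge0.
elim: n Nn {L1g} => [|n IH] Nn.
  have N0 : N = 0%N by apply/eqP; rewrite -leqn0.
  rewrite big_geq ?N0// mulr0 addr0; apply: Ex_le; [exact: LQ|exact: Lrho|move=> w /=].
  rewrite /okr; case: ifP => [_|/negbT].
    by rewrite mul1r subrr mul0r addr0.
  rewrite negb_or -ltNge => /andP[_ bad]; rewrite mul0r add0r subr0 mul1r; apply: rho_even.
  by rewrite (gtr0_norm r0); exact: ltW.
move: Nn; rewrite leq_eqVlt => /orP[/eqP Nn|Nn].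
  rewrite big_geq -?Nn// mulr0 addr0 Nn; apply: Ex_le; [exact: LQ|exact: Lrho|move=> w].
  have -> : gd N n.+1 w = okr N n.+1 (xi n.+1 w).
    by rewrite /= gd_early ?mul1r// Nn.
  rewrite /okr Nn ltnn/=; case: ifP => [_|/negbT].
    by rewrite mul1r subrr mul0r addr0.
  rewrite -ltNge => bad; rewrite mul0r add0r subr0 mul1r; apply: rho_even.
  by rewrite (gtr0_norm r0); exact: ltW.
rewrite big_nat_recr//= mulrDr addrA; have := IH Nn; have := Qs_step n; lra.
Qed.

(** * Rates on the event of no exit *)

Section rates.
Hypotheses (N0 : (0 < N)%N) (gq1 : forall k, (N <= k)%N -> q * gam k.+1 <= 1)
  (gq2 : forall k, (N <= k)%N -> gam k <= (1 + q / 2 * gam k.+1) * gam k.+1).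

Let Eg k := Ex P (fun w => gdN k w * e k w ^+ 2).

Let gamN0 k : (N <= k)%N -> 0 < gam k.
Proof. by case: k => [|k] Nk; [move: N0; rewrite ltnNge Nk|exact: gam_gt0]. Qed.

Let gm k : (N <= k)%N -> 2 * (q / 2) * gam k.+1 <= 1.
Proof. by move=> /gq1 h; apply: le_trans h; rewrite le_eqVlt; apply/orP; left; apply/eqP; field. Qed.

Lemma gd_sqr_rec k : (N <= k)%N -> Eg k.+1 <= (1 - q * gam k.+1) * Eg k + gam k.+1 ^+ 2 * c ^+ 2.
Proof.
move=> Nk; set t := gam k.+1; have t0 : 0 <= t by exact: gam_ge0.
pose psi (p : (R * R * R) * R) := p.1.1.2 * (p.1.1.1 - xst - t * H1 al p.1.1.1 p.2) ^+ 2.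
have mpsi : measurable_fun setT psi.
  apply: mfunM => //; apply: mfunX; apply: mfunB; first by apply: mfunB => //; exact: mfun_cst.
  by apply: mfunM; [exact: mfun_cst|exact: mfun_H1].
have eE w : e k.+1 w = xi k w - xst - t * H1 al (xi k w) (Xn k.+1 w) by rewrite eS.
have Lpsi : L1 P (fun w => psi (St N (fun=> 0) (fun=> 0) z0 k w, Xn k.+1 w)).
  apply: LgM; have [_] := Le k.+1; apply: eq_L1 => w; by rewrite eE.
have [||Lh E] := @St_step N (fun=> 0) (fun=> 0) _ mz0 k psi (fun u => u.1.2 * ((u.1.1 - xst) ^+ 2 -
    2 * t * ((u.1.1 - xst) * Vp u.1.1) + t ^+ 2 * Ex P (fun w => H1 al u.1.1 (X w) ^+ 2))) mpsi Lpsi.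
- move=> u; apply: L1Z; by case: (L2B (L2_cst P (u.1.1 - xst)) (L2Z t (LH1 u.1.1))).
- move=> u; rewrite ExZ ?Ex_sqr_expand//; by case: (L2B (L2_cst P (u.1.1 - xst)) (L2Z t (LH1 u.1.1))).
apply: (@le_trans _ _ (Ex P (fun w => psi (St N (fun=> 0) (fun=> 0) z0 k w, Xn k.+1 w)))).
  apply: Ex_le => //; first by apply: LgM; case: (Le k.+1).
  by move=> w; rewrite /psi/= -eE ler_wpM2r ?sqr_ge0// (gdS_le N).
have Lge : L1 P (fun w => gdN k w * e k w ^+ 2) by apply: LgM; case: (Le k).
rewrite E -(ExZ _ Lge) -(Ex_cst P (t ^+ 2 * c ^+ 2)) -ExD//; last exact: L1Z.
apply: Ex_le => //; first by apply: L1D => //; exact: L1Z.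
move=> w /=; have := @gd_zero_drift N k w Nk; rewrite -/(e k w).
have := EH1sqr (xi k w); move: (Ex P _) => y; have := sqr_ge0 (e k w); have := sqr_ge0 t; have := sqr_ge0 c.
case: (gd01 N k w) => ->; rewrite ?mul0r ?mulr0 ?mul1r ?add0r => h1 h2 h3 h4 h5.
  by rewrite mulr_ge0.
have := ler_wpM2l t0 h5; have := ler_wpM2l h2 h4.
clear E Lh Lpsi eE mpsi psi; clearbody t; lra.
Qed.

Let Lge k : L1 P (fun w => gdN k w * e k w ^+ 2).
Proof. by apply: LgM; case: (Le k). Qed.

Let Eg_ge0 k : 0 <= Eg k.
Proof. by apply: Ex_ge0 => w; rewrite mulr_ge0 ?gd_ge0 ?sqr_ge0. Qed.

Let CD := (gam N)^-1 + c ^+ 2 / (q / 2).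

(** [rec_normalized] with weight [gam] and [m = q / 2]. The constant [(gam N)^-1] covers the initial
    time because the flag forces [|e_N| <= r <= 1]. *)
Lemma gd_sqr_bnd k : (N <= k)%N -> Eg k <= CD * gam k.
Proof.
move=> Nk.
have H := @rec_normalized _ (fun k => gam k.+1) gam (fun=> 0) Eg (q / 2) (gam N)^-1 (c ^+ 2) N.
have q2 : 0 < q / 2 by rewrite divr_gt0.
have := H q2 (sqr_ge0 _) (fun k => gam_ge0 b g10 _) gm gamN0 gq2 (fun k _ => Eg_ge0 k).
move=> /(_ _ _ k Nk) h; rewrite mulrC; apply: le_trans (h _ _) _ => {h}.
- move=> j Nj; apply: (le_trans (gd_sqr_rec Nj)); rewrite add0r.
  by rewrite le_eqVlt; apply/orP; left; apply/eqP; field.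
- rewrite mulVf ?gt_eqF ?gamN0// -[leRHS](Ex_cst P); apply: Ex_le => // w.
  case: (gd01 N N w) => g; rewrite g ?mul0r// mul1r -(real_normK (num_real _)).
  by rewrite expr_le1//; apply: le_trans r1; apply: (@gd_ok N).
- rewrite ler_wpM2l ?gam_ge0// lerD2r lrec0_le// ?invr_ge0 ?gam_ge0// => j; exact: gam_ge0.
Qed.

Let S1 k := Ex P (fun w => gdN k w * `|e k w|).

Let CD_ge0 : 0 <= CD.
Proof. by rewrite addr_ge0 ?invr_ge0 ?gam_ge0// divr_ge0 ?sqr_ge0// divr_ge0// ltW. Qed.

Lemma gd_abs_bnd k : (N <= k)%N -> S1 k <= Num.sqrt (CD * gam k).
Proof.
move=> Nk; rewrite -(@ler_pXn2r _ 2)// ?nnegrE ?sqrtr_ge0//; last first.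
  by apply: Ex_ge0 => w; rewrite mulr_ge0 ?gd_ge0.
rewrite sqr_sqrtr; last exact: le_trans (Eg_ge0 k) (gd_sqr_bnd Nk).
apply: le_trans (gd_sqr_bnd Nk).
have Lgf : L2 P (fun w => gdN k w * e k w).
  apply: (@L2_bndM _ _ _ _ _ _ 1) => //; first exact: L1_meas (Lg k).
  by move=> w; rewrite ger0_norm ?gd_ge0 ?gd_le1.
rewrite [leRHS](_ : _ = Ex P (fun w => (gdN k w * e k w) ^+ 2)); last first.
  by apply: eq_Ex => w; rewrite exprMn gd_sqr.
apply: le_trans (Ex_abs_sqr Lgf); rewrite lerXn2r ?nnegrE//; last first.
- apply: Ex_le.
  + by apply: LgM; apply: L1_abs; exact: L2_L1.
  + by apply: L1_abs; exact: L2_L1.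
  + by move=> w; rewrite normrM (ger0_norm (gd_ge0 _ _ _)).
- by apply: Ex_ge0.
- by apply: Ex_ge0 => w; rewrite mulr_ge0 ?gd_ge0.
Qed.

Section martingale.
Variables (a bb : nat -> R) (z : R -> R -> R) (Zc C1 C2 : R).
Hypotheses (mz : measurable_fun setT (fun p : R * R => z p.1 p.2)) (Zc0 : 0 <= Zc)
  (Hz : forall x y, `|z x y| <= Zc * (1 + `|x - xst|))
  (Ez : forall x, Ex P (fun w => z x (X w)) = 0)
  (Ez2 : forall x, Ex P (fun w => z x (X w) ^+ 2) <= C1 * `|x - xst| + C2 * (x - xst) ^+ 2).

Local Notation A := (Ar N a bb z).

Let Lz x : L2 P (fun w => z x (X w)).
Proof.
apply: (@L2_bnd _ _ _ _ _ (Zc * (1 + `|x - xst|))) => //.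
by apply: (measurableT_comp mz (measurable_fun_pair _ _)) => //; exact: mfun_cst.
Qed.

Lemma Ar_early k w : (k <= N)%N -> A k w = 0.
Proof.
elim: k => [//|k IH] kN; have /= := IH (ltnW kN) => ->.
by rewrite leqNgt kN/= !mulr0 mul0r addr0.
Qed.

Lemma gdz_bnd k w y : (N <= k)%N -> `|gdN k w * z (xi k w) y| <= 2 * Zc.
Proof.
move=> Nk; case: (gd01 N k w) => g; first by rewrite g mul0r normr0 mulr_ge0.
rewrite g mul1r; apply: (le_trans (Hz _ _)); rewrite mulrC ler_wpM2r//.
by have := le_trans (gd_ok Nk g) r1; rewrite /e; lra.
Qed.

Lemma Ar_bnd k : exists C, forall w, `|A k w| <= C.
Proof.
elim: k => [|k [C HC]]; first by exists 0 => w; rewrite normr0.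
exists (`|a k| * C + `|bb k| * (2 * Zc)) => w /=.
apply: (le_trans (ler_normD _ _)); apply: lerD; first by rewrite normrM ler_wpM2l.
rewrite -mulrA normrM ler_wpM2l//; case: ifP => [Nk|_]; first exact: gdz_bnd.
by rewrite mul0r normr0 mulr_ge0.
Qed.

Lemma L2_Ar k : L2 P (A k).
Proof. by have [C HC] := Ar_bnd k; apply: (@L2_bnd _ _ _ _ _ C) => //; exact: mAr. Qed.

(** The increment has conditional mean 0, so the cross term vanishes. [C1] is meant for jumps of
    indicators, of variance [O(|e|)], and [C2] for Lipschitz integrands, of variance [O(e^2)]. *)
Lemma Ar_sqr k : (N <= k)%N -> Ex P (fun w => A k.+1 w ^+ 2) <=
  a k ^+ 2 * Ex P (fun w => A k w ^+ 2) + bb k ^+ 2 * (C1 * S1 k + C2 * Eg k).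
Proof.
move=> Nk.
pose psi (p : (R * R * R) * R) := (a k * p.1.2 + bb k * p.1.1.2 * z p.1.1.1 p.2) ^+ 2.
have mpsi : measurable_fun setT psi.
  apply: mfunX; apply: mfunD; first by apply: mfunM => //; exact: mfun_cst.
  apply: mfunM; first by apply: mfunM => //; exact: mfun_cst.
  by apply: (measurableT_comp mz (measurable_fun_pair m1 m4)).
have AE w : A k.+1 w = a k * A k w + bb k * gdN k w * z (xi k w) (Xn k.+1 w) by rewrite /= Nk.
have Lpsi : L1 P (fun w => psi (St N a bb z k w, Xn k.+1 w)).
  by have [_] := L2_Ar k.+1; apply: eq_L1 => w; rewrite AE.
have L2u (u : R * R * R) : L2 P (fun w => a k * u.2 + bb k * u.1.2 * z u.1.1 (X w)).
  by apply: L2D; [exact: L2_cst|exact: L2Z].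
have [||Lh E] := @St_step N a bb _ mz k psi (fun u => (a k * u.2) ^+ 2 +
    (bb k * u.1.2) ^+ 2 * Ex P (fun w => z u.1.1 (X w) ^+ 2)) mpsi Lpsi.
- by move=> u; case: (L2u u).
- move=> u; have [_ Lz2] := Lz u.1.1; have Lz1 := L2_L1 (Lz u.1.1).
  rewrite (@eq_Ex _ _ _ P _ (fun w => ((a k * u.2) ^+ 2 + (2 * (a k * u.2) * (bb k * u.1.2)) * z u.1.1 (X w))
    + (bb k * u.1.2) ^+ 2 * z u.1.1 (X w) ^+ 2)); last by move=> w; rewrite /psi/=; ring.
  rewrite ExD; [|by apply: L1D => //; exact: L1Z|exact: L1Z].
  by rewrite ExD//; [rewrite Ex_cst !ExZ// Ez mulr0 addr0|exact: L1Z].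
have [_ LA2] := L2_Ar k; have Lg1 : L1 P (fun w => gdN k w * `|e k w|).
  by apply: LgM; apply: L1_abs; exact: L2_L1.
rewrite [leLHS](_ : _ = Ex P (fun w => psi (St N a bb z k w, Xn k.+1 w))); last first.
  by apply: eq_Ex => w; rewrite AE.
rewrite E /S1 /Eg -!(ExZ _ LA2) -(ExZ _ Lg1) -(ExZ _ (Lge k)) -ExD; [|exact: L1Z..].
rewrite -ExZ -?ExD; [|exact: L1Z|by apply: L1Z; apply: L1D; exact: L1Z|by apply: L1D; exact: L1Z].
apply: Ex_le => //; first by apply: L1D; [exact: L1Z|by apply: L1Z; apply: L1D; exact: L1Z].
move=> w /=; rewrite !exprMn lerD2l gd_sqr -mulrA ler_wpM2l ?sqr_ge0//.
rewrite mulrCA [C2 * _]mulrCA -mulrDr ler_wpM2l ?gd_ge0//; exact: Ez2.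
Qed.

End martingale.

Let Ex_sqr_center D : L2 P D -> Ex P (fun w => (D w - Ex P D) ^+ 2) <= Ex P (fun w => D w ^+ 2).
Proof.
move=> LD; have [_ LD2] := LD; have LD1 := L2_L1 LD; set v := Ex P D.
rewrite (@eq_Ex _ _ _ P _ (fun w => (D w ^+ 2 - 2 * v * D w) + v ^+ 2)); last by move=> w; ring.
have L' := L1Z (2 * v) LD1.
rewrite ExD//; last exact: L1B.
by rewrite ExB// ExZ// Ex_cst -/v; have := sqr_ge0 v; lra.
Qed.

Lemma energy_bnd CS n : (forall n, \sum_(k < n) gam k.+1 ^+ 2 <= CS) ->
  Ex P (fun w => e n w ^+ 2) <= M0 + c ^+ 2 * CS.
Proof.
move=> HCS; have := energy_sum n; have := ler_wpM2l (sqr_ge0 c) (HCS n).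
have : 0 <= \sum_(k < n) gam k.+1 * Ex P (fun w => e k w * Vp (xi k w)); last by lra.
by apply: sumr_ge0 => k _; rewrite mulr_ge0 ?gam_ge0// Ex_ge0// => w; exact: drift_ge0.
Qed.

Lemma rho_sum_bnd CS n : (forall n, \sum_(k < n) gam k.+1 ^+ 2 <= CS) ->
  \sum_(k < n) gam k.+1 * Ex P (fun w => rho (e k w)) <= (M0 + c ^+ 2 * CS) / (q * r).
Proof.
move=> HCS; have := energy_sum n; have := ler_wpM2l (sqr_ge0 c) (HCS n) => h1 h2.
have qr : 0 < q * r by rewrite mulr_gt0.
rewrite ler_pdivlMr// mulr_suml.
apply: (@le_trans _ _ (2 * \sum_(k < n) gam k.+1 * Ex P (fun w => e k w * Vp (xi k w)))); last first.
  have : 0 <= Ex P (fun w => e n w ^+ 2) by apply: Ex_ge0 => w; exact: sqr_ge0.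
  by lra.
rewrite mulr_sumr; apply: ler_sum => k _; rewrite [leRHS]mulrCA -mulrA ler_wpM2l ?gam_ge0//.
rewrite mulrC -[leRHS]ExZ; last exact: (L2_L1M (Le k) (LVk k)).
rewrite -ExZ//; apply: Ex_le; [exact: L1Z|by apply: L1Z; exact: (L2_L1M (Le k) (LVk k))|move=> w].
by have := rho_drift (xi k w); rewrite -/(e k w); lra.
Qed.

Lemma abs_bnd CS n : (forall n, \sum_(k < n) gam k.+1 ^+ 2 <= CS) ->
  Ex P (fun w => `|e n w|) <= 1 + (M0 + c ^+ 2 * CS).
Proof.
move=> HCS; have [_ Le2] := Le n.
apply: (@le_trans _ _ (Ex P (fun w => 1 + e n w ^+ 2))); last first.
  by rewrite ExD// Ex_cst lerD2l energy_bnd.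
apply: Ex_le; [by apply: L1_abs; exact: L2_L1|exact: L1D|move=> w].
by rewrite -(real_normK (num_real (e n w))); have := sqr_ge0 (`|e n w| - 1); nra.
Qed.

Let zeta x y := H1 al x y - H1 al xst y - Vp x.

Let mzeta : measurable_fun setT (fun p : R * R => zeta p.1 p.2).
Proof.
apply: mfunB; last by apply: mfun_comp; [exact: mVp|exact: measurable_fst].
by apply: mfunB; apply: mfun_H1; mfun.
Qed.

Let c30 : 0 <= 3 * c. Proof. by rewrite mulr_ge0// ltW. Qed.

Let zeta_bnd x y : `|zeta x y| <= 3 * c * (1 + `|x - xst|).
Proof.
apply: (@le_trans _ _ (3 * c)); last by rewrite ler_peMr// lerDl.
rewrite /zeta; apply: (le_trans (ler_normB _ _)); apply: (le_trans (lerD (ler_normB _ _) (lexx _))).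
by have := H1_le x y; have := H1_le xst y; have := Vp_bnd x; lra.
Qed.

Let Ezeta x : Ex P (fun w => zeta x (X w)) = 0.
Proof.
have L1x := L2_L1 (LH1 x); have L1y := L2_L1 (LH1 xst).
rewrite /zeta ExB//; last exact: L1B.
by rewrite ExB// Ex_cst -/(Vp x) -/(Vp xst) Hst subr0 subrr.
Qed.

(** The difference of the two indicators has modulus 0 or 1, so its square has the same mean as its
    modulus, at most [MF |x - xst|]. This first order is still enough: under the flag [E |e|] is
    [O(sqrt gam)], which tends to 0. *)
Let Ezeta2 x : Ex P (fun w => zeta x (X w) ^+ 2) <= (ca ^+ 2 * MF) * `|x - xst| + 0 * (x - xst) ^+ 2.
Proof.
rewrite mul0r addr0.
have LD := L2B (LH1 x) (LH1 xst); have [_ LD2] := LD.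
have VE : Vp x = Ex P (fun w => H1 al x (X w) - H1 al xst (X w)).
  by rewrite ExB; [rewrite -/(Vp x) -/(Vp xst) Hst subr0|exact: L2_L1 (LH1 _)..].
rewrite /zeta VE; apply: (le_trans (Ex_sqr_center LD)).
rewrite -mulrA; apply: (@le_trans _ _ (ca ^+ 2 * Ex P (fun w =>
    `|(if x <= X w then 1 else 0) - (if xst <= X w then 1 else 0)|))); last by rewrite ler_wpM2l ?sqr_ge0.
have mi t : measurable_fun setT (fun w => if t <= X w then 1 else 0 : R).
  by apply: mfun_if; [apply: mfun_le => //|..]; exact: mfun_cst.
have Ld : L1 P (fun w => `|(if x <= X w then 1 else 0) - (if xst <= X w then 1 else 0) : R|).
  apply: (@L1_bnd _ _ _ _ _ 1); first by apply: mfun_abs; apply: mfunB.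
  by move=> w; case: ifP; case: ifP; rewrite ?subrr ?subr0 ?sub0r ?normrN ?normr1 ?normr0 ?normr1.
rewrite -ExZ//; apply: Ex_le => //; first exact: L1Z.
move=> w; rewrite /H1 -/ca; case: ifP; case: ifP => _ _;
  rewrite ?mulr1 ?mulr0 ?subrr ?subr0 ?sub0r ?normrN ?normr1 ?normr0 ?mulr1 ?mulr0 ?expr0n//;
  by rewrite le_eqVlt; apply/orP; left; apply/eqP; ring.
Qed.

Fixpoint lin (k : nat) (w : T) : R :=
  if k is k'.+1 then (1 - q * gam k) * lin k' w - gam k * H1 al xst (Xn k w) else 0.

Fixpoint lbd (k : nat) : R :=
  if k is k'.+1 then `|1 - q * gam k| * lbd k' + gam k * c else 0.

Lemma lin_bnd k w : `|lin k w| <= lbd k.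
Proof.
elim: k => [|k IH] /=; first by rewrite normr0.
apply: (le_trans (ler_normB _ _)); apply: lerD; first by rewrite normrM ler_wpM2l.
by rewrite normrM (ger0_norm (gam_ge0 b g10 _)) ler_wpM2l ?gam_ge0// H1_le.
Qed.

Lemma mlin k : measurable_fun setT (lin k).
Proof.
elim: k => [|k IH]; first exact: mfun_cst.
apply: mfunB; first by apply: mfunM => //; exact: mfun_cst.
by apply: mfunM; [exact: mfun_cst|apply: mfun_H1 => //; exact: mfun_cst].
Qed.

Let A1 := Ar N (fun k => 1 - q * gam k.+1) (fun k => - gam k.+1) zeta.
(** What is left of the error after the linear part and the martingale. While the flag is 1, its
    only source is the drift remainder, so absolute values can be taken without losing the
    cancellations of the noise. *)
Let B1 k w := e k w - lin k w - A1 k w.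
Let EgB k := Ex P (fun w => gdN k w * `|B1 k w|).

Let LB1 k : L2 P (B1 k).
Proof.
apply: L2B; last exact: (L2_Ar _ _ mzeta c30 zeta_bnd).
by apply: L2B => //; apply: (@L2_bnd _ _ _ _ _ (lbd k)); [exact: mlin|exact: lin_bnd].
Qed.

Let B1S k w : (N <= k)%N -> gdN k w = 1 ->
  B1 k.+1 w = (1 - q * gam k.+1) * B1 k w + gam k.+1 * (q * e k w - Vp (xi k w)).
Proof.
move=> Nk g; rewrite /B1 /A1 eS [lin _ _]/= [Ar _ _ _ _ _ _]/= Nk g /zeta; ring.
Qed.

Let LgB k : L1 P (fun w => gdN k w * `|B1 k w|).
Proof. by apply: LgM; apply: L1_abs; exact: L2_L1. Qed.

Let LgE k : L1 P (fun w => gdN k w * `|e k w|).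
Proof. by apply: LgM; apply: L1_abs; exact: L2_L1. Qed.

Let EgB_rec k : (N <= k)%N -> EgB k.+1 <= (1 - q * gam k.+1) * EgB k + gam k.+1 * (L * Eg k + dq * S1 k).
Proof.
move=> Nk; have q1 := gq1 Nk; set t := gam k.+1 in q1 *; have t0 : 0 <= t by exact: gam_ge0.
rewrite /EgB /Eg /S1 -(ExZ L (Lge k)) -(ExZ dq (LgE k)) -(ExZ (1 - q * t) (LgB k)).
rewrite -(ExD (L1Z L (Lge k)) (L1Z dq (LgE k))) -(ExZ t (L1D (L1Z L (Lge k)) (L1Z dq (LgE k)))).
rewrite -ExD; [|exact: L1Z|by apply: L1Z; apply: L1D; exact: L1Z].
apply: Ex_le; [exact: LgB|by apply: L1D; [exact: L1Z|by apply: L1Z; apply: L1D; exact: L1Z]|].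
move=> w; apply: (@le_trans _ _ (gdN k w * `|B1 k.+1 w|)); first by rewrite ler_wpM2r// gdS_le.
case: (gd01 N k w) => g; rewrite g ?mul0r ?mulr0 ?add0r ?mulr0// !mul1r B1S//.
apply: (le_trans (ler_normD _ _)); apply: lerD; first by rewrite normrM ger0_norm// subr_ge0.
by rewrite normrM (ger0_norm t0) ler_wpM2l// distrC; exact: Hlin.
Qed.

Variables (CS : R).
Hypothesis HCS : forall n, \sum_(k < n) gam k.+1 ^+ 2 <= CS.
Let ME := M0 + c ^+ 2 * CS.

Let M00 : 0 <= M0.
Proof. by apply: le_trans Ex0; apply: Ex_ge0 => w; exact: sqr_ge0. Qed.

Let CS0 : 0 <= CS.
Proof. by have := HCS 0%N; rewrite big_ord0. Qed.

Let ME0 : 0 <= ME.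
Proof. by rewrite addr_ge0// mulr_ge0// sqr_ge0. Qed.

Let q20 : 0 < q / 2. Proof. exact: divr_gt0. Qed.

(** Dominating sequences: [E A1^2 <= gam k * sA k], and [sqrt (gam k) * sB k] bounds the part of
    [E (gd |B1|)] that does not come from [dq]. Only shared constants enter. *)
Definition sA := lrec (q / 2) (fun k => gam k.+1) (fun k => ca ^+ 2 * MF * Num.sqrt (CD * gam k)) 0 N.
Definition sB := lrec (q / 2) (fun k => gam k.+1) (fun k => 2 * L * CD * Num.sqrt (gam k))
  ((1 + ME + lbd N) / Num.sqrt (gam N)) N.

Let gam2 k : (N <= k)%N -> gam k <= 2 * gam k.+1.
Proof.
move=> Nk; apply: (le_trans (gq2 Nk)); rewrite ler_wpM2r ?gam_ge0//.
by have := gm Nk; have := gam_ge0 b g10 k.+1; lra.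
Qed.

Let EA_bnd k : (N <= k)%N -> Ex P (fun w => A1 k w ^+ 2) <= gam k * sA k.
Proof.
move=> Nk; have -> : sA k = sA k + 0 / (q / 2) by rewrite mul0r addr0.
apply: (@rec_normalized _ (fun k => gam k.+1) gam _ (fun j => Ex P (fun w => A1 j w ^+ 2))) => //.
- by move=> j; exact: gam_ge0.
- by move=> j _; apply: Ex_ge0 => w; exact: sqr_ge0.
- move=> j Nj; apply: (le_trans (Ar_sqr _ _ mzeta c30 zeta_bnd Ezeta Ezeta2 Nj)).
  rewrite mul0r !addr0 sqrrN; have h := gq1 Nj.
  have t0 : 0 <= gam j.+1 := gam_ge0 b g10 _.
  apply: lerD.
    rewrite (_ : 2 * (q / 2) = q); last by field.
    apply: ler_wpM2r; first by apply: Ex_ge0 => w; exact: sqr_ge0.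
    have qt : 0 <= q * gam j.+1 by rewrite mulr_ge0// ltW.
    by rewrite expr2 ler_piMr ?subr_ge0//; lra.
  rewrite -expr2 ler_wpM2l ?sqr_ge0// ler_wpM2l ?mulr_ge0 ?(ltW ca0)//.
  exact: gd_abs_bnd.
- rewrite mul0r (@eq_Ex _ _ _ P _ (fun=> 0)) ?Ex_cst// => w.
  by rewrite /A1 Ar_early// expr0n.
Qed.

Let EB_bnd k : (N <= k)%N ->
  EgB k <= Num.sqrt (gam k) * (sB k + (2 * Num.sqrt CD * dq) / (q / 2)).
Proof.
move=> Nk; apply: (@rec_normalized _ (fun k => gam k.+1) (fun k => Num.sqrt (gam k))) => //.
- by rewrite !mulr_ge0// sqrtr_ge0.
- by move=> j; exact: gam_ge0.
- by move=> j Nj; rewrite sqrtr_gt0 gamN0.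
- move=> j Nj; have t0 : 0 <= q / 2 * gam j.+1 by rewrite mulr_ge0 ?gam_ge0// ltW.
  have -> : 1 + q / 2 * gam j.+1 = Num.sqrt ((1 + q / 2 * gam j.+1) ^+ 2).
    by rewrite sqrtr_sqr ger0_norm// addr_ge0.
  rewrite -sqrtrM ?sqr_ge0// ler_wsqrtr//; apply: (le_trans (gq2 Nj)).
  by rewrite ler_wpM2r ?gam_ge0// expr2 ler_peMr ?lerDl// addr_ge0.
- by move=> j _; apply: Ex_ge0 => w; rewrite mulr_ge0 ?gd_ge0.
- move=> j Nj; apply: (le_trans (EgB_rec Nj)).
  rewrite (_ : 2 * (q / 2) = q); last by field.
  rewrite lerD2l -mulrA ler_wpM2l ?gam_ge0//.
  have g0 := ltW (gamN0 Nj); have g1' : 0 <= gam j.+1 := gam_ge0 b g10 _.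
  have sg : Num.sqrt (gam j) <= 2 * Num.sqrt (gam j.+1).
    have -> : (2 : R) = Num.sqrt (2 ^+ 2) by rewrite sqrtr_sqr ger0_norm.
    rewrite -sqrtrM ?sqr_ge0// ler_wsqrtr//; apply: (le_trans (gam2 Nj)).
    by rewrite ler_wpM2r//; lra.
  rewrite mulrDr; apply: lerD.
    apply: (@le_trans _ _ (L * (CD * gam j))); first by rewrite ler_wpM2l// gd_sqr_bnd.
    rewrite -{1}(sqr_sqrtr g0) expr2.
    have h : 0 <= L * CD * Num.sqrt (gam j) by rewrite !mulr_ge0 ?sqrtr_ge0.
    by have := ler_wpM2l h sg; lra.
  (* The slope gap gives a source of the same order as the weight [sqrt gam]. It does not vanish
     along [k], so it is the constant part [D] of the recursion. *)
  apply: (@le_trans _ _ (dq * Num.sqrt (CD * gam j))); first by rewrite ler_wpM2l// gd_abs_bnd.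
  rewrite sqrtrM//.
  have h : 0 <= dq * Num.sqrt CD by rewrite mulr_ge0 ?sqrtr_ge0.
  by have := ler_wpM2l h sg; lra.
- rewrite divfK; last by rewrite gt_eqF// sqrtr_gt0 gamN0.
  have LeN : L1 P (fun w => `|e N w|) by apply: L1_abs; exact: L2_L1.
  apply: (@le_trans _ _ (Ex P (fun w => `|e N w| + lbd N))); last first.
    by rewrite ExD// Ex_cst lerD2r; exact: abs_bnd.
  apply: Ex_le => //; first exact: L1D.
  move=> w; apply: (@le_trans _ _ (1 * `|B1 N w|)); first by rewrite ler_wpM2r// gd_le1.
  rewrite mul1r /B1 /A1 Ar_early// subr0; apply: (le_trans (ler_normB _ _)).
  by rewrite lerD2l lin_bnd.
Qed.

Lemma xi_lin_bnd k : (N <= k)%N -> L1 P (fun w => gdN k w * `|e k w - lin k w|) /\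
  Ex P (fun w => gdN k w * `|e k w - lin k w|) <=
  Num.sqrt (gam k) * (sB k + Num.sqrt (sA k) + 4 / q * Num.sqrt CD * dq).
Proof.
move=> Nk; have LA : L2 P (A1 k) by exact: (L2_Ar _ _ mzeta c30 zeta_bnd).
have LA1 := L1_abs (L2_L1 LA).
have Ll : L2 P (lin k) by apply: (@L2_bnd _ _ _ _ _ (lbd k)); [exact: mlin|exact: lin_bnd].
have Lgl : L1 P (fun w => gdN k w * `|e k w - lin k w|).
  by apply: LgM; apply: L1_abs; apply: L2_L1; exact: L2B.
split => //; apply: (@le_trans _ _ (EgB k + Ex P (fun w => `|A1 k w|))).
  rewrite -ExD//; apply: Ex_le => //; first exact: L1D.
  move=> w; rewrite (_ : e k w - lin k w = B1 k w + A1 k w); last by rewrite /B1; ring.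
  have := ler_normD (B1 k w) (A1 k w); have := normr_ge0 (A1 k w).
  by case: (gd01 N k w) => ->; rewrite ?mul0r ?mul1r ?add0r.
have sA0 : 0 <= sA k.
  rewrite -(pmulr_rge0 _ (gamN0 Nk)); apply: le_trans (EA_bnd Nk).
  by apply: Ex_ge0 => w; exact: sqr_ge0.
have h1 := EB_bnd Nk.
have h2 : Ex P (fun w => `|A1 k w|) <= Num.sqrt (gam k) * Num.sqrt (sA k).
  rewrite -sqrtrM ?gam_ge0// -(@ler_pXn2r _ 2)// ?nnegrE ?sqrtr_ge0//; last exact: Ex_ge0.
  rewrite sqr_sqrtr; last by rewrite mulr_ge0// gam_ge0.
  by apply: le_trans (EA_bnd Nk); exact: Ex_abs_sqr.
rewrite (_ : 4 / q * Num.sqrt CD * dq = 2 * Num.sqrt CD * dq / (q / 2)); last first.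
  by field; rewrite gt_eqF.
by apply: (le_trans (lerD h1 h2)); rewrite -mulrDr addrAC.
Qed.

(** * The averaged component chi *)

Let pos (x y : R) := Num.max (y - x) 0.

Let pos_lip x y v : `|pos x v - pos y v| <= `|x - y|.
Proof.
rewrite /pos /Num.max; have [h1|h1] := ltP (v - x) 0; have [h2|h2] := ltP (v - y) 0.
- by rewrite subrr normr0.
- by rewrite sub0r normrN ger0_norm// ler_normr; apply/orP; left; lra.
- by rewrite subr0 ger0_norm// distrC ler_normr; apply/orP; left; lra.
- by rewrite distrC (_ : v - y - (v - x) = x - y)//; ring.
Qed.

Let Lpos x : L1 P (fun w => pos x (X w)).
Proof.
apply: (@L1_le _ _ _ _ _ (fun w => `|X w| + `|x|)).
- by rewrite /pos; mfun.
- move=> w; apply: le_trans (ler_normB _ _).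
  by rewrite /pos /Num.max; case: ifP; rewrite ?normr0.
- by apply: L1D => //; exact: L1_abs.
Qed.

Let psi' x y := ca * (pos x y - pos xst y).

Let Lpsi' x : L2 P (fun w => psi' x (X w)).
Proof.
apply: (@L2_bnd _ _ _ _ _ (ca * `|x - xst|)).
  by rewrite /psi' /pos; mfun.
by move=> w; rewrite /psi' normrM (gtr0_norm ca0) ler_wpM2l ?(ltW ca0).
Qed.

Let Psi' x := Ex P (fun w => psi' x (X w)).
Let PsiE x : Psi' x = Vf x - Vf xst - (x - xst).
Proof. by rewrite /Psi' /psi' ExZ ?ExB//; [rewrite /Vf -/ca /pos; ring|exact: L1B]. Qed.

Let Psi_lip x y : `|Psi' x - Psi' y| <= ca * `|x - y|.
Proof.
have l1 := L2_L1 (Lpsi' x); have l2 := L2_L1 (Lpsi' y).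
rewrite /Psi' -ExB//; apply: (le_trans (Ex_abs (L1B l1 l2))).
rewrite -[leRHS](Ex_cst P); apply: Ex_le => //; first by apply: L1_abs; exact: L1B.
move=> w; rewrite /psi' -mulrBr normrM (gtr0_norm ca0) ler_wpM2l ?(ltW ca0)//.
rewrite (_ : _ - _ - _ = pos x (X w) - pos y (X w)); last by ring.
exact: pos_lip.
Qed.

Let Psi_xst : Psi' xst = 0.
Proof. by rewrite PsiE !subrr. Qed.

Let mPsi : measurable_fun setT Psi'.
Proof.
apply: mfun_continuous => x; apply/cvgrPdist_le => eps eps0.
near=> y; apply: (le_trans (Psi_lip _ _)).
rewrite mulrC -ler_pdivlMr//; near: y; apply/nbhs_ballP.
by exists (eps / ca) => /=; [exact: divr_gt0|move=> y /ltW].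
Unshelve. all: by end_near. Qed.

Let z2 x y := psi' x y - Psi' x.

Let mz2 : measurable_fun setT (fun p : R * R => z2 p.1 p.2).
Proof.
apply: mfunB; last by apply: mfun_comp => //; exact: measurable_fst.
by rewrite /psi' /pos; mfun.
Qed.

Let ca20 : 0 <= 2 * ca. Proof. by rewrite mulr_ge0// ltW. Qed.

Let z2_bnd x y : `|z2 x y| <= 2 * ca * (1 + `|x - xst|).
Proof.
have h1 := Psi_lip x xst; rewrite Psi_xst subr0 in h1.
have h2 : `|psi' x y| <= ca * `|x - xst| by rewrite normrM (gtr0_norm ca0) ler_wpM2l ?(ltW ca0).
by rewrite /z2; apply: (le_trans (ler_normB _ _)); have := ca0; lra.
Qed.

Let Ez2 x : Ex P (fun w => z2 x (X w)) = 0.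
Proof. by rewrite /z2 ExB ?Ex_cst ?subrr//; exact: L2_L1. Qed.

Let Ez22 x : Ex P (fun w => z2 x (X w) ^+ 2) <= 0 * `|x - xst| + ca ^+ 2 * (x - xst) ^+ 2.
Proof.
rewrite mul0r add0r; apply: (le_trans (Ex_sqr_center (Lpsi' x))).
rewrite -[leRHS](Ex_cst P); apply: Ex_le => //; first by case: (Lpsi' x).
move=> w; rewrite /psi' exprMn ler_wpM2l ?sqr_ge0//.
rewrite -(real_normK (num_real (pos _ _ - _))) -(real_normK (num_real (x - xst))).
by rewrite lerXn2r ?nnegrE.
Qed.

Definition eta (x : R) : R := ca * (pos xst x - Ex P (fun w => pos xst (X w))).

(** [chi] is a running average, so [k * chi_k] is a plain sum; [Rm] is its deviation from the
    centred sum of the noise frozen at [xst]. *)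
Definition Rm k w := k%:R * (ch k w - Vf xst) - \sum_(j < k) eta (Xn j.+1 w).

(** By [PsiE], the conditional mean of this increment is [Vf xi - Vf xst]: the first-order terms in
    [e] cancel, and minimality of [xst] leaves order [e^2]. *)
Let RmS k w : Rm k.+1 w = Rm k w + (psi' (xi k w) (Xn k.+1 w) + e k w).
Proof.
have chS : k.+1%:R * ch k.+1 w = k%:R * ch k w + xi k w + ca * pos (xi k w) (Xn k.+1 w).
  rewrite /ch /= -/(xi k w) -/(ch k w) /H2 -/ca -/(pos (xi k w) (Xn k.+1 w)).
  have k0 : (k.+1%:R : R) != 0 by rewrite pnatr_eq0.
  rewrite mulrBr [X in _ - X]mulrA divff// mul1r -[in X in X * _]natr1; ring.
rewrite /Rm mulrBr chS big_ord_recr/= /eta /psi' /e /Vf -/ca -/(pos _ _) -natr1.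
rewrite -/(Ex P (fun w => pos xst (X w))); ring.
Qed.

(** A crude bound, linear in [k]: it gives integrability, and at the fixed time [N] the initial
    value for [B2]. *)
Let LRm k : L1 P (Rm k) /\ Ex P (fun w => `|Rm k w|) <= k%:R * ((1 + ca) * (1 + ME)).
Proof.
elim: k => [|k [IH1 IH2]].
  rewrite (_ : Rm 0 = fun=> 0); last by apply/funext => w; rewrite /Rm big_ord0 mul0r subrr.
  by split => //; rewrite (@eq_Ex _ _ _ P _ (fun=> 0)) ?Ex_cst ?mul0r// => w; rewrite normr0.
have RmE : Rm k.+1 = fun w => Rm k w + (psi' (xi k w) (Xn k.+1 w) + e k w).
  by apply/funext => w; exact: RmS.
have Lek := L2_L1 (Le k); have Lak := L1_abs Lek; have mxk := mxi k; have mXk := mXn k.+1.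
have db w : `|psi' (xi k w) (Xn k.+1 w) + e k w| <= (1 + ca) * `|e k w|.
  apply: (le_trans (ler_normD _ _)); rewrite mulrDl mul1r addrC lerD2l.
  by rewrite normrM (gtr0_norm ca0) ler_wpM2l ?(ltW ca0)//; exact: pos_lip.
have LD : L1 P (fun w => psi' (xi k w) (Xn k.+1 w) + e k w).
  apply: (L1_le _ db); last exact: L1Z.
  by apply: mfunD => //; rewrite /psi' /pos; mfun.
rewrite RmE; split; first exact: L1D.
have LR := L1_abs IH1.
apply: (@le_trans _ _ (Ex P (fun w => `|Rm k w| + (1 + ca) * `|e k w|))).
  apply: Ex_le; [by apply: L1_abs; exact: L1D|by apply: L1D => //; exact: L1Z|move=> w].
  by apply: (le_trans (ler_normD _ _)); rewrite lerD2l.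
rewrite ExD//; last exact: L1Z.
rewrite ExZ// -natr1 [leRHS]mulrDl mul1r; apply: lerD => //.
by rewrite ler_wpM2l ?addr_ge0 ?(ltW ca0)//; exact: abs_bnd.
Qed.

Let A2 := Ar N (fun=> 1) (fun=> 1) z2.
Let B2 k w := Rm k w - A2 k w.
Let LA2 k : L2 P (A2 k). Proof. exact: (L2_Ar _ _ mz2 ca20 z2_bnd). Qed.
Let LB2 k : L1 P (B2 k).
Proof. by apply: L1B; [case: (LRm k)|exact: L2_L1]. Qed.

Let B2S k w : (N <= k)%N -> gdN k w = 1 -> B2 k.+1 w = B2 k w + (Vf (xi k w) - Vf xst).
Proof.
move=> Nk g; rewrite /B2 /A2 RmS [Ar _ _ _ _ _ _]/= Nk g /z2 PsiE /e; ring.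
Qed.

Let Sg k := \sum_(j < k) gam j.+1.

Let SgS k : Sg k.+1 = Sg k + gam k.+1. Proof. by rewrite /Sg big_ord_recr. Qed.
Let Sg0 k : 0 <= Sg k. Proof. by apply: sumr_ge0 => j _; exact: gam_ge0. Qed.

Let Eg2 k : (N <= k)%N -> Eg k <= 2 * CD * gam k.+1.
Proof.
by move=> Nk; apply: (le_trans (gd_sqr_bnd Nk)); by have := ler_wpM2l CD_ge0 (gam2 Nk); lra.
Qed.

Let EA2_bnd k : (N <= k)%N -> Ex P (fun w => A2 k w ^+ 2) <= 2 * ca ^+ 2 * CD * Sg k.
Proof.
move=> /subnKC <-; elim: (k - N)%N => [|j IH].
  rewrite addn0 (@eq_Ex _ _ _ P _ (fun=> 0)) ?Ex_cst; last by move=> w; rewrite /A2 Ar_early// expr0n.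
  by rewrite !mulr_ge0 ?(ltW ca0).
have Nj : (N <= N + j)%N by rewrite leq_addr.
rewrite addnS; apply: (le_trans (Ar_sqr _ _ mz2 ca20 z2_bnd Ez2 Ez22 Nj)).
rewrite expr1n !mul1r mul0r add0r SgS mulrDr; apply: lerD => //.
by have := ler_wpM2l (sqr_ge0 ca) (Eg2 Nj); lra.
Qed.

Let EB2_bnd k : (N <= k)%N -> Ex P (fun w => gdN k w * `|B2 k w|) <=
  N%:R * ((1 + ca) * (1 + ME)) + 2 * Lv * CD * Sg k.
Proof.
move=> /subnKC <-; elim: (k - N)%N => [|j IH].
  rewrite addn0; apply: (@le_trans _ _ (Ex P (fun w => `|Rm N w|))).
    apply: Ex_le; [by apply: LgM; exact: L1_abs|by apply: L1_abs; case: (LRm N)|move=> w].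
    rewrite /B2 /A2 Ar_early// subr0 ler_piMl// gd_le1//.
  have [_ h] := LRm N; apply: (le_trans h).
  by rewrite lerDl !mulr_ge0 ?sqr_ge0.
have Nj : (N <= N + j)%N by rewrite leq_addr.
rewrite addnS SgS; move: (N + j)%N Nj IH => i Ni IH.
have Lgb : L1 P (fun w => gdN i w * `|B2 i w|) by apply: LgM; exact: L1_abs.
apply: (@le_trans _ _ (Ex P (fun w => gdN i w * `|B2 i w| + Lv * (gdN i w * e i w ^+ 2)))).
  apply: Ex_le; [by apply: LgM; exact: L1_abs|by apply: L1D => //; exact: L1Z|move=> w].
  apply: (@le_trans _ _ (gdN i w * `|B2 i.+1 w|)); first by rewrite ler_wpM2r// gdS_le.
  case: (gd01 N i w) => g; rewrite g ?mul0r ?mulr0 ?add0r// !mul1r B2S//.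
  apply: (le_trans (ler_normD _ _)); rewrite lerD2l.
  by have /andP[h1 h2] := HVf (xi i w); rewrite ger0_norm.
rewrite ExD//; last exact: L1Z.
by rewrite ExZ//; have := ler_wpM2l Lv0 (Eg2 Ni); rewrite /Eg; lra.
Qed.

(** The bound grows like the sum of the steps, which is [o(sqrt n)] because [b > 1/2]. Both the
    variance of [A2] and the drift in [B2] are sums of [E e^2], of order [gam]. *)
Lemma Rm_bnd k : (N <= k)%N -> L1 P (fun w => gdN k w * `|Rm k w|) /\ Ex P (fun w => gdN k w * `|Rm k w|) <=
  1 + N%:R * ((1 + ca) * (1 + ME)) + (2 * Lv * CD + 2 * ca ^+ 2 * CD) * Sg k.
Proof.
move=> Nk; have [LR _] := LRm k.
split; first by apply: LgM; exact: L1_abs.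
have LAa := L1_abs (L2_L1 (LA2 k)).
have Lgb : L1 P (fun w => gdN k w * `|B2 k w|) by apply: LgM; exact: L1_abs.
apply: (@le_trans _ _ (Ex P (fun w => gdN k w * `|B2 k w|) + Ex P (fun w => `|A2 k w|))).
  rewrite -ExD//; apply: Ex_le; [by apply: LgM; exact: L1_abs|exact: L1D|move=> w].
  rewrite (_ : Rm k w = B2 k w + A2 k w); last by rewrite /B2; ring.
  have := ler_normD (B2 k w) (A2 k w); have := normr_ge0 (A2 k w).
  by case: (gd01 N k w) => ->; rewrite ?mul0r ?mul1r ?add0r.
have h1 := EB2_bnd Nk; have h2 := EA2_bnd Nk; have h3 := Ex_abs_sqr (LA2 k).
have h4 : Ex P (fun w => `|A2 k w|) <= 1 + Ex P (fun w => A2 k w ^+ 2).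
  by move: h3; move: (Ex P (fun w => `|A2 k w|)) => y; have := sqr_ge0 (y - 1); nra.
lra.
Qed.

End rates.
End flagged.

End sa_system.

(** * Bounds uniform over the systems *)

Section sa_uniform.
Context {d} {T : measurableType d} {R : realType} (P : probability T R).
Variables (al g1 b q r L MF Lv M0 : R).
Hypotheses (al01 : 0 < al < 1) (g10 : 0 < g1) (b12 : 1 / 2 < b) (b1 : b <= 1)
  (q0 : 0 < q) (r0 : 0 < r) (r1 : r <= 1) (L0 : 0 <= L) (MF0 : 0 <= MF) (Lv0 : 0 <= Lv)
  (M00 : 0 <= M0) (qg : b = 1 -> 1 < q / 2 * g1).

(** The constants [q], [r], [L], [MF], [Lv], [M0] are outside the record, common to all systems; the
    samples, [xst] and [dq] vary. [dq] bounds the gap between the common slope [q] and the slope of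
    the mean field at [xst]. *)
Record sa_sys (x0 : T -> R) (Xn : nat -> T -> R) (X : T -> R) (xst dq : R) : Prop := SaSys {
  sys_mx0 : measurable_fun setT x0;
  sys_mXn : forall n, measurable_fun setT (Xn n);
  sys_mX : measurable_fun setT X;
  sys_XnX : forall n, same_law P (Xn n.+1) X;
  sys_indep : mutually_independent P
    (fun o : option nat => if o is Some n then sigma_of (Xn n.+1) else sigma_of x0);
  sys_LX : L1 P X;
  sys_dq0 : 0 <= dq;
  sys_HF : forall x y,
    Ex P (fun w => `|(if x <= X w then 1 else 0) - (if y <= X w then 1 else 0)|) <= MF * `|x - y|;
  sys_Hst : Vp P al X xst = 0;
  sys_Hdrift1 : forall x, `|x - xst| <= r -> q / 2 * (x - xst) ^+ 2 <= (x - xst) * Vp P al X x;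
  sys_Hdrift2 : forall x, r <= `|x - xst| -> q / 2 * r * `|x - xst| <= (x - xst) * Vp P al X x;
  sys_Hlin : forall x, `|Vp P al X x - q * (x - xst)| <= L * (x - xst) ^+ 2 + dq * `|x - xst|;
  sys_HVf : forall x, 0 <= Vf P al X x - Vf P al X xst <= Lv * (x - xst) ^+ 2;
  sys_Lx0 : L2 P (fun w => x0 w - xst);
  sys_Ex0 : Ex P (fun w => (x0 w - xst) ^+ 2) <= M0
}.

(** The ratio of consecutive steps is at most [1 + 1/k], and [1/k <= q / 2 * gam (k+1)] from some
    rank on; for [b = 1] this is where [1 < q / 2 * g1] enters. *)
Lemma sa_start_rank (N1 : nat) : exists2 N, (N1 <= N)%N & (0 < N)%N /\
  forall k, (N <= k)%N -> q * gam g1 b k.+1 <= 1 /\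
    gam g1 b k <= (1 + q / 2 * gam g1 b k.+1) * gam g1 b k.+1.
Proof.
have q20 : 0 < q / 2 by rewrite divr_gt0.
have [N2 _ H2] : \forall n \near \oo, n.+1%:R^-1 <= q / 2 * gam g1 b n.+2.
  by apply: inv_nat_le_gam.
have [N3 _ H3] : \forall n \near \oo, q * gam g1 b n.+1 <= 1.
  have := gam_cvg0 g10 b12; move/cvgrPdist_le => /(_ q^-1); rewrite invr_gt0 => /(_ q0).
  apply: filterS => n; rewrite sub0r normrN ger0_norm ?gam_ge0// => h.
  by rewrite mulrC -ler_pdivlMr// mul1r.
exists (maxn N1 (maxn N2.+1 N3)); first by rewrite leq_max leqnn.
split; first by rewrite !leq_max/= orbT.
move=> k; rewrite !geq_max => /and3P[_ k2 k3]; split; first exact: H3.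
case: k k2 {k3} => // k k2; have := H2 k k2 => /= h.
have g0 := gam_gt0 b g10 k.+1.
have : gam g1 b k.+1 / gam g1 b k.+2 <= 1 + k.+1%:R^-1 by apply: gam_ratio.
rewrite ler_pdivrMr// => h'; apply: (le_trans h').
by rewrite ler_wpM2r ?lerD2l// ltW.
Qed.

(** [n0] and [C] come before the system because later the system and [n] vary together. The function
    [g] is the indicator of no exit between a fixed time [N] and [n]. *)
Theorem sa_approx (eps : R) : 0 < eps -> exists (n0 : nat) (C : R),
  forall x0 Xn X xst dq, sa_sys x0 Xn X xst dq -> forall n, (n0 <= n)%N ->
  exists g : T -> R, [/\ measurable_fun setT g, forall w, g w = 0 \/ g w = 1,
    Ex P (fun w => 1 - g w) <= eps,
    L1 P (fun w => g w * `|xi al g1 b x0 Xn n w - xst - lin al g1 b Xn xst q n w|) /\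
    Ex P (fun w => g w * `|xi al g1 b x0 Xn n w - xst - lin al g1 b Xn xst q n w|)
      <= (eps + C * dq) * Num.sqrt (gam g1 b n) &
    L1 P (fun w => g w * `|Rm P al g1 b x0 Xn X xst n w|) /\
    Ex P (fun w => g w * `|Rm P al g1 b x0 Xn X xst n w|) <= eps * Num.sqrt n%:R].
Proof.
move=> eps0; set c : R := 1 + (1 - al)^-1; set ca : R := (1 - al)^-1.
have [CS HCS] := gam_sq_sum_bounded g10 b12.
have CS0 : 0 <= CS by have := HCS 0%N; rewrite big_ord0.
have [N1 _ [N10 HN1]] := sa_start_rank 0.
have rr0 : 0 < rho r.
  rewrite /rho subr_gt0 -[ltLHS]sqrtr1 ltr_sqrt; last by rewrite ltr_wpDr ?sqr_ge0.
  by rewrite ltrDl exprn_gt0.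
have re0 : 0 < rho r * (eps / 2) by rewrite mulr_gt0// divr_gt0.
have cc0 : 0 <= c ^+ 2 / 2 by rewrite divr_ge0 ?sqr_ge0.
have Bd0 : 0 <= (M0 + c ^+ 2 * CS) / (q * r).
  have qr : 0 <= q * r by rewrite mulr_ge0// ltW.
  have cC : 0 <= c ^+ 2 * CS by rewrite mulr_ge0// sqr_ge0.
  by rewrite divr_ge0// addr_ge0.
(* At this time [E rho (e_N)] and the weighted tail of the squared steps are each at most
   [rho r * eps / 2], which makes the exit probability at most [eps]. *)
have [N NN1 [tailN rhoN]] := rho_decay_unif N1 g10 b12 b1 cc0 Bd0 re0.
have N0 : (0 < N)%N := leq_trans N10 NN1.
have HN k : (N <= k)%N -> q * gam g1 b k.+1 <= 1 by move=> /(leq_trans NN1)/HN1[].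
have HN' k : (N <= k)%N -> gam g1 b k <= (1 + q / 2 * gam g1 b k.+1) * gam g1 b k.+1.
  by move=> /(leq_trans NN1)/HN1[].
pose CD := (gam g1 b N)^-1 + c ^+ 2 / (q / 2).
pose C1 := 1 + N%:R * ((1 + ca) * (1 + (M0 + c ^+ 2 * CS))).
pose C2 := 2 * Lv * CD + 2 * ca ^+ 2 * CD.
have q20 : 0 < q / 2 by rewrite divr_gt0.
have gc : (fun k => gam g1 b k.+1) @ \oo --> 0 := gam_cvg0 g10 b12.
have gs : (fun k => Num.sqrt (gam g1 b k)) @ \oo --> 0.
  rewrite -[X in _ --> X]sqrtr0; apply: continuous_cvg; first exact: sqrt_continuous.
  by rewrite -cvg_shiftS; exact: gc.
have sA0 : (fun k => Num.sqrt (sA al g1 b q MF N k)) @ \oo --> 0.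
  rewrite -[X in _ --> X]sqrtr0; apply: continuous_cvg; first exact: sqrt_continuous.
  apply: lrec_cvg0 => //; [by move=> k; exact: gam_ge0|exact: gam_sum|].
  rewrite -[X in _ --> X](mulr0 (ca ^+ 2 * MF)); apply: cvgMr.
  have CD0 : 0 <= CD by rewrite addr_ge0 ?invr_ge0 ?gam_ge0// divr_ge0 ?sqr_ge0// ltW.
  rewrite -/c -/CD; under eq_fun do rewrite sqrtrM//.
  have : (fun k => Num.sqrt CD * Num.sqrt (gam g1 b k)) @ \oo --> Num.sqrt CD * 0 by exact: cvgMr.
  by rewrite mulr0.
have sB0 : sB al g1 b q L M0 N CS @ \oo --> 0.
  apply: lrec_cvg0 => //; [by move=> k; exact: gam_ge0|exact: gam_sum|].
  by rewrite -[X in _ --> X](mulr0 (2 * L * CD)); apply: cvgMr.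
have G0 : (fun n => C1 * Num.sqrt n%:R^-1 + C2 * ((\sum_(k < n) gam g1 b k.+1) / Num.sqrt n%:R)) @ \oo --> 0.
  have s0 : (fun n : nat => Num.sqrt (n%:R^-1 : R)) @ \oo --> 0.
    by rewrite -cvg_shiftS; exact: sqrt_inv_cvg0.
  have v0 : (fun n => (\sum_(k < n) gam g1 b k.+1) / Num.sqrt n%:R) @ \oo --> (0 : R) by exact: gam_avg_cvg0.
  have := cvgD (@cvgMr _ _ _ _ _ C1 _ s0) (@cvgMr _ _ _ _ _ C2 _ v0); rewrite !mulr0 addr0; exact.
have e2 : 0 < eps / 2 by rewrite divr_gt0.
move/cvgrPdist_le : sA0 => /(_ _ e2) [n1 _ H1].
move/cvgrPdist_le : sB0 => /(_ _ e2) [n2 _ H2].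
move/cvgrPdist_le : G0 => /(_ _ eps0) [n3 _ H3].
exists (maxn N (maxn n1 (maxn n2 n3))), (4 / q * Num.sqrt CD).
move=> x0 Xn X xst dq [mx0 mXn mX XnX indep LX dq0 HF Hst Hd1 Hd2 Hl HVf Lx0 Ex0] n.
rewrite !geq_max => /and4P[nN nn1 nn2 nn3].
exists (gd al g1 b x0 Xn xst r N n); split.
- by apply: (@mgd _ _ _ al g1 b x0 Xn xst r _ _ N (fun=> 0) (fun=> 0) (fun _ _ => 0)) => //; exact: mfun_cst.
- by move=> w; exact: gd01.
- rewrite -(ler_pM2l rr0).
  apply: (le_trans (@exit_prob _ _ _ P al g1 b al01 g10 x0 Xn X xst q r mx0 mXn mX XnX indep q0 r0 Hd1 Hd2 Lx0 N n nN)).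
  rewrite [X in rho r * X](splitr eps) mulrDr; apply: lerD; last exact: tailN.
  apply: (rhoN (fun k => Ex P (fun w => rho (xi al g1 b x0 Xn k w - xst)))).
  + by move=> k; apply: Ex_ge0 => w; exact: rho_ge0.
  (* The threshold of the flag is [j.+1], beyond both times, so nothing is stopped. *)
  + move=> i j ij; exact: (@rho_incr _ _ _ P al g1 b al01 g10 x0 Xn X xst q r mx0 mXn mX XnX indep q0 r0 Hd1 Hd2 Lx0 j.+1 i j ij).
  + move=> m; exact: (@rho_sum_bnd _ _ _ P al g1 b al01 g10 x0 Xn X xst q r MF M0).
- have [] // := @xi_lin_bnd _ _ _ P al g1 b al01 g10 x0 Xn X xst q r L MF M0 dq mx0 mXn mX XnX indep q0 r0 r1 L0 MF0 dq0 HF Hst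
    Hd1 Hd2 Hl Lx0 Ex0 N N0 HN HN' CS HCS n nN => Ll h; split => //; apply: (le_trans h).
  rewrite mulrC ler_wpM2r ?sqrtr_ge0// lerD2r (splitr eps) lerD//.
    by have := H2 n nn2; rewrite sub0r normrN => h'; apply: le_trans (ler_norm _) h'.
  by have := H1 n nn1; rewrite sub0r normrN => h'; apply: le_trans (ler_norm _) h'.
- have [] // := @Rm_bnd _ _ _ P al g1 b al01 g10 x0 Xn X xst q r MF Lv M0 mx0 mXn mX XnX indep LX q0 r0 r1 MF0 Lv0 HF
    Hd1 Hd2 HVf Lx0 Ex0 N N0 HN HN' CS HCS n nN => Ll h; split => //; apply: (le_trans h).
  have n0 : 0 < Num.sqrt n%:R :> R by rewrite sqrtr_gt0 ltr0n (leq_trans N0).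
  rewrite -ler_pdivrMr//; have := H3 n nn3; rewrite sub0r normrN => h'; apply: le_trans h'.
  apply: le_trans (ler_norm _).
  by rewrite [leLHS]mulrDl -[X in _ + X <= _]mulrA sqrtrV ?ler0n.
Qed.

End sa_uniform.

(** * Densities and quantiles *)

Section one_pdf.
Context {d} {T : measurableType d} {R : realType} (P : probability T R).
Variables (X : T -> R) (f : R -> R).
Hypotheses (mX : measurable_fun setT X) (fX : is_pdf P X f) (cf : continuous f).

Local Notation F := (cdf_of P X).

Let mpre (B : set R) : measurable B -> measurable (X @^-1` B).
Proof. by move=> mB; rewrite -[X in measurable X]setTI; exact: mX. Qed.

Lemma cdfE x : (F x)%:E = P (X @^-1` `]-oo, x]).
Proof. by rewrite fineK// fin_num_measure//; exact: mpre. Qed.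

Let mf (D : set R) : measurable_fun D (EFin \o f).
Proof.
apply: (measurable_funS measurableT) => //; apply/measurable_EFinP.
exact: continuous_measurable_fun.
Qed.

Lemma cdf_incrE x y : x <= y ->
  (F y - F x)%:E = (\int[lebesgue_measure]_(t in `]x, y]) (f t)%:E)%E.
Proof.
move=> xy; have [f0 H] := fX.
rewrite EFinB !cdfE !H (@itv_bndbnd_setU _ _ -oo%O (BRight x) (BRight y))//.
rewrite ge0_integral_setU//=; last 3 first.
- exact: mf.
- by move=> t _; rewrite lee_fin.
- rewrite disj_set2E; apply/eqP/seteqP; split => t //= [].
  by rewrite !in_itv/= => tx /andP[xt _]; move: (le_lt_trans tx xt); rewrite ltxx.
rewrite addeAC subee ?add0e// -H fin_num_measure//; exact: mpre.
Qed.

Lemma cdf_mono x y : x <= y -> F x <= F y.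
Proof.
move=> xy; rewrite -subr_ge0 -lee_fin cdf_incrE//; apply: integral_ge0 => t _.
by rewrite lee_fin; case: fX.
Qed.

Lemma cdf_incr_ge c x y : x <= y -> (forall t, x < t <= y -> c <= f t) -> c * (y - x) <= F y - F x.
Proof.
move=> xy H; have [c0|c0] := leP c 0.
  by apply: (@le_trans _ _ 0); [rewrite mulr_le0_ge0// subr_ge0|rewrite subr_ge0 cdf_mono].
rewrite -lee_fin cdf_incrE// EFinM.
have -> : (y - x)%:E = lebesgue_measure (`]x, y]%classic : set R).
  rewrite lebesgue_measure_itv/= lte_fin; case: ltP => // yx.
  by rewrite (@le_anti _ _ x y) ?subrr// xy yx.
rewrite -integral_cst//; apply: ge0_le_integral => //.
- by move=> t _; rewrite lee_fin ltW.
- exact: mf.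
Qed.

End one_pdf.

Section two_pdf.
Context {d} {T : measurableType d} {R : realType} (P : probability T R).
Variables (X X' : T -> R) (f f' : R -> R).
Hypotheses (mX : measurable_fun setT X) (fX : is_pdf P X f) (cf : continuous f).

Lemma cdf_incr_le c x y : 0 <= c -> x <= y -> (forall t, x < t <= y -> f t <= c) ->
  cdf_of P X y - cdf_of P X x <= c * (y - x).
Proof.
move=> c0 xy H; rewrite -lee_fin (cdf_incrE mX fX cf)// EFinM.
have -> : (y - x)%:E = lebesgue_measure (`]x, y]%classic : set R).
  rewrite lebesgue_measure_itv/= lte_fin; case: ltP => // yx.
  by rewrite (@le_anti _ _ x y) ?subrr// xy yx.
rewrite -integral_cst//; apply: ge0_le_integral => //.
- by move=> t _; rewrite lee_fin; case: fX.
- by apply: (measurable_funS measurableT) => //; apply/measurable_EFinP; exact: continuous_measurable_fun.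
Qed.

Hypotheses (mX' : measurable_fun setT X') (fX' : is_pdf P X' f') (cf' : continuous f').

Lemma cdf_incr_cmp eps x y : 0 <= eps -> x <= y -> (forall t, x < t <= y -> f t <= f' t + eps) ->
  cdf_of P X y - cdf_of P X x <= cdf_of P X' y - cdf_of P X' x + eps * (y - x).
Proof.
move=> e0 xy H; rewrite -lee_fin (cdf_incrE mX fX cf)// EFinD (cdf_incrE mX' fX' cf')// EFinM.
have -> : (y - x)%:E = lebesgue_measure (`]x, y]%classic : set R).
  rewrite lebesgue_measure_itv/= lte_fin; case: ltP => // yx.
  by rewrite (@le_anti _ _ x y) ?subrr// xy yx.
rewrite -integral_cst// -ge0_integralD//; last 2 first.
- by move=> t _; rewrite lee_fin; case: fX'.
- by apply: (measurable_funS measurableT) => //; apply/measurable_EFinP; exact: continuous_measurable_fun.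
apply: ge0_le_integral => //.
- by move=> t _; rewrite lee_fin; case: fX.
- by apply: (measurable_funS measurableT) => //; apply/measurable_EFinP; exact: continuous_measurable_fun.
- apply: emeasurable_funD => //.
  by apply: (measurable_funS measurableT) => //; apply/measurable_EFinP; exact: continuous_measurable_fun.
Qed.

End two_pdf.

Section smooth_pdf.
Context {d} {T : measurableType d} {R : realType} (P : probability T R).
Variables (al : R) (X : T -> R) (f : R -> R) (Mf Lf : R).
Hypotheses (al01 : 0 < al < 1) (mX : measurable_fun setT X) (fX : is_pdf P X f) (cf : continuous f)
  (fM : forall x, `|f x| <= Mf) (fL : forall x y, `|f x - f y| <= Lf * `|x - y|) (LX : L1 P X).

Local Notation F := (cdf_of P X).
Let ca : R := (1 - al)^-1.
Let al1 : 0 < 1 - al. Proof. by case/andP: al01 => ? ?; rewrite subr_gt0. Qed.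
Let ca0 : 0 < ca. Proof. by rewrite invr_gt0. Qed.
Let Mf0 : 0 <= Mf. Proof. exact: le_trans (normr_ge0 _) (fM 0). Qed.
Let Lf0 : 0 <= Lf.
Proof. by have := fL 0 1; rewrite sub0r normrN normr1 mulr1; apply: le_trans. Qed.

Let mi t : measurable_fun setT (fun w => if t <= X w then 1 else 0 : R).
Proof. by apply: mfun_if; [apply: mfun_le => //|..]; exact: mfun_cst. Qed.
Let mi' t : measurable_fun setT (fun w => if t < X w then 1 else 0 : R).
Proof. by apply: mfun_if; [apply: mfun_lt => //|..]; exact: mfun_cst. Qed.

Let Li t : L1 P (fun w => if t <= X w then 1 else 0 : R).
Proof. by apply: (@L1_bnd _ _ _ _ _ 1) => // w; case: ifP; rewrite ?normr1 ?normr0. Qed.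
Let Li' t : L1 P (fun w => if t < X w then 1 else 0 : R).
Proof. by apply: (@L1_bnd _ _ _ _ _ 1) => // w; case: ifP; rewrite ?normr1 ?normr0. Qed.

Lemma cdf_lip x y : x <= y -> F y - F x <= Mf * (y - x).
Proof.
move=> xy; apply: (cdf_incr_le mX fX cf) => // t _; exact: le_trans (ler_norm _) (fM t).
Qed.

Lemma Ex_gt x : Ex P (fun w => if x < X w then 1 else 0) = 1 - F x.
Proof.
rewrite /Ex /Rintegral.
rewrite (_ : (fun w => _) = fun w => (\1_(X @^-1` `]x, +oo[) w)%:E); last first.
  apply/funext => w; rewrite indicE; congr (_%:E).
  case: ifP => h.
    by rewrite mem_set//= in_itv/= h.
  by rewrite memNset//= in_itv/= andbT; apply/negP; rewrite h.
have mA : measurable (X @^-1` `]x, +oo[) by rewrite -[X in measurable X]setTI; exact: mX.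
have mB : measurable (X @^-1` `]-oo, x]) by rewrite -[X in measurable X]setTI; exact: mX.
rewrite integral_indic// setIT.
have H := probability_setC P mB.
rewrite (_ : X @^-1` `]x, +oo[ = ~` (X @^-1` `]-oo, x])); last first.
  by rewrite preimage_setC; congr (_ @^-1` _); rewrite setCitvl.
by apply: etrans (congr1 fine H) _; rewrite fineB ?fin_num_measure.
Qed.

(** The law has no atoms: replacing the threshold [x] by the strict one [x - t] costs at most
    [Mf * t]. *)
Lemma Ex_ge x : Ex P (fun w => if x <= X w then 1 else 0) = 1 - F x.
Proof.
apply/eqP; rewrite eq_le; apply/andP; split; last first.
  rewrite -Ex_gt; apply: Ex_le => // w; case: ifP => [/ltW ->//|_]; by case: ifP.
apply/ler_addgt0Pr => eps eps0.
have M1 : 0 < Mf + 1 by rewrite ltr_wpDl.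
pose t := eps / (Mf + 1); have t0 : 0 < t by rewrite divr_gt0.
apply: (@le_trans _ _ (1 - F (x - t))).
  rewrite -Ex_gt; apply: Ex_le => // w; case: ifP => h; last by case: ifP.
  by rewrite (lt_le_trans _ h)// ltrBlDr ltrDl.
have := @cdf_lip (x - t) x; rewrite gerBl ltW// subKr => /(_ isT) h.
have : Mf * t <= eps.
  by rewrite /t mulrCA ger_pMr// ler_pdivrMr// mul1r lerDl.
lra.
Qed.

Lemma VpE x : Vp P al X x = ca * (F x - al).
Proof.
rewrite /Vp /H1 -/ca ExB//; last exact: L1Z.
rewrite Ex_cst ExZ// Ex_ge /ca; field; by rewrite gt_eqF.
Qed.

Lemma Ex_ind_lip x y :
  Ex P (fun w => `|(if x <= X w then 1 else 0) - (if y <= X w then 1 else 0)|) <= Mf * `|x - y|.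
Proof.
wlog xy : x y / x <= y.
  move=> H; have [|/ltW yx] := leP x y; first exact: H.
  rewrite distrC (@eq_Ex _ _ _ P _ (fun w => `|(if y <= X w then 1 else 0) - (if x <= X w then 1 else 0)|)).
    exact: H.
  by move=> w; rewrite distrC.
rewrite (@eq_Ex _ _ _ P _ (fun w => (if x <= X w then 1 else 0) - (if y <= X w then 1 else 0))).
  rewrite ExB// !Ex_ge distrC ger0_norm ?subr_ge0//.
  by have := cdf_lip xy; lra.
move=> w; apply: ger0_norm; rewrite subr_ge0; case: ifP => h; last by case: ifP.
by rewrite (le_trans xy h).
Qed.

Lemma cdf_quad x y : `|F y - F x - f x * (y - x)| <= Lf * (y - x) ^+ 2.
Proof.
have [xy|/ltW yx] := leP x y.
  have s0 : 0 <= y - x by rewrite subr_ge0.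
  have H t : x < t <= y -> f x - Lf * (y - x) <= f t /\ f t <= f x + Lf * (y - x).
    move=> /andP[xt ty]; have := fL t x; rewrite (@ger0_norm _ (t - x)) ?subr_ge0 ?(ltW xt)// => h.
    have : Lf * (t - x) <= Lf * (y - x) by rewrite ler_wpM2l// lerB.
    by move: h; rewrite ler_norml => /andP[]; lra.
  have h1 := @cdf_incr_ge _ _ _ P X f mX fX cf (f x - Lf * (y - x)) x y xy (fun t h => (H t h).1).
  have c0 : 0 <= f x + Lf * (y - x) by rewrite addr_ge0 ?mulr_ge0//; case: fX.
  have h2 := @cdf_incr_le _ _ _ P X f mX fX cf (f x + Lf * (y - x)) x y c0 xy (fun t h => (H t h).2).
  by rewrite ler_norml; apply/andP; split; move: h1 h2; nra.
have s0 : 0 <= x - y by rewrite subr_ge0.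
have H t : y < t <= x -> f x - Lf * (x - y) <= f t /\ f t <= f x + Lf * (x - y).
  move=> /andP[xt ty]; have := fL t x; rewrite distrC [`|t - x|]distrC (@ger0_norm _ (x - t)) ?subr_ge0// => h.
  have : Lf * (x - t) <= Lf * (x - y) by rewrite ler_wpM2l// lerB// ltW.
  by move: h; rewrite ler_norml => /andP[]; lra.
have h1 := @cdf_incr_ge _ _ _ P X f mX fX cf (f x - Lf * (x - y)) y x yx (fun t h => (H t h).1).
have c0 : 0 <= f x + Lf * (x - y) by rewrite addr_ge0 ?mulr_ge0//; case: fX.
have h2 := @cdf_incr_le _ _ _ P X f mX fX cf (f x + Lf * (x - y)) y x c0 yx (fun t h => (H t h).2).
by rewrite ler_norml; apply/andP; split; move: h1 h2; nra.
Qed.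

Let Lpos x : L1 P (fun w => Num.max (X w - x) 0).
Proof.
apply: (@L1_le _ _ _ _ _ (fun w => `|X w| + `|x|)).
- by mfun.
- move=> w; apply: le_trans (ler_normB _ _).
  by rewrite /Num.max; case: ifP; rewrite ?normr0.
- by apply: L1D => //; exact: L1_abs.
Qed.

Lemma VfunE x : Vfun P al X x = Vf P al X x.
Proof. by rewrite /Vfun /Vf expectation.unlock. Qed.

(* Convexity: [Vp] is a subgradient of [Vf]. *)
Lemma Vf_subgrad x y : Vf P al X x - Vf P al X y <= (x - y) * Vp P al X x.
Proof.
have e : Vp P al X x = 1 - ca * Ex P (fun w => if x <= X w then 1 else 0).
  by rewrite /Vp /H1 -/ca ExB//; [rewrite Ex_cst ExZ|exact: L1Z].
rewrite /Vf -/ca e.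
suff : Ex P (fun w => Num.max (X w - x) 0) + (x - y) * Ex P (fun w => if x <= X w then 1 else 0)
   <= Ex P (fun w => Num.max (X w - y) 0).
  by move=> h; have := ler_wpM2l (ltW ca0) h; lra.
rewrite -ExZ// -ExD//; last exact: L1Z.
apply: Ex_le => //; first by apply: L1D => //; exact: L1Z.
move=> w; case: ifP => h.
  by rewrite max_l ?subr_ge0// mulr1 le_max; apply/orP; left; lra.
by rewrite max_r ?mulr0 ?addr0 ?le_max ?lexx ?orbT// subr_le0 ltW// ltNge h.
Qed.

Variable xst : R.
Hypothesis hxst : is_minimizer (Vfun P al X) xst.

(** Minimality and the subgradient inequality give [(x - xst) * Vp x >= 0] on both sides of [xst];
    [Vp] is Lipschitz, so it vanishes there. *)
Lemma Vp_min : Vp P al X xst = 0.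
Proof.
have H x : 0 <= (x - xst) * Vp P al X x.
  by apply: le_trans (Vf_subgrad x xst); rewrite subr_ge0 -!VfunE.
have lip x y : x <= y -> Vp P al X y - Vp P al X x <= ca * Mf * (y - x).
  by move=> xy; rewrite !VpE -mulrBr -mulrA ler_wpM2l ?(ltW ca0)//; have := cdf_lip xy; lra.
have M1 : 0 < ca * Mf + 1 by rewrite ltr_wpDl// mulr_ge0// ltW.
have cM0 : 0 <= ca * Mf by rewrite mulr_ge0// ltW.
apply/eqP; rewrite eq_le; apply/andP; split; rewrite leNgt; apply/negP => h.
  (* Within distance [t] the Lipschitz bound keeps [Vp] above half of its supposedly positive value
     at [xst]. *)
  pose t := Vp P al X xst / 2 / (ca * Mf + 1).
  have t0 : 0 < t by rewrite !divr_gt0.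
  have := lip (xst - t) xst; rewrite gerBl (ltW t0) subKr => /(_ isT) h1.
  have := H (xst - t); rewrite addrAC subrr sub0r mulNr oppr_ge0 pmulr_rle0// => h2.
  have h3 : (ca * Mf + 1) * t = Vp P al X xst / 2 by rewrite mulrC divfK// gt_eqF.
  by have := ltW t0; lra.
pose t := - Vp P al X xst / 2 / (ca * Mf + 1).
have t0 : 0 < t by rewrite !divr_gt0// oppr_gt0.
have := lip xst (xst + t); rewrite lerDl (ltW t0) => /(_ isT) h1.
have := H (xst + t); rewrite addrAC subrr add0r pmulr_rge0// => h2.
have h3 : (ca * Mf + 1) * t = - Vp P al X xst / 2 by rewrite mulrC divfK// gt_eqF.
move: h1; rewrite addrAC subrr add0r; have := ltW t0; lra.
Qed.

Lemma cdf_min : F xst = al.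
Proof.
have := Vp_min; rewrite VpE => /eqP; rewrite mulf_eq0 (gt_eqF ca0)/= subr_eq0 => /eqP //.
Qed.

Lemma Vf_quad x : 0 <= Vf P al X x - Vf P al X xst <= ca * Mf * (x - xst) ^+ 2.
Proof.
apply/andP; split; first by rewrite subr_ge0 -!VfunE.
apply: (le_trans (Vf_subgrad x xst)); rewrite VpE -cdf_min.
have [h|/ltW h] := leP xst x.
  have := cdf_lip h; have s0 : 0 <= x - xst by rewrite subr_ge0.
  by move=> h1; have := ler_wpM2l (mulr_ge0 (ltW ca0) s0) h1; lra.
have := cdf_lip h; have s0 : 0 <= xst - x by rewrite subr_ge0.
by move=> h1; have := ler_wpM2l (mulr_ge0 (ltW ca0) s0) h1; lra.
Qed.

Lemma Vp_lin q x : `|Vp P al X x - q * (x - xst)| <=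
  ca * Lf * (x - xst) ^+ 2 + `|ca * f xst - q| * `|x - xst|.
Proof.
rewrite VpE -cdf_min.
have -> : ca * (F x - F xst) - q * (x - xst) = ca * (F x - F xst - f xst * (x - xst)) +
  (ca * f xst - q) * (x - xst) by ring.
apply: (le_trans (ler_normD _ _)); rewrite !normrM (gtr0_norm ca0) lerD2r -mulrA.
by rewrite ler_wpM2l ?(ltW ca0)//; exact: cdf_quad.
Qed.

(** Inside the ball, by integrating the lower bound of the density; outside, by monotonicity of the
    cdf from the boundary of the ball on. *)
Lemma Vp_drift q r : 0 < r -> (forall x, `|x - xst| <= r -> q / 2 <= ca * f x) ->
  (forall x, `|x - xst| <= r -> q / 2 * (x - xst) ^+ 2 <= (x - xst) * Vp P al X x) /\
  (forall x, r <= `|x - xst| -> q / 2 * r * `|x - xst| <= (x - xst) * Vp P al X x).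
Proof.
move=> r0 Hf; pose m := q / 2 / ca.
have qm : q / 2 = ca * m by rewrite /m mulrCA divff ?mulr1// gt_eqF.
have Hf' x : `|x - xst| <= r -> m <= f x.
  by move=> /Hf; rewrite qm ler_pM2l.
have up x : xst <= x -> x - xst <= r -> m * (x - xst) <= F x - F xst.
  move=> h hr; apply: (cdf_incr_ge mX fX cf) => // t /andP[t1 t2].
  by apply: Hf'; rewrite ger0_norm ?subr_ge0 ?(ltW t1)//; apply: le_trans hr; rewrite lerB.
have dn x : x <= xst -> xst - x <= r -> m * (xst - x) <= F xst - F x.
  move=> h hr; apply: (cdf_incr_ge mX fX cf) => // t /andP[t1 t2].
  by apply: Hf'; rewrite distrC ger0_norm ?subr_ge0//; apply: le_trans hr; rewrite lerB// ltW.
split => x; rewrite VpE -cdf_min qm; have [h|/ltW h] := leP xst x.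
- have s0 : 0 <= x - xst by rewrite subr_ge0.
  rewrite ger0_norm// => hr; have := ler_wpM2l (mulr_ge0 (ltW ca0) s0) (up x h hr); lra.
- have s0 : 0 <= xst - x by rewrite subr_ge0.
  rewrite distrC ger0_norm// => hr; have := ler_wpM2l (mulr_ge0 (ltW ca0) s0) (dn x h hr); lra.
- have s0 : 0 <= x - xst by rewrite subr_ge0.
  rewrite ger0_norm// => hr.
  have h1 : m * r <= F (xst + r) - F xst.
    by have := up (xst + r); rewrite lerDl (ltW r0) addrAC subrr add0r lexx => /(_ isT isT).
  have h2 : F (xst + r) <= F x by apply: (cdf_mono mX fX cf); lra.
  have h3 : m * r <= F x - F xst by lra.
  by have := ler_wpM2l (mulr_ge0 (ltW ca0) s0) h3; lra.
- have s0 : 0 <= xst - x by rewrite subr_ge0.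
  rewrite distrC ger0_norm// => hr.
  have h1 : m * r <= F xst - F (xst - r).
    by have := dn (xst - r); rewrite gerBl (ltW r0) subKr lexx => /(_ isT isT).
  have h2 : F x <= F (xst - r) by apply: (cdf_mono mX fX cf); lra.
  have h3 : m * r <= F xst - F x by lra.
  by have := ler_wpM2l (mulr_ge0 (ltW ca0) s0) h3; lra.
Qed.

End smooth_pdf.

(** * From convergence of cdfs to convergence of moments *)

Lemma cvg_sum_ord {R : realType} m (F : nat -> nat -> R) (l : nat -> R) :
  (forall i, F i @ \oo --> l i) -> (fun K => \sum_(i < m) F i K) @ \oo --> \sum_(i < m) l i.
Proof.
move=> H; elim: m => [|m IH].
  by under eq_fun do rewrite big_ord0; rewrite big_ord0; exact: cvg_cst.
by under eq_fun do rewrite big_ord_recr/=; rewrite big_ord_recr; exact: cvgD.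
Qed.

Section staircase.
Context {R : realType}.
Variables (h : R -> R) (Lh a s : R).
Hypotheses (s0 : 0 <= s) (hL : forall x y, `|h x - h y| <= Lh * `|x - y|)
  (ha : forall x, x <= a -> h x = h a).

(** On each cell of the grid it takes the value of [h] at the right end. It is written with
    indicators of half-lines, so that its expectation is a finite combination of values of the
    cdf. *)
Definition stair (m : nat) (x : R) : R :=
  h a + \sum_(i < m) (h (a + i.+1%:R * s) - h (a + i%:R * s)) * (if a + i%:R * s < x then 1 else 0).

Let Lh0 : 0 <= Lh.
Proof. by have := hL 1 0; rewrite subr0 normr1 mulr1; apply: le_trans. Qed.

Let mono (i m : nat) : (i <= m)%N -> a + i%:R * s <= a + m%:R * s.
Proof. by move=> im; rewrite lerD2l ler_wpM2r// ler_nat. Qed.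

Let stairS m (x : R) : stair m.+1 x =
  stair m x + (h (a + m.+1%:R * s) - h (a + m%:R * s)) * (if a + m%:R * s < x then 1 else 0).
Proof. by rewrite /stair big_ord_recr/= addrA. Qed.

Let stair_tele m (x : R) : a + m%:R * s < x -> stair m x = h (a + m%:R * s).
Proof.
elim: m => [|m IH] mx; first by rewrite /stair big_ord0 mul0r !addr0.
have mx' : a + m%:R * s < x by apply: le_lt_trans mx; exact: mono.
by rewrite stairS mx' IH// mulr1 addrC subrK.
Qed.

Lemma stair_err m (x : R) : `|h (Num.min x (a + m%:R * s)) - stair m x| <= Lh * s.
Proof.
elim: m => [|m IH].
  by rewrite /stair big_ord0 mul0r !addr0 ha ?subrr ?normr0 ?mulr_ge0// ge_min lexx orbT.
have [xm|xm] := leP x (a + m%:R * s).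
  rewrite stairS ltNge xm/= mulr0 addr0 min_l; last by apply: (le_trans xm); exact: mono.
  by rewrite min_l in IH.
rewrite stairS xm stair_tele// mulr1 [h (a + m%:R * s) + _]addrC subrK.
apply: (le_trans (hL _ _)); rewrite ler_wpM2l//.
have [xm1|xm1] := leP x (a + m.+1%:R * s); last by rewrite subrr normr0.
rewrite distrC ger0_norm ?subr_ge0// -natr1 mulrDl mul1r; move: xm; lra.
Qed.

Lemma lip_continuous : continuous h.
Proof.
move=> x; apply/cvgrPdist_le => eps eps0.
have K0 : 0 < Lh + 1 by rewrite ltr_wpDl.
near=> y; apply: (le_trans (hL _ _)).
apply: (@le_trans _ _ ((Lh + 1) * `|x - y|)); first by rewrite ler_wpM2r// lerDl.
rewrite mulrC -ler_pdivlMr//; near: y; apply/nbhs_ballP.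
by exists (eps / (Lh + 1)) => /=; [exact: divr_gt0|move=> y /ltW].
Unshelve. all: by end_near. Qed.

End staircase.

Section cdf_convergence.
Context {d} {T : measurableType d} {R : realType} (P : probability T R).
Variables (X : nat -> T -> R).
Hypotheses (mX : forall K, measurable_fun setT (X K))
  (Fcvg : forall x, (fun K => cdf_of P (X K) x) @ \oo --> cdf_of P (X 0%N) x).

Let Li (f : T -> R) t : measurable_fun setT f -> L1 P (fun w => if t < f w then 1 else 0 : R).
Proof.
move=> mf; apply: (@L1_bnd _ _ _ _ _ 1); last by move=> w; case: ifP; rewrite ?normr1 ?normr0.
by apply: mfun_if; [apply: mfun_lt => //|..]; exact: mfun_cst.
Qed.

Lemma Ex_stair h a s m K : L1 P (fun w => stair h a s m (X K w)) /\
  Ex P (fun w => stair h a s m (X K w)) = h a +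
   \sum_(i < m) (h (a + i.+1%:R * s) - h (a + i%:R * s)) * (1 - cdf_of P (X K) (a + i%:R * s)).
Proof.
pose G (i : nat) w := (h (a + i.+1%:R * s) - h (a + i%:R * s)) * (if a + i%:R * s < X K w then 1 else 0).
have LG i : L1 P (G i) by apply: L1Z; exact: Li.
have LS : L1 P (fun w => \sum_(i < m) G i w) by apply: L1_sum.
split; first by apply: L1D.
rewrite /stair (ExD (L1_cst _ _) LS) Ex_cst (Ex_sum (fun i _ => LG i)); congr (_ + _); apply: eq_bigr => i _.
by rewrite ExZ ?Ex_gt//; exact: Li.
Qed.

(** The staircase error [Lh * s] is uniform in [K], and the expectations of a fixed staircase
    converge because the cdfs do. *)
Lemma Ex_lip_cvg h Lh a A : (forall x y, `|h x - h y| <= Lh * `|x - y|) ->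
  (forall x, x <= a -> h x = h a) -> (forall x, a + A <= x -> h x = h (a + A)) ->
  0 <= A -> (exists M, forall x, `|h x| <= M) ->
  (fun K => Ex P (fun w => h (X K w))) @ \oo --> Ex P (fun w => h (X 0%N w)).
Proof.
move=> hL ha hA A0 [M hM].
have Lh0 : 0 <= Lh by have := hL 1 0; rewrite subr0 normr1 mulr1; apply: le_trans.
have LhX K : L1 P (fun w => h (X K w)).
  apply: (@L1_bnd _ _ _ _ _ M) => //; apply: mfun_comp => //.
  by apply: mfun_continuous; exact: lip_continuous hL.
apply/cvgrPdist_le => eps eps0.
pose m := (Num.truncn (3 * Lh * A / eps)).+1.
have m0 : 0 < m%:R :> R by rewrite ltr0n.
pose s := A / m%:R; have s0 : 0 <= s by rewrite divr_ge0// ltW.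
have ms : m%:R * s = A by rewrite /s mulrCA divff ?mulr1// gt_eqF.
have Ls : Lh * s <= eps / 3.
  rewrite /s mulrA ler_pdivrMr// -ler_pdivrMl ?divr_gt0//.
  have : 3 * Lh * A / eps <= m%:R by rewrite /m ltW// -truncn_lt_nat// !mulr_ge0 ?invr_ge0// ltW.
  by rewrite invf_div; move=> h1; apply: le_trans h1; rewrite le_eqVlt; apply/orP; left; apply/eqP; field; rewrite gt_eqF.
have err K : `|Ex P (fun w => h (X K w)) - Ex P (fun w => stair h a s m (X K w))| <= eps / 3.
  have [LS _] := Ex_stair h a s m K; have LB := L1B (LhX K) LS.
  rewrite -ExB//; apply: (le_trans (Ex_abs LB)); rewrite -[leRHS](Ex_cst P).
  apply: Ex_le => //; first exact: L1_abs.
  move=> w; apply: le_trans Ls; have := stair_err s0 hL ha m (X K w); rewrite ms.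
  by case: (leP (X K w) (a + A)) => // /ltW/hA ->.
have C : (fun K => Ex P (fun w => stair h a s m (X K w))) @ \oo --> Ex P (fun w => stair h a s m (X 0%N w)).
  rewrite (_ : (fun K => _) = fun K => h a + \sum_(i < m)
     (h (a + i.+1%:R * s) - h (a + i%:R * s)) * (1 - cdf_of P (X K) (a + i%:R * s))); last first.
    by apply/funext => K; case: (Ex_stair h a s m K).
  have [_ ->] := Ex_stair h a s m 0; apply: cvgD; first exact: cvg_cst.
  apply: (@cvg_sum_ord _ m (fun i K => (h (a + i.+1%:R * s) - h (a + i%:R * s)) *
     (1 - cdf_of P (X K) (a + i%:R * s))) (fun i => (h (a + i.+1%:R * s) - h (a + i%:R * s)) *
     (1 - cdf_of P (X 0%N) (a + i%:R * s)))) => i; apply: cvgMr; apply: cvgB => //; exact: cvg_cst.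
have e3 : 0 < eps / 3 by rewrite divr_gt0.
move/cvgrPdist_le : C => /(_ _ e3); apply: filterS => K HK.
have := err K; have := err 0%N; move: HK.
move: (Ex P (fun w => h (X 0%N w))) (Ex P (fun w => h (X K w))) => x y.
move: (Ex P (fun w => stair h a s m (X 0%N w))) (Ex P (fun w => stair h a s m (X K w))) => x' y'.
rewrite !ler_norml => /andP[? ?] /andP[? ?] /andP[? ?]; apply/andP; split; lra.
Qed.

Hypotheses (LX : forall K, (0 < K)%N -> L2 P (X K))
  (UI : forall eps : R, 0 < eps -> exists2 A : R, 0 <= A &
    forall K, (0 < K)%N -> Ex P (fun w => if A < `|X K w| then X K w ^+ 2 else 0) <= eps).

Lemma sqr_bnd : exists2 M : R, 0 <= M & forall K, (0 < K)%N -> Ex P (fun w => X K w ^+ 2) <= M.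
Proof.
have [A A0 HA] := UI ltr01; exists (A ^+ 2 + 1); first by rewrite addr_ge0 ?sqr_ge0.
move=> K K0; have [mXK LK2] := LX K0.
have LI : L1 P (fun w => if A < `|X K w| then X K w ^+ 2 else 0).
  apply: (L1_le _ _ LK2).
    apply: mfun_if; [apply: mfun_lt; [exact: mfun_cst|by mfun]|by mfun|exact: mfun_cst].
  by move=> w; case: ifP => _; rewrite ?normr0 ?sqr_ge0// ger0_norm// sqr_ge0.
apply: (@le_trans _ _ (Ex P (fun w => A ^+ 2 + (if A < `|X K w| then X K w ^+ 2 else 0)))).
  apply: Ex_le => //; first exact: L1D.
  move=> w; case: ifP => h; first by rewrite lerDr sqr_ge0.
  by rewrite addr0 -(real_normK (num_real (X K w))) lerXn2r ?nnegrE// leNgt h.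
by rewrite ExD// Ex_cst lerD2l; exact: HA.
Qed.

Variable x0 : R.
Let u K w := Num.max (X K w - x0) 0.
Let clip (A x : R) : R := Num.min (Num.max (x - x0) 0) A.

Let clip_incr (A x y : R) : x <= y -> 0 <= clip A y - clip A x <= y - x.
Proof.
move=> xy; rewrite /clip.
have [] : Num.max (x - x0) 0 <= Num.max (y - x0) 0 /\
    Num.max (y - x0) 0 - Num.max (x - x0) 0 <= y - x.
  by rewrite /Num.max; case: ltP => ?; case: ltP => ?; split; lra.
move: (Num.max (x - x0) 0) (Num.max (y - x0) 0) => v v' h1 h2.
by rewrite /Num.min; case: ltP => ?; case: ltP => ?; apply/andP; split; lra.
Qed.

Let clip_lip (A x y : R) : `|clip A x - clip A y| <= `|x - y|.
Proof.
wlog xy : x y / x <= y.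
  move=> H; have [|/ltW yx] := leP x y; first exact: H.
  by rewrite distrC [leRHS]distrC; exact: H.
have /andP[h1 h2] := clip_incr A xy.
by rewrite distrC [leRHS]distrC ger0_norm//; exact: le_trans h2 (ler_norm _).
Qed.

Let clip_ge0 (A x : R) : 0 <= A -> 0 <= clip A x.
Proof. by move=> A0; rewrite le_min A0 le_max lexx orbT. Qed.

Let clip_le (A x : R) : clip A x <= A.
Proof. by rewrite ge_min lexx orbT. Qed.

Let clip_lo (A x : R) : 0 <= A -> x <= x0 -> clip A x = 0.
Proof. by move=> A0 h; rewrite /clip max_r ?subr_le0// min_l. Qed.

Let clip_hi (A x : R) : 0 <= A -> x0 + A <= x -> clip A x = A.
Proof. by move=> A0 h; rewrite /clip min_r// le_max lerBrDl h. Qed.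

Let clip_cvg (A : R) : 0 <= A -> (fun K => Ex P (fun w => clip A (X K w))) @ \oo --> Ex P (fun w => clip A (X 0%N w)).
Proof.
move=> A0; apply: (@Ex_lip_cvg (clip A) 1 x0 A) => //.
- by move=> x y; rewrite mul1r; exact: clip_lip.
- by move=> x h; rewrite !clip_lo.
- by move=> x h; rewrite !clip_hi.
- by exists A => x; rewrite ger0_norm ?clip_ge0.
Qed.

Let clip2_cvg (A : R) : 0 <= A -> (fun K => Ex P (fun w => clip A (X K w) ^+ 2)) @ \oo --> Ex P (fun w => clip A (X 0%N w) ^+ 2).
Proof.
move=> A0; apply: (@Ex_lip_cvg (fun x => clip A x ^+ 2) (2 * A) x0 A) => //.
- move=> x y; rewrite subr_sqr normrM [leRHS]mulrC; apply: ler_pM => //.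
  rewrite ger0_norm ?addr_ge0 ?clip_ge0//; have := clip_le A x; have := clip_le A y; lra.
- by move=> x h; rewrite !clip_lo.
- by move=> x h; rewrite !clip_hi.
- exists (A ^+ 2) => x; rewrite ger0_norm ?sqr_ge0// lerXn2r ?nnegrE ?clip_ge0//.
Qed.

Let mu K : measurable_fun setT (u K). Proof. by rewrite /u; mfun. Qed.
Let u0 K w : 0 <= u K w. Proof. by rewrite le_max lexx orbT. Qed.

Let u_abs K w : u K w <= `|X K w| + `|x0|.
Proof.
rewrite /u ge_max addr_ge0// andbT; apply: le_trans (ler_norm _) _; exact: ler_normB.
Qed.

Let Lu K : (0 < K)%N -> L2 P (u K).
Proof.
move=> K0; apply: (@L2_le _ _ _ _ _ (fun w => `|X K w| + `|x0|)) => //.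
  by move=> w; rewrite (ger0_norm (u0 _ _)) (@ger0_norm _ (`|X K w| + _)) ?addr_ge0.
by apply: L2D; [apply: L2_abs; exact: LX|exact: L2_cst].
Qed.

Let mclip (A : R) K : measurable_fun setT (fun w => clip A (X K w)).
Proof.
apply: mfun_comp => //; apply: mfun_continuous; apply: (@lip_continuous _ _ 1) => x y.
by rewrite mul1r; exact: clip_lip.
Qed.

Let Lclip (A : R) K : 0 <= A -> L2 P (fun w => clip A (X K w)).
Proof. by move=> A0; apply: (@L2_bnd _ _ _ _ _ A); [exact: mclip|move=> w; rewrite ger0_norm ?clip_ge0]. Qed.

(* [u <= 2 |X|] as soon as [u > A >= 2 |x0|]. *)
Let clip_err (eps : R) : 0 < eps -> exists2 A0 : R, 0 <= A0 & forall (A : R) K, A0 <= A -> (0 < K)%N ->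
  `|Ex P (u K) - Ex P (fun w => clip A (X K w))| <= eps /\
  `|Ex P (fun w => u K w ^+ 2) - Ex P (fun w => clip A (X K w) ^+ 2)| <= eps.
Proof.
move=> eps0; have e4 : 0 < eps / 4 by rewrite divr_gt0.
have [B B0 HB] := UI e4.
exists (1 + 2 * B + 2 * `|x0|); first by rewrite !addr_ge0// mulr_ge0.
move=> A K hA K0; have A0 : 0 <= A by apply: le_trans hA; rewrite !addr_ge0// mulr_ge0.
have [mXK LK2] := LX K0; have [_ Lu2] := Lu K0; have [_ Lc2] := Lclip K A0.
pose I w := if B < `|X K w| then X K w ^+ 2 else 0.
have I0 w : 0 <= I w by rewrite /I; case: ifP => // _; exact: sqr_ge0.
have LI : L1 P I.
  apply: (L1_le _ _ LK2).
    apply: mfun_if; [apply: mfun_lt; [exact: mfun_cst|by mfun]|by mfun|exact: mfun_cst].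
  by move=> w; rewrite /I; case: ifP => _; rewrite ?normr0 ?sqr_ge0// ger0_norm// sqr_ge0.
have key w : clip A (X K w) = u K w \/ [/\ clip A (X K w) = A, 1 <= A, A < u K w & u K w ^+ 2 <= 4 * I w].
  rewrite /clip -/(u K w); have [h|h] := leP (u K w) A; [by left|right].
  have A1 : 1 <= A by apply: le_trans hA; rewrite -addrA lerDl addr_ge0// mulr_ge0.
  split => //; have uX := u_abs K w.
  have h1 : `|x0| <= `|X K w| by have := normr_ge0 x0; lra.
  have h2 : B < `|X K w| by have := normr_ge0 x0; lra.
  rewrite /I h2 -(real_normK (num_real (X K w))).
  have h3 : u K w <= 2 * `|X K w| by lra.
  by have := u0 K w; move: h3; move: (`|X K w|) (u K w) => p v; nra.
have HI : Ex P (fun w => 4 * I w) <= eps.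
  by rewrite ExZ//; have := HB K K0; rewrite -/I; lra.
have LI4 := L1Z 4 LI.
split.
- rewrite -ExB; [|exact: L2_L1 (Lu K0)|exact: L2_L1 (Lclip K A0)].
  have LB := L1B (L2_L1 (Lu K0)) (L2_L1 (Lclip K A0)).
  apply: (le_trans (Ex_abs LB)); apply: le_trans HI; apply: Ex_le => //; first exact: L1_abs.
  move=> w; case: (key w) => [->|[-> A1 h1 h2]]; first by rewrite subrr normr0 mulr_ge0.
  rewrite ger0_norm; last by rewrite subr_ge0 ltW.
  by apply: le_trans h2; nra.
- rewrite -ExB//.
  have LB := L1B Lu2 Lc2.
  apply: (le_trans (Ex_abs LB)); apply: le_trans HI; apply: Ex_le => //; first exact: L1_abs.
  move=> w; case: (key w) => [->|[-> A1 h1 h2]]; first by rewrite subrr normr0 mulr_ge0.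
  rewrite ger0_norm; first by apply: le_trans h2; rewrite gerBl sqr_ge0.
  by rewrite subr_ge0; have := ltW h1; nra.
Qed.

(** The second moment at [K = 0] is inherited from the other indices: [min (u^2, n)] is the square
    of [u] clipped at [sqrt n], and its expectation is a limit of expectations bounded uniformly in
    [K]. *)
Lemma L2_limit_pos : L2 P (u 0%N).
Proof.
split => //; have [M M0 HM] := sqr_bnd.
have [] // := @L1_trunc _ _ _ P (fun w => u 0%N w ^+ 2) (2 * M + 2 * x0 ^+ 2).
- by mfun.
- by move=> w; exact: sqr_ge0.
move=> n; pose A : R := Num.sqrt n%:R; have A0 : 0 <= A by exact: sqrtr_ge0.
have -> : Ex P (fun w => Num.min (u 0%N w ^+ 2) n%:R) = Ex P (fun w => clip A (X 0%N w) ^+ 2).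
  apply: eq_Ex => w; have nA : n%:R = A ^+ 2 by rewrite sqr_sqrtr.
  rewrite /clip -/(u 0%N w) nA; have [h|h] := leP (u 0%N w) A.
    by rewrite min_l// lerXn2r ?nnegrE.
  by rewrite min_r// lerXn2r ?nnegrE// ltW.
apply: (cvgr_to_le (clip2_cvg A0)); exists 1%N => // K /= K0.
have [_ Lc2] := Lclip K A0; have [_ LK2] := LX K0.
apply: (@le_trans _ _ (Ex P (fun w => 2 * X K w ^+ 2 + 2 * x0 ^+ 2))).
  apply: Ex_le => //; first by apply: L1D => //; exact: L1Z.
  move=> w; apply: (@le_trans _ _ (u K w ^+ 2)).
    by rewrite lerXn2r ?nnegrE ?clip_ge0// /clip ge_min lexx.
  have := u_abs K w; have := u0 K w.
  rewrite -(real_normK (num_real (X K w))) -(real_normK (num_real x0)).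
  by have := sqr_ge0 (`|X K w| - `|x0|); move: (`|X K w|) (`|x0|) (u K w) => p p' v; nra.
rewrite ExD//; last exact: L1Z.
by rewrite ExZ// Ex_cst lerD2r ler_wpM2l//; exact: HM.
Qed.

Let clip_n (w : T) : (fun n : nat => clip n%:R (X 0%N w)) @ \oo --> u 0%N w.
Proof.
apply: cvg_near_cst; exists (Num.truncn (u 0%N w)).+1 => // n /= nw.
by rewrite /clip -/(u 0%N w); apply/min_idPl; rewrite ltW// -truncn_lt_nat.
Qed.

(** Clipped moments converge. Clipping costs little uniformly over [K > 0] by [clip_err], and at
    [K = 0] by dominated convergence. *)
Lemma Ex_pos_cvg : (fun K => Ex P (u K)) @ \oo --> Ex P (u 0%N) /\
  (fun K => Ex P (fun w => u K w ^+ 2)) @ \oo --> Ex P (fun w => u 0%N w ^+ 2).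
Proof.
have [_ Lu2] := L2_limit_pos; have Lu1 := L2_L1 L2_limit_pos.
have c1 : (fun n : nat => Ex P (fun w => clip n%:R (X 0%N w))) @ \oo --> Ex P (u 0%N).
  apply: (@Ex_dominated _ _ _ P _ _ (u 0%N)); [by move=> n; exact: mclip|exact: mu|exact: clip_n| |exact: Lu1].
  by move=> n w; rewrite ger0_norm ?clip_ge0// /clip ge_min lexx.
have c2 : (fun n : nat => Ex P (fun w => clip n%:R (X 0%N w) ^+ 2)) @ \oo --> Ex P (fun w => u 0%N w ^+ 2).
  apply: (@Ex_dominated _ _ _ P _ _ (fun w => u 0%N w ^+ 2)) => //.
  - by move=> n; apply: mfunX.
  - by apply: mfunX.
  - by move=> w; apply: cvgM; exact: clip_n.
  - move=> n w; rewrite ger0_norm ?sqr_ge0// lerXn2r ?nnegrE ?clip_ge0//.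
    by rewrite /clip ge_min lexx.
split; apply/cvgrPdist_le => eps eps0; have e3 : 0 < eps / 3 by rewrite divr_gt0.
- have [A0 A00 HA] := clip_err e3.
  move/cvgrPdist_le : c1 => /(_ _ e3) [n1 _ H1].
  pose n := maxn n1 (Num.truncn A0).+1.
  have hA : A0 <= n%:R by rewrite ltW// -truncn_lt_nat// leq_max leqnn orbT.
  have := clip_cvg (ler0n R n); move/cvgrPdist_le => /(_ _ e3) [n2 _ H2].
  exists n2.+1 => // K /= K2; have [h1 _] := HA _ K hA (leq_trans (ltn0Sn _) K2).
  have h2 := H2 K (ltnW K2); have h3 : `|_ - _| <= _ := H1 n (leq_maxl _ _).
  move: h1 h2 h3; rewrite !ler_norml => /andP[? ?] /andP[? ?] /andP[? ?]; apply/andP; split; lra.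
- have [A0 A00 HA] := clip_err e3.
  move/cvgrPdist_le : c2 => /(_ _ e3) [n1 _ H1].
  pose n := maxn n1 (Num.truncn A0).+1.
  have hA : A0 <= n%:R by rewrite ltW// -truncn_lt_nat// leq_max leqnn orbT.
  have := clip2_cvg (ler0n R n); move/cvgrPdist_le => /(_ _ e3) [n2 _ H2].
  exists n2.+1 => // K /= K2; have [_ h1] := HA _ K hA (leq_trans (ltn0Sn _) K2).
  have h2 := H2 K (ltnW K2); have h3 : `|_ - _| <= _ := H1 n (leq_maxl _ _).
  move: h1 h2 h3; rewrite !ler_norml => /andP[? ?] /andP[? ?] /andP[? ?]; apply/andP; split; lra.
Qed.

End cdf_convergence.

(** * The approximations of the nested expectation *)

Lemma cvg_close {R : realType} (a b e : nat -> R) (l : R) : a @ \oo --> l -> e @ \oo --> 0 ->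
  (forall n, `|a n - b n| <= e n) -> b @ \oo --> l.
Proof.
move=> al e0 ab; have : (fun n => b n - a n) @ \oo --> 0.
  apply/cvgrPdist_le => eps eps0; move/cvgrPdist_le : e0 => /(_ _ eps0); apply: filterS => n.
  rewrite !sub0r !normrN distrC => h; apply: le_trans (ab n) _; exact: le_trans (ler_norm _) h.
move=> H; have -> : b = fun n => a n + (b n - a n) by apply/funext => n; rewrite addrC subrK.
by rewrite -[l]addr0; exact: cvgD.
Qed.

Section family.
Context {d} {T : measurableType d} {R : realType} (P : probability T R).
Variables (al : R) (X : nat -> T -> R) (f : nat -> R -> R) (xis : nat -> R) (Mf Lf : R).
Hypotheses (al01 : 0 < al < 1) (mX : forall K, measurable_fun setT (X K))
  (LX1 : forall K, L1 P (X K)) (fX : forall K, is_pdf P (X K) (f K)) (cf : forall K, continuous (f K))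
  (fM : forall K x, `|f K x| <= Mf) (fL : forall K x y, `|f K x - f K y| <= Lf * `|x - y|)
  (floc : forall a b eps : R, 0 < eps ->
    \forall K \near \oo, forall x, a <= x <= b -> `|f K x - f 0%N x| <= eps)
  (F0 : (fun K => cdf_of P (X K) (xis 0%N)) @ \oo --> cdf_of P (X 0%N) (xis 0%N))
  (flow : forall r, 0 < r -> exists2 c : R, 0 < c & forall K x, `|x - xis 0%N| < r -> c <= f K x)
  (hxis : forall K, is_minimizer (Vfun P al (X K)) (xis K)).

Let ca : R := (1 - al)^-1.
Let al1 : 0 < 1 - al. Proof. by case/andP: al01 => ? ?; rewrite subr_gt0. Qed.
Let ca0 : 0 < ca. Proof. by rewrite invr_gt0. Qed.
Let Mf0 : 0 <= Mf. Proof. exact: le_trans (normr_ge0 _) (fM 0%N 0). Qed.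
Let Lf0 : 0 <= Lf.
Proof. by have := fL 0%N 0 1; rewrite sub0r normrN normr1 mulr1; apply: le_trans. Qed.

Local Notation F K := (cdf_of P (X K)).
Local Notation x0 := (xis 0%N).

(** Convergence is given at the single point [x0]. It spreads to every [x] because increments of the
    cdfs between [x0] and [x] are integrals of densities converging uniformly there. *)
Lemma cdf_cvg x : (fun K => F K x) @ \oo --> F 0%N x.
Proof.
apply/cvgrPdist_le => eps eps0.
have D0 : 0 < `|x - x0| + 1 by rewrite ltr_wpDl.
pose e := eps / 2 / (`|x - x0| + 1); have e0 : 0 < e by rewrite !divr_gt0.
have eD : e * `|x - x0| <= eps / 2.
  by rewrite /e mulrAC ler_pdivrMr// ler_wpM2l ?lerDl// divr_ge0// ltW.
have e2 : 0 < eps / 2 by rewrite divr_gt0.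
move/cvgrPdist_le : F0 => /(_ _ e2) H0.
near=> K.
have h0 : `|F 0%N x0 - F K x0| <= eps / 2 by near: K.
have hf : forall t, Num.min x x0 <= t <= Num.max x x0 -> `|f K t - f 0%N t| <= e.
  by near: K; exact: floc.
have hle J J' : (forall t, Num.min x x0 <= t <= Num.max x x0 -> f J t <= f J' t + e) ->
    `|x - x0| * e + (F J' (Num.max x x0) - F J' (Num.min x x0)) >= F J (Num.max x x0) - F J (Num.min x x0).
  move=> H; have mm : Num.min x x0 <= Num.max x x0 by rewrite le_max ge_min lexx.
  have := @cdf_incr_cmp _ _ _ P (X J) (X J') (f J) (f J') (mX J) (fX J) (@cf J) (mX J') (fX J') (@cf J') e _ _ (ltW e0) mm.
  move=> /(_ _)/le_trans; apply => //.
    by move=> t /andP[t1 t2]; apply: H; rewrite t2 ltW.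
  rewrite addrC lerD2r mulrC ler_wpM2r ?(ltW e0)//.
  by rewrite /Num.min /Num.max; case: ltP => h; [rewrite distrC|]; exact: ler_norm.
have h1 : F K (Num.max x x0) - F K (Num.min x x0) <= `|x - x0| * e + (F 0%N (Num.max x x0) - F 0%N (Num.min x x0)).
  by apply: hle => t /hf; rewrite ler_norml => /andP[]; lra.
have h2 : F 0%N (Num.max x x0) - F 0%N (Num.min x x0) <= `|x - x0| * e + (F K (Num.max x x0) - F K (Num.min x x0)).
  by apply: hle => t /hf; rewrite ler_norml => /andP[]; lra.
move: h0 h1 h2 eD; rewrite ![`|x - x0| * e]mulrC !ler_norml => /andP[? ?].
by rewrite /Num.max /Num.min; case: ltP => h *; apply/andP; split; lra.
Unshelve. all: by end_near. Qed.

Let Fxis K : F K (xis K) = al.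
Proof. exact: (@cdf_min _ _ _ P al (X K) (f K) Mf al01 (mX K) (fX K) (@cf K) (fM K) (LX1 K)). Qed.

Let Fmono K x y : x <= y -> F K x <= F K y.
Proof. exact: (@cdf_mono _ _ _ P (X K) (f K) (mX K) (fX K) (@cf K)). Qed.

(** [F K x0] tends to [al], which is the value of [F K] at [xis K], and near [x0] the slope of [F K]
    is bounded below uniformly in [K]. *)
Lemma xis_cvg : xis @ \oo --> x0.
Proof.
apply/cvgrPdist_le => eps eps0.
have [c c0 Hc] : exists2 c : R, 0 < c & forall K x, `|x - x0| < 2 * eps -> c <= f K x.
  by apply: flow; rewrite mulr_gt0.
have ce0 : 0 < c * eps / 2 by rewrite divr_gt0// mulr_gt0.
move/cvgrPdist_le : F0 => /(_ _ ce0); apply: filterS => K; rewrite Fxis ler_norml => /andP[h1 h2].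
have up : c * (x0 + eps - x0) <= F K (x0 + eps) - F K x0.
  apply: (@cdf_incr_ge _ _ _ P (X K) (f K) (mX K) (fX K) (@cf K)); first by rewrite lerDl ltW.
  by move=> t /andP[t1 t2]; apply: Hc; rewrite ger0_norm; lra.
have dn : c * (x0 - (x0 - eps)) <= F K x0 - F K (x0 - eps).
  apply: (@cdf_incr_ge _ _ _ P (X K) (f K) (mX K) (fX K) (@cf K)); first by rewrite gerBl ltW.
  by move=> t /andP[t1 t2]; apply: Hc; rewrite ler0_norm; lra.
rewrite ler_norml; apply/andP; split; rewrite leNgt; apply/negP => h.
- have := @Fmono K (x0 + eps) (xis K); rewrite Fxis => /(_ _) h3.
  have : F K (x0 + eps) <= al by apply: h3; lra.
  have := mulr_gt0 c0 eps0; lra.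
- have := @Fmono K (xis K) (x0 - eps); rewrite Fxis => /(_ _) h3.
  have : al <= F K (x0 - eps) by apply: h3; lra.
  have := mulr_gt0 c0 eps0; lra.
Qed.

Lemma fxis_cvg : (fun K => f K (xis K)) @ \oo --> f 0%N x0.
Proof.
apply/cvgrPdist_le => eps eps0; have e2 : 0 < eps / 2 by rewrite divr_gt0.
have L1 : 0 < Lf + 1 by rewrite ltr_wpDl.
have eL : 0 < eps / 2 / (Lf + 1) by rewrite divr_gt0.
have := xis_cvg; move/cvgrPdist_le => /(_ _ eL) H.
near=> K.
have h1 : `|x0 - xis K| <= eps / 2 / (Lf + 1) by near: K.
have h2 : forall t, x0 <= t <= x0 -> `|f K t - f 0%N t| <= eps / 2 by near: K; exact: floc.
have := h2 x0; rewrite lexx => /(_ isT) h3.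
have h4 : `|f K x0 - f K (xis K)| <= eps / 2.
  apply: (le_trans (fL K _ _)); apply: (@le_trans _ _ ((Lf + 1) * `|x0 - xis K|)).
    by rewrite ler_wpM2r// lerDl.
  by rewrite mulrC -ler_pdivlMr.
by move: h3 h4; rewrite !ler_norml => /andP[? ?] /andP[? ?]; apply/andP; split; lra.
Unshelve. all: by end_near. Qed.

Let q : R := ca * f 0%N x0.

Lemma q_gt0 : 0 < q.
Proof.
have [c c0 Hc] := flow ltr01; rewrite mulr_gt0//; apply: lt_le_trans c0 (Hc _ _ _).
by rewrite subrr normr0.
Qed.

Variables (Xn : nat -> nat -> T -> R) (xi0 : nat -> T -> R) (g1 b MB : R).
Hypotheses (mXn : forall K n, measurable_fun setT (Xn K n)) (mxi0 : forall K, measurable_fun setT (xi0 K))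
  (lawXn : forall K, (0 < K)%N -> forall n, same_law P (Xn K n.+1) (X K))
  (indepXn : forall K, (0 < K)%N -> mutually_independent P
     (fun o : option nat => if o is Some n then sigma_of (Xn K n.+1) else sigma_of (xi0 K)))
  (Lxi0 : forall K, (0 < K)%N -> L2 P (xi0 K)) (Exi0 : forall K, (0 < K)%N -> Ex P (fun w => xi0 K w ^+ 2) <= MB).

Lemma near_sa_sys : exists r M0 : R, [/\ 0 < r, r <= 1, 0 <= M0 &
  \forall K \near \oo, sa_sys P al q r (ca * Lf) Mf (ca * Mf) M0 (xi0 K) (Xn K) (X K) (xis K)
    `|ca * f K (xis K) - q| ].
Proof.
have f00 : 0 < f 0%N x0 by have := q_gt0; rewrite pmulr_rgt0.
have L40 : 0 < 4 * (Lf + 1) by rewrite mulr_gt0// ltr_wpDl.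
(* Within distance [r] the Lipschitz bound moves the density by at most a quarter of [f 0 x0].
   Another quarter covers the gap between [f K (xis K)] and [f 0 x0]; the half that is left is the
   slope [q / 2]. *)
pose r := Num.min 1 (f 0%N x0 / (4 * (Lf + 1))).
have r0 : 0 < r by rewrite lt_min ltr01 divr_gt0.
have r1 : r <= 1 by rewrite ge_min lexx.
have Lr : Lf * r <= f 0%N x0 / 4.
  apply: (@le_trans _ _ ((Lf + 1) * (f 0%N x0 / (4 * (Lf + 1))))).
    by apply: ler_pM => //; [exact: ltW|rewrite lerDl|rewrite ge_min lexx orbT].
  by rewrite le_eqVlt; apply/orP; left; apply/eqP; field; rewrite gt_eqF// ltr_wpDl.
(* From [(x - y)^2 <= 2 x^2 + 2 y^2], with [|xis K| <= |x0| + 1] for large [K]. *)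
pose M0 := 2 * MB + 2 * (`|x0| + 1) ^+ 2.
have MB0 : 0 <= MB by apply: le_trans (Exi0 (ltn0Sn 0)); apply: Ex_ge0 => w; exact: sqr_ge0.
exists r, M0; split => //; first by rewrite addr_ge0// mulr_ge0// sqr_ge0.
near=> K.
have K0 : (0 < K)%N by near: K; exists 1%N.
have h1 : `|x0 - xis K| <= 1.
  by near: K; have := xis_cvg; move/cvgrPdist_le => /(_ _ ltr01).
have h2 : `|f 0%N x0 - f K (xis K)| <= f 0%N x0 / 4.
  by near: K; have := fxis_cvg; move/cvgrPdist_le; apply; rewrite divr_gt0.
have Hf x : `|x - xis K| <= r -> q / 2 <= ca * f K x.
  move=> xr; rewrite /q -mulrA ler_pM2l//.
  have h3 : `|f K x - f K (xis K)| <= f 0%N x0 / 4.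
    by apply: (le_trans (fL K _ _)); apply: le_trans Lr; rewrite ler_wpM2l.
  by move: h2 h3; rewrite !ler_norml => /andP[? ?] /andP[? ?]; lra.
have [D1 D2] := @Vp_drift _ _ _ P al (X K) (f K) Mf al01 (mX K) (fX K) (@cf K) (fM K) (LX1 K) (xis K) (hxis K) q r r0 Hf.
have L0 := Lxi0 K0; have [_ L02] := L0.
have Lx : L2 P (fun w => xi0 K w - xis K) by apply: L2B => //; exact: L2_cst.
constructor => //.
- exact: lawXn.
- exact: indepXn.
- exact: (@Ex_ind_lip _ _ _ P (X K) (f K) Mf).
- exact: (@Vp_min _ _ _ P al (X K) (f K) Mf).
- exact: (@Vp_lin _ _ _ P al (X K) (f K) Mf).
- exact: (@Vf_quad _ _ _ P al (X K) (f K) Mf).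
- have [_ Lx2] := Lx.
  apply: (@le_trans _ _ (Ex P (fun w => 2 * xi0 K w ^+ 2 + 2 * xis K ^+ 2))).
    apply: Ex_le => //; first by apply: L1D => //; exact: L1Z.
    by move=> w; have := sqr_ge0 (xi0 K w + xis K); nra.
  rewrite ExD//; last exact: L1Z.
  rewrite ExZ// Ex_cst /M0 lerD// ler_wpM2l//; first exact: Exi0.
  rewrite -(real_normK (num_real (xis K))) lerXn2r ?nnegrE ?addr_ge0//.
  have : `|xis K| <= `|x0| + `|x0 - xis K|.
    by rewrite -{1}(subKr x0 (xis K)); exact: ler_normB.
  by lra.
Unshelve. all: by end_near. Qed.

Hypotheses (LX : forall K, (0 < K)%N -> L2 P (X K))
  (UI : forall eps : R, 0 < eps -> exists2 A : R, 0 <= A &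
    forall K, (0 < K)%N -> Ex P (fun w => if A < `|X K w| then X K w ^+ 2 else 0) <= eps).

Let v K w := Num.max (X K w - xis K) 0.
Let u K w := Num.max (X K w - x0) 0.

Let vu K w : `|v K w - u K w| <= `|xis K - x0|.
Proof.
rewrite /v /u /Num.max; have [h1|h1] := ltP (X K w - xis K) 0; have [h2|h2] := ltP (X K w - x0) 0.
- by rewrite subrr normr0.
- by rewrite sub0r normrN ger0_norm// ler_normr; apply/orP; left; lra.
- by rewrite subr0 ger0_norm// distrC ler_normr; apply/orP; left; lra.
- by rewrite distrC (_ : X K w - x0 - (X K w - xis K) = xis K - x0)//; ring.
Qed.

Let v_ge0 K w : 0 <= v K w. Proof. by rewrite le_max lexx orbT. Qed.
Let u_ge0 K w : 0 <= u K w. Proof. by rewrite le_max lexx orbT. Qed.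
Let mv K : measurable_fun setT (v K). Proof. by rewrite /v; mfun. Qed.

Lemma L2_pos K : L2 P (v K).
Proof.
case: K => [|K].
  exact: (@L2_limit_pos _ _ _ P X mX cdf_cvg LX UI x0).
apply: (@L2_le _ _ _ _ _ (fun w => `|X K.+1 w| + `|xis K.+1|)) => //.
  move=> w; rewrite (ger0_norm (v_ge0 _ _)) (@ger0_norm _ (`|X K.+1 w| + _)) ?addr_ge0//.
  by rewrite /v ge_max addr_ge0// andbT; apply: le_trans (ler_norm _) _; exact: ler_normB.
by apply: L2D; [apply: L2_abs; exact: LX|exact: L2_cst].
Qed.

Let Lu K : L2 P (u K).
Proof.
have [mvK _] := L2_pos K.
apply: (@L2_le _ _ _ _ _ (fun w => v K w + `|xis K - x0|)) => //.
- by rewrite /u; mfun.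
- move=> w; rewrite (ger0_norm (u_ge0 _ _)) (@ger0_norm _ (v K w + _)) ?addr_ge0//.
  by have := vu K w; rewrite ler_norml => /andP[]; lra.
- by apply: L2D; [exact: L2_pos|exact: L2_cst].
Qed.

(** Moving the threshold from [x0] to [xis K] changes the positive part by at most [|xis K - x0|],
    so the moving threshold reduces to the fixed one. *)
Lemma Ex_pos_xis_cvg : (fun K => Ex P (v K)) @ \oo --> Ex P (v 0%N) /\
  (fun K => Ex P (fun w => v K w ^+ 2)) @ \oo --> Ex P (fun w => v 0%N w ^+ 2).
Proof.
have [c1 c2] := @Ex_pos_cvg _ _ _ P X mX cdf_cvg LX UI x0.
have D : (fun K => `|xis K - x0|) @ \oo --> 0.
  rewrite -[X in _ --> X](normr0 R) -[X in `|X|](subrr x0); apply: cvg_norm.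
  by apply: cvgB; [exact: xis_cvg|exact: cvg_cst].
have Lu1 K := L2_L1 (Lu K); have Lv1 K := L2_L1 (L2_pos K).
have E0 K : `|Ex P (u K) - Ex P (v K)| <= `|xis K - x0|.
  rewrite -ExB//; have LB := L1B (Lu1 K) (Lv1 K); apply: (le_trans (Ex_abs LB)).
  rewrite -[leRHS](Ex_cst P); apply: Ex_le => //; first exact: L1_abs.
  by move=> w; rewrite distrC.
have E2 K : `|Ex P (fun w => u K w ^+ 2) - Ex P (fun w => v K w ^+ 2)| <= `|xis K - x0| * (2 * Ex P (u K) + `|xis K - x0|).
  have [_ Lu2] := Lu K; have [_ Lv2] := L2_pos K; have LB := L1B Lu2 Lv2.
  rewrite -ExB//; apply: (le_trans (Ex_abs LB)).
  apply: (@le_trans _ _ (Ex P (fun w => `|xis K - x0| * (2 * u K w + `|xis K - x0|)))).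
    apply: Ex_le => //; [exact: L1_abs|by apply: L1Z; apply: L1D => //; exact: L1Z|move=> w].
    rewrite subr_sqr normrM distrC; apply: ler_pM => //.
    rewrite ger0_norm ?addr_ge0//; have := vu K w; rewrite ler_norml => /andP[]; lra.
  by rewrite ExZ ?ExD// ?ExZ ?Ex_cst//; [exact: L1Z|apply: L1D => //; exact: L1Z].
split; first exact: cvg_close c1 D E0.
apply: cvg_close c2 _ E2; rewrite -[X in _ --> X](mul0r (2 * Ex P (u 0%N) + 0)).
apply: cvgM => //; apply: cvgD => //; exact: cvgMr.
Qed.

Lemma eta_UI (eps : R) : 0 < eps -> exists2 B : R, 0 <= B & \forall K \near \oo,
  Ex P (fun w => if B < `|eta P al (X K) (xis K) (X K w)| then eta P al (X K) (xis K) (X K w) ^+ 2 else 0)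
    <= eps.
Proof.
move=> eps0; pose C := `|x0| + 1 + (Ex P (v 0%N) + 1).
have Ev0 K : 0 <= Ex P (v K) by apply: Ex_ge0 => w; exact: v_ge0.
have C0 : 0 <= C by rewrite !addr_ge0.
have e0 : 0 < eps / (4 * ca ^+ 2) by rewrite divr_gt0// mulr_gt0// exprn_gt0.
have [A A0 HA] := UI e0.
(* Above this level [|X| > C + A]. Then [C], which covers the threshold and the centring, is
   dominated by [|X|], so that [|eta| <= 2 ca |X|] and the tail of [X] beyond [A] controls that of
   [eta]. *)
exists (ca * (2 * C + A)); first by rewrite mulr_ge0 ?(ltW ca0)// addr_ge0// mulr_ge0.
near=> K.
have K0 : (0 < K)%N by near: K; exists 1%N.
have h1 : `|x0 - xis K| <= 1.
  by near: K; have := xis_cvg; move/cvgrPdist_le => /(_ _ ltr01).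
have h2 : `|Ex P (v 0%N) - Ex P (v K)| <= 1.
  by near: K; have [] := Ex_pos_xis_cvg; move/cvgrPdist_le => /(_ _ ltr01).
have hx : `|xis K| <= `|x0| + 1.
  have : `|xis K| <= `|x0| + `|x0 - xis K|.
    by rewrite -{1}(subKr x0 (xis K)); exact: ler_normB.
  by lra.
have eb w : `|eta P al (X K) (xis K) (X K w)| <= ca * (`|X K w| + C).
  rewrite /eta -/ca -/(v K) -/(v K w) normrM (gtr0_norm ca0) ler_wpM2l ?(ltW ca0)//.
  apply: (le_trans (ler_normB _ _)); rewrite (ger0_norm (v_ge0 K w)) (ger0_norm (Ev0 K)).
  have : v K w <= `|X K w| + `|xis K|.
    by rewrite /v ge_max addr_ge0// andbT; apply: le_trans (ler_norm _) _; exact: ler_normB.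
  by move: h2; rewrite ler_norml /C => /andP[]; lra.
have meta : measurable_fun setT (fun w => eta P al (X K) (xis K) (X K w)).
  by rewrite /eta; mfun.
pose I w := if A < `|X K w| then X K w ^+ 2 else 0.
have [mXK LK2] := LX K0.
have I0 w : 0 <= I w by rewrite /I; case: ifP => // _; exact: sqr_ge0.
have LI : L1 P I.
  apply: (L1_le _ _ LK2).
    apply: mfun_if; [apply: mfun_lt; [exact: mfun_cst|by mfun]|by mfun|exact: mfun_cst].
  by move=> w; rewrite /I; case: ifP => _; rewrite ?normr0 ?sqr_ge0// ger0_norm// sqr_ge0.
pose J w := if ca * (2 * C + A) < `|eta P al (X K) (xis K) (X K w)|
  then eta P al (X K) (xis K) (X K w) ^+ 2 else 0.
have JI w : J w <= 4 * ca ^+ 2 * I w.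
  rewrite /J; case: ifP => h; last by rewrite !mulr_ge0 ?(ltW ca0).
  have h3 : 2 * C + A < `|X K w| + C by rewrite -(ltr_pM2l ca0); exact: lt_le_trans h (eb w).
  have h4 : A < `|X K w| by lra.
  rewrite /I h4 -(real_normK (num_real (eta _ _ _ _ _))) -(real_normK (num_real (X K w))).
  have h5 : `|eta P al (X K) (xis K) (X K w)| <= 2 * ca * `|X K w|.
    apply: (le_trans (eb w)); have : C <= `|X K w| by lra.
    by move=> h6; have := ler_wpM2l (ltW ca0) h6; lra.
  rewrite (_ : 4 * ca ^+ 2 * `|X K w| ^+ 2 = (2 * ca * `|X K w|) ^+ 2); last by ring.
  by rewrite lerXn2r ?nnegrE// !mulr_ge0 ?(ltW ca0).
apply: (@le_trans _ _ (Ex P (fun w => 4 * ca ^+ 2 * I w))).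
  have LI4 := L1Z (4 * ca ^+ 2) LI; apply: Ex_le => //.
  apply: (L1_le _ _ LI4).
    apply: mfun_if; [apply: mfun_lt; [exact: mfun_cst|by mfun]|by mfun|exact: mfun_cst].
  move=> w; rewrite ger0_norm; first exact: JI.
  by case: ifP => // _; exact: sqr_ge0.
rewrite ExZ// mulrC -ler_pdivlMr; last by rewrite mulr_gt0// exprn_gt0.
exact: HA.
Unshelve. all: by end_near. Qed.

End family.

(** * Moments of the nested averages *)

Section power_mean.
Context {R : realType}.

(** Jensen by induction: the mean of [n + 2] terms is a convex combination of the mean of the first
    [n + 1] and of the last term. *)
Lemma power_mean (p : R) (x : nat -> R) n : 1 <= p -> (forall k, 0 <= x k) ->
  (n.+1%:R^-1 * \sum_(k < n.+1) x k) `^ p <= n.+1%:R^-1 * \sum_(k < n.+1) x k `^ p.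
Proof.
move=> p1 x0; elim: n => [|n IH]; first by rewrite !big_ord1 invr1 !mul1r.
rewrite big_ord_recr [in leRHS]big_ord_recr/=.
set S := \sum_(k < n.+1) x k in IH *; set Sp := \sum_(k < n.+1) x k `^ p in IH *.
have n0 : 0 < n.+1%:R :> R by rewrite ltr0n.
have n1 : 0 < n.+2%:R :> R by rewrite ltr0n.
have S0 : 0 <= S by apply: sumr_ge0.
pose t : R := n.+1%:R / n.+2%:R.
have t0 : 0 <= t by rewrite divr_ge0// ltW.
have t1 : t <= 1 by rewrite /t ler_pdivrMr// mul1r ler_nat.
have tE : 1 - t = n.+2%:R^-1.
  apply: (mulIf (lt0r_neq0 n1)); rewrite mulrBl mulVf ?lt0r_neq0// mul1r /t divfK ?lt0r_neq0//.
  by rewrite -[n.+2%:R]natr1 addrAC subrr add0r.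
have tE' z : n.+2%:R^-1 * z = t * (n.+1%:R^-1 * z).
  by rewrite /t mulrA [t * _]mulrAC divff ?mul1r// gt_eqF.
have H : (t * (n.+1%:R^-1 * S) + (1 - t) * x n.+1) `^ p <=
    t * (n.+1%:R^-1 * S) `^ p + (1 - t) * x n.+1 `^ p.
  apply: (@convex_powR R p p1 (Itv01 t0 t1) (n.+1%:R^-1 * S) (x n.+1)).
    by rewrite inE/= in_itv/= andbT mulr_ge0// invr_ge0 ltW.
  by rewrite inE/= in_itv/= andbT.
rewrite !mulrDr (tE' S) (tE' Sp) -tE; apply: (le_trans H).
by rewrite lerD2r ler_wpM2l.
Qed.

End power_mean.

Section phi_moments.
Context {d} {T : measurableType d} {R : realType} (P : probability T R).
Context {dU dV} {U : measurableType dU} {V : measurableType dV}.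
Variables (Y : T -> U) (Z : T -> V) (Zs : nat -> T -> V) (phi : U -> V -> R) (delta : R).
Hypotheses (mY : measurable_fun setT Y) (mZ : measurable_fun setT Z)
  (mphi : measurable_fun setT (fun p : U * V => phi p.1 p.2))
  (indepYZ : mutually_independent P (fun b : bool => if b then sigma_of Y else sigma_of Z))
  (mZs : forall k, measurable_fun setT (Zs k)) (lawZs : forall k, same_law P (Zs k) Z)
  (indepZs : mutually_independent P
     (fun o : option nat => if o is Some k then sigma_of (Zs k) else sigma_of Y))
  (d0 : 0 < delta) (hmom : ('E_P[fun w => (`|phi (Y w) (Z w)| `^ (2 + delta))%R] < +oo)%E).

Let p : R := 2 + delta.

Let mYZ : measurable_fun setT (fun w => (Y w, Z w)).
Proof. exact: measurable_fun_pair. Qed.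
Let mYZs k : measurable_fun setT (fun w => (Y w, Zs k w)).
Proof. exact: measurable_fun_pair. Qed.

Let fY : {mfun T >-> U} := mfun_Sub (mem_set mY).
Let fZ : {mfun T >-> V} := mfun_Sub (mem_set mZ).
Let fYZ : {mfun T >-> (U * V)%type} := mfun_Sub (mem_set mYZ).
Let fYZs k : {mfun T >-> (U * V)%type} := mfun_Sub (mem_set (mYZs k)).

Let law1 C : measurable C -> (distribution P fY \x distribution P fZ)%E C = distribution P fYZ C.
Proof.
apply: product_measure_unique => A B mA mB.
have := indepYZ (J := [:: true; false]) (A := fun b => if b then Y @^-1` A else Z @^-1` B) isT.
rewrite !big_cons !big_nil setIT mule1; apply => -[] _; [by exists A|by exists B].
Qed.

Let law2 k C : measurable C -> (distribution P fY \x distribution P fZ)%E C = distribution P (fYZs k) C.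
Proof.
apply: product_measure_unique => A B mA mB.
have := indepZs (J := [:: None; Some k])
  (A := fun o => if o is Some j then Zs j @^-1` B else Y @^-1` A) isT.
rewrite !big_cons !big_nil setIT mule1 => H; apply: (etrans (H _)).
  by move=> [j|] _; [exists B|exists A].
by congr (_ * _)%E; exact: lawZs.
Qed.

(** Both pairs have the product of the laws of [Y] and [Z] as joint law. *)
Lemma ge0_integral_pair_law k (g : U * V -> \bar R) : measurable_fun setT g -> (forall x, 0 <= g x)%E ->
  (\int[P]_w g (Y w, Zs k w) = \int[P]_w g (Y w, Z w))%E.
Proof.
move=> mg g0.
transitivity (\int[distribution P (fYZs k)]_x g x)%E.
  by rewrite ge0_integral_distribution.
transitivity (\int[distribution P fYZ]_x g x)%E; last by rewrite ge0_integral_distribution.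
by apply: eq_measure_integral => A mA _; apply: etrans (law1 mA); rewrite (law2 k).
Qed.

Let mg : measurable_fun setT (fun x : U * V => (`|phi x.1 x.2| `^ p)%:E).
Proof.
apply/measurable_EFinP; apply: (@measurableT_comp _ _ _ _ _ _ (fun x : R => x `^ p)).
  exact: measurable_powR.
exact: (measurableT_comp (@normr_measurable _ setT) mphi).
Qed.

Let M : R := Ex P (fun w => `|phi (Y w) (Z w)| `^ p).

Let Lphi k : L1 P (fun w => `|phi (Y w) (Zs k w)| `^ p) /\
  Ex P (fun w => `|phi (Y w) (Zs k w)| `^ p) = M.
Proof.
have H : (\int[P]_w (`|phi (Y w) (Zs k w)| `^ p)%:E = \int[P]_w (`|phi (Y w) (Z w)| `^ p)%:E)%E.
  by apply: (@ge0_integral_pair_law k (fun x => (`|phi x.1 x.2| `^ p)%:E)) => // x; rewrite lee_fin powR_ge0.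
split; last by rewrite /M /Ex /Rintegral H.
apply/integrableP; split.
  exact: (measurableT_comp mg (mYZs k)).
under eq_integral do rewrite /= ger0_norm ?powR_ge0//.
by rewrite H; move: hmom; rewrite expectation.unlock.
Qed.

Variable X0 : T -> R.
Local Notation X K := (Xh Y Zs phi X0 K).

Let mphik k : measurable_fun setT (fun w => phi (Y w) (Zs k w)).
Proof. exact: (measurableT_comp mphi (mYZs k)). Qed.

Lemma mXh K : (0 < K)%N -> measurable_fun setT (X K).
Proof.
case: K => // K _; rewrite /Xh; apply: mfunM; first exact: mfun_cst.
exact: (@mfun_sum _ _ _ K.+1 (fun k w => phi (Y w) (Zs k w))).
Qed.

Lemma Xh_moment K : (0 < K)%N -> L1 P (fun w => `|X K w| `^ p) /\ Ex P (fun w => `|X K w| `^ p) <= M.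
Proof.
move=> K0; have mXK := mXh K0; case: K K0 mXK => // K _ mXK.
have p1 : 1 <= p by rewrite /p; move: d0; lra.
pose S w := K.+1%:R^-1 * \sum_(k < K.+1) `|phi (Y w) (Zs k w)| `^ p.
have LSu : L1 P (fun w => \sum_(k < K.+1) `|phi (Y w) (Zs k w)| `^ p).
  by apply: (@L1_sum _ _ _ P K.+1 (fun k w => `|phi (Y w) (Zs k w)| `^ p)) => k _; case: (Lphi k).
have XS w : `|X K.+1 w| `^ p <= S w.
  apply: le_trans (@power_mean R p (fun k => `|phi (Y w) (Zs k w)|) K p1 (fun k => normr_ge0 _)).
  apply: ge0_ler_powR; rewrite ?nnegrE//; first by move: p1; lra.
    by rewrite mulr_ge0 ?invr_ge0 ?ler0n//; apply: sumr_ge0.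
  rewrite normrM ger0_norm ?invr_ge0 ?ler0n// ler_wpM2l ?invr_ge0 ?ler0n//.
  exact: ler_norm_sum.
have LS : L1 P S by exact: L1Z.
have LX : L1 P (fun w => `|X K.+1 w| `^ p).
  apply: (L1_le _ _ LS); last by move=> w; rewrite ger0_norm ?powR_ge0.
  apply: (@measurableT_comp _ _ _ _ _ _ (fun x : R => x `^ p)); first exact: measurable_powR.
  exact: mfun_abs.
split => //; apply: (@le_trans _ _ (Ex P S)); first exact: Ex_le.
rewrite ExZ// (Ex_sum (F := fun k w => `|phi (Y w) (Zs k w)| `^ p)); last by move=> k _; case: (Lphi k).
rewrite (eq_bigr (fun=> M)); last by move=> k _; case: (Lphi k).
by rewrite sumr_const card_ord -[M *+ _]mulr_natl mulrA mulVf ?mul1r// pnatr_eq0.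
Qed.

Lemma L2_Xh K : (0 < K)%N -> L2 P (X K).
Proof.
move=> K0; have mXK := mXh K0; have [LK _] := Xh_moment K0; split => //.
apply: (@L1_le _ _ _ _ _ (fun w => 1 + `|X K w| `^ p)); [by mfun| |exact: L1D].
move=> w; rewrite ger0_norm ?sqr_ge0// -(real_normK (num_real (X K w))).
have [h|h] := leP (`|X K w|) 1.
  by apply: (@le_trans _ _ 1); [rewrite expr_le1|rewrite lerDl powR_ge0].
apply: (@le_trans _ _ (`|X K w| `^ p)); last by rewrite lerDr.
by rewrite -powR_mulrn//; apply: ler_powR; [exact: ltW|rewrite /p lerDl ltW].
Qed.

Lemma Xh_UI (eps : R) : 0 < eps -> exists2 A : R, 0 <= A &
  forall K, (0 < K)%N -> Ex P (fun w => if A < `|X K w| then X K w ^+ 2 else 0) <= eps.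
Proof.
move=> eps0; have M0 : 0 <= M by apply: Ex_ge0 => w; exact: powR_ge0.
have Me : 0 < (M + 1) / eps by rewrite divr_gt0// ltr_wpDl.
(* With [A^delta = (M + 1) / eps]: where [|X| > A] one has [X^2 <= A^(- delta) |X|^(2 + delta)], so
   the tail is at most [eps M / (M + 1)]. *)
pose A := ((M + 1) / eps) `^ delta^-1; have A0 : 0 < A by exact: powR_gt0.
have AE : A `^ delta = (M + 1) / eps by rewrite /A -powRrM mulVf ?gt_eqF// powRr1// ltW.
exists A; first exact: ltW.
move=> K K0; have [LK EK] := Xh_moment K0; have [mXK LK2] := L2_Xh K0.
apply: (@le_trans _ _ (Ex P (fun w => ((M + 1) / eps)^-1 * `|X K w| `^ p))).
  apply: Ex_le; last 1 first.
  - move=> w; case: ifP => h; last by rewrite mulr_ge0 ?powR_ge0// invr_ge0 ltW.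
    rewrite mulrC ler_pdivlMr// -AE -(real_normK (num_real (X K w))) /p.
    have X0' : 0 < `|X K w| := lt_trans A0 h.
    rewrite powRD; last by rewrite (gt_eqF X0') implybT.
    rewrite powR_mulrn// ler_wpM2l ?sqr_ge0//; apply: ge0_ler_powR; rewrite ?nnegrE ?(ltW d0) ?(ltW A0)//.
    exact: ltW.
  - apply: (L1_le _ _ LK2).
      apply: mfun_if; [apply: mfun_lt; [exact: mfun_cst|by mfun]|by mfun|exact: mfun_cst].
    by move=> w; case: ifP => _; rewrite ?normr0 ?sqr_ge0// ger0_norm// sqr_ge0.
  - exact: L1Z.
rewrite ExZ// mulrC ler_pdivrMr// mulrCA divff ?gt_eqF// mulr1.
by apply: (le_trans EK); rewrite lerDl.
Qed.

End phi_moments.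

(** * Gaussian vectors and variance weights *)

Section gauss_plane.
Context {R : realType}.
Local Notation N01 := (@normal_prob R 0 1).

Definition N2 := (N01 \x N01)%E.

HB.instance Definition _ := Measure.on N2.

Let N2_setT : N2 setT = 1%E.
Proof.
rewrite /N2 -setXTT product_measure1E//; rewrite [X in (X * _)%E]probability_setT mul1e.
exact: probability_setT.
Qed.

HB.instance Definition _ := Measure_isProbability.Build _ _ _ N2 N2_setT.

Let fubini (h : R * R -> R) : measurable_fun setT h -> (exists M, forall p, `|h p| <= M) ->
  (Ex N2 h)%:E = (\int[N01]_z1 \int[N01]_z2 (h (z1, z2))%:E)%E.
Proof.
move=> mh [M hM]; have Lh : L1 N2 h by apply: (@L1_bnd _ _ _ _ _ M).
by rewrite -(Ex_fin Lh) (integral12_prod_meas1 Lh).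
Qed.

Let mlin2 (a b : R) : measurable_fun setT (fun z : R * R => a * z.1 + b * z.2).
Proof.
by apply: mfunD; apply: mfunM; [exact: mfun_cst|exact: measurable_fst|exact: mfun_cst|exact: measurable_snd].
Qed.

Definition lmap2 (l11 l12 l21 l22 : R) (z : R * R) : R * R :=
  (l11 * z.1 + l12 * z.2, l21 * z.1 + l22 * z.2).

Lemma measurable_lmap2 l11 l12 l21 l22 : measurable_fun setT (lmap2 l11 l12 l21 l22).
Proof. by apply: measurable_fun_pair; exact: mlin2. Qed.

Lemma gauss2_expectE (l11 l12 l21 l22 : R) (g : R * R -> R) : measurable_fun setT g ->
  (exists M, forall p, `|g p| <= M) ->
  gauss2_expect l11 l12 l21 l22 g = (Ex N2 (fun z => g (lmap2 l11 l12 l21 l22 z)))%:E.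
Proof.
move=> mg [M gM]; rewrite fubini//; last by exists M => p.
exact: (measurableT_comp mg (measurable_lmap2 _ _ _ _)).
Qed.

(** [gcosE] is applied twice; in the inner integral the phase is [a * z1 + th]. *)
Lemma N2_cos (a b th : R) : Ex N2 (fun z : R * R => cos (a * z.1 + b * z.2 + th)) =
  expR (- ((a ^+ 2 + b ^+ 2) / 2)) * cos th.
Proof.
apply: EFin_inj; rewrite fubini; last 2 first.
- by apply: (measurableT_comp (continuous_measurable_fun (@continuous_cos R))); apply: mfunD; [exact: mlin2|exact: mfun_cst].
- by exists 1 => p; exact: cos_max.
have mc (c0 s : R) : measurable_fun setT (fun z : R => cos (s * z + c0)).
  apply: mfun_continuous => x; apply: continuous_comp; last exact: continuous_cos.
  by apply: cvgD; [apply: cvgMr; exact: cvg_id|exact: cvg_cst].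
have Lc (c0 s : R) : L1 N01 (fun z : R => cos (s * z + c0)).
  by apply: (@L1_bnd _ _ _ _ _ 1); [exact: mc|move=> z; exact: cos_max].
transitivity (\int[N01]_z1 (expR (- (b ^+ 2 / 2)) * cos (a * z1 + th))%:E)%E.
  apply: eq_integral => z1 _.
  rewrite -(gcosE (a * z1 + th) b) /gcos -(Ex_fin (Lc _ _)).
  by apply: eq_integral => z2 _; congr (cos _)%:E; rewrite /= addrA; congr (_ + _); exact: addrC.
rewrite (Ex_fin (L1Z _ (Lc _ _))) ExZ//; congr (_%:E).
have := gcosE th a; rewrite /gcos => ->.
by rewrite mulrA -expRD; congr (expR _ * _); ring.
Qed.

End gauss_plane.

Section variance_sum.
Context {d} {T : measurableType d} {R : realType} (P : probability T R).
Variables (x0 : T -> R) (xs : nat -> T -> R) (X : T -> R) (y : nat -> R -> R).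
Hypotheses (mx0 : measurable_fun setT x0) (mxs : forall n, measurable_fun setT (xs n))
  (mX : measurable_fun setT X) (xsX : forall n, same_law P (xs n) X)
  (indep : mutually_independent P
    (fun o : option nat => if o is Some n then sigma_of (xs n) else sigma_of x0))
  (my : forall k, measurable_fun setT (y k)) (LX : forall k, L2 P (fun w => y k (X w)))
  (Ey : forall k, Ex P (fun w => y k (X w)) = 0).

Let S n w := \sum_(k < n) y k (xs k w).

Let mS n : measurable_fun setT (S n).
Proof. by apply: (@mfun_sum _ _ _ n (fun k w => y k (xs k w))) => k; exact: measurableT_comp. Qed.

Let S_indep n : indep_rv P (S n) (xs n).
Proof.
apply: (@chain_indep _ _ _ P _ _ x0 xs S (fun=> 0) (fun n p => p.1 + y n p.2)) => //.
- move=> k; apply: mfunD; first exact: measurable_fst.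
  by apply: measurableT_comp => //; exact: measurable_snd.
- by move=> w; rewrite /S big_ord0.
- by move=> k w; rewrite /S big_ord_recr.
Qed.

Let Lxs k : L2 P (fun w => y k (xs k w)).
Proof.
have myx : measurable_fun setT (fun w => y k (xs k w)) by exact: measurableT_comp.
split => //; have [_ Lk] := LX k.
pose fx : {mfun T >-> R} := mfun_Sub (mem_set (mxs k)).
pose fX : {mfun T >-> R} := mfun_Sub (mem_set mX).
have H : (\int[P]_w (y k (xs k w) ^+ 2)%:E = \int[P]_w (y k (X w) ^+ 2)%:E)%E.
  have mg : measurable_fun setT (fun x => (y k x ^+ 2)%:E).
    by apply/measurable_EFinP; exact: mfunX.
  transitivity (\int[distribution P fx]_x (y k x ^+ 2)%:E)%E.
    by rewrite ge0_integral_distribution// => x; rewrite lee_fin sqr_ge0.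
  transitivity (\int[distribution P fX]_x (y k x ^+ 2)%:E)%E.
    by apply: eq_measure_integral => A mA _; exact: xsX.
  by rewrite ge0_integral_distribution// => x; rewrite lee_fin sqr_ge0.
apply/integrableP; split; first by apply/measurable_EFinP; exact: mfunX.
under eq_integral do rewrite /= ger0_norm ?sqr_ge0//.
rewrite H; case/integrableP : Lk => _.
by under eq_integral do rewrite /= ger0_norm ?sqr_ge0//.
Qed.

(** Centred independent summands are orthogonal. The second moments obtained here serve for
    tightness. *)
Lemma variance_sum n : L2 P (S n) /\
  Ex P (fun w => S n w ^+ 2) = \sum_(k < n) Ex P (fun w => y k (X w) ^+ 2).
Proof.
elim: n => [|n [LS IH]].
  have -> : S 0%N = fun=> 0 by apply/funext => w; rewrite /S big_ord0.
  by rewrite big_ord0; split; [exact: L2_cst|rewrite (@eq_Ex _ _ _ P _ (fun=> 0)) ?Ex_cst// => w; rewrite expr0n].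
have SE w : S n.+1 w = S n w + y n (xs n w) by rewrite /S big_ord_recr.
have LS1 : L2 P (S n.+1).
  have -> : S n.+1 = fun w => S n w + y n (xs n w) by apply/funext.
  exact: L2D.
split => //.
have [_ LS2] := LS; have [_ Ly2] := LX n; have Ly1 := L2_L1 (LX n).
pose psi (p : R * R) := (p.1 + y n p.2) ^+ 2.
have mpsi : measurable_fun setT psi.
  apply: mfunX; apply: mfunD; first exact: measurable_fst.
  by apply: (measurableT_comp (my n)); exact: measurable_snd.
have Lpsi : L1 P (fun w => psi (S n w, xs n w)).
  by case: LS1 => _; apply: eq_L1 => w; rewrite SE.
have [||Lh E] := @Ex_indep _ _ _ P _ _ (S n) (xs n) X (mS n) (mxs n) mX (xsX n) (@S_indep n)
  psi (fun u => u ^+ 2 + Ex P (fun w => y n (X w) ^+ 2)) mpsi Lpsi.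
- by move=> u; case: (L2D (L2_cst P u) (LX n)).
- move=> u; rewrite (@eq_Ex _ _ _ P _ (fun w => (u ^+ 2 + 2 * u * y n (X w)) + y n (X w) ^+ 2)).
    rewrite ExD//; last by apply: L1D => //; exact: L1Z.
    by rewrite ExD//; [rewrite Ex_cst ExZ// Ey mulr0 addr0|exact: L1Z].
  by move=> w; rewrite /psi/=; ring.
rewrite big_ord_recr/= -IH.
transitivity (Ex P (fun w => psi (S n w, xs n w))); first by apply: eq_Ex => w; rewrite SE.
by rewrite E /comp ExD// Ex_cst.
Qed.

End variance_sum.

(** * Weights of the linearized recursion *)

Section weights.
Context {R : realType}.
Variables (g1 b q : R).
Hypotheses (g10 : 0 < g1) (b12 : 1 / 2 < b) (b1 : b <= 1) (q0 : 0 < q)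
  (qg : b = 1 -> 1 < q / 2 * g1).
Local Notation gam := (gam g1 b).

(** For [k < n] this is [gam (k+1)] times the product of [1 - q gam j] over [k + 1 < j <= n]: up to
    sign, the weight of sample [k + 1] in the linearized iterate. *)
Fixpoint cf (n k : nat) : R :=
  if n is n'.+1 then (if k == n' then gam n else (1 - q * gam n) * cf n' k) else 0.

(** One recursion for the sums of the weights, of their squares and of their absolute cubes. *)
Let cf_sum (F : R -> R) n : F 0 = 0 -> (forall x y, F (x * y) = F x * F y) ->
  \sum_(k < n.+1) F (cf n.+1 k) = F (1 - q * gam n.+1) * \sum_(k < n) F (cf n k) + F (gam n.+1).
Proof.
move=> F0 FM; rewrite big_ord_recr/= eqxx; congr (_ + _).
rewrite mulr_sumr; apply: eq_bigr => k _; rewrite ltn_eqF//; exact: FM.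
Qed.

Let gc : (fun n => gam n.+1) @ \oo --> 0. Proof. exact: gam_cvg0. Qed.

Lemma cf_sum_cvg : (fun n => \sum_(k < n) cf n k) @ \oo --> q^-1.
Proof.
rewrite -[q^-1]mul1r; apply: (@rec_cvg _ (fun n => gam n.+1) _ (fun=> 1) (fun=> q)) => //.
- by move=> k; exact: gam_ge0.
- exact: gam_sum.
- exact: cvg_cst.
- exact: cvg_cst.
- by apply: nearW => k; rewrite (cf_sum (F := id))// mulr1.
Qed.

Let ind : R := if b == 1 then g1^-1 else 0.

Let ind_lt : ind < q.
Proof.
rewrite /ind; case: eqP => // /qg h; rewrite -[ltLHS]mul1r ltr_pdivrMr//.
by apply: (lt_trans h); rewrite ltr_pM2r// gtr_pMr// invf_lt1// ltr1n.
Qed.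

(** Divided by [gam n], the sum obeys a recursion with source 1. Its rate tends to [2 q - ind]: the
    square doubles [q], and [ind] is the limiting relative decrease of the steps per unit of
    step. *)
Lemma cf_sqr_sum_cvg : (fun n => (\sum_(k < n) cf n k ^+ 2) / gam n) @ \oo --> (2 * q - ind)^-1.
Proof.
have l0 : 0 < 2 * q - ind by have := ind_lt; have := q0; lra.
rewrite -cvg_shiftS -[(2 * q - ind)^-1]mul1r.
pose rr n := gam n.+1 / gam n.+2.
pose G n := - ((rr n - 1) / gam n.+2) + (2 * q - q ^+ 2 * gam n.+2) * rr n.
have gS : (fun n => gam n.+2) @ \oo --> 0 by rewrite (cvg_shiftS (fun n => gam n.+1)).
have rc : (fun n => (rr n - 1) / gam n.+2) @ \oo --> ind by exact: gam_ratio_cvg.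
have rr1 : rr @ \oo --> (1 : R).
  have -> : rr = fun n => 1 + (rr n - 1) / gam n.+2 * gam n.+2.
    by apply/funext => n; rewrite divfK ?gt_eqF ?gam_gt0// addrC subrK.
  rewrite -[X in _ --> X]addr0; apply: cvgD; first exact: cvg_cst.
  by rewrite -[X in _ --> X](mulr0 ind); exact: cvgM.
have Gc : G @ \oo --> 2 * q - ind.
  rewrite addrC -[X in _ --> _ + X]mulr1; apply: cvgD; first exact: cvgN.
  apply: cvgM => //; rewrite -[X in _ --> X]subr0; apply: cvgB; first exact: cvg_cst.
  by rewrite -[X in _ --> X](mulr0 (q ^+ 2)); exact: cvgMr.
apply: (@rec_cvg _ (fun n => gam n.+2) _ (fun=> 1) G) => //.
- by move=> k; exact: gam_ge0.
- move=> B; have [N _ HN] := gam_sum g10 b1 (B + gam 1).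
  exists N => // n /= Nn; have := HN n.+1 (leqW Nn).
  by rewrite big_ord_recl [leLHS]addrC lerD2l.
- exact: cvg_cst.
- apply: nearW => n.
  have E : \sum_(k < n.+2) cf n.+2 k ^+ 2 =
      (1 - q * gam n.+2) ^+ 2 * (\sum_(k < n.+1) cf n.+1 k ^+ 2) + gam n.+2 ^+ 2.
    by apply: (cf_sum (F := fun x => x ^+ 2)); [rewrite expr0n|move=> *; rewrite exprMn].
  rewrite [LHS](_ : _ = (\sum_(k < n.+2) cf n.+2 k ^+ 2) / gam n.+2)// E mulr1 /G /rr; set w := \sum_(k < _) _.
  have h1 := gam_gt0 b g10 n; have h2 := gam_gt0 b g10 n.+1.
  rewrite [X in _ = _ * X + _](_ : _ = w / gam n.+1)//.
  by field; rewrite !gt_eqF.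
Qed.

(** Lyapunov condition for the weights: at [n = K^2] the factor [h^(- 3 b)] is of order
    [gam^(- 3/2)], so the scaled sum of cubes is [O(sqrt gam)]. *)
Lemma cf_cube_sum_le : exists2 C : R, 0 <= C &
  \forall n \near \oo, \sum_(k < n) `|cf n k| ^+ 3 <= C * gam n ^+ 2.
Proof.
have [N _ [N0 HN]] := @sa_start_rank _ g1 b q g10 b12 b1 q0 qg 0.
have gN k : (N <= k)%N -> 0 < gam k.
  by case: k => [|k] Nk; [move: N0; rewrite ltnNge Nk|exact: gam_gt0].
pose x n := (\sum_(k < n) `|cf n k| ^+ 3) / gam n ^+ 2.
have x0 n : 0 <= x n by rewrite divr_ge0 ?sqr_ge0// sumr_ge0// => k _; rewrite exprn_ge0.
pose C := Num.max (x N) (1 / q).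
have C0 : 0 <= C by rewrite le_max x0.
exists C => //; exists N => // n /= Nn.
rewrite -ler_pdivrMr ?exprn_gt0 ?gN//.
apply: (@rec_le_bounded _ (fun n => gam n.+1) x q C 1 N) => //; [by move=> k _; exact: gam_ge0|by move=> k /HN[]| | |].
- move=> k Nk; have [h1 h2] := HN k Nk; rewrite /x.
  rewrite (cf_sum (F := fun x => `|x| ^+ 3)) ?normr0 ?expr0n//; last by move=> *; rewrite normrM exprMn.
  have gk := gN k Nk; have gk1 := gam_gt0 b g10 k.
  have Sz : 0 <= \sum_(k0 < k) `|cf k k0| ^+ 3 by apply: sumr_ge0 => j _; rewrite exprn_ge0.
  move: (\sum_(k0 < k) _) Sz => S S0.
  rewrite ger0_norm ?subr_ge0// (ger0_norm (ltW gk1)).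
  move: h1 h2; set g := gam k.+1 in gk1 *; set g' := gam k in gk *.
  move=> h1 h2; have t0 : 0 < q * g by rewrite mulr_gt0.
  rewrite mulrDl mulr1 (_ : g ^+ 3 / g ^+ 2 = g); last by field; rewrite gt_eqF.
  rewrite lerD2r.
  have h3 : (1 - q * g) * g' <= g.
    apply: (@le_trans _ _ ((1 - q * g) * ((1 + q / 2 * g) * g))); first by rewrite ler_wpM2l ?subr_ge0.
    rewrite mulrA ler_piMl ?ltW//; have := sqr_ge0 (q * g).
    by rewrite (_ : q / 2 * g = q * g / 2); [move: (q * g) t0 => t t0; nra|field].
  rewrite ler_pdivrMr ?exprn_gt0// -[leRHS]mulrA.
  have -> : (1 - q * g) ^+ 3 * S = (1 - q * g) * (S / g' ^+ 2 * ((1 - q * g) * g') ^+ 2).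
    by field; rewrite gt_eqF.
  apply: ler_wpM2l; first by rewrite subr_ge0.
  apply: ler_wpM2l; first by rewrite divr_ge0 ?sqr_ge0.
  by rewrite lerXn2r ?nnegrE ?(ltW gk1)// mulr_ge0 ?(ltW gk)// subr_ge0.
- by rewrite le_max lexx.
- by rewrite le_max lexx orbT.
Qed.

End weights.

Lemma linE {d} {T : measurableType d} {R : realType} (al g1 b : R) (Xn : nat -> T -> R) xst q n w :
  lin al g1 b Xn xst q n w = - \sum_(k < n) cf g1 b q n k * H1 al xst (Xn k.+1 w).
Proof.
elim: n => [|n IH]; first by rewrite big_ord0 oppr0.
rewrite big_ord_recr/= eqxx IH mulrN -opprD mulr_sumr; congr (- (_ + _)).
by apply: eq_bigr => k _; rewrite ltn_eqF// mulrA.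
Qed.

Lemma scale_sqrt_gam {R : realType} (g1 b : R) K : 0 < g1 -> (0 < K)%N ->
  hK K `^ (- b) * Num.sqrt (gam g1 b (K ^ 2)%N) = Num.sqrt g1.
Proof.
move=> g10 K0; have h := gam_norm g1 b K0.
by rewrite -[in RHS]h [in RHS]sqrtrM ?sqr_ge0// sqrtr_sqr ger0_norm// powR_ge0.
Qed.

Lemma hK_cvg0 {R : realType} : (fun K => hK K : R) @ \oo --> 0.
Proof. by rewrite /hK -cvg_shiftS; exact: cvg_harmonic. Qed.

Lemma cvg_sqr_index {R : realType} (u : nat -> R) (l : R) : u @ \oo --> l -> (fun K => u (K ^ 2)%N) @ \oo --> l.
Proof.
move=> ul; apply: cvg_comp ul => A [N _ HN]; exists N => // K /= NK.
by apply: HN => /=; rewrite (leq_trans NK)// -mulnn; case: (K) => // k; rewrite leq_pmulr.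
Qed.

(** For [h > 0] the product is [h^(1 - b)]. It multiplies the covariance of the two scaled
    coordinates, whence the indicator off the diagonal of [Sigma]. *)
Lemma scale_cross_cvg {R : realType} (g1 b : R) : 0 < g1 -> 1 / 2 < b -> b <= 1 ->
  (fun K => hK K `^ (- b) * hK K) @ \oo --> (if b == 1 then 1 else 0 : R).
Proof.
move=> g10 b12 b1; case: eqP => [->|/eqP bn1].
  apply: cvg_near_cst; exists 1%N => // K /= K0.
  have hK0 : 0 < hK K :> R by rewrite invr_gt0 ltr0n.
  by rewrite powRN powRr1 ?(ltW hK0)// mulVf// gt_eqF.
apply/cvgrPdist_le => eps eps0; rewrite /= in eps0.
have t0 : 0 < eps ^+ 2 / g1 by rewrite divr_gt0// exprn_gt0.
have [N _ HN] : \forall n \near \oo, n.+1%:R^-1 <= eps ^+ 2 / g1 * gam g1 b n.+2.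
  by apply: inv_nat_le_gam => // bb; rewrite bb eqxx in bn1.
exists N.+1 => // K /= K0; have K1 : (0 < K)%N := leq_trans (ltn0Sn _) K0.
rewrite sub0r normrN ger0_norm ?mulr_ge0 ?powR_ge0 ?invr_ge0 ?ler0n//.
rewrite -(@ler_pXn2r _ 2)// ?nnegrE ?mulr_ge0 ?powR_ge0 ?invr_ge0 ?ler0n ?(ltW eps0)//.
have n0 : (0 < K ^ 2)%N by rewrite expn_gt0 K1.
have NK : (N <= (K ^ 2).-1)%N.
  by rewrite -ltnS prednK// (leq_trans K0)// -mulnn leq_pmulr.
have := HN _ NK; rewrite prednK// => h.
have gm : gam g1 b (K ^ 2).+1 <= gam g1 b (K ^ 2).
  have := gam_ratio_ge1 g10 b12 (K ^ 2).-1.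
  by rewrite prednK// ler_pdivlMr ?gam_gt0// mul1r.
have E := gam_norm g1 b K1.
have hE : hK K ^+ 2 = (K ^ 2)%:R^-1 :> R by rewrite /hK exprVn natrX.
(* The square of the product is [h^(- 2 b) / n] with [n = K^2], compared with
   [h^(- 2 b) gam n = g1]. *)
rewrite exprMn hE; apply: (@le_trans _ _ (hK K `^ (- b) ^+ 2 * (eps ^+ 2 / g1 * gam g1 b (K ^ 2)))).
  rewrite ler_wpM2l ?sqr_ge0//; apply: (le_trans h).
  by rewrite ler_wpM2l// ltW.
rewrite (_ : _ * (_ * _) = hK K `^ (- b) ^+ 2 * gam g1 b (K ^ 2) * (eps ^+ 2 / g1)); last by ring.
by rewrite E mulrC divfK// gt_eqF.
Qed.

(** * The limit law *)

Lemma cvg_scale {R : realType} (k l : R) (u : nat -> R) : u @ \oo --> l -> (fun K => k * u K) @ \oo --> k * l.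
Proof. by move=> ul; exact: cvgMr. Qed.
Arguments cvg_scale {R} k {l u} _.

Section limit_law.
Context {d} {T : measurableType d} {R : realType} (P : probability T R).
Variables (al g1 b q r L MF Lv M0 : R).
Hypotheses (al01 : 0 < al < 1) (g10 : 0 < g1) (b12 : 1 / 2 < b) (b1 : b <= 1)
  (q0 : 0 < q) (r0 : 0 < r) (r1 : r <= 1) (L0 : 0 <= L) (MF0 : 0 <= MF) (Lv0 : 0 <= Lv)
  (M00 : 0 <= M0) (qg : b = 1 -> 1 < q / 2 * g1).
Variables (X : nat -> T -> R) (xis : nat -> R) (Xn : nat -> nat -> T -> R) (xi0 : nat -> T -> R)
  (dq : nat -> R).

Local Notation nu K x := (H1 al (xis K) x).
Local Notation et K x := (eta P al (X K) (xis K) x).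
Local Notation gam := (gam g1 b).

Variables (V1 C12 V2 : R).
Hypotheses
  (Hsys : \forall K \near \oo, sa_sys P al q r L MF Lv M0 (xi0 K) (Xn K) (X K) (xis K) (dq K))
  (dq0 : dq @ \oo --> 0)
  (Hnu : (fun K => Ex P (fun w => nu K (X K w) ^+ 2)) @ \oo --> V1)
  (Hnue : (fun K => Ex P (fun w => nu K (X K w) * et K (X K w))) @ \oo --> C12)
  (Het : (fun K => Ex P (fun w => et K (X K w) ^+ 2)) @ \oo --> V2)
  (Let : \forall K \near \oo, L2 P (fun w => et K (X K w)))
  (HUI : forall eps : R, 0 < eps -> exists2 B : R, 0 <= B & \forall K \near \oo,
    Ex P (fun w => if B < `|et K (X K w)| then et K (X K w) ^+ 2 else 0) <= eps).

Let c : R := 1 + (1 - al)^-1.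
Let c0 : 0 < c. Proof. by rewrite addr_gt0// invr_gt0; case/andP: al01 => ? ?; rewrite subr_gt0. Qed.

Let kap K : R := hK K `^ (- b).
Let hh K : R := hK K.
Let kap_ge0 K : 0 <= kap K. Proof. exact: powR_ge0. Qed.
Let hh_ge0 K : 0 <= hh K. Proof. by rewrite invr_ge0. Qed.
Let hh_sqr K : (0 < K)%N -> (K ^ 2)%:R * hh K ^+ 2 = 1.
Proof. by move=> K0; rewrite /hh /hK exprVn natrX divff// expf_neq0// pnatr_eq0 -lt0n. Qed.

Let cfK K k := cf g1 b q (K ^ 2) k.

(** Cramer-Wold: one summand of the combination of the two scaled coordinates with coefficients [s]
    and [t]. The minus sign comes from [linE]. *)
Let yy s t K k (x : R) := - (s * kap K * cfK K k) * nu K x + (t * hh K) * et K x.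

Let Lsum s t K w := \sum_(k < K ^ 2) yy s t K k (Xn K k.+1 w).

Let LsumE s t K w : Lsum s t K w = s * (kap K * lin al g1 b (Xn K) (xis K) q (K ^ 2) w) +
  t * (hh K * \sum_(j < K ^ 2) et K (Xn K j.+1 w)).
Proof.
rewrite /Lsum /yy linE big_split/=; congr (_ + _); last by rewrite !mulr_sumr; apply: eq_bigr => j _; rewrite mulrA.
rewrite !mulrN !mulr_sumr -sumrN; apply: eq_bigr => j _; rewrite /cfK; ring.
Qed.

Let vv s t K := \sum_(k < K ^ 2) Ex P (fun w => yy s t K k (X K w) ^+ 2).

Let met K : measurable_fun setT (fun x : R => et K x).
Proof. by rewrite /eta; mfun. Qed.

Let mnu K : measurable_fun setT (fun x : R => nu K x).
Proof. by apply: mfun_H1; [exact: mfun_cst|exact: measurable_id]. Qed.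

Let Lnu K : measurable_fun setT (X K) -> L2 P (fun w => nu K (X K w)).
Proof.
move=> mXK; apply: (@L2_bnd _ _ _ _ _ c); last by move=> w; exact: H1_le.
by apply: mfun_H1 => //; exact: mfun_cst.
Qed.

Let myy s t K k : measurable_fun setT (yy s t K k).
Proof. by apply: mfunD; apply: mfunM => //; exact: mfun_cst. Qed.

Let Lyy s t K k : measurable_fun setT (X K) -> L2 P (fun w => et K (X K w)) ->
  L2 P (fun w => yy s t K k (X K w)).
Proof. by move=> mXK LK; apply: L2D; apply: L2Z => //; exact: Lnu. Qed.

Let Eet K : L1 P (X K) -> Ex P (fun w => et K (X K w)) = 0.
Proof.
move=> LX; have Lp : L1 P (fun w => Num.max (X K w - xis K) 0).
  apply: (@L1_le _ _ _ _ _ (fun w => `|X K w| + `|xis K|)).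
  - by have mX := L1_meas LX; mfun.
  - by move=> w; apply: le_trans (ler_normB _ _); rewrite /Num.max; case: ifP; rewrite ?normr0.
  - by apply: L1D => //; exact: L1_abs.
rewrite /eta ExZ; last exact: L1B.
by rewrite ExB// Ex_cst subrr mulr0.
Qed.

Let Eyy s t K k : L1 P (X K) -> L2 P (fun w => et K (X K w)) -> Vp P al (X K) (xis K) = 0 ->
  Ex P (fun w => yy s t K k (X K w)) = 0.
Proof.
move=> LX LK H; have LN := L2_L1 (Lnu (L1_meas LX)); have LE := L2_L1 LK.
rewrite /yy ExD; [|exact: L1Z..].
by rewrite (ExZ _ LN) (ExZ _ LE) Eet// mulr0 addr0 -/(Vp P al (X K) (xis K)) H mulr0.
Qed.

Let vvE s t K : (0 < K)%N -> measurable_fun setT (X K) -> L2 P (fun w => et K (X K w)) ->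
  vv s t K = s ^+ 2 * (kap K ^+ 2 * \sum_(k < K ^ 2) cfK K k ^+ 2) * Ex P (fun w => nu K (X K w) ^+ 2)
   - 2 * s * t * (kap K * hh K) * (\sum_(k < K ^ 2) cfK K k) * Ex P (fun w => nu K (X K w) * et K (X K w))
   + t ^+ 2 * Ex P (fun w => et K (X K w) ^+ 2).
Proof.
move=> K0 mXK LK; have LN := Lnu mXK; have [_ LN2] := LN; have [_ LE2] := LK.
have LNE := L2_L1M LN LK.
set E1 := Ex P (fun w => nu K (X K w) ^+ 2); set E12 := Ex P (fun w => nu K (X K w) * et K (X K w)).
set E2 := Ex P (fun w => et K (X K w) ^+ 2).
have E k : Ex P (fun w => yy s t K k (X K w) ^+ 2) = s ^+ 2 * kap K ^+ 2 * E1 * cfK K k ^+ 2 +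
    (- (2 * s * t * (kap K * hh K) * E12)) * cfK K k + t ^+ 2 * hh K ^+ 2 * E2.
  rewrite (@eq_Ex _ _ _ P _ (fun w => ((s * kap K * cfK K k) ^+ 2 * nu K (X K w) ^+ 2 +
    (- (2 * (s * kap K * cfK K k) * (t * hh K))) * (nu K (X K w) * et K (X K w))) + (t * hh K) ^+ 2 * et K (X K w) ^+ 2)).
    rewrite ExD; [|by apply: L1D; exact: L1Z|exact: L1Z].
    rewrite ExD; [|exact: L1Z|exact: L1Z].
    by rewrite !ExZ// -/E1 -/E12 -/E2; ring.
  by move=> w; rewrite /yy; ring.
rewrite /vv (eq_bigr _ (fun (k : 'I_(K ^ 2)) _ => E k)) !big_split/= -!mulr_sumr sumr_const card_ord -[E2 *+ _]mulr_natl.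
have := hh_sqr K0; set h2 := hh K ^+ 2; set N := (K ^ 2)%:R => h.
rewrite (_ : t ^+ 2 * h2 * (N * E2) = t ^+ 2 * (N * h2) * E2); last by ring.
by rewrite h; ring.
Qed.

Let ind : R := if b == 1 then g1^-1 else 0.
Let ind01 : R := if b == 1 then 1 else 0.

(** Variance of the limiting combination; the minus sign of the cross term, inherited from [yy],
    meets a value [C12] that is nonpositive in the application. *)
Definition lim_var (s t : R) : R := s ^+ 2 * (g1 / (2 * q - ind)) * V1
  - 2 * s * t * ind01 * q^-1 * C12 + t ^+ 2 * V2.

Let kap_cf_sqr : (fun K => kap K ^+ 2 * \sum_(k < K ^ 2) cfK K k ^+ 2) @ \oo --> g1 / (2 * q - ind).
Proof.
have H := cvg_sqr_index (cf_sqr_sum_cvg g10 b12 b1 q0 qg).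
have := cvg_scale g1 H; apply: cvg_trans; apply: near_eq_cvg.
near=> K; have K0 : (0 < K)%N by near: K.
have g0 : gam (K ^ 2) != 0 by rewrite gt_eqF// -[(K ^ 2)%N]prednK ?expn_gt0 ?K0// gam_gt0.
by rewrite /= -[X in X * _](gam_norm g1 b K0) -/(kap K) -mulrA [gam _ * _]mulrCA mulfV// mulr1.
Unshelve. all: by end_near. Qed.

Let vv_cvg s t : vv s t @ \oo --> lim_var s t.
Proof.
have H1 := kap_cf_sqr; have H2 := cvg_sqr_index (cf_sum_cvg g10 b12 b1 q0).
have H3 := scale_cross_cvg g10 b12 b1.
have : (fun K => s ^+ 2 * (kap K ^+ 2 * \sum_(k < K ^ 2) cfK K k ^+ 2) * Ex P (fun w => nu K (X K w) ^+ 2)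
   - 2 * s * t * (kap K * hh K) * (\sum_(k < K ^ 2) cfK K k) * Ex P (fun w => nu K (X K w) * et K (X K w))
   + t ^+ 2 * Ex P (fun w => et K (X K w) ^+ 2)) @ \oo --> lim_var s t.
  apply: cvgD; last exact: cvgMr.
  apply: cvgB; first by apply: cvgM => //; exact: cvgMr.
  by apply: cvgM => //; apply: cvgM => //; exact: cvgMr.
apply: cvg_trans; apply: near_eq_cvg; near=> K; rewrite vvE//; first by near: K.
- by have [] : sa_sys P al q r L MF Lv M0 (xi0 K) (Xn K) (X K) (xis K) (dq K) by near: K.
- by near: K.
Unshelve. all: by end_near. Qed.

Let cube s K := \sum_(k < K ^ 2) `|s * kap K * cfK K k| ^+ 3.

Let cube_cvg0 s : cube s @ \oo --> 0.
Proof.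
have [C C0 HC] := cf_cube_sum_le g10 b12 b1 q0 qg.
have Hs : (fun K => `|s| ^+ 3 * (C * Num.sqrt g1 ^+ 3) * Num.sqrt (gam (K ^ 2))) @ \oo --> 0.
  rewrite -[X in _ --> X](mulr0 (`|s| ^+ 3 * (C * Num.sqrt g1 ^+ 3))); apply: cvgMr.
  apply: (@cvg_sqr_index _ (fun n => Num.sqrt (gam n))).
  rewrite -[X in _ --> X]sqrtr0; apply: continuous_cvg; first exact: sqrt_continuous.
  by rewrite -cvg_shiftS; exact: gam_cvg0.
apply: (@squeeze_cvgr _ _ _ _ (fun=> 0) (fun K => `|s| ^+ 3 * (C * Num.sqrt g1 ^+ 3) * Num.sqrt (gam (K ^ 2)))) => //; last exact: cvg_cst.
have HC2 : \forall K \near \oo, \sum_(k < K ^ 2) `|cfK K k| ^+ 3 <= C * gam (K ^ 2) ^+ 2.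
  have [N _ HN] := HC; exists N => // K /= NK; apply: HN => /=.
  by rewrite (leq_trans NK)// -mulnn; case: (K) => // k; rewrite leq_pmulr.
near=> K; have K0 : (0 < K)%N by near: K.
rewrite sumr_ge0/=; last by move=> k _; exact: exprn_ge0.
rewrite /cube (eq_bigr (fun k : 'I_(K ^ 2) => (`|s| ^+ 3 * kap K ^+ 3) * `|cfK K k| ^+ 3)); last first.
  by move=> k _; rewrite !normrM (ger0_norm (kap_ge0 K)) !exprMn.
rewrite -mulr_sumr; apply: (@le_trans _ _ (`|s| ^+ 3 * kap K ^+ 3 * (C * gam (K ^ 2) ^+ 2))).
  rewrite ler_wpM2l ?mulr_ge0 ?exprn_ge0//; near: K; exact: HC2.
have g0 : 0 <= gam (K ^ 2) by exact: gam_ge0.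
rewrite -{1}(sqr_sqrtr g0) -(scale_sqrt_gam b g10 K0) -/(kap K).
by rewrite le_eqVlt; apply/orP; left; apply/eqP; ring.
Unshelve. all: by end_near. Qed.

Let err s t K := \sum_(k < K ^ 2) (4 * Ex P (fun w => mcub (yy s t K k (X K w))) +
  Ex P (fun w => yy s t K k (X K w) ^+ 2) ^+ 2 / 4).

Let mcub_nu a K w : mcub (a * nu K (X K w)) <= c ^+ 3 * `|a| ^+ 3.
Proof.
rewrite /mcub ge_min; apply/orP; right; rewrite normrM exprMn mulrC ler_wpM2r ?exprn_ge0//.
by rewrite lerXn2r ?nnegrE ?(ltW c0)// H1_le.
Qed.

Let mcub_et a B K w : 0 <= B -> mcub (a * et K (X K w)) <= `|a| ^+ 3 * B ^+ 3 +
  a ^+ 2 * (if B < `|et K (X K w)| then et K (X K w) ^+ 2 else 0).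
Proof.
move=> B0; have p0 : 0 <= `|a| ^+ 3 * B ^+ 3 by rewrite mulr_ge0 ?exprn_ge0.
case: ltP => h; rewrite /mcub ge_min; apply/orP; [left|right].
  by rewrite exprMn lerDr.
by rewrite mulr0 addr0 normrM exprMn ler_wpM2l ?exprn_ge0// lerXn2r ?nnegrE.
Qed.

(** Each weight is controlled by the sum of squares; this bound turns fourth powers of the weights
    into cubes. *)
Let sqr_sum_le s K : kap K ^+ 2 * \sum_(k < K ^ 2) cfK K k ^+ 2 <= g1 / (2 * q - ind) + 1 ->
  forall k : 'I_(K ^ 2), `|s * kap K * cfK K k| <= 1 + s ^+ 2 * (g1 / (2 * q - ind) + 1).
Proof.
move=> h k; apply: (@le_trans _ _ (1 + (s * kap K * cfK K k) ^+ 2)).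
  by rewrite -(real_normK (num_real (s * kap K * cfK K k))); have := sqr_ge0 (`|s * kap K * cfK K k| - 1); nra.
rewrite lerD2l !exprMn -mulrA ler_wpM2l ?sqr_ge0//; apply: le_trans h.
rewrite ler_wpM2l ?sqr_ge0// (bigD1 k)//= lerDl sumr_ge0// => j _; exact: sqr_ge0.
Qed.

(** The bounded noise [nu] contributes through the sum of cubed weights. The summands of [eta] have
    equal weights [t h] but unbounded values: below the level [B] they give [n h^3 B^3], of order
    [h], and above it uniform integrability gives [n h^2 e' = e'], up to constants. *)
Let err_cvg0 s t : err s t @ \oo --> 0.
Proof.
apply/cvgrPdist_le => eps eps0; rewrite /= in eps0.
have t1 : 0 < 64 * t ^+ 2 + 1 by rewrite ltr_wpDl// mulr_ge0// sqr_ge0.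
(* Chosen so that [32 * t^2 * e' <= eps / 2], where 32 is the factor 4 in [err] times the 8 of
   [mcubD]. *)
have e'0 : 0 < eps / 2 / (64 * t ^+ 2 + 1) by rewrite !divr_gt0.
have [B B0 HB] := HUI e'0; set e' := eps / 2 / (64 * t ^+ 2 + 1) in e'0 HB.
pose A := 1 + s ^+ 2 * (g1 / (2 * q - ind) + 1).
pose U K := (32 * c ^+ 3 + 2 * c ^+ 4 * A) * cube s K + 32 * `|t| ^+ 3 * B ^+ 3 * hh K +
  2 * t ^+ 4 * (V2 + 1) ^+ 2 * hh K ^+ 2.
have hc : hh @ \oo --> 0 by exact: hK_cvg0.
have Uc : U @ \oo --> 0.
  have h1 := cvg_scale (32 * c ^+ 3 + 2 * c ^+ 4 * A) (cube_cvg0 s).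
  have h2 := cvg_scale (32 * `|t| ^+ 3 * B ^+ 3) hc.
  have hc2 : (fun K => hh K ^+ 2) @ \oo --> 0 by rewrite -[X in _ --> X](mulr0 0); exact: cvgM.
  have h3 := cvg_scale (2 * t ^+ 4 * (V2 + 1) ^+ 2) hc2.
  by have := cvgD (cvgD h1 h2) h3; rewrite !mulr0 !addr0; apply.
have e2 : 0 < eps / 2 by rewrite divr_gt0.
near=> K; have K0 : (0 < K)%N by near: K.
have [mx0' mXn' mXK _ _ LXK _ _ _ _ _ _ _ _ _] : sa_sys P al q r L MF Lv M0 (xi0 K) (Xn K) (X K) (xis K) (dq K) by near: K.
have LK : L2 P (fun w => et K (X K w)) by near: K.
have HBK : Ex P (fun w => if B < `|et K (X K w)| then et K (X K w) ^+ 2 else 0) <= e' by near: K.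
have HU : `|0 - U K| <= eps / 2 by near: K; move/cvgrPdist_le : Uc; apply.
have HV : Ex P (fun w => et K (X K w) ^+ 2) <= V2 + 1.
  have : `|V2 - Ex P (fun w => et K (X K w) ^+ 2)| <= 1 by near: K; move/cvgrPdist_le : Het; apply.
  by rewrite ler_norml => /andP[]; lra.
have HS : kap K ^+ 2 * \sum_(k < K ^ 2) cfK K k ^+ 2 <= g1 / (2 * q - ind) + 1.
  have : `|g1 / (2 * q - ind) - kap K ^+ 2 * \sum_(k < K ^ 2) cfK K k ^+ 2| <= 1.
    by near: K; have := kap_cf_sqr; move/cvgrPdist_le; apply.
  by rewrite ler_norml => /andP[]; lra.
have LN := Lnu mXK; have [_ LN2] := LN; have [_ LE2] := LK.
pose I w := if B < `|et K (X K w)| then et K (X K w) ^+ 2 else 0.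
have mE : measurable_fun setT (fun w => et K (X K w)) by case: LK.
have LI : L1 P I.
  apply: (L1_le _ _ LE2).
    apply: mfun_if; [apply: mfun_lt; [exact: mfun_cst|by apply: mfun_abs]|by apply: mfunX|exact: mfun_cst].
  by move=> w; rewrite /I; case: ifP => _; rewrite ?normr0 ?sqr_ge0// ger0_norm// sqr_ge0.
have V0 : 0 <= Ex P (fun w => et K (X K w) ^+ 2) by apply: Ex_ge0 => w; exact: sqr_ge0.
have bound (k : 'I_(K ^ 2)) : 4 * Ex P (fun w => mcub (yy s t K k (X K w))) +
    Ex P (fun w => yy s t K k (X K w) ^+ 2) ^+ 2 / 4 <=
    (32 * c ^+ 3 + 2 * c ^+ 4 * A) * `|s * kap K * cfK K k| ^+ 3 +
    (32 * (`|t * hh K| ^+ 3 * B ^+ 3) + 32 * (t * hh K) ^+ 2 * e' + 2 * (t * hh K) ^+ 4 * (V2 + 1) ^+ 2).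
  set a := s * kap K * cfK K k; set bb := t * hh K.
  have aA : `|a| <= A by exact: sqr_sum_le.
  have h1 : Ex P (fun w => mcub (yy s t K k (X K w))) <=
      8 * (c ^+ 3 * `|a| ^+ 3 + (`|bb| ^+ 3 * B ^+ 3 + bb ^+ 2 * e')).
    apply: (@le_trans _ _ (Ex P (fun w => 8 * (c ^+ 3 * `|a| ^+ 3 + (`|bb| ^+ 3 * B ^+ 3 + bb ^+ 2 * I w))))).
      apply: Ex_le.
      - by apply: L1_mcub; exact: Lyy.
      - by apply: L1Z; apply: L1D => //; apply: L1D => //; exact: L1Z.
      - move=> w; apply: (le_trans (mcubD _ _)); rewrite ler_wpM2l// lerD//.
          by have := mcub_nu (- a) K w; rewrite normrN.
        exact: mcub_et.
    rewrite ExZ; last by apply: L1D => //; apply: L1D => //; exact: L1Z.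
    rewrite ExD//; last by apply: L1D => //; exact: L1Z.
    rewrite ExD//; last exact: L1Z.
    rewrite !Ex_cst ExZ// ler_wpM2l// !lerD2l ler_wpM2l ?sqr_ge0//.
  have h2 : Ex P (fun w => yy s t K k (X K w) ^+ 2) <= 2 * c ^+ 2 * `|a| ^+ 2 + 2 * bb ^+ 2 * (V2 + 1).
    apply: (@le_trans _ _ (Ex P (fun w => 2 * c ^+ 2 * `|a| ^+ 2 + 2 * bb ^+ 2 * et K (X K w) ^+ 2))).
      apply: Ex_le; [by case: (Lyy s t k mXK LK)|by apply: L1D => //; exact: L1Z|move=> w].
      have h : nu K (X K w) ^+ 2 <= c ^+ 2.
        by rewrite -(real_normK (num_real (H1 _ _ _))) lerXn2r ?nnegrE ?(ltW c0)// H1_le.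
      rewrite /yy -/a -/bb real_normK ?num_real//.
      have := ler_wpM2l (sqr_ge0 a) h; have := sqr_ge0 (a * nu K (X K w) + bb * et K (X K w)).
      by move: (nu K (X K w)) (et K (X K w)) => x z; nra.
    rewrite ExD//; last exact: L1Z.
    have b2 : 0 <= 2 * bb ^+ 2 by rewrite mulr_ge0// sqr_ge0.
    by rewrite Ex_cst ExZ// lerD2l; apply: ler_wpM2l.
  have h3 : Ex P (fun w => yy s t K k (X K w) ^+ 2) ^+ 2 <= 8 * c ^+ 4 * A * `|a| ^+ 3 + 8 * bb ^+ 4 * (V2 + 1) ^+ 2.
    have E0 : 0 <= Ex P (fun w => yy s t K k (X K w) ^+ 2) by apply: Ex_ge0 => w; exact: sqr_ge0.
    apply: (@le_trans _ _ ((2 * c ^+ 2 * `|a| ^+ 2 + 2 * bb ^+ 2 * (V2 + 1)) ^+ 2)).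
      by rewrite lerXn2r ?nnegrE//; exact: le_trans E0 h2.
    have h4 : `|a| ^+ 4 <= A * `|a| ^+ 3 by rewrite exprS ler_wpM2r ?exprn_ge0.
    have h5 := ler_wpM2l (exprn_ge0 4 (ltW c0)) h4.
    have := sqr_ge0 (2 * c ^+ 2 * `|a| ^+ 2 - 2 * bb ^+ 2 * (V2 + 1)); move: h5.
    move: (`|a|) => x; lra.
  by move: h1 h3; lra.
rewrite sub0r normrN ger0_norm; last first.
  apply: sumr_ge0 => k _; rewrite addr_ge0// ?divr_ge0 ?sqr_ge0// mulr_ge0//.
  by apply: Ex_ge0 => w; exact: mcub_ge0.
apply: (le_trans (ler_sum _ (fun k _ => bound k))).
rewrite big_split/= -mulr_sumr -/(cube s K) sumr_const card_ord.
set bd := (X in _ + X *+ (K ^ 2)); rewrite -[bd *+ _]mulr_natl.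
have := hh_sqr K0; set N := (K ^ 2)%:R => h.
have -> : N * bd =
   (N * hh K ^+ 2) * (32 * `|t| ^+ 3 * B ^+ 3 * hh K + 32 * t ^+ 2 * e' + 2 * t ^+ 4 * (V2 + 1) ^+ 2 * hh K ^+ 2).
  by rewrite /bd normrM (ger0_norm (hh_ge0 K)); ring.
rewrite h mul1r; move: HU; rewrite sub0r normrN => /(le_trans (ler_norm _)); rewrite /U.
have : 32 * t ^+ 2 * e' <= eps / 2.
  by rewrite /e' mulrA ler_pdivrMr//; have := sqr_ge0 t; have := ltW eps0; nra.
lra.
Unshelve. all: by end_near. Qed.

Let Lsum_charfun s t th : (fun K => Ex P (fun w => cos (Lsum s t K w + th))) @ \oo -->
  expR (- (lim_var s t / 2)) * cos th.
Proof.
have : (fun K => expR (- (vv s t K / 2)) * cos th) @ \oo --> expR (- (lim_var s t / 2)) * cos th.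
  apply: cvgMl; apply: continuous_cvg; first exact: continuous_expR.
  by apply: cvgN; apply: cvgMl; exact: vv_cvg.
move=> H; apply/cvgrPdist_le => eps eps0; have e2 : 0 < eps / 2 by rewrite divr_gt0.
near=> K.
have [mx0' mXn' mXK XnXK ind' LXK _ _ Hst' _ _ _ _ _ _] : sa_sys P al q r L MF Lv M0 (xi0 K) (Xn K) (X K) (xis K) (dq K) by near: K.
have LK : L2 P (fun w => et K (X K w)) by near: K.
have h1 : `|expR (- (lim_var s t / 2)) * cos th - expR (- (vv s t K / 2)) * cos th| <= eps / 2.
  by near: K; move/cvgrPdist_le : H; apply.
have h2 : `|0 - err s t K| <= eps / 2 by near: K; have := err_cvg0 s t; move/cvgrPdist_le; apply.
have h3 := @charfun_sum_approx _ _ _ P (xi0 K) (fun k => Xn K k.+1) (X K) (yy s t K) mx0' (fun k => mXn' k.+1) mXK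
  XnXK ind' (myy s t K) (fun k => Lyy s t k mXK LK) (fun k => Eyy s t k LXK LK Hst') (K ^ 2) th.
rewrite -/(vv s t K) -/(err s t K) -/(Lsum s t K) in h3.
move: h2; rewrite sub0r normrN => /(le_trans (ler_norm _)) h2.
move: h1 (le_trans h3 h2); rewrite !ler_norml => /andP[? ?] /andP[? ?]; apply/andP; split; lra.
Unshelve. all: by end_near. Qed.

Definition Wlaw K w : R * R :=
  (kap K * (xi al g1 b (xi0 K) (Xn K) (K ^ 2) w - xis K),
   (hh K)^-1 * (ch al g1 b (xi0 K) (Xn K) (K ^ 2) w - Vf P al (X K) (xis K))).

Let L1K K w := kap K * lin al g1 b (Xn K) (xis K) q (K ^ 2) w.
Let L2K K w := hh K * \sum_(j < K ^ 2) et K (Xn K j.+1 w).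
Let R1K K w := kap K * (xi al g1 b (xi0 K) (Xn K) (K ^ 2) w - xis K - lin al g1 b (Xn K) (xis K) q (K ^ 2) w).
Let R2K K w := hh K * Rm P al g1 b (xi0 K) (Xn K) (X K) (xis K) (K ^ 2) w.

Let W1E K w : (Wlaw K w).1 = L1K K w + R1K K w.
Proof. by rewrite /Wlaw/= /L1K /R1K; ring. Qed.

Let W2E K w : (0 < K)%N -> (Wlaw K w).2 = L2K K w + R2K K w.
Proof.
move=> K0; rewrite /Wlaw/= /L2K /R2K /Rm -mulrDr (addrC (\sum_(j < _) _)) subrK mulrA; congr (_ * _).
have h0 : hh K != 0 by rewrite /hh /hK invr_eq0 pnatr_eq0 -lt0n.
by apply: (mulIf h0); rewrite mulVf// -mulrA mulrCA -expr2 hh_sqr.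
Qed.

Let Lsum12 s t K w : Lsum s t K w = s * L1K K w + t * L2K K w.
Proof. exact: LsumE. Qed.

Let remainder (eps : R) : 0 < eps -> \forall K \near \oo, exists g : T -> R,
  [/\ measurable_fun setT g, forall w, g w = 0 \/ g w = 1, Ex P (fun w => 1 - g w) <= eps,
    L1 P (fun w => g w * `|R1K K w|) /\ Ex P (fun w => g w * `|R1K K w|) <= eps &
    L1 P (fun w => g w * `|R2K K w|) /\ Ex P (fun w => g w * `|R2K K w|) <= eps].
Proof.
move=> eps0; have sg0 : 0 < Num.sqrt g1 by rewrite sqrtr_gt0.
(* The second argument is for the first coordinate, whose error is multiplied by [sqrt g1] and
   shared equally with the term in [dq]. *)
pose e := Num.min eps (eps / 2 / Num.sqrt g1).
have e0 : 0 < e by rewrite lt_min eps0/= !divr_gt0.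
have [n0 [C HC]] := sa_approx P al01 g10 b12 b1 q0 r0 r1 L0 MF0 Lv0 M00 qg e0.
have dC : (fun K => C * dq K) @ \oo --> 0 by rewrite -[X in _ --> X](mulr0 C); exact: cvg_scale.
have e2 : 0 < eps / 2 / Num.sqrt g1 by rewrite !divr_gt0.
near=> K; have K0 : (0 < K)%N by near: K.
have sysK : sa_sys P al q r L MF Lv M0 (xi0 K) (Xn K) (X K) (xis K) (dq K) by near: K.
have hd : C * dq K <= eps / 2 / Num.sqrt g1.
  have : `|0 - C * dq K| <= eps / 2 / Num.sqrt g1 by near: K; move/cvgrPdist_le : dC; apply.
  by rewrite sub0r normrN; apply: le_trans; exact: ler_norm.
have nK : (n0 <= K ^ 2)%N.
  have : (n0 <= K)%N by near: K; exists n0.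
  by move=> h; rewrite (leq_trans h)// -mulnn leq_pmulr.
have [g [mg g01 Eg [Lg1 Eg1] [Lg2 Eg2]]] := HC _ _ _ _ _ sysK _ nK.
exists g; split => //.
- by apply: (le_trans Eg); rewrite /e ge_min lexx.
- have E w : g w * `|R1K K w| = kap K * (g w * `|xi al g1 b (xi0 K) (Xn K) (K ^ 2) w - xis K - lin al g1 b (Xn K) (xis K) q (K ^ 2) w|).
    by rewrite /R1K normrM (ger0_norm (kap_ge0 K)); ring.
  split; first by apply: (eq_L1 _ (L1Z (kap K) Lg1)) => w; rewrite E.
  rewrite (eq_Ex _ E) ExZ//; apply: (le_trans (ler_wpM2l (kap_ge0 K) Eg1)).
  rewrite mulrCA scale_sqrt_gam// -ler_pdivlMr//.
  apply: (@le_trans _ _ (eps / 2 / Num.sqrt g1 + eps / 2 / Num.sqrt g1)).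
    by rewrite lerD// /e ge_min lexx orbT.
  by rewrite -mulrDl -splitr.
- have E w : g w * `|R2K K w| = hh K * (g w * `|Rm P al g1 b (xi0 K) (Xn K) (X K) (xis K) (K ^ 2) w|).
    by rewrite /R2K normrM (ger0_norm (hh_ge0 K)); ring.
  split; first by apply: (eq_L1 _ (L1Z (hh K) Lg2)) => w; rewrite E.
  rewrite (eq_Ex _ E) ExZ//; apply: (le_trans (ler_wpM2l (hh_ge0 K) Eg2)).
  rewrite natrX sqrtr_sqr ger0_norm ?ler0n// mulrCA /hh /hK mulVf ?mulr1 ?pnatr_eq0 -?lt0n//.
  by rewrite /e ge_min lexx.
Unshelve. all: by end_near. Qed.

Let mW1 K : measurable_fun setT (xi0 K) -> (forall n, measurable_fun setT (Xn K n)) ->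
  measurable_fun setT (xi al g1 b (xi0 K) (Xn K) (K ^ 2)).
Proof. by move=> mx mXn'; exact: mxi. Qed.

Let mch K n : measurable_fun setT (xi0 K) -> (forall n, measurable_fun setT (Xn K n)) ->
  measurable_fun setT (ch al g1 b (xi0 K) (Xn K) n).
Proof.
move=> mx mXn'; elim: n => [|n IH]; first exact: mfun_cst.
have mxn : measurable_fun setT (xi al g1 b (xi0 K) (Xn K) n) by exact: mxi.
apply: mfunB => //; apply: mfunM; first exact: mfun_cst.
rewrite /H2; apply: mfunB; first exact: mfunB.
apply: mfunM; first exact: mfun_cst.
by apply: mfun_max; [apply: mfunB => //; exact: mXn'|exact: mfun_cst].
Qed.

Lemma measurable_Wlaw K : measurable_fun setT (xi0 K) -> (forall n, measurable_fun setT (Xn K n)) ->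
  measurable_fun setT (Wlaw K).
Proof.
move=> mx mXn'; apply: measurable_fun_pair; apply: mfunM; (try exact: mfun_cst); apply: mfunB; (try exact: mfun_cst).
  exact: mW1.
exact: mch.
Qed.

Let mL1K K : (forall n, measurable_fun setT (Xn K n)) -> measurable_fun setT (L1K K).
Proof. by move=> mXn'; apply: mfunM; [exact: mfun_cst|exact: mlin]. Qed.

Let mL2K K : (forall n, measurable_fun setT (Xn K n)) -> measurable_fun setT (L2K K).
Proof.
move=> mXn'; apply: mfunM; first exact: mfun_cst.
by apply: (@mfun_sum _ _ _ (K ^ 2) (fun j w => et K (Xn K j.+1 w))) => j; exact: (measurableT_comp (@met K)).
Qed.

Let cos_lip (x y : R) : `|cos x - cos y| <= `|x - y|.
Proof.
have -> : cos x - cos y = - 2 * (sin ((x + y) / 2) * sin ((x - y) / 2)).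
  have := cosD ((x + y) / 2) ((x - y) / 2); have := cosB ((x + y) / 2) ((x - y) / 2).
  rewrite (_ : (x + y) / 2 + (x - y) / 2 = x); last by field.
  rewrite (_ : (x + y) / 2 - (x - y) / 2 = y); last by field.
  by move=> -> ->; ring.
rewrite !normrM normrN (ger0_norm (ler0n _ 2)).
have h1 : `|sin ((x + y) / 2)| <= 1 by exact: sin_max.
have h2 : `|sin ((x - y) / 2)| <= `|x - y| / 2.
  by apply: (le_trans (normr_sin_le _)); rewrite normrM [`|2^-1|]ger0_norm.
have := ler_pM (normr_ge0 _) (normr_ge0 _) h1 h2; rewrite mul1r; lra.
Qed.

(** On the good event the cosine is 1-Lipschitz in the remainders; off it the two cosines differ by
    at most 2. *)
Lemma Wlaw_charfun s t th : (fun K => Ex P (fun w => cos (s * (Wlaw K w).1 + t * (Wlaw K w).2 + th)))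
  @ \oo --> expR (- (lim_var s t / 2)) * cos th.
Proof.
apply/cvgrPdist_le => eps eps0; rewrite /= in eps0.
have D0 : 0 < 2 * (2 + `|s| + `|t|) by rewrite mulr_gt0// !ltr_wpDr.
have e0 : 0 < eps / (2 * (2 + `|s| + `|t|)) by rewrite divr_gt0.
have e2 : 0 < eps / 2 by rewrite divr_gt0.
near=> K; have K0 : (0 < K)%N by near: K.
have [mx0' mXn' mXK _ _ LXK _ _ _ _ _ _ _ _ _] : sa_sys P al q r L MF Lv M0 (xi0 K) (Xn K) (X K) (xis K) (dq K) by near: K.
have h1 : `|expR (- (lim_var s t / 2)) * cos th - Ex P (fun w => cos (Lsum s t K w + th))| <= eps / 2.
  by near: K; have := @Lsum_charfun s t th; move/cvgrPdist_le; apply.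
have [g [mg g01 Eg [Lg1 Eg1] [Lg2 Eg2]]] : exists g : T -> R,
  [/\ measurable_fun setT g, forall w, g w = 0 \/ g w = 1, Ex P (fun w => 1 - g w) <= eps / (2 * (2 + `|s| + `|t|)),
    L1 P (fun w => g w * `|R1K K w|) /\ Ex P (fun w => g w * `|R1K K w|) <= eps / (2 * (2 + `|s| + `|t|)) &
    L1 P (fun w => g w * `|R2K K w|) /\ Ex P (fun w => g w * `|R2K K w|) <= eps / (2 * (2 + `|s| + `|t|))].
  by near: K; exact: remainder.
have mW := measurable_Wlaw mx0' mXn'.
have mW1' : measurable_fun setT (fun w => (Wlaw K w).1) by exact: (measurableT_comp measurable_fst mW).
have mW2' : measurable_fun setT (fun w => (Wlaw K w).2) by exact: (measurableT_comp measurable_snd mW).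
have mc f : measurable_fun setT f -> L1 P (fun w => cos (f w)).
  move=> mf; apply: (@L1_bnd _ _ _ _ _ 1); last by move=> w; exact: cos_max.
  by apply: mfun_comp => //; apply: mfun_continuous; exact: continuous_cos.
have LA : L1 P (fun w => cos (s * (Wlaw K w).1 + t * (Wlaw K w).2 + th)).
  by apply: mc; apply: mfunD; [apply: mfunD; apply: mfunM => //|]; exact: mfun_cst.
have LB : L1 P (fun w => cos (Lsum s t K w + th)).
  apply: mc; apply: mfunD; last exact: mfun_cst.
  rewrite (_ : Lsum s t K = fun w => s * L1K K w + t * L2K K w); last by apply/funext => w; rewrite Lsum12.
  by apply: mfunD; apply: mfunM; [exact: mfun_cst|exact: mL1K|exact: mfun_cst|exact: mL2K].
have Lg : L1 P (fun w => 1 - g w).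
  apply: (@L1_bnd _ _ _ _ _ 1); first by apply: mfunB => //; exact: mfun_cst.
  by move=> w; case: (g01 w) => ->; rewrite ?subr0 ?subrr ?normr1 ?normr0.
have h2 : `|Ex P (fun w => cos (Lsum s t K w + th)) - Ex P (fun w => cos (s * (Wlaw K w).1 + t * (Wlaw K w).2 + th))| <= eps / 2.
  rewrite -ExB//; apply: (le_trans (Ex_abs (L1B LB LA))).
  apply: (@le_trans _ _ (Ex P (fun w => 2 * (1 - g w) + (`|s| * (g w * `|R1K K w|) + `|t| * (g w * `|R2K K w|))))).
    apply: Ex_le; [by apply: L1_abs; exact: L1B|by apply: L1D; [exact: L1Z|by apply: L1D; exact: L1Z]|move=> w].
    case: (g01 w) => ->; rewrite ?subr0 ?subrr ?mul0r ?mulr0 ?mulr1 ?mul1r ?addr0 ?add0r.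
      apply: (le_trans (ler_normB _ _)); have := cos_max (Lsum s t K w + th).
      have := cos_max (s * (Wlaw K w).1 + t * (Wlaw K w).2 + th); lra.
    rewrite distrC; apply: (le_trans (cos_lip _ _)); rewrite W1E W2E// Lsum12.
    rewrite (_ : _ - _ = s * R1K K w + t * R2K K w); last by ring.
    by apply: (le_trans (ler_normD _ _)); rewrite !normrM.
  rewrite ExD; [|exact: L1Z|by apply: L1D; exact: L1Z].
  rewrite ExD; [|exact: L1Z|exact: L1Z].
  rewrite !ExZ//; set e := eps / _ in Eg Eg1 Eg2.
  have := ler_wpM2l (normr_ge0 s) Eg1; have := ler_wpM2l (normr_ge0 t) Eg2.
  have : e * (2 * (2 + `|s| + `|t|)) = eps by rewrite /e divfK// gt_eqF.
  by move: Eg; lra.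
rewrite (splitr eps); apply: le_trans (lerD h1 h2); apply: le_trans (ler_normD _ _).
by rewrite addrA subrK.
Unshelve. all: by end_near. Qed.

Let Lsum_sqr s t K : sa_sys P al q r L MF Lv M0 (xi0 K) (Xn K) (X K) (xis K) (dq K) ->
  L2 P (fun w => et K (X K w)) -> L2 P (Lsum s t K) /\ Ex P (fun w => Lsum s t K w ^+ 2) = vv s t K.
Proof.
move=> [mx0' mXn' mXK XnXK ind' LXK _ _ Hst' _ _ _ _ _ _] LK.
exact: (@variance_sum _ _ _ P (xi0 K) (fun k => Xn K k.+1) (X K) (yy s t K) mx0' (fun k => mXn' k.+1) mXK
  XnXK ind' (myy s t K) (fun k => Lyy s t k mXK LK) (fun k => Eyy s t k LXK LK Hst') (K ^ 2)).
Qed.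

(** Chebyshev for the linear parts, whose second moments converge, and Markov for the remainders on
    the good event. *)
Lemma Wlaw_tight (e : R) : 0 < e -> exists2 A : R, 0 < A &
  \forall K \near \oo, Ex P (fun w => outside A (Wlaw K w)) <= e.
Proof.
move=> e0; have e2 : 0 < e / 2 by rewrite divr_gt0.
pose B := `|lim_var 1 0| + `|lim_var 0 1| + 2.
have B0 : 0 < B by rewrite ltr_wpDl.
pose A := 1 + (4 * B + 4 * (e / 2)) / (e / 2).
have A1 : 1 <= A by rewrite lerDl divr_ge0// ?(ltW e2)// addr_ge0// mulr_ge0// ltW.
have A0 : 0 < A by exact: lt_le_trans A1.
exists A => //; near=> K; have K0 : (0 < K)%N by near: K.
have sysK : sa_sys P al q r L MF Lv M0 (xi0 K) (Xn K) (X K) (xis K) (dq K) by near: K.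
have LK : L2 P (fun w => et K (X K w)) by near: K.
have [mx0' mXn' _ _ _ _ _ _ _ _ _ _ _ _ _] := sysK.
have [g [mg g01 Eg [Lg1 Eg1] [Lg2 Eg2]]] : exists g : T -> R,
  [/\ measurable_fun setT g, forall w, g w = 0 \/ g w = 1, Ex P (fun w => 1 - g w) <= e / 2,
    L1 P (fun w => g w * `|R1K K w|) /\ Ex P (fun w => g w * `|R1K K w|) <= e / 2 &
    L1 P (fun w => g w * `|R2K K w|) /\ Ex P (fun w => g w * `|R2K K w|) <= e / 2].
  by near: K; exact: remainder.
have v1 : vv 1 0 K <= `|lim_var 1 0| + 1.
  have : `|lim_var 1 0 - vv 1 0 K| <= 1 by near: K; have := @vv_cvg 1 0; move/cvgrPdist_le; apply.
  by rewrite ler_norml => /andP[]; have := ler_norm (lim_var 1 0); lra.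
have v2 : vv 0 1 K <= `|lim_var 0 1| + 1.
  have : `|lim_var 0 1 - vv 0 1 K| <= 1 by near: K; have := @vv_cvg 0 1; move/cvgrPdist_le; apply.
  by rewrite ler_norml => /andP[]; have := ler_norm (lim_var 0 1); lra.
have [[_ Q1] E1] := Lsum_sqr 1 0 sysK LK; have [[_ Q2] E2] := Lsum_sqr 0 1 sysK LK.
have F1 w : Lsum 1 0 K w = L1K K w by rewrite Lsum12 mul1r mul0r addr0.
have F2 w : Lsum 0 1 K w = L2K K w by rewrite Lsum12 mul1r mul0r add0r.
have {}Q1 : L1 P (fun w => L1K K w ^+ 2) by apply: eq_L1 Q1 => w; rewrite F1.
have {}Q2 : L1 P (fun w => L2K K w ^+ 2) by apply: eq_L1 Q2 => w; rewrite F2.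
have {}E1 : Ex P (fun w => L1K K w ^+ 2) = vv 1 0 K by rewrite -E1; apply: eq_Ex => w; rewrite F1.
have {}E2 : Ex P (fun w => L2K K w ^+ 2) = vv 0 1 K by rewrite -E2; apply: eq_Ex => w; rewrite F2.
have Lg : L1 P (fun w => 1 - g w).
  apply: (@L1_bnd _ _ _ _ _ 1); first by apply: mfunB => //; exact: mfun_cst.
  by move=> w; case: (g01 w) => ->; rewrite ?subr0 ?subrr ?normr1 ?normr0.
(* Either [|y| >= A / 2], or [|x| > A / 2] and then [4 x^2 > A^2 >= A]. *)
have half (x y : R) : A < `|x + y| -> A <= 4 * x ^+ 2 + 2 * `|y|.
  move=> h; have := ler_normD x y; rewrite -(real_normK (num_real x)).
  by have := normr_ge0 x; move: (`|x|) (`|y|) (`|x + y|) h => u v z; nra.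
have key w : outside A (Wlaw K w) <= (1 - g w) + A^-1 *
   ((4 * L1K K w ^+ 2 + 4 * L2K K w ^+ 2) + (2 * (g w * `|R1K K w|) + 2 * (g w * `|R2K K w|))).
  have p1 : 0 <= 4 * L1K K w ^+ 2 by rewrite mulr_ge0// sqr_ge0.
  have p2 : 0 <= 4 * L2K K w ^+ 2 by rewrite mulr_ge0// sqr_ge0.
  have p3 := normr_ge0 (R1K K w); have p4 := normr_ge0 (R2K K w).
  have Ai : 0 <= A^-1 by rewrite invr_ge0 ltW.
  case: (g01 w) => ->; rewrite ?subr0 ?subrr ?mul0r ?mulr0 ?mul1r ?addr0 ?add0r.
    by apply: (le_trans (outside_le1 _ _)); rewrite lerDl mulr_ge0// addr_ge0.
  rewrite /outside W1E W2E//; case: ifPn => [_|].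
    by rewrite mulr_ge0// !addr_ge0// mulr_ge0.
  rewrite negb_and -!ltNge mulrC => /orP[] /half h; rewrite ler_pdivlMr// mul1r; lra.
have LL : L1 P (fun w => 4 * L1K K w ^+ 2 + 4 * L2K K w ^+ 2) by apply: L1D; exact: L1Z.
have LR : L1 P (fun w => 2 * (g w * `|R1K K w|) + 2 * (g w * `|R2K K w|)) by apply: L1D; exact: L1Z.
apply: (@le_trans _ _ (Ex P (fun w => (1 - g w) + A^-1 *
   ((4 * L1K K w ^+ 2 + 4 * L2K K w ^+ 2) + (2 * (g w * `|R1K K w|) + 2 * (g w * `|R2K K w|)))))).
  apply: Ex_le => //; last by apply: L1D => //; apply: L1Z; exact: L1D.
  apply: (@L1_bnd _ _ _ _ _ 1); last by move=> w; rewrite ger0_norm ?outside_ge0 ?outside_le1.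
  exact: (measurableT_comp (measurable_outside A) (measurable_Wlaw mx0' mXn')).
rewrite ExD//; last by apply: L1Z; exact: L1D.
rewrite ExZ; last exact: L1D.
rewrite (ExD LL LR) (ExD (L1Z 4 Q1) (L1Z 4 Q2)) (ExD (L1Z 2 Lg1) (L1Z 2 Lg2)).
rewrite (ExZ _ Q1) (ExZ _ Q2) (ExZ _ Lg1) (ExZ _ Lg2) E1 E2 [leRHS](splitr e) lerD// mulrC ler_pdivrMr//.
apply: (@le_trans _ _ (4 * B + 4 * (e / 2))); first by rewrite /B; move: v1 v2 Eg1 Eg2; lra.
by rewrite /A [leRHS]mulrDr mulr1 [X in _ <= _ + X]mulrC divfK ?gt_eqF// lerDr ltW.
Unshelve. all: by end_near. Qed.

Theorem Wlaw_cvg (S11 S12 S22 : R) : 0 < S11 ->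
  (forall s t, lim_var s t = s ^+ 2 * S11 + 2 * s * t * S12 + t ^+ 2 * S22) ->
  (forall K, measurable_fun setT (xi0 K)) -> (forall K n, measurable_fun setT (Xn K n)) ->
  cvg_law_gauss2 P Wlaw S11 S12 S22.
Proof.
move=> S110 HS mx0' mXn'.
have v0 s t : 0 <= lim_var s t.
  apply: (cvgr_to_ge (@vv_cvg s t)); apply: nearW => K; apply: sumr_ge0 => k _; apply: Ex_ge0 => w; exact: sqr_ge0.
(* As a limit of variances [lim_var] is nonnegative; at [(- S12, S11)] it equals [S11] times the
   determinant. *)
have psd : S12 ^+ 2 <= S11 * S22.
  have := v0 (- S12) S11; rewrite HS.
  rewrite (_ : _ + _ = S11 * (S11 * S22 - S12 ^+ 2)); last by ring.
  by rewrite pmulr_rge0// subr_ge0.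
(* Cholesky factor of the covariance, lower triangular. *)
pose l11 := Num.sqrt S11; have l110 : 0 < l11 by rewrite sqrtr_gt0.
have l11E : l11 ^+ 2 = S11 by rewrite sqr_sqrtr// ltW.
pose l21 := S12 / l11.
have l21E : l21 ^+ 2 = S12 ^+ 2 / S11 by rewrite /l21 exprMn exprVn l11E.
pose l22 := Num.sqrt (S22 - l21 ^+ 2).
have l22E : l22 ^+ 2 = S22 - l21 ^+ 2.
  by rewrite sqr_sqrtr// l21E subr_ge0 ler_pdivrMr// mulrC.
exists l11, 0, l21, l22; split.
- by rewrite expr0n addr0.
- by rewrite mul0r addr0 /l21 mulrCA divff ?mulr1// gt_eqF.
- by rewrite l22E addrC subrK.
move=> g cg mg [M gM]; rewrite gauss2_expectE//; last by exists M.
have H : (fun K => Ex P (fun w => g (Wlaw K w))) @ \oo --> Ex (@N2 R) (fun z => g (lmap2 l11 0 l21 l22 z)).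
  apply: (@charfun_weak_cvg _ _ _ P _ _ (@N2 R) Wlaw (lmap2 l11 0 l21 l22) _ _ _ _ g M) => //.
  - by move=> K; exact: measurable_Wlaw.
  - exact: measurable_lmap2.
  - move=> s t th; rewrite (_ : Ex _ _ = expR (- (lim_var s t / 2)) * cos th); first exact: Wlaw_charfun.
    rewrite (@eq_Ex _ _ _ (@N2 R) _ (fun z => cos ((s * l11 + t * l21) * z.1 + (t * l22) * z.2 + th))).
      rewrite N2_cos HS; congr (expR (- (_ / 2)) * _).
      have l1121 : l11 * l21 = S12 by rewrite /l21 mulrCA divff ?mulr1// gt_eqF.
      by rewrite -l1121 -l11E (_ : S22 = l22 ^+ 2 + l21 ^+ 2); [ring|rewrite l22E subrK].
    by move=> z; rewrite /lmap2/=; congr (cos _); ring.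
  - exact: Wlaw_tight.
rewrite (_ : (fun K => _) = fun K => (Ex P (fun w => g (Wlaw K w)))%:E).
  by apply: cvg_EFin => //; exact: nearW.
apply/funext => K; rewrite expectation.unlock -Ex_fin//.
apply: (@L1_bnd _ _ _ _ _ M) => //; exact: (measurableT_comp mg (measurable_Wlaw (mx0' K) (mXn' K))).
Qed.

End limit_law.

(** A set without supremum, empty or unbounded, has [sup] equal to 0 by convention, so boundedness
    need not be checked. *)
Lemma sup_ge0 {R : realType} (A : set R) : (forall x, A x -> 0 <= x) -> 0 <= sup A.
Proof.
move=> A0; have [hs|/sup_out ->//] := pselect (has_sup A).
by have [[x Ax] _] := hs; apply: le_trans (A0 x Ax) _; exact: sup_upper_bound.
Qed.

Lemma supnorm_ge0 {R : realType} (f : R -> R) : 0 <= supnorm f.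
Proof. by apply: sup_ge0 => _ [x _ <-]. Qed.

(** * Moments of the noise at the minimizer *)

Section noise_moments.
Context {d} {T : measurableType d} {R : realType} (P : probability T R).
Variables (al : R) (X : T -> R) (f : R -> R) (Mf xst : R).
Hypotheses (al01 : 0 < al < 1) (mX : measurable_fun setT X) (fX : is_pdf P X f) (cf : continuous f)
  (fM : forall x, `|f x| <= Mf) (LX : L1 P X) (hxst : is_minimizer (Vfun P al X) xst)
  (Lp : L2 P (fun w => Num.max (X w - xst) 0)).

Let ca : R := (1 - al)^-1.
Let al1 : 1 - al != 0. Proof. by case/andP: al01 => ? ?; rewrite gt_eqF// subr_gt0. Qed.
Let p w := Num.max (X w - xst) 0.
Let m := Ex P p.
Let I w : R := if xst <= X w then 1 else 0.

Let LI : L1 P I.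
Proof.
apply: (@L1_bnd _ _ _ _ _ 1).
  by apply: mfun_if; [apply: mfun_le => //|..]; exact: mfun_cst.
by move=> w; rewrite /I; case: ifP; rewrite ?normr1 ?normr0.
Qed.

Let EI : Ex P I = 1 - al.
Proof. by rewrite (Ex_ge mX fX cf fM) (@cdf_min _ _ _ P al X f Mf). Qed.

Lemma Ex_nu_sqr : Ex P (fun w => H1 al xst (X w) ^+ 2) = al * ca.
Proof.
rewrite (@eq_Ex _ _ _ P _ (fun w => 1 + (ca ^+ 2 - 2 * ca) * I w)); last first.
  by move=> w; rewrite /H1 /I -/ca; case: ifP => _; ring.
by rewrite ExD ?Ex_cst ?ExZ ?EI//; [rewrite /ca; field|exact: L1Z].
Qed.

(** The positive part vanishes off the event [xst <= X], so its product with the indicator is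
    itself, and only first moments appear. *)
Lemma Ex_nu_eta : Ex P (fun w => H1 al xst (X w) * eta P al X xst (X w)) = - (ca ^+ 2 * al * m).
Proof.
have Lp1 := L2_L1 Lp.
rewrite (@eq_Ex _ _ _ P _ (fun w => ((ca - ca ^+ 2) * p w + ca ^+ 2 * m * I w) - ca * m)); last first.
  move=> w; rewrite /H1 /I /eta -/ca -/m -/p -/(p w); case: ifP => h; first by ring.
  have -> : p w = 0 by rewrite /p max_r// subr_le0 ltW// ltNge h.
  by ring.
rewrite ExB//; last by apply: L1D; exact: L1Z.
rewrite ExD; [|exact: L1Z..].
by rewrite !ExZ// Ex_cst EI -/m /ca; field.
Qed.

Lemma Ex_eta_sqr : Ex P (fun w => eta P al X xst (X w) ^+ 2) = ca ^+ 2 * (Ex P (fun w => p w ^+ 2) - m ^+ 2).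
Proof.
have Lp1 := L2_L1 Lp; have [_ Lp2] := Lp.
rewrite (@eq_Ex _ _ _ P _ (fun w => (ca ^+ 2 * p w ^+ 2 - (2 * ca ^+ 2 * m) * p w) + ca ^+ 2 * m ^+ 2)); last first.
  by move=> w; rewrite /eta -/ca -/m -/p -/(p w); ring.
rewrite ExD//; last by apply: L1B; exact: L1Z.
rewrite ExB; [|exact: L1Z..].
by rewrite !ExZ// Ex_cst -/m; ring.
Qed.

Lemma L2_eta : L2 P (fun w => eta P al X xst (X w)).
Proof. by apply: L2Z; apply: L2B => //; exact: L2_cst. Qed.

Lemma fine_variance : fine (variance P p) = Ex P (fun w => p w ^+ 2) - m ^+ 2.
Proof.
have Lp1 := L2_L1 Lp; have [_ Lp2] := Lp.
rewrite /variance covariance.unlock expectation.unlock.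
transitivity (Ex P (fun w => (p w - m) ^+ 2)); first by [].
rewrite (@eq_Ex _ _ _ P _ (fun w => (p w ^+ 2 - (2 * m) * p w) + m ^+ 2)); last by move=> w; ring.
rewrite ExD//; last by apply: L1B => //; exact: L1Z.
by rewrite ExB ?ExZ ?Ex_cst//; [rewrite -/m; ring|exact: L1Z].
Qed.

End noise_moments.
Theorem mainTheorem1
  (d : measure_display) (T : measurableType d) (R : realType)
  (P : probability T R) (alpha : R) (halpha : 0 < alpha < 1)
  (* Y (R^dY-valued) and Z (R^dZ-valued) independent, phi measurable, phi(Y,Z) in L^1 *)
  (dY dZ : nat) (Y : T -> dY.-tuple R) (Z : T -> dZ.-tuple R)
  (phi : dY.-tuple R -> dZ.-tuple R -> R)
  (mY : measurable_fun setT Y) (mZ : measurable_fun setT Z)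
  (mphi : measurable_fun setT (fun p : dY.-tuple R * dZ.-tuple R => phi p.1 p.2))
  (indepYZ : mutually_independent P
               (fun b : bool => if b then sigma_of Y else sigma_of Z))
  (int_phi : P.-integrable setT (fun w => (phi (Y w) (Z w))%:E))
  (* X_0 = E[phi(Y,Z) | Y] *)
  (X0 : T -> R) (hX0 : is_cond_exp_given P X0 (fun w => phi (Y w) (Z w)) Y)
  (* Z^(1), Z^(2), ... i.i.d. copies of Z, independent of Y (indexed from 0) *)
  (Zs : nat -> T -> dZ.-tuple R) (mZs : forall k, measurable_fun setT (Zs k))
  (lawZs : forall k, same_law P (Zs k) Z)
  (indepZs : mutually_independent P
     (fun o : option nat => if o is Some k then sigma_of (Zs k) else sigma_of Y))
  (* pdfs f K of X_{1/K} (K >= 1) and f 0 of X_0 *)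
  (f : nat -> R -> R)
  (* minimizers xis K of V_{1/K} (K >= 1) and xis 0 of V_0 *)
  (xis : nat -> R)
  (hxis : forall K, is_minimizer (Vfun P alpha (Xh Y Zs phi X0 K)) (xis K))
  (* Assumption A *)
  (hA : assumptionA P alpha (Xh Y Zs phi X0) f)
  (* NSA inputs: for each K >= 1, i.i.d. copies Xn K n (n >= 1) of X_{1/K},
     and an initial value xi0 K independent of them *)
  (Xn : nat -> nat -> T -> R) (xi0 : nat -> T -> R)
  (mXn : forall K n, measurable_fun setT (Xn K n))
  (mxi0 : forall K, measurable_fun setT (xi0 K))
  (lawXn : forall K, (0 < K)%N -> forall n, same_law P (Xn K n.+1) (Xh Y Zs phi X0 K))
  (indepXn : forall K, (0 < K)%N -> mutually_independent P
     (fun o : option nat => if o is Some n then sigma_of (Xn K n.+1)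
                            else sigma_of (xi0 K)))
  (* Assumption B *)
  (hB : exists M : R, forall K, (0 < K)%N ->
     ('E_P[fun w => (`|xi0 K w| ^+ 2 *
         expR (4 / (1 - alpha) * Num.max 1 (alpha / (1 - alpha))
               * sup [set supnorm (f K') | K' in [set K' : nat | (0 < K')%N]]
               * `|xi0 K w|))%R] <= M%:E)%E)
  (* moment condition *)
  (hmom : exists delta : R, 0 < delta /\
     ('E_P[fun w => (`|phi (Y w) (Z w)| `^ (2 + delta))%R] < +oo)%E)
  (* step sequence *)
  (gamma1 beta : R) (hgamma1 : 0 < gamma1) (hbeta : 1 / 2 < beta <= 1)
  (hlam : beta = 1 -> lambda_const alpha f xis * gamma1 > 1) :
  let gamma := fun n : nat => gamma1 * (n%:R `^ (- beta)) in
  let chis := fun K => Vfun P alpha (Xh Y Zs phi X0 K) (xis K) in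
  let ind1 : R := if beta == 1 then 1 else 0 in
  cvg_law_gauss2 P
    (fun K w =>
       let p := nsa alpha gamma (xi0 K w) (fun n => Xn K n w) (K ^ 2)%N in
       ((hK K) `^ (- beta) * (p.1 - xis K), (hK K)^-1 * (p.2 - chis K)))
    (alpha * gamma1 / (2 * f 0%N (xis 0%N) - gamma1^-1 * (1 - alpha) * ind1))
    (alpha * (chis 0%N - xis 0%N) / f 0%N (xis 0%N) * ind1)
    (fine (variance P (fun w => Num.max (X0 w - xis 0%N) 0)) / (1 - alpha) ^+ 2).
Proof.
move=> gamma chis ind1; have /andP[hb12 hb1] := hbeta; have /andP[al0 al1] := halpha.
have oma : 0 < 1 - alpha by rewrite subr_gt0.
pose ca : R := (1 - alpha)^-1; have ca0 : 0 < ca by rewrite invr_gt0.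
pose X := Xh Y Zs phi X0.
have [[v [w [_ _ HF Hmin]]] Hpdf floc Hlow [[Mf fM] [Lf fL]]] := hA.
have [delta [delta0 Hmom]] := hmom.
have LX K : (0 < K)%N -> L2 P (X K).
  exact: (L2_Xh mY mZ mphi indepYZ mZs lawZs indepZs delta0 Hmom).
have UI : forall eps : R, 0 < eps -> exists2 A : R, 0 <= A &
    forall K, (0 < K)%N -> Ex P (fun w => if A < `|X K w| then X K w ^+ 2 else 0) <= eps.
  exact: (Xh_UI mY mZ mphi indepYZ mZs lawZs indepZs delta0 Hmom).
have LX1 K : L1 P (X K).
  by case: K => [|K]; [case: hX0|exact: L2_L1 (LX _ _)].
have mX K := L1_meas (LX1 K).
have fX K : is_pdf P (X K) (f K) by case: (Hpdf K).
have cf K : continuous (f K) by case: (Hpdf K).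
have [_ w0 _] := Hmin _ (hxis 0%N).
(* Assumption A (i) at the minimizer: for [K > 0] the cdfs differ by [v h + w h], which tends to
   0. *)
have F0 : (fun K => cdf_of P (X K) (xis 0%N)) @ \oo --> cdf_of P (X 0%N) (xis 0%N).
  have hc : (fun K => v (xis 0%N) * hK K + w K (xis 0%N) * hK K) @ \oo --> (0 : R).
    have h1 := cvg_scale (v (xis 0%N)) (@hK_cvg0 R).
    by have := cvgD h1 (cvgM w0 (@hK_cvg0 R)); rewrite !mulr0 addr0; apply.
  apply/cvgrPdist_le => eps eps0; move/cvgrPdist_le : hc => /(_ _ eps0) [N _ HN].
  exists N.+1 => // K /= NK; have := HN K (ltnW NK).
  by rewrite -HF ?(leq_trans _ NK)// sub0r normrN distrC.
have flow : forall r : R, 0 < r -> exists2 c : R, 0 < c & forall K x, `|x - xis 0%N| < r -> c <= f K x.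
  by move=> r r0; have [c [c0 Hc]] := Hlow _ (hxis 0%N) r r0; exists c.
have f0 K x : 0 <= f K x by case: (fX K).
have [MB HMB] := hB.
have Hxi K : (0 < K)%N -> L2 P (xi0 K) /\ Ex P (fun w => xi0 K w ^+ 2) <= MB.
  move=> K0; have := HMB K K0; rewrite expectation.unlock.
  set c1 := 4 / (1 - alpha) * _ * _ => H.
  (* The exponent being nonnegative, the exponential weight of Assumption B is at least 1, so B
     bounds the second moments of the initial values. *)
  have c10 : 0 <= c1.
    apply: mulr_ge0; first by apply: mulr_ge0; [rewrite divr_ge0// ltW|rewrite le_max ler01].
    by apply: sup_ge0 => _ [K' _ <-]; exact: supnorm_ge0.
  have H' : (\int[P]_w (xi0 K w ^+ 2)%:E <= MB%:E)%E.
    apply: le_trans H; apply: ge0_le_integral => //.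
    - by move=> t _; rewrite lee_fin sqr_ge0.
    - by apply/measurable_EFinP; apply: mfunX.
    - apply/measurable_EFinP; apply: mfunM; first by apply: mfunX; exact: mfun_abs.
      apply: (mfun_comp (h := expR)); first by apply: mfun_continuous; exact: continuous_expR.
      by apply: mfunM; [exact: mfun_cst|exact: mfun_abs].
    - move=> t _; rewrite lee_fin real_normK ?num_real// ler_peMr ?sqr_ge0//.
      by rewrite -[leLHS]expR0 ler_expR mulr_ge0.
  have LI : L1 P (fun w => xi0 K w ^+ 2).
    apply/integrableP; split; first by apply/measurable_EFinP; apply: mfunX.
    under eq_integral do rewrite /= ger0_norm ?sqr_ge0//.
    by apply: le_lt_trans H' _; rewrite ltry.
  by split; [split|rewrite -lee_fin -(Ex_fin LI)].
pose q := ca * f 0%N (xis 0%N).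
have q0 : 0 < q by exact: (q_gt0 halpha flow).
(* [lambda] is at most the first argument of its minimum at [K = 0], which is [3 / 8 * q], and this
   is below [q / 2]. *)
have qg : beta = 1 -> 1 < q / 2 * gamma1.
  move=> b11; apply: (lt_le_trans (hlam b11)); rewrite ler_pM2r//.
  apply: (@le_trans _ _ (3 / 8 * q)); last by have := ltW q0; lra.
  (* Needed because [inf] has a default value on sets that are not bounded below. *)
  have lb : has_lbound (range (fun K : nat =>
      Num.min (3 / 8 * (f K (xis K) / (1 - alpha)))
      (supnorm (f K) / (1 - alpha) * (f K (xis K) / (1 - alpha)) ^+ 4
        / (4 * (lipc (f K) / (1 - alpha)) ^+ 2)))).
    exists 0 => _ [K _ <-]; rewrite le_min; apply/andP; split.
      by rewrite mulr_ge0 ?divr_ge0 ?(ltW oma).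
    apply: divr_ge0; last by apply: mulr_ge0; rewrite ?sqr_ge0.
    by apply: mulr_ge0; [rewrite divr_ge0 ?supnorm_ge0// ltW|rewrite exprn_ge0// divr_ge0// ltW].
  apply: (le_trans (ge_inf lb (imageT _ 0%N))).
  by rewrite ge_min /q mulrC [in leRHS]mulrC [ca * _]mulrC lexx.
have [r [M0 [r0 r1 M00 Hsys]]] := near_sa_sys halpha mX LX1 fX cf fM fL floc F0 flow hxis mXn mxi0 lawXn indepXn
  (fun K K0 => (Hxi K K0).1) (fun K K0 => (Hxi K K0).2).
have Mf0 : 0 <= Mf := le_trans (normr_ge0 _) (fM 0%N 0).
have Lf0 : 0 <= Lf by have := fL 0%N 0 1; rewrite sub0r normrN normr1 mulr1; apply: le_trans.
have Lp K : L2 P (fun w => Num.max (X K w - xis K) 0).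
  exact: (L2_pos mX fX cf floc F0 LX UI).
have [c1 c2] := Ex_pos_xis_cvg halpha mX LX1 fX cf fM floc F0 flow hxis LX UI.
set m := Ex P (fun w => Num.max (X 0%N w - xis 0%N) 0) in c1.
set m2 := Ex P (fun w => Num.max (X 0%N w - xis 0%N) 0 ^+ 2) in c2.
have dq0 : (fun K => `|ca * f K (xis K) - q|) @ \oo --> 0.
  rewrite -[X in _ --> X](normr0 R) -[X in `|X|](subrr q); apply: cvg_norm.
  apply: cvgB; last exact: cvg_cst.
  apply: cvg_scale; exact: (fxis_cvg halpha mX LX1 fX cf fM fL floc F0 flow hxis).
have Hnu : (fun K => Ex P (fun w => H1 alpha (xis K) (X K w) ^+ 2)) @ \oo --> alpha * ca.
  apply: cvg_near_cst; apply: nearW => K.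
  exact: (Ex_nu_sqr halpha (mX K) (fX K) (@cf K) (fM K) (LX1 K) (hxis K)).
have Hnue : (fun K => Ex P (fun w => H1 alpha (xis K) (X K w) * eta P alpha (X K) (xis K) (X K w))) @ \oo -->
    - (ca ^+ 2 * alpha * m).
  rewrite (_ : (fun K => _) = fun K => - (ca ^+ 2 * alpha * Ex P (fun w => Num.max (X K w - xis K) 0))).
    by apply: cvgN; exact: cvg_scale.
  apply/funext => K; exact: (Ex_nu_eta halpha (mX K) (fX K) (@cf K) (fM K) (LX1 K) (hxis K) (Lp K)).
have Het : (fun K => Ex P (fun w => eta P alpha (X K) (xis K) (X K w) ^+ 2)) @ \oo --> ca ^+ 2 * (m2 - m ^+ 2).
  rewrite (_ : (fun K => _) = fun K => ca ^+ 2 * (Ex P (fun w => Num.max (X K w - xis K) 0 ^+ 2) -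
     Ex P (fun w => Num.max (X K w - xis K) 0) ^+ 2)).
    by apply: cvg_scale; apply: cvgB => //; exact: cvgM.
  by apply/funext => K; exact: Ex_eta_sqr.
have HUI : forall eps : R, 0 < eps -> exists2 B : R, 0 <= B & \forall K \near \oo,
    Ex P (fun w => if B < `|eta P alpha (X K) (xis K) (X K w)| then eta P alpha (X K) (xis K) (X K w) ^+ 2 else 0) <= eps.
  exact: (eta_UI halpha mX LX1 fX cf fM floc F0 flow hxis LX UI).
have Let : \forall K \near \oo, L2 P (fun w => eta P alpha (X K) (xis K) (X K w)).
  by apply: nearW => K; exact: L2_eta.
have f00 : 0 < f 0%N (xis 0%N) by rewrite -(pmulr_rgt0 _ ca0).
have den : 0 < 2 * f 0%N (xis 0%N) - gamma1^-1 * (1 - alpha) * ind1.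
  have qE : f 0%N (xis 0%N) = q * (1 - alpha) by rewrite /q mulrAC mulVf ?mul1r// gt_eqF.
  rewrite /ind1; case: eqP => [b11|_]; last by rewrite mulr0 subr0 mulr_gt0.
  have h : gamma1^-1 < q.
    rewrite -[ltLHS]mul1r ltr_pdivrMr//; apply: (lt_trans (qg b11)).
    by rewrite ltr_pM2r// gtr_pMr// invf_lt1// ltr1n.
  rewrite mulr1 qE mulrA -mulrBl mulr_gt0//; lra.
have WE : (fun K w =>
       let p := nsa alpha gamma (xi0 K w) (fun n => Xn K n w) (K ^ 2)%N in
       ((hK K) `^ (- beta) * (p.1 - xis K), (hK K)^-1 * (p.2 - chis K))) =
    Wlaw P alpha gamma1 beta X xis Xn xi0.
  by apply/funext => K; apply/funext => t; rewrite /Wlaw /chis VfunE.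
rewrite WE; apply: (@Wlaw_cvg _ _ _ P alpha gamma1 beta q r (ca * Lf) Mf (ca * Mf) M0 halpha hgamma1 hb12 hb1 q0 r0 r1
  _ Mf0 _ M00 qg X xis Xn xi0 (fun K => `|ca * f K (xis K) - q|) (alpha * ca) (- (ca ^+ 2 * alpha * m))
  (ca ^+ 2 * (m2 - m ^+ 2)) Hsys dq0 Hnu Hnue Het Let HUI) => //.
- by rewrite mulr_ge0// ltW.
- by rewrite mulr_ge0// ltW.
- by rewrite divr_gt0// mulr_gt0.
(* Matching with [Sigma]: for [q = ca * f 0 (xis 0)], the entry [alpha * ca * gamma1 / (2 q - ind)]
   loses its factors [ca], and [chis 0 - xis 0 = ca * m] turns the cross term into the stated
   one. *)
- move=> s t; rewrite /lim_var (fine_variance (Lp 0%N)) -/m -/m2 /chis VfunE /Vf -/ca -/X -/m.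
  have oma' : 1 - alpha != 0 by rewrite gt_eqF.
  have f0' : f 0%N (xis 0%N) != 0 by rewrite gt_eqF.
  have g0' : gamma1 != 0 by rewrite gt_eqF.
  move: den; rewrite /ind1 /q /ca; case: eqP => _ /lt0r_neq0 den'.
    have den2 : 2 * f 0%N (xis 0%N) * gamma1 - (1 - alpha) != 0.
      apply: contraNneq den' => h; apply/eqP; apply: (mulIf g0').
      by rewrite mul0r -h; field.
    field; rewrite ?oma' ?f0' ?g0' ?den2//.
  rewrite mulr0 subr0 in den'.
  by field; rewrite ?oma' ?f0' ?g0'.
Qed.
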